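(* Let $d\ge1$, $\rho\in(0,\infty)$ and $\Lambda\in[1,\infty)$, and let $\mathbf a_\circ$ satisfy the assumptions listed in the context with ellipticity constant $\Lambda$. Let $u\in L^2(\mathcal M_\delta(\mathbb R^d))$ be supported in $Q_{l_u}$ (i.e. $\mathcal F_{Q_{l_u}}$-measurable), let $t\ge\max\{l_u^2,16\Lambda^2\}$ and $K\ge\sqrt t$, and let $u_t:=P_tu$. Then $$\mathbb E_\rho\big[(u_t-\mathcal A_Ku_t)^2\big]\le C(\Lambda)\exp\left(-\frac{K}{\sqrt t}\right)\mathbb E_\rho[u^2],$$ where $C(\Lambda)$ is a finite constant depending only on $\Lambda$, and $\mathcal A_Ku_t:=\mathbb E_\rho[u_t\mid\mathcal F_{Q_K}]$.
   Context: Configurations. $\mathcal M_\delta(\mathbb R^d)$ is the set of Radon measures on $\mathbb R^d$ of the form $\mu=\sum_{i\in I}\delta_{x_i}$ with $I$ finite or countable. For a Borel set $U\subset\mathbb R^d$, $\mathcal F_U$ is the smallest $\sigma$-algebra making $\mu\mapsto\mu(V)$ measurable for every Borel $V\subset U$, and $\mathcal F:=\mathcal F_{\mathbb R^d}$. $\mathbb P_\rho$ is the law on $(\mathcal M_\delta(\mathbb R^d),\mathcal F)$ of the Poisson point process with constant intensity $\rho$, with expectation $\mathbb E_\rho$; $L^2$ is with respect to $\mathbb P_\rho$. $Q_s:=[-\frac s2,\frac s2]^d$ (closed cube) and $B_1$ is the unit ball centered at $0$. $\mu\llcorner U$ is the restriction of $\mu$ to $U$, and $\tau_h\mu(U):=\mu(U-h)$.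 Gradient. For $x\in\operatorname{supp}\mu$, $\nabla f(\mu,x)$ is the vector with components $\partial_k f(\mu,x)=\lim_{h\to0}\frac1h\big(f(\mu-\delta_x+\delta_{x+h\mathbf e_k})-f(\mu)\big)$, $1\le k\le d$. Function spaces. $C^\infty_c(\mathcal M_\delta(\mathbb R^d))$ is the set of bounded functions $f:\mathcal M_\delta(\mathbb R^d)\to\mathbb R$ such that $f$ is $\mathcal F_V$-measurable for some compact $V$, and for every $N\in\mathbb N$ the map $(x_1,\dots,x_N)\mapsto f(\sum_{i=1}^N\delta_{x_i})$ is $C^\infty$ on $(\mathbb R^d)^N$. Set $\|f\|_{H^1}^2:=\mathbb E_\rho[f^2]+\mathbb E_\rho[\int_{\mathbb R^d}|\nabla f(\mu,x)|^2\,d\mu(x)]$; $H^1_0(\mathcal M_\delta(\mathbb R^d))$ is the completion for this norm of $\{f\in C^\infty_c(\mathcal M_\delta(\mathbb R^d)):\|f\|_{H^1}<\infty\}$. Coefficients. $\mathbf a_\circ:\mathcal M_\delta(\mathbb R^d)\to\mathbb R^{d\times d}_{sym}$ is measurable, satisfies $|\xi|^2\le\xi\cdot\mathbf a_\circ(\mu)\xi\le\Lambda|\xi|^2$ for all $\mu$ and $\xi\in\mathbb R^d$, and is local: $\mathbf a_\circ(\mu)=\mathbf a_\circ(\mu\llcorner B_1)$. Set $\mathbf a(\mu,x):=\mathbf a_\circ(\tau_{-x}\mu)$. Semigroup. $\mathcal E^{\mathbf a}(f,g):=\mathbb E_\rho\big[\int_{\mathbb R^d}\nabla f(\mu,x)\cdot\mathbf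 a(\mu,x)\nabla g(\mu,x)\,d\mu(x)\big]$ with domain $H^1_0(\mathcal M_\delta(\mathbb R^d))$ is a Dirichlet form; $(P_t)_{t\ge0}$ is the associated strongly continuous Markov semigroup on $L^2(\mathcal M_\delta(\mathbb R^d))$. *)

(* Defs.v *)
From HB Require Import structures.
From mathcomp Require Import all_boot all_order all_algebra.
From mathcomp Require Import all_classical all_reals all_analysis.
From mathcomp Require Import measurable_realfun.

Set Implicit Arguments.
Unset Strict Implicit.
Unset Printing Implicit Defensive.

Import Order.TTheory GRing.Theory Num.Theory.
Import numFieldNormedType.Exports.

Local Open Scope classical_set_scope.
Local Open Scope ring_scope.

HB.instance Definition _ (R : realType) (m n : nat) :=
  @isMeasurable.Build (sigma_display (@open 'M[R]_(m, n))) 'M[R]_(m, n)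
    <<s @open 'M[R]_(m, n) >>
    (@sigma_algebra0 _ setT (@open 'M[R]_(m, n)))
    (@sigma_algebraC _ (@open 'M[R]_(m, n)))
    (@sigma_algebra_bigcup _ setT (@open 'M[R]_(m, n))).

Section euclidean.
Context {R : realType} {d : nat}.
Local Notation E := 'rV[R]_d.

(* [bilin u A v] is u . (A v). *)
Definition bilin (u : E) (A : 'M[R]_d) (v : E) : R := (u *m A *m v^T) ord0 ord0.

(* The norm of the library on 'rV[R]_d is the sup norm, hence this one. *)
Definition sqnorm (u : E) : R := \sum_(i < d) u ord0 i ^+ 2.

Definition unit_ball : set E := [set x | sqnorm x <= 1].

Definition cube (s : R) : set E :=
  [set x | forall i : 'I_d, - (s / 2) <= x ord0 i <= s / 2].

Definition box (a b : E) : set E :=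
  [set x | forall i : 'I_d, a ord0 i <= x ord0 i <= b ord0 i].

Definition box_volume (a b : E) : R :=
  \prod_(i < d) Num.max 0 (b ord0 i - a ord0 i).

(* d-dimensional Lebesgue measure, as an outer measure. *)
Definition volume (A : set E) : \bar R :=
  ereal_inf [set \sum_(0 <= k <oo) (box_volume (ab k).1 (ab k).2)%:E |
    ab in [set ab : nat -> E * E |
             A `<=` \bigcup_k box (ab k).1 (ab k).2]]%E.

End euclidean.

Section smooth_functions.
Context {R : realType} {m n : nat}.

Fixpoint classC (k : nat) (g : 'M[R]_(m, n) -> R) : Prop :=
  continuous g /\
  if k is k'.+1 then
    forall i j, (forall X, derivable g X (delta_mx i j)) /\
                classC k' (fun X => 'D_(delta_mx i j) g X)
  else True.

Definition smooth (g : 'M[R]_(m, n) -> R) : Prop := forall k, classC k g.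

End smooth_functions.

Section configurations.
Context (R : realType) (d : nat).
Local Notation E := 'rV[R]_d.

(* A sum of Dirac masses is considered as a function on all subsets of R^d;
   since it is determined by its values on singletons, two elements of [config]
   which coincide on Borel sets are equal. On R^d a Borel measure is Radon if
   and only if it is finite on compact sets. *)
Definition is_config (m : set E -> \bar R) : Prop :=
  (exists (I : set nat) (x : nat -> E),
     forall A, m A = \esum_(i in I) \d_(x i) A)%E /\
  (forall K, compact K -> m K < +oo)%E.

Record config := Config {
  config_fun :> set E -> \bar R ;
  configP : is_config config_fun }.

Section config_measure.
Variable mu : config.
Local Open Scope ereal_scope.

Lemma config_mseries :
  exists nu : {measure set E -> \bar R}^nat, mu = mseries nu 0 :> (_ -> _).
Proof.
have [[I [x muE]] _] := configP mu.
exists (fun i => if i \in I then \d_(x i) : {measure set E -> \bar R}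
                 else mzero : {measure set E -> \bar R}).
apply/funext => A; rewrite muE esum_mkcond /mseries nneseries_esumT//.
by apply: eq_esum => i _; case: ifP.
Qed.

Lemma config0 : mu set0 = 0.
Proof. by have [nu ->] := config_mseries; exact: measure0. Qed.

Lemma config_ge0 A : 0 <= mu A.
Proof. by have [nu ->] := config_mseries; exact: measure_ge0. Qed.

Lemma config_semi_sigma_additive : semi_sigma_additive mu.
Proof.
have [nu ->] := config_mseries.
exact: (@measure_semi_sigma_additive _ _ _ (mseries nu 0)).
Qed.

End config_measure.

HB.instance Definition _ (mu : config) := isMeasure.Build _ _ _
  (config_fun mu) (config0 mu) (config_ge0 mu)
  (@config_semi_sigma_additive mu).

Lemma is_config_sum (N : nat) (X : 'M[R]_(N, d)) :
  is_config (fun A => \sum_(i < N) \d_(row i X) A)%E.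
Proof.
split; last by move=> K _; apply/lte_sum_pinfty => i _; rewrite diracE ltry.
exists `I_N, (fun k => if insub k is Some i then row (i : 'I_N) X else 0) => A.
rewrite esum_fset//.
by rewrite -fsbig_ord; apply: eq_bigr => i _; rewrite valK.
Qed.

Definition sum_config N (X : 'M[R]_(N, d)) : config := Config (is_config_sum X).

HB.instance Definition _ := gen_eqMixin config.
HB.instance Definition _ := gen_choiceMixin config.
HB.instance Definition _ :=
  isPointed.Build config (sum_config (0 : 'M[R]_(0, d))).

(* [sigF U] is F_U. *)
Definition sigF_gen (U : set E) : set (set config) :=
  [set A | exists (V : set E) (B : set (\bar R)), [/\ measurable V, V `<=` U,
     measurable B & A = [set mu : config | B (mu V)]]].

Definition sigF (U : set E) : set (set config) := <<s sigF_gen U >>.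

HB.instance Definition _ := @isMeasurable.Build
  (sigma_display (sigF_gen setT)) config (sigF setT)
  (@sigma_algebra0 _ setT (sigF_gen setT))
  (@sigma_algebraC _ (sigF_gen setT))
  (@sigma_algebra_bigcup _ setT (sigF_gen setT)).

Lemma is_config_restr (mu : config) (U : set E) :
  is_config (fun A => mu (A `&` U)).
Proof.
have [[I [x muE]] mufin] := configP mu; split; last first.
  move=> K /mufin; apply: le_lt_trans; rewrite !muE.
  apply: le_esum => i _; rewrite !diracE lee_fin ler_nat.
  by case: (boolP (_ \in _ `&` _)) => // /set_mem[Kx _]; rewrite mem_set.
exists (I `&` x @^-1` U), x => A; rewrite muE esum_mkcondr.
apply: eq_esum => i _; rewrite !diracE in_setI.
rewrite (_ : (i \in x @^-1` U) = (x i \in U)) ?mem_setE//.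
by case: (x i \in U); rewrite ?andbT ?andbF.
Qed.

Definition restr (mu : config) (U : set E) : config :=
  Config (is_config_restr mu U).

Lemma is_config_shift (h : E) (mu : config) :
  is_config (fun A => mu [set y | A (y + h)]).
Proof.
have [[I [x muE]] mufin] := configP mu; split; last first.
  move=> K cK; suff : compact [set y | K (y + h)] by move=> /mufin.
  have -> : [set y | K (y + h)] = (fun y => y - h) @` K.
    apply/seteqP; split=> [y /= Ky|_ [y Ky <-]/=]; last by rewrite subrK.
    by exists (y + h); rewrite ?addrK.
  apply: (continuous_compact _ cK).
  apply: continuous_subspaceT => y.
  by apply: (@continuousB _ _ _ id (fun=> h)); [exact: cvg_id|exact: cst_continuous].
by exists I, (fun i => x i + h) => A; rewrite muE.
Qed.

(* tau_h mu, i.e. U |-> mu (U - h). *)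
Definition shift (h : E) (mu : config) : config :=
  Config (is_config_shift h mu).

Lemma is_config_move (mu : config) (x y : E) : mu [set x] != 0%E ->
  is_config (fun A => mu A - \d_x A + \d_y A)%E.
Proof.
have [[I [z muE]] mufin] := configP mu => mux.
split; last first.
  move=> K /mufin muK; rewrite lte_add_pinfty//; last by rewrite diracE ltry.
  by rewrite lte_add_pinfty// diracE -EFinN ltry.
have [i0 Ii0 zi0] : exists2 i, I i & z i = x.
  apply: contrapT => Nz; move/negP: mux; apply; rewrite muE esum1// => i Ii.
  rewrite diracE memNset//= => zix; apply: Nz; by exists i.
exists I, (fun i => if i == i0 then y else z i) => A.
rewrite muE.
have split_esum (t : nat -> E) : (\esum_(i in I) \d_(t i) A =
    \d_(t i0) A + \esum_(i in I `&` ~` [set i0]) \d_(t i) A :> \bar R)%E.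
  rewrite (esumID [set i0]); last by move=> i _; exact: measure_ge0.
  rewrite (_ : I `&` [set i0] = [set i0]) ?esum_set1//.
  by apply/seteqP; split=> [i []//|i ->].
rewrite split_esum [RHS]split_esum eqxx zi0.
rewrite (addeC (\d_x A)) addeK; last by rewrite diracE.
rewrite addeC; congr (_ + _)%E; apply: eq_esum => i [_ /eqP/negPf ii0].
by rewrite ii0.
Qed.

(* mu - delta_x + delta_y for x in the support of mu (junk value otherwise) *)
Definition move (mu : config) (x y : E) : config :=
  match pselect (mu [set x] != 0%E) with
  | left mux => Config (is_config_move y mux)
  | right _ => mu
  end.

End configurations.

Section poisson.
Context {R : realType} {d : nat}.
Local Notation E := 'rV[R]_d.
Local Notation M := (config R d).

(* P_rho, characterized by Poisson counts and complete independence. *)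
Definition is_poisson (rho : R) (P : probability M R) : Prop :=
  (forall A : set E, measurable A -> (volume A < +oo)%E -> forall k : nat,
     P [set mu | mu A = k%:R%:E] =
     ((rho * fine (volume A)) ^+ k / k`!%:R *
        expR (- (rho * fine (volume A))))%:E) /\
  (forall (n : nat) (A : 'I_n -> set E) (B : 'I_n -> set (\bar R)),
     (forall i, measurable (A i)) -> trivIset setT A ->
     (forall i, measurable (B i)) ->
     P [set mu | forall i, B i (mu (A i))] =
     (\prod_(i < n) P [set mu | B i (mu (A i))])%E).

End poisson.

Section measurability.
Context {T : Type} {R : realType}.

Definition measurable_wrt (G : set (set T)) (f : T -> R) : Prop :=
  forall B : set R, measurable B -> G (f @^-1` B).

End measurability.

(* [g] is a version of E[f | G]. *)
Definition is_condexp {disp} {T : measurableType disp} {R : realType}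
    (P : probability T R) (G : set (set T)) (f g : T -> R) : Prop :=
  [/\ measurable_wrt G g,
      P.-integrable setT (EFin \o g) &
      forall A, G A -> (\int[P]_(x in A) (g x)%:E = \int[P]_(x in A) (f x)%:E)%E].

Section sobolev.
Context {R : realType} {d : nat}.
Local Notation E := 'rV[R]_d.
Local Notation M := (config R d).

Definition partial (k : 'I_d) (f : M -> R) (mu : M) (x : E) : R :=
  lim ((fun h : R => h^-1 *
    (f (move mu x (x + h *: delta_mx ord0 k)) - f mu)) @ 0^').

Definition grad (f : M -> R) (mu : M) (x : E) : E :=
  \row_k partial k f mu x.

Definition Cc_infty (f : M -> R) : Prop :=
  [/\ exists b, forall mu, `|f mu| <= b,
      exists2 V : set E, compact V & measurable_wrt (sigF V) f &
      forall N, smooth (fun X : 'M[R]_(N, d) => f (sum_config X))].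

Variable P : probability M R.

(* The square of the H^1 norm of [f], with [F] in the role of its gradient. *)
Definition H1sq (f : M -> R) (F : M -> E -> E) : \bar R :=
  ('E_P[fun mu => (f mu ^+ 2)%R]
   + \int[P]_mu \int[mu]_x (sqnorm (F mu x))%:E)%E.

(* The completion for the H^1 norm is realized as the closure of the set of
   pairs (f, grad f) in the direct sum of L^2(P_rho) and of the L^2 space of
   vector fields for the measure mu(dx) P_rho(dmu), which is complete.
   [H10 P f F] means that f is in H^1_0 and that F is its gradient. *)
Definition H10 (f : M -> R) (F : M -> E -> E) : Prop :=
  [/\ f \in Lfun P 2%:E,
      forall k, measurable_fun setT (fun p : M * E => F p.1 p.2 ord0 k),
      (H1sq f F < +oo)%E &
      exists fn : nat -> M -> R,
        (forall n, Cc_infty (fn n) /\ (H1sq (fn n) (grad (fn n)) < +oo)%E) /\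
        H1sq (fun mu => fn n mu - f mu)
          (fun mu x => grad (fn n) mu x - F mu x) @[n --> \oo] --> 0%E].

End sobolev.

Section dirichlet_form.
Context {R : realType} {d : nat}.
Local Notation E := 'rV[R]_d.
Local Notation M := (config R d).

(* The unit ball in the locality condition is closed, which makes this
   condition the weakest. *)
Definition admissible (Lambda : R) (a0 : M -> 'M[R]_d) : Prop :=
  [/\ forall i j, measurable_fun setT (fun mu => a0 mu i j),
      forall mu, (a0 mu)^T = a0 mu,
      forall mu (xi : E),
        sqnorm xi <= bilin xi (a0 mu) xi <= Lambda * sqnorm xi &
      forall mu, a0 mu = a0 (restr mu unit_ball)].

Definition coef (a0 : M -> 'M[R]_d) (mu : M) (x : E) : 'M[R]_d :=
  a0 (shift (- x) mu).

(* E^a(f, g), as a function of the gradients [F] and [G] of f and g. *)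
Definition energy (P : probability M R) (a0 : M -> 'M[R]_d)
    (F G : M -> E -> E) : \bar R :=
  (\int[P]_mu \int[mu]_x (bilin (F mu x) (coef a0 mu x) (G mu x))%:E)%E.

End dirichlet_form.

Section semigroup.
Context {disp : measure_display} {T : measurableType disp} {R : realType}.
Variables (P : probability T R) (S : R -> (T -> R) -> T -> R).
Local Notation L2 := (Lfun P 2%:E).

(* Strongly continuous Markov semigroup (of symmetric contractions) on L^2;
   the elements of L^2 are represented by functions, whence the equalities
   almost everywhere. *)
Record markov_semigroup : Prop := MarkovSemigroup {
  semigroup_L2 : forall t f, 0 <= t -> f \in L2 -> S t f \in L2 ;
  semigroup_linear : forall t (c : R) f g, 0 <= t -> f \in L2 -> g \in L2 ->
    {ae P, forall x, S t (fun y => c * f y + g y) x = c * S t f x + S t g x} ;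
  semigroup0 : forall f, f \in L2 -> {ae P, forall x, S 0 f x = f x} ;
  semigroupD : forall s t f, 0 <= s -> 0 <= t -> f \in L2 ->
    {ae P, forall x, S (s + t) f x = S s (S t f) x} ;
  semigroup_contraction : forall t f, 0 <= t -> f \in L2 ->
    ('E_P[fun x => (S t f x ^+ 2)%R] <= 'E_P[fun x => (f x ^+ 2)%R])%E ;
  semigroup_symmetric : forall t f g, 0 <= t -> f \in L2 -> g \in L2 ->
    'E_P[fun x => (S t f x * g x)%R]%E = 'E_P[fun x => (f x * S t g x)%R]%E ;
  semigroup_markov : forall t f, 0 <= t -> f \in L2 ->
    {ae P, forall x, 0 <= f x <= 1} -> {ae P, forall x, 0 <= S t f x <= 1} ;
  semigroup_continuous : forall f, f \in L2 ->
    ('E_P[fun x => ((S h f x - f x) ^+ 2)%R] @[h --> 0^'+] --> 0)%E }.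

(* [f] is in the domain of the infinitesimal generator, which maps it to [g]. *)
Definition generator (f g : T -> R) : Prop :=
  ('E_P[fun x => ((h^-1 * (S h f x - f x) - g x) ^+ 2)%R] @[h --> 0^'+] --> 0)%E.

End semigroup.

(* [S] is the semigroup on L^2(P) associated with the form E^a of domain H^1_0:
   its generator is the operator A such that f is in D(A) and A f = g if and
   only if f is in H^1_0 and E^a(f, v) = - (g, v) for every v in H^1_0. *)
Definition associated_semigroup {R : realType} {d : nat}
    (P : probability (config R d) R) (a0 : config R d -> 'M[R]_d)
    (S : R -> (config R d -> R) -> config R d -> R) : Prop :=
  markov_semigroup P S /\
  forall f g, f \in Lfun P 2%:E -> g \in Lfun P 2%:E ->
    generator P S f g <->
    exists2 F, H10 P f F &
      forall v V, H10 P v V ->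
        (energy P a0 F V = - 'E_P[fun mu => (g mu * v mu)%R])%E.

(* Main.v *)
Require Import Defs.
From HB Require Import structures.
From mathcomp Require Import all_boot all_order all_algebra.
From mathcomp Require Import all_classical all_reals all_analysis.
From mathcomp Require Import finmap measurable_realfun ring lra.

Set Implicit Arguments.
Unset Strict Implicit.
Unset Printing Implicit Defensive.

Import Order.TTheory GRing.Theory Num.Theory.
Import numFieldNormedType.Exports.
Import HBNNSimple.

Local Open Scope classical_set_scope.
Local Open Scope ring_scope.

(* For a cutoff [phi] let [gam phi] average a function over a [phi]-thinning of
the configuration completed by fresh independent points, and put
W = al_n - \sum_(j < n) (al_(j+1) - al_j) gam(phi_j), where the phi_j have width
1/4, are equal to 1 on the cube of side lu, increase inside the cube of side K,
and al_j = exp(j / (2 sqrt t)). Then <u, W u> = |u|^2, whereas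
<f, W f> >= al_n |f - A_K f|^2 with al_n of order exp(K / sqrt t). On finite
combinations of exponentials mu |-> \prod_(x in mu) (1 + h x), which are dense
in H^1_0, gradients are explicit, and the locality of the coefficients, the
independence of disjoint regions and Schur products of positive kernels give
E(f, W f) >= - (c / t) <f, W f>. Hence <u_s, W u_s> grows at most like
exp(2 c s / t), first on the domain of the generator and then by density. *)

Notation mbl f := (measurable_fun setT f).
Notation mEFin := measurable_EFinP.
Notation mcomp := measurableT_comp.
Notation mfunM := measurable_funM.
Notation mfunX := measurable_funX.
Notation mfunB := measurable_funB.
Notation mindic := measurable_indic.
Notation intg mu f := (mu.-integrable setT (EFin \o f)).

(** The conditional expectations given the cubes cannot be tested against directly: they jump when a
    point crosses the boundary, so in general they are not in H^1_0. The thinning [gam phi] sends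
    the exponential of [h] to a multiple of that of [phi h]; it preserves smooth exponentials, and
    its matrix elements depend on [phi] only through the exponential of a Gram kernel linear in
    [phi], so comparisons become monotonicity in [phi]. The cutoffs have the form 1 - lam^2, whence
    |grad phi_j|^2 <= C (phi_(j+1) - phi_j): terms in grad phi_j are bounded by increments of
    quadratic forms, which geometric weights and summation by parts turn into a small multiple of
    <f, W f>. Where the unit ball around a point stays in {phi_j = 1}, thinning can only lower the
    energy. Near the edge only Young's inequality is available, and t >= 16 Lambda^2 makes the
    weights vary slowly enough to absorb the loss. The constant does not see the dimension because
    the cutoffs are built on a smooth sup norm, within 1 of the sup norm and with gradient at most
    1, and it does not see the intensity because both sides of each comparison are forms under the
    same law. *)

Lemma cvg_bound {R : realType} (u v : nat -> R) (l : R) :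
 (forall n, `|l - u n| <= v n) -> v n @[n --> \oo] --> 0 ->
 u n @[n --> \oo] --> l.
Proof.
move=> uv v0; apply/cvgrPdist_lt => e e0.
move/cvgrPdist_lt : v0 => /(_ e e0); apply: filterS => n /=.
rewrite sub0r normrN; apply: le_lt_trans; apply: le_trans (uv n) _.
exact: ler_norm.
Qed.

(** * Square-integrable functions: inner product, norm, convergence, completeness *)

Section square_integrable.
Context {disp : measure_display} {T : measurableType disp} {R : realType}.
Variable mu : {measure set T -> \bar R}.
Implicit Types (f g h : T -> R) (c : R).

Definition L2 f :=
 mbl f /\ (\int[mu]_x (f x ^+ 2)%:E < +oo)%E.

Definition ip f g : R := \int[mu]_x (f x * g x).

Lemma L2_mbl f : L2 f -> mbl f.
Proof. by case. Qed.

Lemma L2_sqr f : L2 f -> mu.-integrable setT (fun x => (f x ^+ 2)%:E).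
Proof.
move=> [mf f2]; apply/integrableP; split.
 by apply/mEFin; exact: mfunX.
by under eq_integral do rewrite gee0_abs ?lee_fin ?sqr_ge0//.
Qed.

Lemma L2_mul f g : L2 f -> L2 g ->
 intg mu (fun x => f x * g x).
Proof.
move=> sf sg.
have := integrableD measurableT (L2_sqr sf) (L2_sqr sg).
apply: le_integrable => //.
 by apply/mEFin/mfunM; apply: L2_mbl.
move=> x _ /=; rewrite lee_fin (ger0_norm (addr_ge0 _ _)) ?sqr_ge0//.
have := sqr_ge0 (`|f x| - `|g x|); rewrite normrM.
rewrite -(real_normK (num_real (f x))) -(real_normK (num_real (g x))).
by have := normr_ge0 (f x); have := normr_ge0 (g x); nra.
Qed.

Lemma L2D f g : L2 f -> L2 g -> L2 (fun x => f x + g x).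
Proof.
move=> sf sg; split.
 by apply: measurable_funD; apply: L2_mbl.
have h := integrableD measurableT (integrableZl measurableT 2%R (L2_sqr sf))
 (integrableZl measurableT 2%R (L2_sqr sg)).
apply: le_lt_trans (integrable_lty measurableT h) => //.
apply: ge0_le_integral => //.
- by move=> x _; rewrite lee_fin sqr_ge0.
- apply/mEFin/mfunX/measurable_funD; exact: L2_mbl.
- exact: measurable_int h.
- by move=> x _ /=; rewrite lee_fin; have := sqr_ge0 (f x - g x); nra.
Qed.

Lemma L2Z c f : L2 f -> L2 (fun x => c * f x).
Proof.
move=> [mf f2]; split; first exact: mfunM.
under eq_integral do rewrite exprMn EFinM.
rewrite ge0_integralZl//; last 3 first.
- by apply/mEFin/mfunX.
- by move=> x _; rewrite lee_fin sqr_ge0.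
- by rewrite lee_fin sqr_ge0.
by rewrite lte_mul_pinfty// lee_fin sqr_ge0.
Qed.

Lemma L2N f : L2 f -> L2 (fun x => - f x).
Proof. by move=> /(L2Z (-1)); under eq_fun do rewrite mulN1r. Qed.

Lemma L2B f g : L2 f -> L2 g -> L2 (fun x => f x - g x).
Proof. by move=> sf sg; apply: L2D => //; exact: L2N. Qed.

Lemma L20 : L2 (fun=> 0).
Proof.
split; first exact: measurable_cst.
under eq_integral do rewrite expr0n /=.
by rewrite integral0.
Qed.

Lemma L2_sum (I : Type) (s : seq I) (F : I -> T -> R) :
 (forall i, L2 (F i)) -> L2 (fun x => \sum_(i <- s) F i x).
Proof.
move=> sF; elim: s => [|i s ih].
 by under eq_fun do rewrite big_nil; exact: L20.
by under eq_fun do rewrite big_cons; exact: L2D.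
Qed.

Lemma ipC f g : ip f g = ip g f.
Proof. by apply: eq_Rintegral => x _; rewrite mulrC. Qed.

Lemma ipDl f g h : L2 f -> L2 g -> L2 h ->
 ip (fun x => f x + g x) h = ip f h + ip g h.
Proof.
move=> sf sg sh; rewrite /ip -RintegralD//; try exact: L2_mul.
by apply: eq_Rintegral => x _; rewrite mulrDl.
Qed.

Lemma ipZl c f g : L2 f -> L2 g -> ip (fun x => c * f x) g = c * ip f g.
Proof.
move=> sf sg; rewrite /ip -RintegralZl//; last exact: L2_mul.
by apply: eq_Rintegral => x _; rewrite mulrA.
Qed.

Lemma ipNl f g : L2 f -> L2 g -> ip (fun x => - f x) g = - ip f g.
Proof.
move=> sf sg; rewrite -mulN1r -ipZl//; apply: eq_Rintegral => x _.
by rewrite mulN1r.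
Qed.

Lemma ipBl f g h : L2 f -> L2 g -> L2 h ->
 ip (fun x => f x - g x) h = ip f h - ip g h.
Proof. by move=> sf sg sh; rewrite ipDl// ?ipNl//; exact: L2N. Qed.

Lemma ipDr f g h : L2 f -> L2 g -> L2 h ->
 ip h (fun x => f x + g x) = ip h f + ip h g.
Proof. by move=> *; rewrite ipC ipDl// ipC (ipC g). Qed.

Lemma ipZr c f g : L2 f -> L2 g -> ip g (fun x => c * f x) = c * ip g f.
Proof. by move=> *; rewrite ipC ipZl// ipC. Qed.

Lemma ipBr f g h : L2 f -> L2 g -> L2 h ->
 ip h (fun x => f x - g x) = ip h f - ip h g.
Proof. by move=> *; rewrite ipC ipBl// ipC (ipC g). Qed.

Lemma ip_suml (I : Type) (s : seq I) (F : I -> T -> R) g :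
 (forall i, L2 (F i)) -> L2 g ->
 ip (fun x => \sum_(i <- s) F i x) g = \sum_(i <- s) ip (F i) g.
Proof.
move=> sF sg; elim: s => [|i s ih].
 rewrite big_nil /ip.
 under eq_Rintegral do rewrite big_nil mul0r.
 by rewrite Rintegral_cst// mul0r.
under [X in ip X _ = _]eq_fun do rewrite big_cons.
by rewrite (ipDl (sF i) (L2_sum _ sF) sg) ih big_cons.
Qed.

Lemma ip_ge0 f : 0 <= ip f f.
Proof. by apply: Rintegral_ge0 => x _; rewrite -expr2 sqr_ge0. Qed.

Lemma ip_sqr f : L2 f -> (\int[mu]_x (f x ^+ 2)%:E = (ip f f)%:E)%E.
Proof.
by move=> sf; rewrite /ip /Rintegral fineK//; exact: integrable_fin_num (L2_mul sf sf).
Qed.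

Lemma eq_ae_ip f f' g : mbl f -> mbl f' ->
 mbl g ->
 {ae mu, forall x, f x = f' x} -> ip f g = ip f' g.
Proof.
move=> mf mf' mg ff'; congr fine; apply: ae_eq_integral => //.
- by apply/mEFin/mfunM.
- by apply/mEFin/mfunM.
- by apply: filterS ff' => x -> _.
Qed.

Lemma ip_CS f g : L2 f -> L2 g -> ip f g ^+ 2 <= ip f f * ip g g.
Proof.
move=> sf sg.
have H c : 0 <= ip f f + 2 * c * ip f g + c ^+ 2 * ip g g.
 have := ip_ge0 (fun x => f x + c * g x).
 have scg := L2Z c sg; have sfg := L2D sf scg.
 rewrite ipDl// !ipDr// !ipZl// !ipZr// (ipC g f).
 by rewrite (_ : _ + _ = ip f f + 2 * c * ip f g + c ^+ 2 * ip g g)//; ring.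
have := ip_ge0 g; have := ip_ge0 f.
rewrite [0 <= ip g g]le_eqVlt => f0 /predU1P[g0|g0].
 have fg0 : ip f g = 0.
  (* With [ip g g = 0] the quadratic [H] is affine in [c], and this [c] would give it the value
     -1. *)
  apply/eqP/negP => /negP fg; have := H (- (ip f f + 1) / (2 * ip f g)).
  rewrite -g0 mulr0 addr0.
  have -> : 2 * (- (ip f f + 1) / (2 * ip f g)) * ip f g = - (ip f f + 1).
   by field.
  by lra.
 by rewrite fg0 -g0 expr0n mulr0.
have := H (- ip f g / ip g g).
have -> : ip f f + 2 * (- ip f g / ip g g) * ip f g +
     (- ip f g / ip g g) ^+ 2 * ip g g = ip f f - ip f g ^+ 2 / ip g g.
 by field; rewrite gt_eqF.
by rewrite subr_ge0 ler_pdivrMr.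
Qed.

Definition nrm f : R := Num.sqrt (ip f f).

Lemma nrm_ge0 f : 0 <= nrm f. Proof. exact: sqrtr_ge0. Qed.

Lemma nrm_sqr f : nrm f ^+ 2 = ip f f. Proof. by rewrite sqr_sqrtr// ip_ge0. Qed.

Lemma ip_le_nrm f g : L2 f -> L2 g -> `|ip f g| <= nrm f * nrm g.
Proof.
move=> sf sg; rewrite -ler_sqr ?nnegrE ?mulr_ge0 ?nrm_ge0//.
by rewrite exprMn !nrm_sqr real_normK ?num_real// ip_CS.
Qed.

Lemma nrmD f g : L2 f -> L2 g -> nrm (fun x => f x + g x) <= nrm f + nrm g.
Proof.
move=> sf sg; rewrite -ler_sqr ?nnegrE ?addr_ge0 ?nrm_ge0// nrm_sqr sqrrD !nrm_sqr.
have sfg := L2D sf sg.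
rewrite ipDl// !ipDr// (ipC g f).
by have := ip_le_nrm sf sg; have := ler_norm (ip f g); lra.
Qed.

Lemma nrmZ c f : L2 f -> nrm (fun x => c * f x) = `|c| * nrm f.
Proof.
move=> sf; rewrite /nrm ipZl ?ipZr//; last exact: L2Z.
by rewrite mulrA -expr2 sqrtrM ?sqr_ge0// sqrtr_sqr.
Qed.

Lemma nrmN f : L2 f -> nrm (fun x => - f x) = nrm f.
Proof.
by move=> sf; under eq_fun do rewrite -mulN1r; rewrite nrmZ// normrN1 mul1r.
Qed.

Lemma nrmB f g : L2 f -> L2 g -> nrm (fun x => f x - g x) <= nrm f + nrm g.
Proof.
by move=> sf sg; rewrite -[in leRHS](nrmN sg); apply: nrmD => //; exact: L2N.
Qed.

Lemma nrm_distC f g : L2 f -> L2 g ->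
 nrm (fun x => f x - g x) = nrm (fun x => g x - f x).
Proof.
move=> sf sg; rewrite -nrmN; last exact: L2B.
by under eq_fun do rewrite opprB.
Qed.

Lemma nrm_distD g f h : L2 f -> L2 g -> L2 h ->
 nrm (fun x => f x - h x) <= nrm (fun x => f x - g x) + nrm (fun x => g x - h x).
Proof.
move=> sf sg sh.
have -> : (fun x => f x - h x) = (fun x => (f x - g x) + (g x - h x)).
 by apply/funext => x; rewrite addrA subrK.
by apply: nrmD; exact: L2B.
Qed.

Lemma nrm_sub_ge f g : L2 f -> L2 g ->
 `|nrm f - nrm g| <= nrm (fun x => f x - g x).
Proof.
move=> sf sg; rewrite ler_norml.
have := nrmD (L2B sf sg) sg; under eq_fun do rewrite subrK.
have := nrmD (L2B sg sf) sf; under eq_fun do rewrite subrK.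
rewrite (nrm_distC sg sf) => h1 h2; apply/andP; split; lra.
Qed.

Lemma eq_ae_nrm f g : mbl f -> mbl g ->
 {ae mu, forall x, f x = g x} -> nrm f = nrm g.
Proof.
move=> mf mg fg; rewrite /nrm (eq_ae_ip mf mg mf fg) ipC (eq_ae_ip mf mg mg fg)//.
Qed.

Lemma le_nrm f g : mbl f -> L2 g ->
 (forall x, `|f x| <= `|g x|) -> L2 f /\ nrm f <= nrm g.
Proof.
move=> mf sg fg.
have f2g2 x : f x ^+ 2 <= g x ^+ 2.
 by rewrite -[leLHS]real_normK ?num_real// -[leRHS]real_normK ?num_real// ler_sqr ?nnegrE.
have sf : L2 f.
 split => //; apply: le_lt_trans sg.2; apply: ge0_le_integral => //.
 - by move=> x _; rewrite lee_fin sqr_ge0.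
 - by apply/mEFin/mfunX.
 - by apply/mEFin/mfunX/sg.1.
 - by move=> x _; rewrite lee_fin.
split => //; rewrite ler_wsqrtr// -lee_fin -!ip_sqr//.
apply: ge0_le_integral => //.
- by move=> x _; rewrite lee_fin sqr_ge0.
- by apply/mEFin/mfunX.
- by apply/mEFin/mfunX/sg.1.
- by move=> x _; rewrite lee_fin.
Qed.

Definition L2cvg (fn : nat -> T -> R) f :=
 nrm (fun x => fn n x - f x) @[n --> \oo] --> 0.

Lemma L2cvgP (fn : nat -> T -> R) f : L2cvg fn f <->
 forall e, 0 < e -> exists N, forall n, (N <= n)%N -> nrm (fun x => fn n x - f x) < e.
Proof.
split=> [/cvgrPdist_lt fnf e /fnf[N _ NP]|fnf].
 by exists N => n /NP; rewrite sub0r normrN ger0_norm// nrm_ge0.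
apply/cvgrPdist_lt => e /fnf[N NP]; exists N => // n /NP.
by rewrite sub0r normrN ger0_norm// nrm_ge0.
Qed.

Lemma cvg_ip (fn gn : nat -> T -> R) f g :
 (forall n, L2 (fn n)) -> (forall n, L2 (gn n)) -> L2 f -> L2 g ->
 L2cvg fn f -> L2cvg gn g -> ip (fn n) (gn n) @[n --> \oo] --> ip f g.
Proof.
move=> sfn sgn sf sg fnf gng.
have b n : `|ip f g - ip (fn n) (gn n)| <= nrm (fun x => fn n x - f x) *
  (nrm (fun x => gn n x - g x) + nrm g) + nrm f * nrm (fun x => gn n x - g x).
 have -> : ip f g - ip (fn n) (gn n) =
   - ip (fun x => fn n x - f x) (fun x => (gn n x - g x) + g x)
   - ip f (fun x => gn n x - g x).
  have s1 := L2B (sgn n) sg; have s2 := L2B (sfn n) sf.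
  have E : (fun x => gn n x - g x + g x) = gn n.
   by apply/funext => x; rewrite subrK.
  by rewrite E (ipBl (sfn n) sf (sgn n)) (ipBr (sgn n) sg sf); ring.
 apply: le_trans (ler_normB _ _) _; rewrite normrN lerD//; last first.
  by apply: ip_le_nrm => //; exact: L2B.
 have s1 := L2B (sgn n) sg; have s2 := L2B (sfn n) sf.
 apply: le_trans (ip_le_nrm _ _) _ => //; first exact: L2D.
 by rewrite ler_wpM2l ?nrm_ge0// nrmD.
apply: (cvg_bound b).
rewrite -[X in _ --> X](_ : 0 * (0 + nrm g) + nrm f * 0 = 0); last by ring.
apply: cvgD; last by apply: cvgM => //; exact: cvg_cst.
apply: cvgM => //; apply: cvgD => //; exact: cvg_cst.
Qed.

(** Convergence is asked only almost everywhere because the subsequence of [L2_complete] converges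
    only there. *)
Lemma L2_fatou (fn : nat -> T -> R) f C : (forall n, L2 (fn n)) ->
 mbl f -> {ae mu, forall x, fn n x @[n --> \oo] --> f x} ->
 (forall n, nrm (fn n) <= C) -> L2 f /\ nrm f <= C.
Proof.
move=> sfn mf fnf bC.
have C0 : 0 <= C := le_trans (nrm_ge0 _) (bC 0%N).
have h : (\int[mu]_x (f x ^+ 2)%:E <= (C ^+ 2)%:E)%E.
 rewrite (@ae_eq_integral _ _ _ mu setT
  (fun x => limn_einf (fun n => (fn n x ^+ 2)%:E)))//; last 3 first.
 - by apply/mEFin/mfunX.
 - have -> : (fun x => limn_einf (fun n => (fn n x ^+ 2)%:E)) =
    (fun x => - limn_esup (fun n => - (fn n x ^+ 2)%:E))%E.
   by apply/funext => x; rewrite -limn_einfN; congr limn_einf;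
     apply/funext => n /=; rewrite opprK.
  apply: mcomp => //; apply: measurable_fun_limn_esup => n.
  by apply: mcomp => //; apply/mEFin/mfunX/(sfn n).1.
 - apply: filterS fnf => x fnx _; apply/esym.
  have /cvg_limn_einf_sup[->//] : (fn n x ^+ 2)%:E @[n --> \oo] --> (f x ^+ 2)%:E.
  by apply: cvg_EFin; [exact: nearW|exact: cvgM].
 apply: le_trans (fatou _ _ _ _) _ => //.
 - by move=> n; apply/mEFin/mfunX/(sfn n).1.
 - by move=> n x _; rewrite lee_fin sqr_ge0.
 apply: le_trans (limn_einf_sup _) _; rewrite limn_esup_lim.
 apply: lime_le; first exact: is_cvg_esups.
 apply: nearW => n; apply: ge_ereal_sup => _ [m _ <-].
 by rewrite ip_sqr// lee_fin -nrm_sqr lerXn2r ?nnegrE ?nrm_ge0.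
have sf : L2 f by split => //; exact: le_lt_trans h (ltry _).
split => //; move: h; rewrite ip_sqr// lee_fin -nrm_sqr.
by rewrite ler_sqr ?nnegrE ?nrm_ge0.
Qed.

(** The squared differences are dominated by [4 g^2], which is integrable since [g] is in L^2. *)
Lemma L2_dominated (fn : nat -> T -> R) f g :
 (forall n, mbl (fn n)) -> L2 g ->
 (forall n x, `|fn n x| <= g x) -> (forall x, fn n x @[n --> \oo] --> f x) ->
 L2 f /\ L2cvg fn f.
Proof.
move=> mfn sg fng fnf.
have mf : mbl f.
 by apply: (measurable_fun_cvg mfn) => x _; exact: fnf.
have fg x : `|f x| <= g x.
 have /(@cvg_norm _ _ _ _ _) : fn n x @[n --> \oo] --> f x by exact: fnf.
 move=> h; rewrite -(cvg_lim _ h)//; apply: limr_le; first exact: cvgP h.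
 exact: nearW.
have gg x : `|g x| = g x by rewrite ger0_norm// (le_trans _ (fg x)).
have [sf _] : L2 f /\ nrm f <= nrm g.
 by apply: le_nrm => // x; rewrite gg.
have sfn n : L2 (fn n).
 by have [] : L2 (fn n) /\ nrm (fn n) <= nrm g by apply: le_nrm => // x; rewrite gg.
split => //.
pose h0 := @dominated_convergence _ _ _ mu setT measurableT
 (fun n x => ((fn n x - f x) ^+ 2)%:E) (fun=> 0)%E (fun x => (4 * g x ^+ 2)%:E).
have {h0} : (fun n => (ip (fun x => fn n x - f x) (fun x => fn n x - f x))%:E) @ \oo --> 0%E.
 have [||||| _ h _] := h0; last first.
 - apply: cvg_trans h; apply: near_eq_cvg; apply: nearW => n /=; rewrite -ip_sqr; last exact: L2B.
  by apply: eq_integral => x _; rewrite subr0 ger0_norm// sqr_ge0.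
 - apply: (aeW mu) => x n _; rewrite lee_fin.
  rewrite ger0_norm ?sqr_ge0// -[leLHS]real_normK ?num_real//.
  have -> : 4 * g x ^+ 2 = (g x + g x) ^+ 2 by ring.
  rewrite ler_sqr ?nnegrE//; last by rewrite addr_ge0// -gg.
  by apply: le_trans (ler_normB _ _) _; rewrite lerD.
 - have := integrableZl measurableT 4%R (L2_sqr sg).
  by apply: eq_integrable => // x _; rewrite EFinM.
 - apply: (aeW mu) => x _; apply: cvg_EFin; first exact: nearW.
  rewrite -[X in _ --> X](_ : (f x - f x) ^+ 2 = 0); last by rewrite subrr expr0n.
  by apply: cvgM; apply: cvgB => //; exact: cvg_cst.
 - exact: measurable_cst.
 - by move=> n; apply/mEFin/mfunX/mfunB.
move=> /fine_cvgP[_ h]; rewrite /L2cvg -[X in _ --> X]sqrtr0.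
by apply: continuous_cvg h; exact: sqrt_continuous.
Qed.

(* A subsequence with [|f_(k+1) - f_k| <= 8^-k] makes [\sum_k 4^k |f_(k+1) - f_k|^2]
  integrable, hence converges almost everywhere; Fatou does the rest. *)
Lemma L2_complete (fn : nat -> T -> R) : (forall n, L2 (fn n)) ->
 (forall e, 0 < e -> exists N, forall m n, (N <= m)%N -> (N <= n)%N ->
   nrm (fun x => fn m x - fn n x) < e) ->
 exists2 f, L2 f & L2cvg fn f.
Proof.
move=> sfn cfn.
have /choice[N0 N0P] k : exists N, forall m n, (N <= m)%N -> (N <= n)%N ->
  nrm (fun x => fn m x - fn n x) < 8^-1 ^+ k.
 by apply: cfn; rewrite exprn_gt0// invr_gt0.
pose N k := (\sum_(i < k.+1) N0 i)%N.
have NP k m n : (N k <= m)%N -> (N k <= n)%N ->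
  nrm (fun x => fn m x - fn n x) < 8^-1 ^+ k.
 move=> km kn; apply: N0P; [apply: leq_trans km|apply: leq_trans kn];
 by rewrite /N big_ord_recr leq_addl.
have NS k : (N k <= N k.+1)%N by rewrite /N [leqRHS]big_ord_recr leq_addr.
pose u k := fn (N k).
pose dl k x := u k.+1 x - u k x.
have sdl k : L2 (dl k) := L2B (sfn _) (sfn _).
have ndl k : nrm (dl k) < 8^-1 ^+ k by exact: NP.
pose G x := (\sum_(k <oo) (4 ^+ k * dl k x ^+ 2)%:E)%E.
have mG k : mbl (fun x => (4 ^+ k * dl k x ^+ 2)%:E).
 by apply/mEFin/mfunM => //; exact/mfunX/(sdl k).1.
have G0 k x : (0 <= (4 ^+ k * dl k x ^+ 2)%:E :> \bar R)%E.
 by rewrite lee_fin mulr_ge0 ?sqr_ge0// exprn_ge0.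
have intG : (\int[mu]_x G x < +oo)%E.
 rewrite integral_nneseries//.
 apply: (@le_lt_trans _ _ (\sum_(k <oo) (geometric 1 (2^-1 : R) k)%:E)%E).
  apply: lee_nneseries => [k _ _|k _]; first exact: integral_ge0.
  under eq_integral do rewrite EFinM.
  rewrite ge0_integralZl//; last 2 first.
  - by apply/mEFin/mfunX/(sdl k).1.
  - by move=> x _; rewrite lee_fin sqr_ge0.
  rewrite ip_sqr// -EFinM lee_fin -nrm_sqr /geometric/= mul1r.
  have h : nrm (dl k) ^+ 2 <= (8^-1 ^+ k) ^+ 2.
   by rewrite lerXn2r ?nnegrE ?nrm_ge0 ?exprn_ge0 ?invr_ge0// ltW.
  apply: le_trans (ler_wpM2l _ h) _; first by rewrite exprn_ge0.
  rewrite -exprM mulnC exprM -exprMn lerXn2r ?nnegrE ?invr_ge0//; lra.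
 apply: (@le_lt_trans _ _ 2%:E); last exact: ltry.
 apply: lime_le => [|].
  by apply: is_cvg_nneseries => k _ _; rewrite lee_fin /geometric/= mul1r exprn_ge0.
 apply: nearW => n; rewrite sumEFin lee_fin.
 rewrite (_ : \sum_(0 <= i < n) _ = series (geometric 1 (2^-1 : R)) n)//.
 rewrite geometric_seriesE; last by rewrite lt_eqF//; lra.
 have : 0 <= (2^-1 : R) ^+ n by rewrite exprn_ge0.
 by rewrite /= mul1r ler_pdivrMr; lra.
have aeG : {ae mu, forall x, (G x < +oo)%E}.
 have iG : mu.-integrable setT G.
  apply/integrableP; split.
   by apply: ge0_emeasurable_sum => // k x _ _; exact: G0.
  under eq_integral do rewrite gee0_abs ?nneseries_ge0//.
  exact: intG.
 have := integrable_ae measurableT iG; apply: filterS => x /(_ I).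
 by rewrite ge0_fin_numE// nneseries_ge0.
(* The limit superior is measurable without any convergence; it is the limit wherever [G] is
   finite. *)
pose f x := fine (limn_esup (fun k => (u k x)%:E)).
have mf : mbl f.
 apply: mcomp => //; apply: measurable_fun_limn_esup => k.
 exact/mEFin/(sfn _).1.
have uf : {ae mu, forall x, u k x @[k --> \oo] --> f x}.
 apply: filterS aeG => x Gx.
 suff cu : cvgn (fun k => u k x).
  rewrite /f (_ : limn_esup _ = (limn (u ^~ x))%:E)//.
  have : (u k x)%:E @[k --> \oo] --> (limn (u ^~ x))%:E.
   by apply: cvg_EFin; [exact: nearW|exact: cu].
  by move=> /cvg_limn_einf_sup[].
 (* From [4^k (dl k x)^2 <= G x] the increments are at most [2^-k] times the square root of [G x],
    and [1 + G x] dominates that root. *)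
 have bdl k : `|dl k x| <= geometric (1 + fine (G x)) 2^-1 k.
  have h : 4 ^+ k * dl k x ^+ 2 <= fine (G x).
   rewrite -lee_fin fineK; last first.
    by rewrite ge0_fin_numE// nneseries_ge0.
   rewrite /G (@nneseries_split _ _ 0 k.+1)// add0n big_mkord big_ord_recr/=.
   rewrite -addeA; apply: (@le_trans _ _ ((4 ^+ k * dl k x ^+ 2)%:E + 0)%E).
    by rewrite adde0.
   rewrite addeA; apply: leeD; last exact: nneseries_ge0.
   by apply: leeDr; apply: sume_ge0.
  have fG0 : 0 <= fine (G x).
   by apply: le_trans h; rewrite mulr_ge0 ?sqr_ge0// exprn_ge0.
  rewrite /geometric/= -ler_sqr ?nnegrE ?mulr_ge0 ?exprn_ge0 ?invr_ge0//; last lra.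
  rewrite real_normK ?num_real// exprMn -exprM mulnC exprM.
  have -> : (2^-1 ^+ 2 : R) = 4^-1 by rewrite expr2; field.
  rewrite exprVn ler_pdivlMr ?exprn_gt0// mulrC; nra.
 have : cvgn (series (fun k => dl k x)).
  apply: normed_cvg; apply: series_le_cvg bdl _ => //.
   move=> k; rewrite /geometric/= mulr_ge0 ?exprn_ge0 ?invr_ge0// addr_ge0// fine_ge0//.
   exact: nneseries_ge0.
  by apply: is_cvg_geometric_series; rewrite ger0_norm; lra.
 have -> : (fun k => u k x) = (fun k => u 0%N x + series (fun k => dl k x) k).
  apply/funext => k; exact: (eq_sum_telescope (fun k => u k x)).
 by move=> h; apply: is_cvgD => //; exact: is_cvg_cst.
(* Fatou's lemma along the subsequence, with [fn n] kept fixed. *)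
have key n k : (N k <= n)%N ->
  L2 (fun x => fn n x - f x) /\ nrm (fun x => fn n x - f x) <= 8^-1 ^+ k.
 move=> kn; apply: (@L2_fatou (fun j x => fn n x - u (k + j)%N x)).
 - by move=> j; exact: (L2B (sfn _) (sfn _)).
 - by apply: mfunB => //; exact: (sfn n).1.
 - apply: filterS uf => x ux; apply: cvgB; first exact: cvg_cst.
  by under eq_fun do rewrite addnC; rewrite -(cvg_shiftn k (u ^~ x)) in ux.
 - move=> j; apply/ltW/NP => //; elim: j => [|j ih]; first by rewrite addn0.
  by rewrite addnS (leq_trans ih).
have sf : L2 f.
 have [s0 _] := key (N 0%N) 0%N (leqnn _).
 have := L2B (sfn (N 0%N)) s0; congr L2.
 by apply/funext => x; rewrite opprB addrC subrK.
exists f => //; apply/L2cvgP => e e0.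
have : (8^-1 : R) ^+ k @[k --> \oo] --> 0.
 by apply: cvg_expr; rewrite ger0_norm; lra.
move=> /cvgrPdist_lt /(_ _ e0)[k _ /(_ k (leqnn k))].
rewrite /= sub0r normrN => he; exists (N k) => n kn.
by have [_ h] := key _ _ kn; apply: le_lt_trans h _; apply: le_lt_trans he; exact: ler_norm.
Qed.

End square_integrable.

(** * Dictionary between expectations, L^2 classes and [L2] *)

Section expectation_L2.
Context {disp : measure_display} {T : measurableType disp} {R : realType}.
Variable P : probability T R.
Implicit Types f g : T -> R.

Lemma Lfun2_L2 f : f \in Lfun P 2%:E <-> L2 P f.
Proof.
split=> [fL|[mf f2]].
 split; first by move/sub_Lfun_mfun: fL => /set_mem.
 exact: integrable_lty (Lfun2_integrable_sqr fL).
rewrite classical_sets.inE; apply/andP; split; rewrite classical_sets.inE//= /finite_norm unlock/=.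
apply: poweR_lty; apply: le_lt_trans f2.
rewrite le_eqVlt; apply/orP; left; apply/eqP; apply: eq_integral => x _ /=.
by rewrite (powR_mulrn 2) ?normr_ge0// real_normK ?num_real.
Qed.

Lemma expectation_sqr f : L2 P f ->
 'E_P[fun x => (f x ^+ 2)%R]%E = (ip P f f)%:E.
Proof. by move=> sf; rewrite unlock ip_sqr. Qed.

Lemma expectation_mul f g : L2 P f -> L2 P g ->
 'E_P[fun x => (f x * g x)%R]%E = (ip P f g)%:E.
Proof.
move=> sf sg; rewrite unlock /ip /Rintegral fineK//.
exact: integrable_fin_num (L2_mul sf sg).
Qed.

Lemma L2_bounded f (b : R) : mbl f -> (forall x, `|f x| <= b) ->
 L2 P f.
Proof.
move=> mf fb; split => //.
apply: (@le_lt_trans _ _ (\int[P]_x (b ^+ 2)%:E)%E); last first.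
 apply: (@le_lt_trans _ _ ((b ^+ 2)%:E * P setT)%E); first by rewrite integral_cst.
 by rewrite probability_setT mule1 ltry.

apply: ge0_le_integral => //.
- by move=> x _; rewrite lee_fin sqr_ge0.
- by apply/mEFin/mfunX.
- move=> x _; rewrite lee_fin -[leLHS]real_normK ?num_real//.
 by rewrite lerXn2r ?nnegrE// (le_trans _ (fb x)).
Qed.

End expectation_L2.

Import HBNNSimple.

Lemma prob_integral_cst dT (T : measurableType dT) (R : realType)
  (P : probability T R) (c : R) : (\int[P]_x c%:E = c%:E)%E.
Proof.
transitivity (c%:E * P setT)%E; first by rewrite integral_cst.
by rewrite probability_setT mule1.
Qed.

Lemma mbl_prod_cond dT (T : measurableType dT) (R : realType) (I : Type)
  (s : seq I) (Q : pred I) (h : I -> T -> R) :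
 (forall i, mbl (h i)) ->
 mbl (fun x => \prod_(i <- s | Q i) h i x).
Proof.
move=> mh; elim: s => [|i s ih].
 by under eq_fun do rewrite big_nil; exact: measurable_cst.
under eq_fun do rewrite big_cons; case: (Q i) => //.
exact: mfunM.
Qed.

Lemma nrm0 dT (T : measurableType dT) (R : realType) (mu : {measure set T -> \bar R}) :
 nrm mu (fun=> 0) = 0.
Proof.
rewrite /nrm /ip /Rintegral integral0_eq ?sqrtr0// => x _.
by rewrite mul0r.
Qed.

Lemma L2cvg_cst dT (T : measurableType dT) (R : realType)
  (mu : {measure set T -> \bar R}) (f : T -> R) : L2cvg mu (fun=> f) f.
Proof.
rewrite /L2cvg (_ : (fun x => f x - f x) = fun=> 0); last first.
 by apply/funext => x; rewrite subrr.
by rewrite nrm0; exact: cvg_cst.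
Qed.

Lemma cvg_sumr (R : realType) (I : Type) (s : seq I) (F : I -> nat -> R) (l : I -> R) :
 (forall i, F i n @[n --> \oo] --> l i) ->
 \sum_(i <- s) F i n @[n --> \oo] --> \sum_(i <- s) l i.
Proof.
move=> Fl; elim: s => [|i s ih].
 by under eq_fun do rewrite big_nil; rewrite big_nil; exact: cvg_cst.
by under eq_fun do rewrite big_cons; rewrite big_cons; exact: cvgD.
Qed.

Lemma expRN_ge (R : realType) (x : R) : 0 <= x -> x - x ^+ 2 <= 1 - expR (- x) <= x.
Proof.
move=> x0; apply/andP; split; last by have := expR_ge1Dx (- x); lra.
have h : expR (- x) * (1 + x) <= 1.
 rewrite -[leRHS](@expRxMexpNx_1 R x) mulrC ler_wpM2r ?expR_ge0//.
 exact: expR_ge1Dx.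
have := expR_ge0 (- x); move: (expR _) h => e h e0.
have : (1 + x) * (x - x ^+ 2) <= (1 + x) * (1 - e) by nra.
rewrite ler_pM2l//; lra.
Qed.

(** By [expRN_ge] the quotient lies between [q - l q^2] and [q]. It serves to differentiate the
    Laplace functional in [mecke_ge0]. *)
Lemma cvg_difference_quotient (R : realType) (l q : nat -> R) (q0 : R) :
 (forall n, 0 < l n) -> l n @[n --> \oo] --> 0 -> (forall n, 0 <= q n) ->
 q n @[n --> \oo] --> q0 ->
 (1 - expR (- (l n * q n))) / l n @[n --> \oo] --> q0.
Proof.
move=> l0 lc qp qc.
apply: (@squeeze_cvgr _ _ _ _ (fun n => q n - l n * (q n * q n)) q); last exact: qc.
 apply: nearW => n; have ln := l0 n.
 have /expRN_ge/andP[h1 h2] : 0 <= l n * q n by rewrite mulr_ge0// ltW.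
 rewrite ler_pdivlMr// ler_pdivrMr// (mulrC (q n) (l n)) h2 andbT.
 by apply: le_trans h1; rewrite le_eqVlt; apply/orP; left; apply/eqP; ring.
rewrite -[X in _ --> X]subr0 -[X in _ - X](mul0r (q0 * q0)).
by apply: cvgB => //; apply: cvgM => //; exact: cvgM.
Qed.

(** * Positive semi-definite kernels on an arbitrary index type *)

Section kernels.
Context {R : realType} {I : Type}.
Implicit Types (K : I -> I -> R) (s t : seq (R * I)).

(** Vectors are formal sums, that is lists of weighted indices with repetitions allowed. The same
    lists encode finite combinations of exponentials, whose inner products are therefore values of
    [qf]. *)
Definition qf K s t := \sum_(a <- s) \sum_(b <- t) a.1 * b.1 * K a.2 b.2.

Definition psd K := forall s, 0 <= qf K s s.

Lemma eq_qf K K' s t : (forall i j, K i j = K' i j) -> qf K s t = qf K' s t.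
Proof. by move=> KK'; apply: eq_bigr => a _; apply: eq_bigr => b _; rewrite KK'. Qed.

Lemma eq_psd K K' : (forall i j, K i j = K' i j) -> psd K -> psd K'.
Proof. by move=> KK' pK s; rewrite -(eq_qf s s KK'). Qed.

Lemma qfD K K' s t : qf (fun i j => K i j + K' i j) s t = qf K s t + qf K' s t.
Proof.
rewrite /qf -big_split; apply: eq_bigr => a _; rewrite -big_split; apply: eq_bigr => b _.
by rewrite /= mulrDr.
Qed.

Lemma qfZ c K s t : qf (fun i j => c * K i j) s t = c * qf K s t.
Proof.
rewrite /qf mulr_sumr; apply: eq_bigr => a _; rewrite mulr_sumr; apply: eq_bigr => b _.
by rewrite mulrCA.
Qed.

Lemma qfB K K' s t : qf (fun i j => K i j - K' i j) s t = qf K s t - qf K' s t.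
Proof.
rewrite -[in RHS]mulN1r -qfZ -qfD; apply: eq_qf => i j; rewrite mulN1r//.
Qed.

Lemma qf_sum (J : Type) (r : seq J) (F : J -> I -> I -> R) s t :
 qf (fun i j => \sum_(k <- r) F k i j) s t = \sum_(k <- r) qf (F k) s t.
Proof.
elim: r => [|k r ih].
 rewrite big_nil /qf big1// => a _; rewrite big1// => b _; rewrite big_nil mulr0//.
by rewrite big_cons -ih -qfD; apply: eq_qf => i j; rewrite big_cons.
Qed.

Lemma qfC K s t : (forall i j, K i j = K j i) -> qf K s t = qf K t s.
Proof.
move=> KC; rewrite /qf exchange_big; apply: eq_bigr => a _; apply: eq_bigr => b _.
by rewrite (mulrC b.1) KC.
Qed.

Lemma le_qf K K' s : psd (fun i j => K' i j - K i j) -> qf K s s <= qf K' s s.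
Proof. by move=> /(_ s); rewrite qfB subr_ge0. Qed.

Lemma psdD K K' : psd K -> psd K' -> psd (fun i j => K i j + K' i j).
Proof. by move=> pK pK' s; rewrite qfD addr_ge0. Qed.

Lemma psdZ c K : 0 <= c -> psd K -> psd (fun i j => c * K i j).
Proof. by move=> c0 pK s; rewrite qfZ mulr_ge0. Qed.

Lemma psd_sum (J : Type) (r : seq J) (F : J -> I -> I -> R) : (forall k, psd (F k)) ->
 psd (fun i j => \sum_(k <- r) F k i j).
Proof. by move=> pF s; rewrite qf_sum sumr_ge0// => k _; exact: pF. Qed.

(** The factors [w] are absorbed in the weights of the list. *)
Lemma psd_conj (w : I -> R) K : psd K -> psd (fun i j => w i * w j * K i j).
Proof.
move=> pK s; have := pK [seq (a.1 * w a.2, a.2) | a <- s].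
rewrite /qf big_map; apply: etrans; congr (_ <= _); apply: eq_bigr => a _.
by rewrite big_map; apply: eq_bigr => b _ /=; ring.
Qed.

Lemma psd1 : psd (fun _ _ => 1).
Proof.
move=> s; rewrite (_ : qf _ s s = (\sum_(a <- s) a.1) ^+ 2) ?sqr_ge0//.
rewrite expr2 mulr_suml; apply: eq_bigr => a _; rewrite mulr_sumr.
by apply: eq_bigr => b _; rewrite mulr1.
Qed.

Lemma psd_lim (Kn : nat -> I -> I -> R) K : (forall n, psd (Kn n)) ->
 (forall i j, Kn n i j @[n --> \oo] --> K i j) -> psd K.
Proof.
move=> pK KnK s.
have c : qf (Kn n) s s @[n --> \oo] --> qf K s s.
 apply: cvg_sumr => a; apply: cvg_sumr => b; apply: cvgM; first exact: cvg_cst.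
 exact: KnK.
rewrite -(cvg_lim _ c)//; apply: limr_ge; first exact: cvgP c.
by apply: nearW => n; exact: pK.
Qed.

End kernels.

(** * Directional derivatives and a syntactic class of smooth functions *)

Section directional.
Context {R : realType} {V : normedModType R}.
Implicit Types (f g : V -> R) (x v : V).

Lemma der_val f x v (a b : R) : is_derive x v f a -> a = b -> is_derive x v f b.
Proof. by move=> d <-. Qed.

(** Restricting to a line turns directional derivatives into derivatives of one real variable, for
    which the chain rule and the mean value theorem are at hand. *)
Lemma der_line f x v c :
 is_derive x v f c <-> is_derive (0 : R) (1 : R) (fun t : R => f (t *: v + x)) c.
Proof.
have E : (fun h : R => h^-1 *: (f (h *: v + x) - f x)) =
  (fun h : R => h^-1 *: (f ((h *: (1 : R) + 0) *: v + x) - f (0 *: v + x))).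
 by apply/funext => h; rewrite addr0 scale0r add0r [_%:A]mulr1.
split=> -[d1 d2]; constructor.
- by move/derivable1P: d1.
- by rewrite -d2 /derive E.
- by apply/derivable1P.
- by rewrite -d2 /derive E.
Qed.

Lemma der_chain (u : R -> R) g x v (a b : R) :
 is_derive (g x) (1 : R) u a -> is_derive x v g b ->
 is_derive x v (fun y => u (g y)) (a * b).
Proof.
move=> du /der_line dg; apply/der_line.
apply: (@is_derive1_comp _ u (fun t => g (t *: v + x))) => //.
by rewrite scale0r add0r.
Qed.

Lemma der_add f g x v a b : is_derive x v f a -> is_derive x v g b ->
 is_derive x v (fun y => f y + g y) (a + b).
Proof. by move=> df dg; exact: is_deriveD. Qed.

Lemma der_mul f g x v a b : is_derive x v f a -> is_derive x v g b ->
 is_derive x v (fun y => f y * g y) (a * g x + f x * b).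
Proof.
move=> df dg; have := @is_deriveM _ _ f g x v a b df dg.
by move=> hd; apply: (der_val hd); rewrite /= addrC /GRing.scale /= (mulrC a).
Qed.

Lemma der_const (c : R) x v : is_derive x v (fun=> c) 0.
Proof. exact: is_derive_cst. Qed.

End directional.

Section univariate.
Context {R : realType}.
Implicit Types u : R -> R.

(** Smoothness comes with the whole sequence of derivatives, so that a derivative is again smooth by
    shifting the sequence. *)
Definition usmooth u := exists U : nat -> R -> R,
 U 0%N = u /\ forall k x, is_derive x (1 : R) (U k) (U k.+1 x).

Lemma is_derive1_continuous u x c : is_derive x (1 : R) u c -> {for x, continuous u}.
Proof. by move=> [du _]; apply: differentiable_continuous; exact/derivable1_diffP. Qed.

Lemma usmooth_expR : usmooth (@expR R).
Proof. by exists (fun=> expR); split => // k x; exact: is_derive_expR. Qed.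

End univariate.

Section smooth_class.
Context {R : realType} {m n : nat}.
Local Notation V := 'M[R]_(m, n).
Implicit Types f g : V -> R.

(** [classC] is stated through iterated derivatives, for which closure under products and
    compositions is laborious. This class is stable under these operations and under
    differentiation, so one induction on the order gives [sm_smooth]. *)
Inductive sm : (V -> R) -> Prop :=
| sm_cst (c : R) : sm (fun=> c)
| sm_coord i j : sm (fun X => X i j)
| sm_add f g : sm f -> sm g -> sm (fun X => f X + g X)
| sm_mul f g : sm f -> sm g -> sm (fun X => f X * g X)
| sm_comp u g : usmooth u -> sm g -> sm (fun X => u (g X))
| sm_inv g : sm g -> (forall X, 0 < g X) -> sm (fun X => (g X)^-1)
| sm_ln g : sm g -> (forall X, 0 < g X) -> sm (fun X => ln (g X)).

Lemma sm_sum (I : Type) (s : seq I) (F : I -> V -> R) : (forall i, sm (F i)) ->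
 sm (fun X => \sum_(i <- s) F i X).
Proof.
move=> sF; elim: s => [|i s ih].
 by under eq_fun do rewrite big_nil; exact: sm_cst.
by under eq_fun do rewrite big_cons; exact: sm_add.
Qed.

Lemma sm_prod (I : Type) (s : seq I) (F : I -> V -> R) : (forall i, sm (F i)) ->
 sm (fun X => \prod_(i <- s) F i X).
Proof.
move=> sF; elim: s => [|i s ih].
 by under eq_fun do rewrite big_nil; exact: sm_cst.
by under eq_fun do rewrite big_cons; exact: sm_mul.
Qed.

Lemma sm_opp f : sm f -> sm (fun X => - f X).
Proof.
by move=> sf; under eq_fun do rewrite -mulN1r; apply: sm_mul => //; exact: sm_cst.
Qed.

Lemma sm_sub f g : sm f -> sm g -> sm (fun X => f X - g X).
Proof. by move=> sf sg; apply: sm_add => //; exact: sm_opp. Qed.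

Lemma der_coord X i j (Y : V) : is_derive X Y (fun Z : V => Z i j) (Y i j).
Proof.
apply/der_line; rewrite (_ : (fun t => _) = fun t : R => Y i j * t + X i j); last first.
 by apply/funext => t; rewrite !mxE mulrC.
have := der_add (der_mul (der_const (Y i j) 0 (1 : R)) (is_derive_id (0 : R) (1 : R)))
 (der_const (X i j) (0 : R) (1 : R)).
by move=> hd; apply: (der_val hd); rewrite mul0r add0r addr0 mulr1.
Qed.

Lemma sm_continuous f : sm f -> continuous f.
Proof.
elim=> {f} [c|i j|f g _ cf _ cg|f g _ cf _ cg|u g [U [<- dU]] _ cg|g _ cg g0|g _ cg g0] X.
- exact: cst_continuous.
- exact: coord_continuous.
- exact: cvgD (cf X) (cg X).
- exact: cvgM (cf X) (cg X).
- exact: (cvg_comp _ _ (cg X) (is_derive1_continuous (dU 0%N (g X)))).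
- have gX0 := lt0r_neq0 (g0 X); exact: cvgV gX0 (cg X).
- exact: (cvg_comp _ _ (cg X) (continuous_ln (g0 X))).
Qed.

Lemma sm_derive f i j : sm f -> exists2 f', sm f' &
 forall X, is_derive X (delta_mx i j) f (f' X).
Proof.
elim=> {f} [c|k l|f g sf [f' sf' df] sg [g' sg' dg]|f g sf [f' sf' df] sg [g' sg' dg]
      |u g [U [<- dU]] sg [g' sg' dg]|g sg [g' sg' dg] g0|g sg [g' sg' dg] g0].
- exists (fun=> 0); first exact: sm_cst.
 by move=> X; exact: der_const.
- exists (fun=> (delta_mx i j : V) k l); first exact: sm_cst.
 by move=> X; exact: der_coord.
- exists (fun X => f' X + g' X); first exact: sm_add.
 by move=> X; exact: der_add.
- exists (fun X => f' X * g X + f X * g' X).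
  by apply: sm_add; exact: sm_mul.
 by move=> X; exact: der_mul.
- exists (fun X => U 1%N (g X) * g' X).
  apply: sm_mul => //; apply: sm_comp => //.
  by exists (fun k => U k.+1); split => // k x; exact: (dU k.+1 x).
 by move=> X; apply: der_chain => //; exact: (dU 0%N).
- exists (fun X => - ((g X)^-1 * (g X)^-1) * g' X).
  by apply: sm_mul => //; apply: sm_opp; apply: sm_mul; exact: sm_inv.
 move=> X; apply: (der_chain (u := fun y => y^-1)) => //.
 have := @is_deriveV R id (g X) 1 1 (lt0r_neq0 (g0 X)) (is_derive_id _ _).
 by move=> hd; apply: (der_val hd); rewrite /GRing.scale /= mulr1 -invfM -expr2.
- exists (fun X => (g X)^-1 * g' X); first by apply: sm_mul => //; exact: sm_inv.
 by move=> X; apply: der_chain => //; exact: is_derive1_ln.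
Qed.

Lemma sm_smooth f : sm f -> smooth f.
Proof.
move=> sf k; elim: k f sf => [|k ih] f sf; first by split => //; exact: sm_continuous.
split; first exact: sm_continuous.
move=> i j; have [f' sf' df] := sm_derive i j sf; split.
 by move=> X; have [] := df X.
rewrite (_ : (fun X => _) = f'); first exact: ih.
by apply/funext => X; have [_] := df X.
Qed.

End smooth_class.

Section usmooth_of_sm.
Context {R : realType}.

(** Each member of [sm] has a derivative in [sm]; iterating a choice of it, with functions of one
    variable seen on 1 x 1 matrices, yields the required sequence. *)
Lemma usmooth_sm (u : R -> R) : sm (fun X : 'rV[R]_1 => u (X ord0 ord0)) -> usmooth u.
Proof.
move=> su; pose W := {f : 'rV[R]_1 -> R | sm f}.
have nxt_ex (w : W) : exists w' : W, forall X, is_derive X (delta_mx ord0 ord0) (sval w) (sval w' X).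
 by case: w => f sf; have [f' sf' df] := sm_derive ord0 ord0 sf; exists (exist _ _ sf').
pose nxt w := sval (cid (nxt_ex w)).
have nxtP w : forall X, is_derive X (delta_mx ord0 ord0) (sval w) (sval (nxt w) X).
 by rewrite /nxt; case: cid.
exists (fun k x => sval (iter k nxt (exist _ _ su)) (const_mx x)); split.
 by apply/funext => x /=; rewrite mxE.
move=> k x; have /der_line := nxtP (iter k nxt (exist _ _ su)) (const_mx x).
set f := sval (iter k nxt _); set c := sval _ _ => h1.
apply/der_line; rewrite (_ : (fun t => _) = fun t : R => f (t *: delta_mx ord0 ord0 + const_mx x))//.
apply/funext => t; congr f; apply/matrixP => i j; rewrite !mxE !ord1 /= mulr1.
by rewrite [t%:A]mulr1.
Qed.

End usmooth_of_sm.

(** * Flat functions and a smooth step from 0 to 1 *)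

Section flat_function.
Context {R : realType}.
Implicit Types p q : {poly R}.

(** A polynomial factor in [1/x] makes the family of [exp (-1/x)] closed under differentiation
    ([der_flat]). *)
Definition flat p (x : R) : R := if 0 < x then p.[x^-1] * expR (- x^-1) else 0.

(** With [y = 1/x], a monomial of degree [i] is compared with [(y / (i+1))^(i+1) <= exp y]; the one
    power in excess produces the factor [x]. *)
Lemma flat_le p : exists C : R, forall x, 0 < x -> `|flat p x| <= C * x.
Proof.
pose c (i : nat) : R := i.+1%:R ^+ i.+1.
exists (\sum_(i < size p) `|p`_i| * c i) => x x0; rewrite /flat x0 horner_coef mulr_suml.
apply: le_trans (ler_norm_sum _ _ _) _; rewrite mulr_suml; apply: ler_sum => i _.
rewrite !normrM -!mulrA ler_wpM2l//; pose y := x^-1.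
have y0 : 0 < y by rewrite invr_gt0.
rewrite -/y ger0_norm ?exprn_ge0 ?(ltW y0)// ger0_norm ?expR_ge0// expRN.
rewrite ler_pdivrMr ?expR_gt0//.
have h1 : y / i.+1%:R <= expR (y / i.+1%:R).
 by apply: le_trans (expR_ge1Dx _); rewrite lerDr ler01.
have h2 : (y / i.+1%:R) ^+ i.+1 <= expR y.
 have -> : expR y = expR (y / i.+1%:R) ^+ i.+1.
  by rewrite -expRM_natl; congr expR; rewrite mulrC divfK// pnatr_eq0.
 by rewrite lerXn2r// nnegrE ?expR_ge0// divr_ge0// ltW.
apply: le_trans (_ : c i * x * (y / i.+1%:R) ^+ i.+1 <= _); last first.
 by rewrite ler_wpM2l// mulr_ge0 ?(ltW x0)// exprn_ge0.
rewrite expr_div_n /c exprS (exprS y) /y -exprS le_eqVlt; apply/orP; left; apply/eqP.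
by field; rewrite expf_neq0 ?pnatr_eq0//= gt_eqF.
Qed.

Lemma der_flat p x : is_derive x (1 : R) (flat p) (flat ('X^2 * (p - p^`())) x).
Proof.
have [x0|x0|->] := ltgtP x 0.
- apply: (@near_eq_is_derive _ _ _ (fun=> 0 : R)).
 + near=> y; rewrite /flat ltNge ltW//; near: y; exact: lt_nbhsl.
 + rewrite /flat ltNge ltW//; exact: der_const.
- apply: (@near_eq_is_derive _ _ _ (fun y : R => p.[y^-1] * expR (- y^-1))).
 + near=> y; rewrite /flat ifT//; near: y; exact: lt_nbhsr.
 + have dV : is_derive x (1 : R) (fun y : R => y^-1) (- (x ^- 2)).
   have := @is_deriveV R id x 1 1 (lt0r_neq0 x0) (is_derive_id _ _).
   by move=> hd; apply: (der_val hd); rewrite /GRing.scale /= mulr1.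
  have dN : is_derive x (1 : R) (fun y : R => - y^-1) (x ^- 2).
   have := der_mul (der_const (-1) x (1 : R)) dV.
   rewrite mul0r add0r mulN1r opprK; congr (is_derive _ _ _ _); apply/funext => y; by rewrite mulN1r.
  have d1 := der_chain (is_derive_poly p x^-1) dV.
  have d2 := der_chain (g := fun y : R => - y^-1) (is_derive_expR (- x^-1)) dN.
  have := der_mul d1 d2; move=> hd; apply: (der_val hd).
  rewrite /flat x0 hornerM hornerXn hornerD hornerN -!exprVn.
  by move: (expR _) => e; move: (x^-1) => y; ring.
(* At 0 the quotient [flat p h / h] is [flat ('X * p) h], which [flat_le] bounds by a multiple of
   [h]. *)
- rewrite /flat ltxx; have [C CP] := flat_le ('X * p).
 have CP0 h : `|h^-1 *: (flat p (h *: (1 : R) + 0) - flat p 0)| <= `|C| * `|h|.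
  rewrite /flat ltxx subr0 addr0 [_%:A]mulr1.
  case: (ltP 0 h) => h0; last by rewrite scaler0 normr0 mulr_ge0.
  have := CP h h0; rewrite /flat h0 hornerM hornerX [_ *: _]mulrA => /le_trans; apply.
  by rewrite (ger0_norm (ltW h0)) ler_wpM2r ?ler_norm// ltW.
 have cv : h^-1 *: (flat p (h *: (1 : R) + 0) - flat p 0) @[h --> 0^'] --> (0 : R).
  apply/cvgrPdist_le => e e0; near=> h; rewrite sub0r normrN.
  apply: le_trans (CP0 h) _; apply: le_trans (_ : (`|C| + 1) * `|h| <= _).
   by rewrite ler_wpM2r// lerDl.
  rewrite mulrC -ler_pdivlMr ?ltr_wpDl//; near: h; apply: dnbhs0_le.
  by rewrite divr_gt0// ltr_wpDl.
 by constructor; [apply/cvg_ex; exists 0|exact: cvg_lim cv].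
Unshelve. all: by end_near. Qed.

Lemma usmooth_flat p : usmooth (flat p).
Proof.
exists (fun k => flat (iter k (fun q => 'X^2 * (q - q^`())) p)); split => // k x.
exact: der_flat.
Qed.

Lemma flat_le0 p x : x <= 0 -> flat p x = 0.
Proof. by rewrite /flat ltNge => ->. Qed.

Definition bump0 (x : R) := flat 1 x.

Lemma bump0_gt0 x : 0 < x -> 0 < bump0 x.
Proof. by move=> x0; rewrite /bump0 /flat x0 hornerC mul1r expR_gt0. Qed.

Lemma bump0_ge0 x : 0 <= bump0 x.
Proof. by case: (ltP 0 x) => [/bump0_gt0/ltW//|/(flat_le0 1) h]; rewrite /bump0 h. Qed.

Definition den (x : R) := bump0 x + bump0 (1 - x).

Lemma den_gt0 x : 0 < den x.
Proof.
rewrite /den; case: (ltP 0 x) => x0; first by rewrite ltr_wpDr ?bump0_ge0// bump0_gt0.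
by rewrite ltr_wpDl ?bump0_ge0// bump0_gt0//; lra.
Qed.

Definition step (x : R) : R := bump0 x * (den x)^-1.

Lemma step_ge0 x : 0 <= step x.
Proof. by rewrite mulr_ge0 ?bump0_ge0// invr_ge0 ltW// den_gt0. Qed.

Lemma step_le1 x : step x <= 1.
Proof. by rewrite /step ler_pdivrMr ?den_gt0// mul1r lerDl bump0_ge0. Qed.

Lemma step0 x : x <= 0 -> step x = 0.
Proof. by move=> x0; rewrite /step /bump0 flat_le0// mul0r. Qed.

Lemma step1 x : 1 <= x -> step x = 1.
Proof.
move=> x1; rewrite /step /den /bump0 (flat_le0 1 (x := 1 - x)) ?addr0; last lra.
by rewrite divff// gt_eqF// bump0_gt0//; lra.
Qed.

Lemma sm_step {m n} (g : 'M[R]_(m, n) -> R) : sm g -> sm (fun X => step (g X)).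
Proof.
move=> sg; have s1 : sm (fun X => bump0 (g X)) by apply: sm_comp => //; exact: usmooth_flat.
have s2 : sm (fun X => bump0 (1 - g X)).
 by apply: sm_comp; [exact: usmooth_flat|apply: sm_sub => //; exact: sm_cst].
apply: sm_mul => //; apply: (sm_inv (g := fun X => den (g X))); first exact: sm_add.
by move=> X; exact: den_gt0.
Qed.

Lemma usmooth_step : usmooth step.
Proof. by apply: usmooth_sm; apply: sm_step; exact: sm_coord. Qed.

Definition dstep : R -> R := sval (cid usmooth_step) 1%N.

Lemma der_step x : is_derive x (1 : R) step (dstep x).
Proof. by rewrite /dstep; case: cid => U /= [U0 dU]; rewrite -{1}U0; exact: dU. Qed.

Lemma dstep_eq x c : is_derive x (1 : R) step c -> dstep x = c.
Proof.
by move=> [_ <-]; have [_ <-] := der_step x.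
Qed.

Lemma cts_dstep : continuous dstep.
Proof.
move=> x; rewrite /dstep; case: cid => U /= [U0 dU].
exact: is_derive1_continuous (dU 1%N x).
Qed.

(** The end points are included: there the flat functions vanish together with their derivatives. *)
Lemma dstep_out x : x <= 0 \/ 1 <= x -> dstep x = 0.
Proof.
move=> xo; apply: dstep_eq; pose q : {poly R} := 'X^2 * (1 - 1^`()).
have d1 : is_derive x (1 : R) bump0 (flat q x) by exact: der_flat.
have da : is_derive x (1 : R) (fun y : R => 1 - y) (-1).
 have := der_add (der_const 1 x (1 : R)) (der_mul (der_const (-1) x (1 : R)) (is_derive_id x (1 : R))).
 rewrite mul0r !add0r mulr1; congr (is_derive _ _ _ _); apply/funext => y; by rewrite mulN1r.
have d2 : is_derive x (1 : R) (fun y => bump0 (1 - y)) (flat q (1 - x) * -1).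
 exact: der_chain (der_flat _ _) da.
have dd := der_add d1 d2.
have dI := @is_deriveV R den x _ 1 (lt0r_neq0 (den_gt0 x)) dd.
have := der_mul d1 dI; move=> hd; apply: (der_val hd).
rewrite /GRing.scale /=; case: xo => xo.
 by rewrite /bump0 !(flat_le0 _ xo) !mul0r addr0.
rewrite /den /bump0 (flat_le0 q (x := 1 - x)) ?(flat_le0 1 (x := 1 - x)); try lra.
rewrite mul0r !addr0; have : 0 < flat 1 x by apply: bump0_gt0; lra.
by move: (flat 1 x) (flat q x) => a b a0; field; rewrite gt_eqF.
Qed.

Lemma dstep_bounded : exists2 C : R, 0 <= C & forall x, `|dstep x| <= C.
Proof.
have cd : continuous (fun x => `|dstep x|).
 by move=> x; apply: cvg_norm; exact: cts_dstep.
have [c _ cP] := @EVT_max R (fun x => `|dstep x|) 0 1 ler01 (continuous_subspaceT cd).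
exists `|dstep c| => // x; case: (boolP (x \in `[0, 1])) => [/cP//|].
rewrite in_itv /= negb_and -!ltNge => /orP xo; rewrite dstep_out ?normr0//.
by case: xo => /ltW; [left|right].
Qed.

Lemma step_nd x y : x <= y -> step x <= step y.
Proof.
have bnd_ x' y' : x' <= y' -> bump0 x' <= bump0 y'.
 move=> xy; case: (ltP 0 x') => x0; last by rewrite [leLHS]/bump0 flat_le0// bump0_ge0.
 have y0 : 0 < y' by exact: lt_le_trans xy.
 by rewrite /bump0 /flat x0 y0 !hornerC !mul1r ler_expR lerN2 lef_pV2.
move=> xy; rewrite /step ler_pdivrMr ?den_gt0// mulrAC ler_pdivlMr ?den_gt0//.
have h1 := bnd_ _ _ xy; have h2 : bump0 (1 - y) <= bump0 (1 - x) by apply: bnd_; lra.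
have := bump0_ge0 x; have := bump0_ge0 (1 - y); have := bump0_ge0 (1 - x); rewrite /den.
move: (bump0 x) (bump0 y) (bump0 (1 - x)) (bump0 (1 - y)) h1 h2 => a b c e; nra.
Qed.

End flat_function.

(** * Smooth splines on the integers *)

Section spline.
Context {R : realType}.
Implicit Types s t : R.

Lemma MVT_line (f df : R -> R) (a b : R) : (forall t, is_derive t (1 : R) f (df t)) ->
 exists2 c, Num.min a b <= c <= Num.max a b & f b - f a = df c * (b - a).
Proof.
move=> fd; have cf : continuous f by move=> t; exact: is_derive1_continuous (fd t).
case: (leP a b) => ab.
 have [c cab E] := MVT_segment ab (fun t _ => fd t) (continuous_subspaceT cf).
 by exists c => //; move: cab; rewrite in_itv.
have [c cab E] := MVT_segment (ltW ab) (fun t _ => fd t) (continuous_subspaceT cf).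
exists c; first by move: cab; rewrite in_itv.
by rewrite -opprB E -mulrN opprB.
Qed.

(** Being a difference of translates of [step], its integer translates have telescoping sums; [hat]
    and [dhat] are built in the same way for the same reason. *)
Definition beta t : R := step (t + 1) - step t.

Lemma beta_ge0 t : 0 <= beta t.
Proof. by rewrite subr_ge0 step_nd// lerDl. Qed.

Lemma beta_out t : t <= -1 \/ 1 <= t -> beta t = 0.
Proof. by rewrite /beta => -[]t1; [rewrite !step0 ?subrr//; lra|rewrite !step1 ?subrr//; lra]. Qed.

Lemma sm_beta {m n} (g : 'M[R]_(m, n) -> R) : sm g -> sm (fun X => beta (g X)).
Proof.
move=> sg; apply: sm_sub; last exact: sm_step.
by apply: sm_step; apply: sm_add => //; exact: sm_cst.
Qed.

Lemma usmooth_beta : usmooth beta.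
Proof. by apply: usmooth_sm; apply: sm_beta; exact: sm_coord. Qed.

Lemma cts_beta : continuous beta.
Proof.
by have [U [<- dU]] := usmooth_beta => t; exact: is_derive1_continuous (dU 0%N t).
Qed.

(* an antiderivative of [beta], growing from 0 to 1 *)
Definition ramp t : R := \int[lebesgue_measure]_(x in `]-oo, t]) beta x.

Lemma beta_integrable t : lebesgue_measure.-integrable `]-oo, t] (EFin \o beta).
Proof.
apply: (@integrableS _ _ _ _ setT) => //.
have mb : mbl beta by apply: continuous_measurable_fun; exact: cts_beta.
have i1 : lebesgue_measure.-integrable `[-1, 1] (EFin \o beta).
 apply: continuous_compact_integrable; first exact: segment_compact.
 by apply: continuous_subspaceT; exact: cts_beta.
have : lebesgue_measure.-integrable setT ((EFin \o beta) \_ `[-1, 1]).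
 by apply/integrable_restrict; rewrite ?setTI.
congr (_.-integrable _ _); apply/funext => x; rewrite patchE; case: ifPn => //.
move=> /negP xi; rewrite /= beta_out//; apply: contrapT => /not_orP[/negP h1 /negP h2]; apply: xi.
by apply/mem_set; rewrite /= in_itv /=; move: h1 h2; rewrite -!ltNge => /ltW -> /ltW ->.
Qed.

Lemma der_ramp t : is_derive t (1 : R) ramp (beta t).
Proof.
have tt : t < t + 1 by rewrite ltrDl.
have [||h1 h2] := @continuous_FTC1 R beta -oo%O t (t + 1) tt (beta_integrable _).
- by rewrite ltNyr.
- exact: cts_beta.
by split; [exact: h1|rewrite -h2 derive1E].
Qed.

Lemma ramp0 t : t <= -1 -> ramp t = 0.
Proof.
move=> t1; rewrite /ramp /Rintegral integral0_eq//= => x; rewrite in_itv /= => xt.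
by rewrite beta_out//; left; exact: le_trans t1.
Qed.

Lemma ramp1 t : 1 <= t -> ramp t = 1.
Proof.
have r1 : ramp 1 = 1.
 (* On []0, 1[] the values [beta x] and [beta (x - 1)] add up to 1, so [ramp y + ramp (y - 1)]
    increases by 1 from 0 to 1; this increment is [ramp 1 - ramp (-1)]. *)
 have dr (x : R) : x \in `]0, 1[ -> is_derive x (1 : R) (fun y => ramp y + ramp (y + -1)) ((fun=> 1) x).
  rewrite in_itv /= => /andP[x0 x1].
  have ds : is_derive x (1 : R) (fun y : R => y + -1) 1.
   by have := der_add (is_derive_id x (1 : R)) (der_const (-1) x (1 : R)); rewrite addr0.
  have := der_add (der_ramp x) (der_chain (g := fun y : R => y + -1) (der_ramp (x + -1)) ds).
  move=> hd; apply: (der_val hd); rewrite mulr1 /beta subrK.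
  by rewrite (step0 (x := x + -1)) ?(step1 (x := x + 1)); lra.
 have cr : continuous ramp by move=> x; exact: is_derive1_continuous (der_ramp x).
 have [|c _] := MVT_segment ler01 dr.
  apply: continuous_subspaceT => x; apply: cvgD; first exact: cr.
  apply: (@continuous_comp _ _ _ (fun y : R => y + -1) ramp); last exact: cr.
  by apply: cvgD; [exact: cvg_id|exact: cvg_cst].
 by rewrite subrr add0r (ramp0 (lexx _)) addr0 subr0 mulr1; lra.
move=> t1; have [c ct E] := MVT_line 1 t der_ramp.
move: ct; rewrite (min_idPl t1) (max_idPr t1) => /andP[c1 _].
by move: E; rewrite beta_out ?mul0r; [lra|right].
Qed.

Lemma ramp_nd s t : s <= t -> ramp s <= ramp t.
Proof.
move=> st; have [c _ E] := MVT_line s t der_ramp.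
by rewrite -subr_ge0 E mulr_ge0 ?beta_ge0 ?subr_ge0.
Qed.

Lemma ramp01 t : 0 <= ramp t <= 1.
Proof.
apply/andP; split.
 have [t1|t1] := leP t (-1); first by rewrite ramp0.
 by rewrite -(ramp0 (lexx _)) ramp_nd// ltW.
have [t1|t1] := leP 1 t; first by rewrite ramp1.
by rewrite -[leRHS](ramp1 (lexx _)) ramp_nd// ltW.
Qed.

Lemma usmooth_ramp : usmooth ramp.
Proof.
have [U [U0 dU]] := usmooth_beta.
exists (fun k => if k is k'.+1 then U k' else ramp); split => // -[|k] t //.
by rewrite U0; exact: der_ramp.
Qed.

Definition hat t : R := ramp (t + 1) - ramp t.

Definition dhat t : R := beta (t + 1) - beta t.

Lemma hat_ge0 t : 0 <= hat t.
Proof. by rewrite subr_ge0 ramp_nd// lerDl. Qed.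

Lemma hat_out t : 2 <= `|t| -> hat t = 0.
Proof.
rewrite /hat ler_normr => /orP[]t2.
 by rewrite !ramp1 ?subrr//; lra.
by rewrite !ramp0 ?subrr//; lra.
Qed.

Lemma dhat_out t : 2 <= `|t| -> dhat t = 0.
Proof.
rewrite /dhat ler_normr => /orP[]t2.
 by rewrite !beta_out ?subrr//; right; lra.
by rewrite !beta_out ?subrr//; left; lra.
Qed.

Lemma der_hat t : is_derive t (1 : R) hat (dhat t).
Proof.
have ds : is_derive t (1 : R) (fun y : R => y + 1) 1.
 by have := der_add (is_derive_id t (1 : R)) (der_const 1 t (1 : R)); rewrite addr0.
have dm : is_derive t (1 : R) (fun y : R => -1 * ramp y) (0 * ramp t + -1 * beta t).
 exact: der_mul (der_const (-1) t (1 : R)) (der_ramp t).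
have := der_add (der_chain (g := fun y : R => y + 1) (der_ramp (t + 1)) ds) dm.
rewrite mul0r add0r mulr1 mulN1r.
by congr (is_derive _ _ _ _); apply/funext => y; rewrite mulN1r.
Qed.

Lemma sm_hat {m n} (g : 'M[R]_(m, n) -> R) : sm g -> sm (fun X => hat (g X)).
Proof.
move=> sg; apply: sm_sub; last exact: sm_comp usmooth_ramp sg.
by apply: (sm_comp usmooth_ramp); apply: sm_add => //; exact: sm_cst.
Qed.

Variable K : nat.

Lemma sum_hat t : \sum_(i < (2 * K).+1) hat (t - (i%:R - K%:R)) = ramp (t + K%:R + 1) - ramp (t - K%:R).
Proof.
pose U (i : nat) := - ramp (t - (i%:R - K%:R) + 1).
have E (i : nat) : hat (t - (i%:R - K%:R)) = U i.+1 - U i.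
 rewrite /hat /U opprK addrC; congr (_ + _); congr (- ramp _).
 by rewrite -natr1; lra.
rewrite -(big_mkord xpredT (fun i : nat => hat (t - (i%:R - K%:R)))).
rewrite (eq_bigr (fun i : nat => U i.+1 - U i)) => [|i _]; last exact: E.
rewrite telescope_sumr// /U opprK addrC; congr (ramp _ - ramp _); first lra.
by rewrite -natr1 natrM; lra.
Qed.

Lemma sum_dhat t : \sum_(i < (2 * K).+1) dhat (t - (i%:R - K%:R)) = beta (t + K%:R + 1) - beta (t - K%:R).
Proof.
pose U (i : nat) := - beta (t - (i%:R - K%:R) + 1).
have E (i : nat) : dhat (t - (i%:R - K%:R)) = U i.+1 - U i.
 rewrite /dhat /U opprK addrC; congr (_ + _); congr (- beta _).
 by rewrite -natr1; lra.
rewrite -(big_mkord xpredT (fun i : nat => dhat (t - (i%:R - K%:R)))).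
rewrite (eq_bigr (fun i : nat => U i.+1 - U i)) => [|i _]; last exact: E.
rewrite telescope_sumr// /U opprK addrC; congr (beta _ - beta _); first lra.
by rewrite -natr1 natrM; lra.
Qed.

Lemma sum_beta t : \sum_(i < (2 * K).+1) beta (t - (i%:R - K%:R)) = step (t + K%:R + 1) - step (t - K%:R).
Proof.
pose U (i : nat) := - step (t - (i%:R - K%:R) + 1).
have E (i : nat) : beta (t - (i%:R - K%:R)) = U i.+1 - U i.
 rewrite /beta /U opprK addrC; congr (_ + _); congr (- step _).
 by rewrite -natr1; lra.
rewrite -(big_mkord xpredT (fun i : nat => beta (t - (i%:R - K%:R)))).
rewrite (eq_bigr (fun i : nat => U i.+1 - U i)) => [|i _]; last exact: E.
rewrite telescope_sumr// /U opprK addrC; congr (step _ - step _); first lra.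
by rewrite -natr1 natrM; lra.
Qed.

Lemma sum_hat_le1 t : \sum_(i < (2 * K).+1) hat (t - (i%:R - K%:R)) <= 1.
Proof.
rewrite sum_hat; have /andP[_] := ramp01 (t + K%:R + 1).
by have /andP[+ _] := ramp01 (t - K%:R); lra.
Qed.

(** The bound is uniform in the number of nodes because [|dhat|] is dominated by two translates of
    [beta], each of which sums to at most 1. *)
Lemma sum_normr_dhat t : \sum_(i < (2 * K).+1) `|dhat (t - (i%:R - K%:R))| <= 2.
Proof.
apply: (@le_trans _ _ (\sum_(i < (2 * K).+1) (beta (t + 1 - (i%:R - K%:R)) + beta (t - (i%:R - K%:R))))).
 apply: ler_sum => i _; apply: le_trans (ler_normB _ _) _.
 by rewrite !ger0_norm ?beta_ge0// (addrAC t).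
rewrite big_split /= !sum_beta.
have a1 := step_le1 (t + K%:R + 1); have a2 := step_le1 (t + 1 + K%:R + 1).
by have a3 := step_ge0 (t + 1 - K%:R); have a4 := step_ge0 (t - K%:R); lra.
Qed.

Hypothesis (K1 : (0 < K)%N).

Lemma sum_hat1 t : `|t| <= K%:R - 1 -> \sum_(i < (2 * K).+1) hat (t - (i%:R - K%:R)) = 1.
Proof.
by rewrite ler_norml => /andP[h1 h2]; rewrite sum_hat ramp1 ?ramp0 ?subr0//; lra.
Qed.

Lemma sum_dhat0 t : `|t| <= K%:R - 1 -> \sum_(i < (2 * K).+1) dhat (t - (i%:R - K%:R)) = 0.
Proof.
rewrite ler_norml => /andP[h1 h2]; rewrite sum_dhat !beta_out ?subrr//; first by left; lra.
by right; lra.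
Qed.

(* summation by parts: the splines [hat] reproduce affine functions *)
Lemma sum_node_dhat t : `|t| <= K%:R - 1 ->
 \sum_(i < (2 * K).+1) (i%:R - K%:R) * dhat (t - (i%:R - K%:R)) = 1.
Proof.
rewrite ler_norml => /andP[h1 h2].
pose U (i : nat) := - ((i%:R - 1 - K%:R) * beta (t - (i%:R - K%:R) + 1)) - step (t - (i%:R - K%:R) + 2).
have E (i : nat) : (i%:R - K%:R) * dhat (t - (i%:R - K%:R)) = U i.+1 - U i.
 rewrite /dhat /U -natr1.
 rewrite (_ : t - (i%:R + 1 - K%:R) + 1 = t - (i%:R - K%:R)); last lra.
 rewrite (_ : t - (i%:R + 1 - K%:R) + 2 = t - (i%:R - K%:R) + 1); last lra.
 rewrite {1 4}/beta (_ : t - (i%:R - K%:R) + 1 + 1 = t - (i%:R - K%:R) + 2); last lra.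
 by move: (t - _) => z; rewrite /beta; ring.
rewrite -(big_mkord xpredT (fun i : nat => (i%:R - K%:R) * dhat (t - (i%:R - K%:R)))).
rewrite (eq_bigr (fun i : nat => U i.+1 - U i)) => [|i _]; last exact: E.
rewrite telescope_sumr// /U -natr1 natrM.
rewrite (beta_out (t := _ - (0 - _) + 1)); last by right; lra.
rewrite (beta_out (t := _ + 1)); last by left; lra.
rewrite (step0 (x := _ - (_ + 1 - _) + 2)); last lra.
by rewrite (step1 (x := _ + 2)); lra.
Qed.

End spline.

(** * Uniform approximation of functions of counts by characters *)

Section characters.
Context {R : realType} {Z : finType}.
Implicit Types (u v : (Z -> nat) -> R) (n k : Z -> nat).

(** Evaluated at the numbers [n] of points in the cells of a grid, these characters of the monoid of
    counts become exponentials of configurations ([chr_counts]). *)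
Definition chr k n : R := \prod_z 2^-1 ^+ (k z * n z).

Definition chrspn (s : seq (R * (Z -> nat))) n : R := \sum_(a <- s) a.1 * chr a.2 n.

(** The uniform closure of the span of the characters. It is an algebra, hence contains polynomials
    in [2^-n] and, through them, indicators. *)
Definition capp u := forall e : R, 0 < e -> exists s, forall n, `|u n - chrspn s n| <= e.

Lemma chr0_1 k n : 0 <= chr k n <= 1.
Proof.
apply/andP; split; first by apply: prodr_ge0 => z _; rewrite exprn_ge0// invr_ge0.
apply: prodr_ile1 => z _; rewrite exprn_ge0 ?invr_ge0//= exprn_ile1 ?invr_ge0//.
by rewrite invf_le1// ler1n.
Qed.

Lemma chrspn_bounded s : exists2 b, 0 <= b & forall n, `|chrspn s n| <= b.
Proof.
exists (\sum_(a <- s) `|a.1|) => [|n]; first exact: sumr_ge0.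
apply: le_trans (ler_norm_sum _ _ _) _; apply: ler_sum => a _.
have /andP[c0 c1] := chr0_1 a.2 n.
by rewrite normrM (ger0_norm c0) ler_piMr.
Qed.

Lemma capp_bounded u : capp u -> exists2 b, 0 <= b & forall n, `|u n| <= b.
Proof.
move=> /(_ 1 ltr01)[s us]; have [b b0 sb] := chrspn_bounded s.
exists (1 + b) => [|n]; first by rewrite addr_ge0.
by rewrite -(subrK (chrspn s n) (u n)) (le_trans (ler_normD _ _))// lerD.
Qed.

Lemma capp_spn s : capp (chrspn s).
Proof. by move=> e e0; exists s => n; rewrite subrr normr0 ltW. Qed.

Lemma capp_lim u : (forall e : R, 0 < e -> exists2 v, capp v & forall n, `|u n - v n| <= e) -> capp u.
Proof.
move=> uP e e0; have [v cv uv] := uP (e / 2) (ltac:(by rewrite divr_gt0)).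
have [s vs] := cv (e / 2) (ltac:(by rewrite divr_gt0)).
exists s => n; rewrite (splitr e) (_ : _ - _ = (u n - v n) + (v n - chrspn s n)); last by rewrite addrA subrK.
by rewrite (le_trans (ler_normD _ _))// lerD.
Qed.

Lemma chrspn_mul s t : exists w, forall n, chrspn s n * chrspn t n = chrspn w n.
Proof.
exists [seq (a.1 * b.1, fun z => (a.2 z + b.2 z)%N) | a <- s, b <- t] => n.
rewrite /chrspn big_allpairs_dep mulr_suml; apply: eq_bigr => a _.
rewrite mulr_sumr; apply: eq_bigr => b _ /=.
rewrite mulrACA; congr (_ * _); rewrite -big_split /=; apply: eq_bigr => z _.
by rewrite -exprD mulnDl.
Qed.

Lemma capp_mul u v : capp u -> capp v -> capp (fun n => u n * v n).
Proof.
move=> cu cv; have [bu bu0 ub] := capp_bounded cu; have [bv bv0 vb] := capp_bounded cv.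
move=> e e0; pose e' := Num.min 1 (e / (bu + bv + 1)).
have q0 : 0 < bu + bv + 1 by rewrite ltr_wpDl// addr_ge0.
have e'0 : 0 < e' by rewrite lt_min ltr01 divr_gt0.
have e'1 : e' <= 1 by rewrite ge_min lexx.
have e'e : e' * (bu + bv + 1) <= e by rewrite -ler_pdivlMr// ge_min lexx orbT.
have [s us] := cu _ e'0; have [t vt] := cv _ e'0; have [w wE] := chrspn_mul s t.
exists w => n; rewrite -wE.
rewrite (_ : _ - _ = u n * (v n - chrspn t n) + (u n - chrspn s n) * v n - (u n - chrspn s n) * (v n - chrspn t n)); last by ring.
rewrite (le_trans (ler_normB _ _))//; apply: le_trans e'e.
have h1 : `|u n * (v n - chrspn t n) + (u n - chrspn s n) * v n| <= bu * e' + e' * bv.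
 by rewrite (le_trans (ler_normD _ _))// !normrM lerD// ler_pM.
have h2 : `|(u n - chrspn s n) * (v n - chrspn t n)| <= e' * 1.
 by rewrite normrM ler_pM// (le_trans (vt n)).
by move: h1 h2; lra.
Qed.

Lemma capp_cst c : capp (fun=> c).
Proof.
move=> e e0; exists [:: (c, fun=> 0%N)] => n.
by rewrite /chrspn big_seq1 /= /chr big1 ?mulr1 ?subrr ?normr0 ?(ltW e0).
Qed.

Lemma capp_add u v : capp u -> capp v -> capp (fun n => u n + v n).
Proof.
move=> cu cv e e0; have e20 : 0 < e / 2 by rewrite divr_gt0.
have [s us] := cu _ e20; have [t vt] := cv _ e20; exists (s ++ t) => n.
rewrite /chrspn big_cat/= (splitr e) -!/(chrspn _ _).
by rewrite opprD addrACA (le_trans (ler_normD _ _))// lerD.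
Qed.

Lemma capp_sum (I : Type) (r : seq I) (U : I -> (Z -> nat) -> R) : (forall i, capp (U i)) ->
 capp (fun n => \sum_(i <- r) U i n).
Proof.
move=> cU; elim: r => [|i r ih]; first by under eq_fun do rewrite big_nil; exact: capp_cst.
by under eq_fun do rewrite big_cons; exact: capp_add.
Qed.

Lemma capp_prod (I : Type) (r : seq I) (U : I -> (Z -> nat) -> R) : (forall i, capp (U i)) ->
 capp (fun n => \prod_(i <- r) U i n).
Proof.
move=> cU; elim: r => [|i r ih]; first by under eq_fun do rewrite big_nil; exact: capp_cst.
by under eq_fun do rewrite big_cons; exact: capp_mul.
Qed.

Lemma capp_exp u j : capp u -> capp (fun n => u n ^+ j).
Proof.
move=> cu; elim: j => [|j ih]; first by under eq_fun do rewrite expr0; exact: capp_cst.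
by under eq_fun do rewrite exprS; exact: capp_mul.
Qed.

Lemma capp_half z : capp (fun n => 2^-1 ^+ n z).
Proof.
rewrite (_ : (fun n => _) = chrspn [:: (1, fun y => (y == z) : nat)]); first exact: capp_spn.
apply/funext => n; rewrite /chrspn big_seq1 mul1r /= /chr (bigD1 z)//= eqxx mul1n big1 ?mulr1// => y /negbTE ->.
by rewrite mul0n expr0.
Qed.

Lemma half_gap (i j : nat) : i != j -> (2^-1 ^+ j.+1 : R) <= `|2^-1 ^+ i - 2^-1 ^+ j|.
Proof.
have h0 (a : nat) : 0 <= 2^-1 ^+ a :> R by rewrite exprn_ge0// invr_ge0.
have h2 (a b : nat) : (a <= b)%N -> 2^-1 ^+ b <= 2^-1 ^+ a :> R.
 by move=> ab; rewrite ler_wiXn2l ?invr_ge0// invf_le1// ler1n.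
rewrite neq_ltn => /orP[ij|ij].
 have := h2 _ _ ij; rewrite exprS => h; apply: le_trans (ler_norm _).
 by rewrite exprS; have := h0 i; have := h0 j; lra.
have := h2 _ _ ij; rewrite exprS => h; rewrite distrC; apply: le_trans (ler_norm _).
by have := h0 i; have := h0 j; lra.
Qed.

(* [(1 - (2^-n - 2^-j)^2)^m] tends to the indicator function of [n = j]. *)
Lemma capp_indic z (j : nat) : capp (fun n => (n z == j)%:R).
Proof.
apply: capp_lim => e e0; pose g : R := 2^-1 ^+ j.+1; pose q : R := 1 - g ^+ 2.
have g0 : 0 < g by rewrite exprn_gt0// invr_gt0.
have g1 : g <= 1 by rewrite exprn_ile1 ?invr_ge0// invf_le1// ler1n.
have q0 : 0 <= q by rewrite /q subr_ge0 expr_le1// ltW.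
have q1 : `|q| < 1 by rewrite ger0_norm// /q ltrBlDr ltrDl exprn_gt0.
have : q ^+ m @[m --> \oo] --> (0 : R) by exact: cvg_expr.
move=> /cvgr0Pnorm_le/(_ e e0)[m _ /(_ m (leqnn m)) qm].
exists (fun n => (1 + -1 * (2^-1 ^+ n z + - (2^-1 ^+ j)) ^+ 2) ^+ m).
 apply/capp_exp/capp_add; first exact: capp_cst.
 apply: capp_mul; first exact: capp_cst.
 apply/capp_exp/capp_add; [exact: capp_half|exact: capp_cst].
move=> n; have [->|nj] := eqVneq (n z) j; first by rewrite subrr expr0n mulr0 addr0 expr1n subrr normr0 ltW.
rewrite sub0r normrN; apply: le_trans qm; rewrite !normrX lerXn2r ?nnegrE//.
rewrite [in leRHS]ger0_norm// ger0_norm mulN1r.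
 by rewrite /q lerD2l lerN2 -[leRHS]real_normK ?num_real// lerXn2r ?nnegrE ?(ltW g0)// half_gap.
have h (a : nat) : (0 : R) <= (2^-1 : R) ^+ a <= 1.
 by rewrite exprn_ge0 ?invr_ge0//= exprn_ile1 ?invr_ge0// invf_le1// ler1n.
have /andP[] := h (n z); have /andP[] := h j.
by move: (_ ^+ n z) (_ ^+ j) => a b; nra.
Qed.

(** Only finitely many patterns on [A] give a nonzero value, so [u] is a finite sum of products of
    indicators. In [ind] the coordinates off [A] are pinned to [ord0], so that each pattern is
    counted once. *)
Lemma capp_finite u (A : {set Z}) (B : nat) :
 (forall n n', {in A, n =1 n'} -> u n = u n') ->
 (forall n z, z \in A -> (B <= n z)%N -> u n = 0) -> capp u.
Proof.
move=> uA uB.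
pose ind (k : {ffun Z -> 'I_B.+1}) (n : Z -> nat) : R :=
 \prod_z (if z \in A then (n z == k z :> nat)%:R else (k z == ord0)%:R).
rewrite (_ : u = fun n => \sum_(k : {ffun Z -> 'I_B.+1}) u (fun z => k z) * ind k n).
 apply: capp_sum => k; apply: capp_mul; first exact: capp_cst.
 apply: (capp_prod _ (U := fun z n => if z \in A then _ else _)) => z; case: (z \in A); [exact: capp_indic|exact: capp_cst].
apply/funext => n; have ind1 (k : {ffun Z -> 'I_B.+1}) : ind k n != 0 -> forall z, if z \in A then n z = k z else k z = ord0.
 move=> /prodf_neq0 h z; have := h z isT.
 by case: ifP => _; rewrite pnatr_eq0 eqb0 negbK => /eqP.
have [/existsP[z /andP[zA zB]]|/existsPn nB] := boolP [exists z, (z \in A) && (B <= n z)%N].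
 rewrite (uB _ _ zA zB) big1// => k _.
 have [->|/ind1/(_ z)] := eqVneq (ind k n) 0; first by rewrite mulr0.
 by rewrite zA => nk; rewrite (uB _ z zA) ?mul0r// -nk.
have lt z : z \in A -> (n z < B)%N by move=> zA; have := nB z; rewrite zA /= -ltnNge.
pose k0 : {ffun Z -> 'I_B.+1} := [ffun z => if z \in A then inord (n z) else ord0].
have k0E z : z \in A -> k0 z = n z :> nat.
 by move=> zA; rewrite ffunE zA inordK// ltnS ltnW// lt.
rewrite (bigD1 k0)//= [X in _ + X]big1 ?addr0.
 rewrite /ind big1 ?mulr1; last first.
  by move=> z _; case: ifPn => zA; [rewrite k0E// eqxx|rewrite ffunE (negbTE zA) eqxx].
 by apply: uA => z zA; rewrite k0E.
move=> k kk0; have [->|/ind1 h] := eqVneq (ind k n) 0; first by rewrite mulr0.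
case/eqP: kk0; apply/ffunP => z; have := h z; rewrite ffunE; case: ifP => // _ nk.
by apply/val_inj; rewrite /= nk inordK// ltn_ord.
Qed.

End characters.

Lemma der_bigsum {R : realType} {V : normedModType R} (I : Type) (r : seq I)
  (F : I -> V -> R) (F' : I -> R) (x v : V) : (forall i, is_derive x v (F i) (F' i)) ->
 is_derive x v (fun y => \sum_(i <- r) F i y) (\sum_(i <- r) F' i).
Proof.
move=> dF; elim: r => [|i r ih].
 by rewrite big_nil; under eq_fun do rewrite big_nil; exact: der_const.
by rewrite big_cons; under eq_fun do rewrite big_cons; exact: der_add.
Qed.

(** * Expansion of products of sums over assignments *)

Section multilinear_sums.
Context {R : realType} {J Z : finType}.
Implicit Types (F : J -> Z -> R) (u : {ffun J -> Z} -> R).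

(** When each [F j] is a probability on [Z], this is the mean of [u] over independent random
    assignments of cells [Z] to points [J]. *)
Definition mlsum F u := \sum_(s : {ffun J -> Z}) u s * \prod_j F j (s j).

Lemma mlsum_prod F (w : J -> Z -> R) :
 mlsum F (fun s => \prod_j w j (s j)) = \prod_j \sum_z w j z * F j z.
Proof. by rewrite bigA_distr_bigA; apply: eq_bigr => s _; rewrite -big_split. Qed.

Lemma mlsum_cst F c : mlsum F (fun=> c) = c * \prod_j \sum_z F j z.
Proof. by rewrite /mlsum -mulr_sumr bigA_distr_bigA. Qed.

Lemma mlsum_at F i (w : Z -> R) : mlsum F (fun s => w (s i)) =
 (\sum_z w z * F i z) * \prod_(j | j != i) \sum_z F j z.
Proof.
rewrite (_ : (fun s => _) = fun s : {ffun J -> Z} => \prod_j (if j == i then w else fun=> 1) (s j)).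
 rewrite (mlsum_prod F (fun j => if j == i then w else fun=> 1)) (bigD1 i)//= eqxx; congr (_ * _).
 by apply: eq_bigr => j /negbTE ->; under eq_bigr do rewrite mul1r.
by apply/funext => s; rewrite (bigD1 i)//= eqxx big1 ?mulr1// => j /negbTE ->.
Qed.

Lemma mlsumB F u v : mlsum F u - mlsum F v = mlsum F (fun s => u s - v s).
Proof. by rewrite /mlsum -sumrB; apply: eq_bigr => s _; rewrite mulrBl. Qed.

Lemma mlsum_sum (I : Type) (r : seq I) F (U : I -> {ffun J -> Z} -> R) :
 mlsum F (fun s => \sum_(i <- r) U i s) = \sum_(i <- r) mlsum F (U i).
Proof. by rewrite /mlsum exchange_big; apply: eq_bigr => s _; rewrite mulr_suml. Qed.

Lemma mlsumZ F c u : mlsum F (fun s => c * u s) = c * mlsum F u.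
Proof. by rewrite /mlsum mulr_sumr; apply: eq_bigr => s _; rewrite mulrA. Qed.

Lemma mlsum_le F u (w : R) : 0 <= w -> (forall s : {ffun J -> Z}, \prod_j F j (s j) != 0 -> `|u s| <= w) ->
 `|mlsum F u| <= w * \prod_j \sum_z `|F j z|.
Proof.
move=> w0 uw; rewrite bigA_distr_bigA mulr_sumr (le_trans (ler_norm_sum _ _ _))//.
apply: ler_sum => s _; rewrite normrM -normr_prod.
have [->|Fs] := eqVneq (\prod_j F j (s j)) 0; first by rewrite normr0 !mulr0.
by rewrite ler_wpM2r// uw.
Qed.

Definition upd (s : {ffun J -> Z}) i z : {ffun J -> Z} := [ffun j => if j == i then z else s j].

(** Summing first over the value at [i], which [u] ignores, leaves the vanishing factor. The
    assignments are grouped by their modification [upd s i z0]. *)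
Lemma mlsum_indep F u i : (forall s z, u (upd s i z) = u s) -> \sum_z F i z = 0 -> mlsum F u = 0.
Proof.
move=> ui Fi; case: (pickP (@predT Z)) => [z0 _|Z0]; last first.
 by rewrite /mlsum big1// => s _; have := Z0 (s i).
rewrite /mlsum (partition_big (fun s => upd s i z0) predT)//= big1// => t _.
case: (eqVneq (t i) z0) => tz; last first.
 rewrite big_pred0// => s; apply/negbTE/eqP => E; move: tz.
 by rewrite -E ffunE eqxx eqxx.
rewrite (reindex_onto (fun z => upd t i z) (fun s => s i)) /=; last first.
 move=> s /eqP <-; apply/ffunP => j; rewrite !ffunE; by case: eqP => [->|].
rewrite (eq_bigr (fun z => (u t * \prod_(j | j != i) F j (t j)) * F i z)) => [|z _]; last first.
 rewrite ui (bigD1 i)//= ffunE eqxx -mulrA; congr (_ * _); rewrite mulrC; congr (_ * _).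
 by apply: eq_bigr => j /negbTE ji; rewrite ffunE ji.
rewrite (eq_bigl predT) => [|z]; first by rewrite -mulr_sumr Fi mulr0.
rewrite ffunE eqxx eqxx andbT; apply/eqP/ffunP => j; rewrite !ffunE.
by case: eqP => // ->.
Qed.

End multilinear_sums.

Lemma sum_off {R : realType} N (i : 'I_N) (p q : 'I_N -> R) : (forall j, j != i -> p j = q j) ->
 \sum_(j < N) p j = p i + \sum_(j < N | j != i) q j.
Proof. by move=> pq; rewrite (bigD1 i)//=; congr (_ + _); apply: eq_bigr. Qed.

Lemma cts_mulR {R : realType} {m n} (u v : 'M[R]_(m, n) -> R) :
 continuous u -> continuous v -> continuous (fun X => u X * v X).
Proof. by move=> cu cv X; exact: cvgM (cu X) (cv X). Qed.

Lemma cts_subR {R : realType} {m n} (u v : 'M[R]_(m, n) -> R) :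
 continuous u -> continuous v -> continuous (fun X => u X - v X).
Proof. by move=> cu cv X; exact: cvgB (cu X) (cv X). Qed.

Lemma exists_small {R : realType} (u v : nat -> R) (e : R) :
 u n @[n --> \oo] --> (0 : R) -> v n @[n --> \oo] --> (0 : R) -> 0 < e ->
 exists n, u n * u n + v n <= e.
Proof.
move=> u0 v0 e0.
have : u n * u n + v n @[n --> \oo] --> (0 : R) * 0 + 0 by apply: cvgD => //; exact: cvgM.
rewrite mulr0 addr0 => /cvgr0Pnorm_le/(_ e e0)[n _ /(_ n (leqnn n))] h.
by exists n; exact: le_trans (ler_norm _) h.
Qed.

(** * Extension of a bounded operator from formal combinations to L^2 *)

Section extension_by_density.
Context {disp : measure_display} {T : measurableType disp} {R : realType}.
Variable P : probability T R.
Variables (J : Type) (sp W : J -> T -> R) (sub : J -> J -> J) (c : R).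
Hypotheses (sqsp : forall s, L2 P (sp s)) (sqW : forall s, L2 P (W s))
(sp_sub : forall s t x, sp (sub s t) x = sp s x - sp t x)
(W_sub : forall s t x, W (sub s t) x = W s x - W t x)
(W_le : forall s, nrm P (W s) <= c * nrm P (sp s)) (c0 : 0 <= c).

Lemma W_lip s t : nrm P (fun x => W s x - W t x) <= c * nrm P (fun x => sp s x - sp t x).
Proof.
rewrite (_ : (fun x => W s x - W t x) = W (sub s t)); last by apply/funext => x; rewrite W_sub.
rewrite (_ : (fun x => sp s x - sp t x) = sp (sub s t)); last by apply/funext => x; rewrite sp_sub.
exact: W_le.
Qed.

(** The extension is obtained along one approximating sequence by completeness, and the Lipschitz
    bound then gives convergence along every other one. This freedom is used later to evaluate it on
    smooth or localized exponentials. *)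
Lemma extension : (forall f, L2 P f -> forall e, 0 < e -> exists s, nrm P (fun x => f x - sp s x) < e) ->
 exists Wb : (T -> R) -> T -> R, forall f, L2 P f -> L2 P (Wb f) /\
  forall s : nat -> J, L2cvg P (fun n => sp (s n)) f -> L2cvg P (fun n => W (s n)) (Wb f).
Proof.
move=> dense.
have ex_seq f : L2 P f -> exists s : nat -> J, L2cvg P (fun n => sp (s n)) f.
 move=> sf; have /choice[s sP] : forall n : nat, exists s, nrm P (fun x => f x - sp s x) < n.+1%:R^-1.
  by move=> n; apply: dense => //; rewrite invr_gt0.
 exists s; apply: (cvg_bound (v := fun n => n.+1%:R^-1)); last exact: cvg_harmonic.
 by move=> n; rewrite sub0r normrN ger0_norm ?nrm_ge0// nrm_distC// ltW.
have : forall f, exists g, L2 P f -> L2 P g /\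
  forall s : nat -> J, L2cvg P (fun n => sp (s n)) f -> L2cvg P (fun n => W (s n)) g.
 move=> f; case: (pselect (L2 P f)) => sf; last by exists (fun=> 0).
 have [s sf_s] := ex_seq f sf.
 have [|g sg gs] := @L2_complete _ _ _ P (fun n => W (s n)) (fun n => sqW _).
  move=> e e0; have e'0 : 0 < e / (2 * (c + 1)) by rewrite divr_gt0// mulr_gt0// ltr_wpDl.
  move/L2cvgP : sf_s => /(_ _ e'0)[N NP]; exists N => m n /NP hm /NP hn.
  apply: le_lt_trans (W_lip _ _) _.
  have h : nrm P (fun x => sp (s m) x - sp (s n) x) < 2 * (e / (2 * (c + 1))).
   apply: le_lt_trans (nrm_distD (sqsp _) sf (sqsp _)) _; rewrite (nrm_distC sf (sqsp _)).
   by move: hm hn; lra.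
  apply: (@le_lt_trans _ _ (c * (2 * (e / (2 * (c + 1)))))); first by rewrite ler_wpM2l// ltW.
  rewrite (_ : c * _ = c / (c + 1) * e); last by field; rewrite gt_eqF// ltr_wpDl.
  by rewrite -[ltRHS]mul1r ltr_pM2r// ltr_pdivrMr ?ltr_wpDl// mul1r ltrDl.
 exists g => _; split => // t ft.
 apply: (cvg_bound (v := fun n => c * (nrm P (fun x => sp (t n) x - f x) + nrm P (fun x => sp (s n) x - f x))
   + nrm P (fun x => W (s n) x - g x))).
  move=> n; rewrite sub0r normrN ger0_norm ?nrm_ge0//.
  apply: le_trans (nrm_distD (sqW (t n)) (sqW (s n)) sg) _; rewrite lerD2r.
  apply: le_trans (W_lip _ _) _; rewrite ler_wpM2l//.
  by apply: le_trans (nrm_distD (sqsp _) sf (sqsp _)) _; rewrite (nrm_distC sf (sqsp _)).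
 rewrite -[X in _ --> X](_ : c * (0 + 0) + 0 = 0); last by rewrite !addr0 mulr0.
 by apply: cvgD => //; apply: cvgM; [exact: cvg_cst|exact: cvgD].
move=> /choice[Wb WbP]; exists Wb => f sf; exact: WbP.
Qed.

End extension_by_density.

Lemma cvg_ge_lim {R : realType} (u v : nat -> R) (a b : R) :
 u n @[n --> \oo] --> a -> v n @[n --> \oo] --> b -> (forall n, u n <= v n) -> a <= b.
Proof.
move=> ua vb uv; rewrite -(cvg_lim _ ua)// -(cvg_lim _ vb)//.
by apply: ler_lim; [exact: cvgP ua|exact: cvgP vb|exact: nearW].
Qed.

(** * Finite averages in L^2 *)

Section mean.
Context {disp : measure_display} {T : measurableType disp} {R : realType}.
Variable P : probability T R.

(** The semigroup laws hold only almost everywhere. As statements [dd = 0] about this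
    pseudo-distance they combine through the triangle inequality. *)
Definition dd (f g : T -> R) : R := nrm P (fun x => f x - g x).

Lemma dd_ge0 f g : 0 <= dd f g. Proof. exact: nrm_ge0. Qed.

Lemma ddC f g : L2 P f -> L2 P g -> dd f g = dd g f.
Proof. exact: nrm_distC. Qed.

Lemma ddD g f h : L2 P f -> L2 P g -> L2 P h -> dd f h <= dd f g + dd g h.
Proof. exact: nrm_distD. Qed.

Lemma ddxx f : dd f f = 0.
Proof. by rewrite /dd (_ : (fun x => _) = cst 0) ?nrm0//; apply/funext => x; rewrite subrr. Qed.

Lemma dd_ae f g : L2 P f -> L2 P g -> {ae P, forall x, f x = g x} -> dd f g = 0.
Proof.
move=> sf sg fg; rewrite /dd (eq_ae_nrm (L2B sf sg).1 (@measurable_cst _ _ T R setT 0)) ?nrm0//.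
by apply: filterS fg => x ->; rewrite subrr.
Qed.

Lemma dd_lin c f g f' g' : L2 P f -> L2 P g -> L2 P f' -> L2 P g' ->
 dd (fun x => c * f x + g x) (fun x => c * f' x + g' x) <= `|c| * dd f f' + dd g g'.
Proof.
move=> sf sg sf' sg'; rewrite /dd -nrmZ; last exact: L2B.
have -> : (fun x => c * f x + g x - (c * f' x + g' x)) = fun x => c * (f x - f' x) + (g x - g' x).
 by apply/funext => x; ring.
by apply: nrmD; [apply: L2Z|]; exact: L2B.
Qed.

Definition fsum (n : nat) (f : nat -> T -> R) x : R := \sum_(0 <= i < n) f i x.

Lemma L2_fsum n f : (forall i, L2 P (f i)) -> L2 P (fsum n f).
Proof.
move=> sf; elim: n => [|n ih].
 rewrite (_ : fsum 0 f = fun x => 0 * f 0%N x); first exact: L2Z.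
 by apply/funext => x; rewrite /fsum big_geq// mul0r.
rewrite (_ : fsum n.+1 f = fun x => fsum n f x + f n x); first exact: L2D.
by apply/funext => x; rewrite /fsum big_nat_recr.
Qed.

Lemma fsumS n f : fsum n.+1 f = fun x => 1 * f n x + fsum n f x.
Proof. by apply/funext => x; rewrite /fsum big_nat_recr//= mul1r addrC. Qed.

Lemma dd_fsum n f g (e : R) : (forall i, L2 P (f i)) -> (forall i, L2 P (g i)) ->
 (forall i, (i < n)%N -> dd (f i) (g i) <= e) -> dd (fsum n f) (fsum n g) <= n%:R * e.
Proof.
move=> sf sg; elim: n => [|n ih] h.
 by rewrite mul0r (_ : fsum 0 f = fsum 0 g) ?ddxx//; apply/funext => x; rewrite /fsum !big_geq.
rewrite !fsumS; apply: le_trans (dd_lin 1 (sf n) (L2_fsum n sf) (sg n) (L2_fsum n sg)) _.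
rewrite normr1 mul1r -natr1 mulrDl mul1r addrC lerD ?h//.
by apply: ih => i im; apply: h; rewrite ltnS ltnW.
Qed.

Lemma ddZ c f g : L2 P f -> L2 P g -> dd (fun x => c * f x) (fun x => c * g x) = `|c| * dd f g.
Proof.
by move=> sf sg; rewrite /dd -nrmZ; [congr nrm; apply/funext => x; rewrite mulrBr|exact: L2B].
Qed.

Definition mean n f x : R := n%:R^-1 * fsum n f x.

Lemma L2_mean n f : (forall i, L2 P (f i)) -> L2 P (mean n f).
Proof. by move=> sf; apply: L2Z; exact: L2_fsum. Qed.

Lemma dd_mean n f g (e : R) : (0 < n)%N -> (forall i, L2 P (f i)) -> (forall i, L2 P (g i)) ->
 (forall i, (i < n)%N -> dd (f i) (g i) <= e) -> dd (mean n f) (mean n g) <= e.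
Proof.
move=> n0 sf sg h; rewrite ddZ; try exact: L2_fsum.
by rewrite ger0_norm ?invr_ge0// mulrC ler_pdivrMr ?ltr0n// mulrC; exact: dd_fsum.
Qed.

Lemma mean_cst n f : (0 < n)%N -> mean n (fun=> f) = f.
Proof.
move=> n0; apply/funext => x; rewrite /mean /fsum sumr_const_nat subn0 -[X in _ * X](mulr_natl (f x) n) mulrA.
by rewrite mulVf ?mul1r// pnatr_eq0 -lt0n.
Qed.

(** Brings two Riemann sums to a common refinement. *)
Lemma mean_repeat n m f : (0 < m)%N -> mean n f = mean (n * m) (fun i => f (i %/ m)%N).
Proof.
move=> m0; apply/funext => x; rewrite /mean natrM invfM -mulrA; congr (_ * _).
have -> : fsum (n * m) (fun i => f (i %/ m)%N) x = m%:R * fsum n f x; last first.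
 by rewrite mulrA mulVf ?mul1r// pnatr_eq0 -lt0n.
rewrite /fsum; elim: n => [|n ih]; first by rewrite mul0n !big_geq ?mulr0.
rewrite mulSn (@big_cat_nat _ _ _ (n * m))//=; last exact: leq_addl.
rewrite ih [in RHS]big_nat_recr//= mulrDr; congr (_ + _).
rewrite (_ : \sum_(n * m <= i < m + n * m) f (i %/ m)%N x = \sum_(n * m <= i < m + n * m) f n x).
 by rewrite sumr_const_nat addnK mulr_natl.
apply: eq_big_nat => i /andP[i1 i2]; congr (f _ x).
apply/eqP; rewrite eqn_leq leq_divRL// i1 andbT -ltnS ltn_divLR//.
Qed.

(** Discrete form of the identity between the integrals over [[k, n+k]] and [[0, n]], which differ
    by those over [[n, n+k]] and [[0, k]]. *)
Lemma fsum_shift n k (a : nat -> T -> R) x :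
 fsum n (fun i => a (i + k)%N) x = fsum n a x + fsum k (fun i x => a (n + i)%N x - a i x) x.
Proof.
rewrite /fsum sumrB.
have E1 : \sum_(0 <= i < n + k) a i x = \sum_(0 <= i < k) a i x + \sum_(0 <= i < n) a (i + k)%N x.
 rewrite (@big_cat_nat _ _ _ k) ?leq_addl//=; congr (_ + _).
 by have := big_addn 0 (n + k) k xpredT (fun i => a i x); rewrite add0n addnK => <-.
have E2 : \sum_(0 <= i < n + k) a i x = \sum_(0 <= i < n) a i x + \sum_(0 <= i < k) a (n + i)%N x.
 rewrite (@big_cat_nat _ _ _ n) ?leq_addr//=; congr (_ + _).
 have := big_addn 0 (n + k) n xpredT (fun i => a i x); rewrite add0n addKn => ->.
 by apply: eq_bigr => i _; rewrite addnC.
by move: E1; rewrite E2; move: (\sum_(0 <= i < n) a i x) (\sum_(_ <= _ < _) _) (\sum_(0 <= i < n) a (i + k)%N x) => p q r; move=> h; lra.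
Qed.

End mean.

(** * Semigroups: density of the domain, growth of quadratic forms *)

Section semigroup_facts.
Context {disp : measure_display} {T : measurableType disp} {R : realType}.
Variables (P : probability T R) (S : R -> (T -> R) -> T -> R).
Hypothesis MS : markov_semigroup P S.
Local Notation dd := (dd P).

Lemma S_sq t f : 0 <= t -> L2 P f -> L2 P (S t f).
Proof. by move=> t0 /Lfun2_L2 sf; apply/Lfun2_L2; exact: (semigroup_L2 MS). Qed.

Lemma S_lin t c f g : 0 <= t -> L2 P f -> L2 P g ->
 dd (S t (fun y => c * f y + g y)) (fun y => c * S t f y + S t g y) = 0.
Proof.
move=> t0 sf sg; apply: dd_ae.
- by apply: S_sq => //; apply: L2D => //; exact: L2Z.
- by apply: L2D; [apply: L2Z|]; exact: S_sq.
- by apply: (semigroup_linear MS) => //; exact/Lfun2_L2.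
Qed.

Lemma S_nrm t f : 0 <= t -> L2 P f -> nrm P (S t f) <= nrm P f.
Proof.
move=> t0 sf; rewrite /nrm ler_sqrt ?ip_ge0//.
have := semigroup_contraction MS t0 ((Lfun2_L2 P f).2 sf).
by rewrite (expectation_sqr sf) (expectation_sqr (S_sq t0 sf)) lee_fin.
Qed.

Lemma S_contr t f g : 0 <= t -> L2 P f -> L2 P g -> dd (S t f) (S t g) <= dd f g.
Proof.
move=> t0 sf sg.
have sfg : L2 P (fun y => -1 * g y + f y) by apply: L2D => //; exact: L2Z.
have E1 : dd f g = nrm P (fun y => -1 * g y + f y).
 by congr nrm; apply/funext => x; ring.
have := S_nrm t0 sfg; rewrite -E1; apply: le_trans.
have := S_lin (-1) t0 sg sf; set Z := S t (fun y => _); move=> h.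
have sZ : L2 P Z by exact: S_sq.
have sS : L2 P (fun y => -1 * S t g y + S t f y) by apply: L2D; [apply: L2Z|]; exact: S_sq.
have -> : dd (S t f) (S t g) = nrm P (fun y => -1 * S t g y + S t f y).
 by congr nrm; apply/funext => x; ring.
have := nrm_sub_ge sZ sS; rewrite -/(dd _ _) h ler_norml oppr0 => /andP[_ h1].
have := nrm_sub_ge sS sZ; rewrite -/(dd _ _) ddC// h ler_norml => /andP[_].
by rewrite subr_le0.
Qed.

Lemma S_add s t f : 0 <= s -> 0 <= t -> L2 P f -> dd (S s (S t f)) (S (s + t) f) = 0.
Proof.
move=> s0 t0 sf; have sS := S_sq t0 sf.
rewrite ddC; [|exact: S_sq|by apply: S_sq => //; exact: addr_ge0].
apply: dd_ae; [by apply: S_sq => //; exact: addr_ge0|exact: S_sq|].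
by apply: (semigroupD MS) => //; exact/Lfun2_L2.
Qed.

Lemma S_zero f : L2 P f -> dd (S 0 f) f = 0.
Proof.
by move=> sf; apply: dd_ae => //; [exact: S_sq|apply: (semigroup0 MS); exact/Lfun2_L2].
Qed.

Lemma ereal0_small (X : R -> \bar R) (x : R -> R) : (forall h, 0 < h -> X h = (x h)%:E) ->
 (forall h, 0 < h -> 0 <= x h) ->
 X h @[h --> 0^'+] --> 0%E <->
 forall e : R, 0 < e -> exists2 h0 : R, 0 < h0 & forall h, 0 < h -> h < h0 -> x h <= e.
Proof.
move=> Xx x0; split.
 move=> /fine_cvgP[_ /cvgrPdist_le X0] e e0.
 have [h0 /= h00 H] := X0 e e0; exists h0 => // h hp hh.
 have := H h; rewrite /= sub0r normrN gtr0_norm// => /(_ hh hp).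
 by rewrite Xx//= sub0r normrN ger0_norm// x0.
move=> H; apply/fine_cvgP; split.
 by exists 1 => //= h _ hp; rewrite Xx.
apply/cvgrPdist_le => e e0; have [h0 h00 h] := H e e0; exists h0 => //= t.
move=> th tp; rewrite /= Xx//= sub0r normrN ger0_norm ?x0//.
by apply: h => //; move: th; rewrite /ball_ /= sub0r normrN gtr0_norm.
Qed.

Lemma S_cont f (e : R) : L2 P f -> 0 < e ->
 exists2 h0 : R, 0 < h0 & forall h, 0 <= h -> h < h0 -> dd (S h f) f <= e.
Proof.
move=> sf e0; have := semigroup_continuous MS ((Lfun2_L2 P f).2 sf).
have Xx h : 0 < h -> ('E_P[fun x => ((S h f x - f x) ^+ 2)%R] = (dd (S h f) f ^+ 2)%:E)%E.
 by move=> h0; rewrite nrm_sqr -expectation_sqr//; apply: L2B => //; apply: S_sq => //; exact: ltW.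
move=> /(ereal0_small Xx (fun h _ => sqr_ge0 _))/(_ _ (exprn_gt0 2 e0))[h0 h00 H].
exists h0 => // h; rewrite le_eqVlt => /orP[/eqP<- _|hp hh]; first by rewrite S_zero// ltW.
by rewrite -(@ler_pXn2r _ 2) ?nnegrE ?dd_ge0 ?(ltW e0)// H.
Qed.

(** Multiplying by [h] turns the limit of quotients into the expansion [S h f = f + h g + o(h)], the
    form in which an Euler scheme uses it. *)
Lemma generatorP f g : L2 P f -> L2 P g -> generator P S f g <->
 forall e : R, 0 < e -> exists2 h0 : R, 0 < h0 &
  forall h, 0 < h -> h < h0 -> dd (S h f) (fun x => h * g x + f x) <= h * e.
Proof.
move=> sf sg; pose D h := nrm P (fun x => h^-1 * (S h f x - f x) - g x).
have DE h : 0 < h -> dd (S h f) (fun x => h * g x + f x) = h * D h.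
 move=> h0; have sS := S_sq (ltW h0) sf.
 rewrite -[X in _ = X * _](gtr0_norm h0) /D -nrmZ; last by apply: L2B => //; apply: L2Z; exact: L2B.
 congr nrm; apply/funext => x; move: (S h f x) (f x) (g x) => a b c; field.
 by rewrite gt_eqF.
have Xx h : 0 < h -> ('E_P[fun x => ((h^-1 * (S h f x - f x) - g x) ^+ 2)%R] = (D h ^+ 2)%:E)%E.
 move=> h0; rewrite nrm_sqr -expectation_sqr//; apply: L2B => //; apply: L2Z.
 by apply: L2B => //; apply: S_sq => //; exact: ltW.
rewrite /generator (ereal0_small Xx (fun h _ => sqr_ge0 _)); split=> H e e0.
 have [h0 h00 h] := H _ (exprn_gt0 2 e0); exists h0 => // t t0 th; rewrite DE//; apply: ler_wpM2l; first exact: ltW.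
 by rewrite -(@ler_pXn2r _ 2) ?nnegrE ?nrm_ge0 ?(ltW e0)// h.
pose m := Num.min e 1; have m0 : 0 < m by rewrite lt_min e0 ltr01.
have [h0 h00 h] := H _ m0; exists h0 => // t t0 th.
have := h t t0 th; rewrite DE// ler_pM2l// => Dm.
have m1 : m <= 1 by rewrite ge_min lexx orbT.
have me : m <= e by rewrite ge_min lexx.
have D0 : 0 <= D t by exact: nrm_ge0.
rewrite expr2; apply: (@le_trans _ _ (m * 1)); last by rewrite mulr1.
by apply: ler_pM => //; exact: le_trans Dm m1.
Qed.

Lemma S_cst0 t : 0 <= t -> L2 P (fun=> 0 : R) -> dd (S t (fun=> 0)) (fun=> 0) = 0.
Proof.
move=> t0 s0; apply/eqP; rewrite eq_le dd_ge0 andbT /dd.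
rewrite (_ : (fun x => _) = S t (fun=> 0)); last by apply/funext => x; rewrite subr0.
by rewrite -[leRHS](@nrm0 _ _ _ P); exact: S_nrm.
Qed.

Lemma S_fsum t n f : 0 <= t -> (forall i, L2 P (f i)) ->
 dd (S t (fsum n f)) (fsum n (fun i => S t (f i))) = 0.
Proof.
move=> t0 sf; have sSf i := S_sq t0 (sf i); elim: n => [|n ih].
 have Z0 (h : nat -> T -> R) : fsum 0 h = fun=> 0.
  by apply/funext => x; rewrite /fsum big_geq.
 by rewrite !Z0 S_cst0// -(Z0 f); exact: L2_fsum.
have sF := L2_fsum n sf; have sFS := L2_fsum n sSf.
have sN k (h : nat -> T -> R) : (forall i, L2 P (h i)) -> L2 P (fun x => 1 * h k x + fsum k h x).
 by move=> sh; rewrite -fsumS; exact: L2_fsum.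
rewrite !fsumS; apply/eqP; rewrite eq_le dd_ge0 andbT.
have sL : L2 P (fun x => 1 * S t (f n) x + S t (fsum n f) x).
 by apply: L2D; [exact: L2Z|exact: S_sq].
apply: le_trans (ddD (S_sq t0 (sN n f sf)) sL (sN n _ sSf)) _.
rewrite (S_lin 1 t0 (sf n) sF) add0r.
apply: le_trans (dd_lin 1 (sSf n) (S_sq t0 sF) (sSf n) sFS) _.
by rewrite ih ddxx mulr0 addr0.
Qed.

Lemma S_mean t n f : 0 <= t -> (forall i, L2 P (f i)) ->
 dd (S t (mean n f)) (mean n (fun i => S t (f i))) = 0.
Proof.
move=> t0 sf; have sSf i := S_sq t0 (sf i); have sF := L2_fsum n sf.
pose c : R := n%:R^-1.
have s0 : L2 P (fun=> 0 : R).
 by rewrite (_ : (fun=> 0) = fun x => 0 * f 0%N x); [exact: L2Z|apply/funext => x; rewrite mul0r].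
have E1 (h : T -> R) : (fun x => c * h x) = (fun x => c * h x + 0).
 by apply/funext => x; rewrite addr0.
rewrite /mean -/c !E1; apply/eqP; rewrite eq_le dd_ge0 andbT.
have sA : L2 P (fun y => c * fsum n f y + 0) by rewrite -E1; exact: L2Z.
have sB : L2 P (fun y => c * S t (fsum n f) y + S t (fun=> 0) y).
 by apply: L2D; [apply: L2Z|]; exact: S_sq.
have sC : L2 P (fun y => c * fsum n (fun i => S t (f i)) y + 0).
 by rewrite -E1; apply: L2Z; exact: L2_fsum.
apply: le_trans (ddD (S_sq t0 sA) sB sC) _.
rewrite (S_lin c t0 sF s0) add0r.
apply: le_trans (dd_lin c (S_sq t0 sF) (S_sq t0 s0) (L2_fsum n sSf) s0) _.
by rewrite S_fsum// S_cst0// mulr0 addr0.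
Qed.

Section riemann.
Variables (u : T -> R) (h : R).
Hypotheses (su : L2 P u) (h0 : 0 < h).

Let tm (n i : nat) : R := i%:R * (h / n%:R).
Let tm0 n i : 0 <= tm n i.
Proof. by rewrite mulr_ge0// divr_ge0// ltW. Qed.

Let tm_le n i j : (i <= j)%N -> tm n i <= tm n j.
Proof. by move=> ij; rewrite ler_wpM2r ?ler_nat// divr_ge0// ltW. Qed.

(** A Riemann sum for the mean of [S r u] over [r] in [[0, h]], whose limit lies in the domain of
    the generator. *)
Definition Rsum n : T -> R := mean n (fun i => S (tm n i) u).

Let sS n i : L2 P (S (tm n i) u). Proof. exact: S_sq. Qed.

Lemma L2_Rsum n : L2 P (Rsum n). Proof. exact: L2_mean. Qed.

Lemma Rsum_near n (e : R) : (0 < n)%N -> (forall r, 0 <= r <= h -> dd (S r u) u <= e) ->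
 dd (Rsum n) u <= e.
Proof.
move=> n0 H; rewrite -[X in dd _ X](mean_cst u n0); apply: dd_mean => // i im.
apply: H; rewrite tm0/= /tm mulrCA ger_pMr// ler_pdivrMr ?ltr0n// mul1r ler_nat.
exact: ltnW.
Qed.

Lemma Rsum_refine n m (e : R) : (0 < n)%N -> (0 < m)%N ->
 (forall r, 0 <= r <= h / n%:R -> dd (S r u) u <= e) ->
 dd (Rsum n) (Rsum (n * m)) <= e.
Proof.
move=> n0 m0 H; rewrite /Rsum (mean_repeat n _ m0); apply: dd_mean => //.
 by rewrite muln_gt0 n0.
move=> i im.
pose r := tm (n * m) i - tm n (i %/ m).
have n0' : 0 < n%:R :> R by rewrite ltr0n.
have m0' : 0 < m%:R :> R by rewrite ltr0n.
have rE : r = (i %% m)%:R / m%:R * (h / n%:R).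
 rewrite /r /tm {1}(divn_eq i m) natrD !natrM; move: (i %/ m)%N (i %% m)%N => a b.
 by field; rewrite !gt_eqF.
have r0 : 0 <= r by rewrite rE !mulr_ge0 ?invr_ge0 ?ler0n// ltW.
have r1 : r <= h / n%:R.
 rewrite rE ler_piMl ?divr_ge0 ?ler0n ?(ltW h0)// ler_pdivrMr// mul1r ler_nat.
 by rewrite ltnW// ltn_mod.
have tE : tm (n * m) i = tm n (i %/ m) + r by rewrite /r addrC subrK.
rewrite tE ddC//; last by apply: S_sq; rewrite // addr_ge0.
have ss := S_sq r0 su; have sc := S_sq (tm0 n (i %/ m)) ss.
have sa : L2 P (S (tm n (i %/ m) + r) u) by apply: S_sq; rewrite // addr_ge0.
apply: le_trans (ddD sa sc (sS n (i %/ m))) _.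
rewrite (ddC sa sc) S_add// add0r; apply: le_trans (S_contr (tm0 _ _) ss su) _.
by apply: H; rewrite r0.
Qed.

Lemma Rsum_cauchy (e : R) : 0 < e -> exists N, forall m n, (N <= m)%N -> (N <= n)%N ->
 dd (Rsum m.+1) (Rsum n.+1) < e.
Proof.
move=> e0; have e4 : 0 < e / 4 by rewrite divr_gt0.
have [k k0 H] := S_cont su e4.
pose N := `|Num.floor (h / k)|%N; exists N => m n mN nN.
have key j : (N <= j)%N -> forall r, 0 <= r <= h / j.+1%:R -> dd (S r u) u <= e / 4.
 move=> jN r /andP[r0 r1]; apply: H => //; apply: le_lt_trans r1 _.
 rewrite ltr_pdivrMr ?ltr0n// mulrC -ltr_pdivrMr//.
 have hk : 0 <= h / k by rewrite divr_ge0 ?ltW.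
 apply: (@lt_le_trans _ _ (N.+1%:R)); last by rewrite ler_nat.
 have := floorD1_gt (h / k); rewrite /N -natr1 natr_absz ger0_norm ?floor_ge0// intrD.
 by [].
have h1 := Rsum_refine (ltn0Sn m) (ltn0Sn n) (key m mN).
have h2 := Rsum_refine (ltn0Sn n) (ltn0Sn m) (key n nN).
rewrite mulnC in h2; have := ddD (L2_Rsum m.+1) (L2_Rsum (m.+1 * n.+1)) (L2_Rsum n.+1).
rewrite (ddC (L2_Rsum (m.+1 * n.+1)) (L2_Rsum n.+1)).
by move: h1 h2; move: (dd _ _) (dd _ _) (dd _ _) => a b c; lra.
Qed.

Let w x : R := S h u x - u x.
Let sw : L2 P w.
Proof. by apply: L2B => //; apply: S_sq => //; exact: ltW. Qed.

(** Shifting by [k] steps changes only the two ends of the sum. The difference consists of [k] terms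
    [S (tm n i) w] with [w = S h u - u], each close to [w]. *)
Lemma S_Rsum n k (e : R) : (0 < n)%N ->
 (forall r, 0 <= r <= tm n k -> dd (S r w) w <= e) ->
 dd (S (tm n k) (Rsum n)) (fun x => k%:R / n%:R * w x + Rsum n x) <= k%:R / n%:R * e.
Proof.
move=> n0 H; have n0' : 0 < n%:R :> R by rewrite ltr0n.
pose a i := S (tm n i) u; pose b i x := a (n + i)%N x - a i x.
have sb i : L2 P (b i) := L2B (sS n (n + i)) (sS n i).
have tD i j : tm n i + tm n j = tm n (i + j) by rewrite /tm natrD mulrDl.
have E0 : dd (S (tm n k) (Rsum n)) (mean n (fun i => a (i + k)%N)) = 0.
 apply/eqP; rewrite eq_le dd_ge0 andbT.
 apply: le_trans (ddD (S_sq (tm0 n k) (L2_Rsum n)) (L2_mean n (fun i => S_sq (tm0 n k) (sS n i))) (L2_mean n (fun i => sS n (i + k)%N))) _.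
 rewrite S_mean// add0r; apply: dd_mean => // [i|i _]; first exact: S_sq.
 by rewrite /a addnC -tD S_add.
have E1 : mean n (fun i => a (i + k)%N) = fun x => n%:R^-1 * fsum k b x + Rsum n x.
 by apply/funext => x; rewrite /mean fsum_shift mulrDr addrC.
have E2 : (fun x => k%:R / n%:R * w x + Rsum n x) = fun x => n%:R^-1 * fsum k (fun=> w) x + Rsum n x.
 have E3 (z : R) : k%:R / n%:R * z = n%:R^-1 * (z *+ k) by rewrite -[z *+ k]mulr_natl mulrA [_ / _]mulrC.
 by apply/funext => x; rewrite /fsum sumr_const_nat subn0 E3.
have sR := L2_Rsum n.
have s1 : L2 P (fun x => n%:R^-1 * fsum k b x + Rsum n x).
 by apply: L2D => //; apply: L2Z; exact: L2_fsum.
have s2 : L2 P (fun x => n%:R^-1 * fsum k (fun=> w) x + Rsum n x).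
 by apply: L2D => //; apply: L2Z; exact: L2_fsum.
rewrite E2; apply: le_trans (ddD (S_sq (tm0 n k) sR) s1 s2) _.
rewrite -E1 E0 add0r E1.
apply: le_trans (dd_lin n%:R^-1 (L2_fsum k sb) sR (L2_fsum k (fun=> sw)) sR) _.
rewrite ddxx addr0 ger0_norm ?invr_ge0 ?ler0n// mulrAC mulrC ler_wpM2r ?invr_ge0 ?ler0n//.
apply: dd_fsum => // i ik.
have tn : tm n n = h by rewrite /tm mulrCA divff ?mulr1// gt_eqF.
have sSw := S_sq (tm0 n i) sw.
apply: le_trans (ddD (sb i) sSw sw) _.
rewrite [X in X + _ <= _](_ : _ = 0).
 by rewrite add0r; apply: H; apply/andP; split; [exact: tm0|exact: (tm_le n (ltnW ik))].
have sSh : L2 P (S h u) by apply: S_sq => //; exact: ltW.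
pose L := S (tm n i) (fun x => -1 * u x + S h u x).
have wE : w = fun x => -1 * u x + S h u x by apply/funext => x; rewrite /w; ring.
have bE : b i = fun x => -1 * a i x + a (n + i)%N x by apply/funext => x; rewrite /b; ring.
apply/eqP; rewrite eq_le dd_ge0 andbT.
have sc : L2 P (fun x => -1 * a i x + S (tm n i) (S h u) x).
 exact: (L2D (L2Z (-1) (sS n i)) (S_sq (tm0 n i) sSh)).
apply: le_trans (ddD (sb i) sc sSw) _.
rewrite (ddC sc sSw) wE S_lin// addr0 bE.
apply: le_trans (dd_lin (-1) (sS n i) (sS n (n + i)) (sS n i) (S_sq (tm0 n i) sSh)) _.
rewrite ddxx mulr0 add0r ddC//; last exact: S_sq.
by rewrite /a addnC -tD tn S_add// ltW.
Qed.

End riemann.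

(** The witness [v] is the mean of [S r u] over [[0, h]], close to [u] for small [h]; the generator
    maps it to [(S h u - u) / h]. *)
Lemma domain_dense u (e : R) : L2 P u -> 0 < e ->
 exists v g, [/\ L2 P v, L2 P g, generator P S v g & dd v u <= e].
Proof.
move=> su e0; have [h0 h00 H] := S_cont su e0.
pose h := h0 / 2; have hp : 0 < h by rewrite divr_gt0.
have Hh r : 0 <= r <= h -> dd (S r u) u <= e.
 by move=> /andP[r0 rh]; apply: H => //; apply: le_lt_trans rh _; rewrite /h ltr_pdivrMr//; lra.
pose A n := Rsum u h n.+1; have sA n : L2 P (A n) := L2_Rsum su hp n.+1.
have [v sv Av] := L2_complete sA (Rsum_cauchy su hp).
have sSh : L2 P (S h u) := S_sq (ltW hp) su.
pose w x := S h u x - u x; have sw : L2 P w := L2B sSh su.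
exists v, (fun x => h^-1 * w x); have sg : L2 P (fun x => h^-1 * w x) by exact: L2Z.
have near_v (e' : R) : 0 < e' -> \forall n \near \oo, dd (A n) v <= e'.
 by move=> e'0; apply: (cvgr_le _ Av).
have hn0 : (h + nrm P w) * n.+1%:R^-1 @[n --> \oo] --> (h + nrm P w) * 0.
 by apply: cvgMr; exact: cvg_harmonic.
split => //; last first.
 apply/ler_addgt0Pr => e' e'0; have [n _ Hn] := near_v _ e'0.
 have := Hn n (leqnn n); have := Rsum_near su hp (ltn0Sn n) Hh; rewrite -/(A n).
 by have := ddD sv (sA n) su; rewrite (ddC sv (sA n)); move: (dd _ _) (dd _ _) (dd _ _) => a b c; lra.
apply/generatorP => // e' e'0; have [t0 t00 Ht] := S_cont sw (mulr_gt0 e'0 hp).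
exists t0 => // s sp st; apply/ler_addgt0Pr => e2 e20.
have e4 : 0 < e2 / 4 by rewrite divr_gt0.
have [t1 t10 Hv] := S_cont sv e4.
have m0 : 0 < Num.min t1 (e2 / 4) by rewrite lt_min t10.
have : \forall n \near \oo, dd (A n) v <= e2 / 4 /\ (h + nrm P w) * n.+1%:R^-1 < Num.min t1 (e2 / 4).
 near=> n; split; first by near: n; exact: near_v.
 by near: n; apply: (cvgr_lt _ hn0); rewrite mulr0.
move=> [n _ /(_ n (leqnn n))[h1]]; rewrite lt_min => /andP[h2 h3].
have n0 : 0 < n.+1%:R :> R by rewrite ltr0n.
have W0 : 0 <= nrm P w := nrm_ge0 P w.
(* [sk] is the largest multiple of the mesh below [s]. The remainder [r] is at most one mesh, and
   strong continuity at [v] absorbs it. *)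
pose z := s / (h / n.+1%:R); have z0 : 0 <= z by rewrite !divr_ge0 ?ltW.
pose k := `|Num.floor z|%N.
have kz : k%:R <= z by rewrite /k natr_absz ger0_norm ?floor_ge0// ge_floor.
have zk : z <= k%:R + 1.
 by have := floorD1_gt z; rewrite /k natr_absz ger0_norm ?floor_ge0// intrD => /ltW.
have hn : 0 < h / n.+1%:R by rewrite divr_gt0.
pose sk : R := k%:R * (h / n.+1%:R).
have zE : s = z * (h / n.+1%:R) by rewrite /z divfK// gt_eqF.
have sk0 : 0 <= sk by rewrite mulr_ge0// ltW.
have sks : sk <= s by rewrite zE ler_wpM2r// ltW.
pose r := s - sk; have r0 : 0 <= r by rewrite subr_ge0.
have r1 : r <= h / n.+1%:R.
 by rewrite /r zE /sk -mulrBl -[leRHS]mul1r ler_wpM2r ?(ltW hn)//; lra.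
have q0 : 0 <= n.+1%:R^-1 :> R by rewrite invr_ge0 ltW.
have r2 : r < t1.
 by apply: le_lt_trans r1 _; apply: le_lt_trans h2; rewrite ler_wpM2r//; lra.
have skE : sk + r = s by rewrite /r addrC subrK.
have sSr := S_sq r0 sv; have sSs := S_sq (ltW sp) sv; have sSk := S_sq sk0 sv.
have sSA := S_sq sk0 (sA n).
have a1 : dd (S s v) (S sk v) <= e2 / 4.
 apply: le_trans (ddD sSs (S_sq sk0 sSr) sSk) _.
 rewrite (ddC sSs (S_sq sk0 sSr)) -skE S_add// add0r.
 by apply: le_trans (S_contr sk0 sSr sv) _; exact: Hv.
have a2 : dd (S sk v) (S sk (A n)) <= e2 / 4.
 by apply: le_trans (S_contr sk0 sv (sA n)) _; rewrite ddC.
have kn : k%:R / n.+1%:R = sk / h by rewrite /sk; field; rewrite !gt_eqF.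
have a3 : dd (S sk (A n)) (fun x => k%:R / n.+1%:R * w x + A n x) <= s * e'.
 apply: le_trans (S_Rsum su hp (ltn0Sn n) (k := k) (e := e' * h) _) _.
  move=> q /andP[q0' q1]; apply: Ht => //; apply: le_lt_trans st.
  exact: le_trans q1 sks.
 rewrite kn (_ : sk / h * (e' * h) = sk * e'); last by field; rewrite gt_eqF.
 by rewrite ler_wpM2r// ltW.
have sL (c : R) f : L2 P f -> L2 P (fun x => c * w x + f x) by move=> sf; apply: L2D => //; exact: L2Z.
have a4 : dd (fun x => k%:R / n.+1%:R * w x + A n x) (fun x => k%:R / n.+1%:R * w x + v x) <= e2 / 4.
 by apply: le_trans (dd_lin _ sw (sA n) sw sv) _; rewrite ddxx mulr0 add0r.
have a5 : dd (fun x => k%:R / n.+1%:R * w x + v x) (fun x => s * (h^-1 * w x) + v x) <= e2 / 4.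
 rewrite /dd (_ : (fun x => _) = fun x => - (r / h) * w x); last first.
  apply/funext => x; rewrite kn /r; move: (w x) (v x) => a b; field.
  by rewrite gt_eqF.
 rewrite nrmZ// normrN (ger0_norm (divr_ge0 r0 (ltW hp))).
 apply: le_trans (ltW h3).
 have rh : r / h <= n.+1%:R^-1 by rewrite ler_pdivrMr// mulrC.
 have := ler_wpM2r W0 rh; have := mulr_ge0 (ltW hp) q0; rewrite (mulrDl h) [nrm P w * _]mulrC.
 by move: (h * _) (_ * nrm P w) (_ * nrm P w) => b1 b2 b3; lra.
have := ddD sSs sSk (L2D (L2Z s sg) sv).
have := ddD sSk sSA (L2D (L2Z s sg) sv).
have := ddD sSA (sL (k%:R / n.+1%:R) _ (sA n)) (L2D (L2Z s sg) sv).
have := ddD (sL (k%:R / n.+1%:R) _ (sA n)) (sL (k%:R / n.+1%:R) _ sv) (L2D (L2Z s sg) sv).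
have aux (x1 x2 x3 x4 x5 y1 y2 y3 y4 E : R) : x1 <= e2 / 4 -> x2 <= e2 / 4 -> x3 <= E -> x4 <= e2 / 4 -> x5 <= e2 / 4 ->
 y4 <= x4 + x5 -> y3 <= x3 + y4 -> y2 <= x2 + y3 -> y1 <= x1 + y2 -> y1 <= E + e2 by lra.
exact: (aux _ _ _ _ _ _ _ _ _ _ a1 a2 a3 a4 a5).
Unshelve. all: by end_near.
Qed.

(** [S t] commutes with [S h] and contracts the remainder of the expansion. *)
Lemma generator_S t v g : 0 <= t -> L2 P v -> L2 P g ->
 generator P S v g -> generator P S (S t v) (S t g).
Proof.
move=> t0 sv sg /(generatorP sv sg) H; have st := S_sq t0 sv; have sgt := S_sq t0 sg.
apply/generatorP => // e e0; have [h0 h00 h] := H e e0; exists h0 => // s sp sh.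
have s0 := ltW sp; have sSs := S_sq s0 sv.
have sL : L2 P (fun x => s * g x + v x) by apply: L2D => //; exact: L2Z.
have sL' : L2 P (fun x => s * S t g x + S t v x) by apply: L2D => //; exact: L2Z.
have sa := S_sq s0 st; have sb := S_sq t0 sSs; have sc : L2 P (S (s + t) v) by apply: S_sq => //; exact: addr_ge0.
have := S_contr t0 sSs sL; have := h s sp sh.
have := ddD sa sc sL'; have := ddD sc sb sL'; have := ddD sb (S_sq t0 sL) sL'.
rewrite S_add// S_lin// (ddC sc sb) [in s + t]addrC S_add//.
by move: (dd _ _) (dd _ _) (dd _ _) (dd _ _) (dd _ _) => a1 a2 a3 a4 a5; lra.
Qed.

Section decay.
Variables (Wb : (T -> R) -> T -> R) (Kw c : R).
Hypotheses (Kw0 : 0 <= Kw) (c0 : 0 <= c) (sWb : forall f, L2 P f -> L2 P (Wb f))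
(Wb_sym : forall f g, L2 P f -> L2 P g -> ip P (Wb f) g = ip P f (Wb g))
(Wb_ge0 : forall f, L2 P f -> 0 <= ip P f (Wb f))
(Wb_lip : forall f g, L2 P f -> L2 P g -> dd (Wb f) (Wb g) <= Kw * dd f g).
Hypothesis gen_ge : forall w g, L2 P w -> L2 P g -> generator P S w g ->
 ip P g (Wb w) <= c * ip P w (Wb w).

Let q f := ip P f (Wb f).

(** Second-order expansion of a quadratic form; the symmetry of [Wb] merges the two cross terms. *)
Lemma q_diff f f' : L2 P f -> L2 P f' ->
 q f' - q f <= 2 * ip P (fun x => f' x - f x) (Wb f) + Kw * dd f' f ^+ 2.
Proof.
move=> sf sf'; have sD := L2B sf' sf; have sW := sWb sf; have sW' := sWb sf'.
have E1 : q f' - q f = 2 * ip P (fun x => f' x - f x) (Wb f) + ip P (fun x => f' x - f x) (fun x => Wb f' x - Wb f x).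
 rewrite /q ipBr// !ipBl// -(Wb_sym sf' sf) [ip P (Wb f') f]ipC.
 by move: (ip P f' _) (ip P f _) (ip P f _) => x y z; ring.
rewrite E1 lerD2l; apply: le_trans (ler_norm _) _.
apply: le_trans (ip_le_nrm sD (L2B sW' sW)) _.
rewrite expr2 mulrA mulrC; apply: ler_wpM2r; first exact: nrm_ge0.
exact: Wb_lip.
Qed.

Lemma q_lip f f' : L2 P f -> L2 P f' ->
 q f' - q f <= 2 * nrm P (Wb f) * dd f' f + Kw * dd f' f ^+ 2.
Proof.
move=> sf sf'; apply: le_trans (q_diff sf sf') _; rewrite lerD2r -mulrA ler_wpM2l//.
apply: le_trans (ler_norm _) _; rewrite mulrC.
exact: (ip_le_nrm (L2B sf' sf) (sWb sf)).
Qed.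

(** An Euler scheme replaces differentiation of [q (S s v)] in [s]: a step of length [h] multiplies
    [q] by at most [1 + 2 c h] up to an error [h eta], and the product of these factors is below
    [exp (2 c t)]. *)
Lemma decay_domain v g t : L2 P v -> L2 P g -> generator P S v g -> 0 < t ->
 q (S t v) <= expR (2 * c * t) * q v.
Proof.
move=> sv sg vg t0.
pose B := Kw * nrm P v + nrm P (Wb (fun=> 0)).
have s0 : L2 P (fun=> 0 : R).
 by rewrite (_ : (fun=> 0) = fun x => 0 * v x); [exact: L2Z|apply/funext => x; rewrite mul0r].
have WB r : 0 <= r -> nrm P (Wb (S r v)) <= B.
 move=> r0; have sr := S_sq r0 sv.
 have E1 : nrm P (S r v) = dd (S r v) (fun=> 0) by congr nrm; apply/funext => x; rewrite subr0.
 have := nrm_sub_ge (sWb sr) (sWb s0); rewrite -/(dd _ _) ler_norml => /andP[_].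
 have := Wb_lip sr s0; rewrite -E1; have := ler_wpM2l Kw0 (S_nrm r0 sv); rewrite /B.
 by move: (dd _ _) (nrm _ _) (nrm _ _) (Kw * _) (Kw * _) => a1 a2 a3 a4 a5; lra.
have B0 : 0 <= B := le_trans (nrm_ge0 P _) (WB 0 (lexx 0)).
pose G := nrm P g + 1; have G0 : 0 <= G by rewrite addr_ge0// nrm_ge0.
apply/ler_addgt0Pr => e e0.
(* [e1] bounds both the error in the generator and the time step; the errors accumulated up to time
   [t] are then at most [e1 X]. *)
pose X := expR (2 * c * t) * t * (2 * B + Kw * G ^+ 2 + 1).
have X0 : 0 < X.
 by rewrite !mulr_gt0 ?expR_gt0// ltr_wpDl// addr_ge0 ?mulr_ge0// sqr_ge0.
pose e1 := Num.min 1 (e / X); have e10 : 0 < e1 by rewrite lt_min ltr01 divr_gt0.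
have e11 : e1 <= 1 by rewrite ge_min lexx.
have e1X : e1 * X <= e by rewrite -ler_pdivlMr// ge_min lexx orbT.
have [h0 h00 Hh] := (generatorP sv sg).1 vg e1 e10.
have m0 : 0 < Num.min h0 e1 by rewrite lt_min h00.
have : t * n.+1%:R^-1 @[n --> \oo] --> t * 0 by apply: cvgMr; exact: cvg_harmonic.
rewrite mulr0 => /cvgr_lt /(_ _ m0)[N _ /(_ N (leqnn N))] /=.
set h := t / N.+1%:R; rewrite lt_min => /andP[hh0 he1].
have n0 : 0 < N.+1%:R :> R by rewrite ltr0n.
have hp : 0 < h by rewrite divr_gt0.
have tE : N.+1%:R * h = t by rewrite /h mulrCA divff ?mulr1// gt_eqF.
pose f k := S (k%:R * h) v.
have kh k : 0 <= k%:R * h by rewrite mulr_ge0// ltW.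
have sf k : L2 P (f k) := S_sq (kh k) sv.
pose eta := 2 * e1 * B + Kw * h * G ^+ 2.
have eta0 : 0 <= eta.
 by rewrite addr_ge0// !mulr_ge0 ?sqr_ge0// ltW.
have step k : q (f k.+1) <= (1 + 2 * c * h) * q (f k) + h * eta.
 have sgk := S_sq (kh k) sg.
 have sSh := S_sq (ltW hp) sv.
 have sL : L2 P (fun x => h * g x + v x) by apply: L2D => //; exact: L2Z.
 have sL' : L2 P (fun x => h * S (k%:R * h) g x + f k x) by apply: L2D => //; exact: L2Z.
 have r1 : dd (f k.+1) (fun x => h * S (k%:R * h) g x + f k x) <= h * e1.
  have sb := S_sq (kh k) sSh.
  have := S_contr (kh k) sSh sL; have := Hh h hp hh0.
  have := ddD (sf k.+1) sb sL'; have := ddD sb (S_sq (kh k) sL) sL'.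
  rewrite S_lin// (ddC (sf k.+1) sb) /f -natr1 mulrDl mul1r S_add//; last exact: ltW.
  by move: (dd _ _) (dd _ _) (dd _ _) (dd _ _) => a1 a2 a3 a4; lra.
 have r2 : dd (f k.+1) (f k) <= h * G.
  apply: le_trans (ddD (sf k.+1) sL' (sf k)) _.
  have -> : dd (fun x => h * S (k%:R * h) g x + f k x) (f k) = h * nrm P (S (k%:R * h) g).
   rewrite -[X in _ = X * _](gtr0_norm hp) -nrmZ//; congr nrm; apply/funext => x.
   by rewrite addrK.
  rewrite /G addrC mulrDr mulr1; apply: lerD; first by rewrite ler_wpM2l ?S_nrm// ltW.
  by apply: le_trans r1 _; rewrite ger_pMr.
 have r3 : ip P (fun x => f k.+1 x - f k x) (Wb (f k)) <= h * (c * q (f k)) + h * e1 * B.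
  have sD1 : L2 P (fun x => f k.+1 x - (h * S (k%:R * h) g x + f k x)) by exact: L2B.
  have -> : (fun x => f k.+1 x - f k x) = fun x => h * S (k%:R * h) g x + (f k.+1 x - (h * S (k%:R * h) g x + f k x)).
   by apply/funext => x; ring.
  have sW := sWb (sf k).
  rewrite ipDl//; last exact: L2Z.
  rewrite ipZl//; apply: lerD.
   rewrite ler_wpM2l ?(ltW hp)//; apply: gen_ge => //; exact: generator_S.
  apply: le_trans (ler_norm _) _; apply: le_trans (ip_le_nrm sD1 sW) _.
  by apply: ler_pM => //; [exact: nrm_ge0|exact: nrm_ge0|exact: WB].
 have r4 : Kw * dd (f k.+1) (f k) ^+ 2 <= Kw * (h * G) ^+ 2.
  by apply: (ler_wpM2l Kw0); rewrite ler_pXn2r ?nnegrE ?dd_ge0 ?(mulr_ge0 (ltW hp) G0).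
 have := q_diff (sf k) (sf k.+1); move: r3 r4; rewrite /eta.
 move: (ip P _ _) (Kw * _ ^+ 2) (q (f k)) (q (f k.+1)) => a1 a2 a3 a4 h1 h2 h3.
 have E1 : Kw * (h * G) ^+ 2 = h * (Kw * h * G ^+ 2) by ring.
 by rewrite E1 in h2; lra.
have iter k : q (f k) <= (1 + 2 * c * h) ^+ k * (q (f 0%N) + k%:R * (h * eta)).
 elim: k => [|k ih]; first by rewrite expr0 mul1r mul0r addr0.
 have z0 : 0 <= 2 * c * h by rewrite !mulr_ge0// ltW.
 have z1 : 1 <= 1 + 2 * c * h by lra.
 apply: le_trans (step k) _; rewrite exprS.
 have h1 := ler_wpM2l (le_trans ler01 z1) ih.
 have h2 : h * eta <= (1 + 2 * c * h) * ((1 + 2 * c * h) ^+ k * (h * eta)).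
  rewrite mulrA -exprS; apply: ler_peMl; first by rewrite mulr_ge0// ltW.
  exact: exprn_ege1 z1.
 have E1 (z p a x : R) : z * p * (a + k.+1%:R * x) = z * (p * (a + k%:R * x)) + z * (p * x).
  by rewrite -natr1; ring.
 by rewrite E1; exact: lerD.
have q0 : q (f 0%N) <= q v.
 have sz : L2 P (f 0%N) := sf 0%N.
 have z0 : dd (f 0%N) v = 0 by rewrite /f mul0r S_zero.
 by have := q_lip sv sz; rewrite z0 expr0n/= !mulr0 addr0 subr_le0.
have := iter N.+1; rewrite {1}/f tE => /le_trans; apply.
have p1 : (1 + 2 * c * h) ^+ N.+1 <= expR (2 * c * t).
 have E1 : 2 * c * t = N.+1%:R * (2 * c * h) by rewrite -tE mulrCA.
 have z0 : 0 <= 2 * c * h by rewrite !mulr_ge0// ltW.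
 rewrite E1 expRM_natl lerXn2r ?nnegrE ?expR_ge0 ?expR_ge1Dx//.
 exact: addr_ge0.
have qv0 : 0 <= q v := Wb_ge0 sv.
have eta1 : t * eta <= t * (e1 * (2 * B + Kw * G ^+ 2 + 1)).
 rewrite ler_wpM2l ?(ltW t0)//.
 have : Kw * h * G ^+ 2 <= Kw * e1 * G ^+ 2.
  by rewrite ler_wpM2r ?sqr_ge0// ler_wpM2l// ltW.
 rewrite /eta; move: (G ^+ 2) => G2 h1.
 have -> : e1 * (2 * B + Kw * G2 + 1) = 2 * e1 * B + Kw * e1 * G2 + e1 by ring.
 by have := ltW e10; move: h1; move: (Kw * h * _) (Kw * e1 * _) (2 * e1 * _) => a1 a2 a3; lra.
rewrite mulrA tE.
apply: (@le_trans _ _ (expR (2 * c * t) * (q v + t * (e1 * (2 * B + Kw * G ^+ 2 + 1))))).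
 apply: ler_pM => //; last exact: lerD.
  by rewrite exprn_ge0// addr_ge0// !mulr_ge0// ltW.
 by rewrite addr_ge0 ?(Wb_ge0 (sf 0%N))// mulr_ge0// ltW.
rewrite mulrDr lerD2l; apply: le_trans e1X; rewrite /X le_eqVlt; apply/orP; left; apply/eqP.
by move: (expR _) (_ + 1) => a b; ring.
Qed.

(** Both sides are continuous for the L^2 distance, since [q] is locally Lipschitz and [S t]
    contracts, so the dense domain suffices. *)
Lemma semigroup_decay u t : L2 P u -> 0 < t -> q (S t u) <= expR (2 * c * t) * q u.
Proof.
move=> su t0; have st := S_sq (ltW t0) su.
pose X := expR (2 * c * t); have X0 : 0 < X := expR_gt0 _.
pose B := 2 * nrm P (Wb (S t u)) + 3 * Kw + X * (2 * nrm P (Wb u) + Kw).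
have B0 : 0 <= B.
 by rewrite !addr_ge0 ?mulr_ge0 ?addr_ge0 ?mulr_ge0 ?nrm_ge0 ?(ltW X0).
have near_q f f' (e : R) : L2 P f -> L2 P f' -> 0 <= e <= 1 -> dd f' f <= e ->
  q f' - q f <= (2 * nrm P (Wb f) + Kw) * e.
 move=> sf sf' /andP[e0 e1] fe; apply: le_trans (q_lip sf sf') _; rewrite [leRHS]mulrDl.
 apply: lerD; first by rewrite ler_wpM2l// mulr_ge0// nrm_ge0.
 rewrite ler_wpM2l//; apply: le_trans (_ : e ^+ 2 <= _); first by rewrite ler_pXn2r// nnegrE ?dd_ge0.
 by rewrite expr2 ler_piMl.
apply/ler_addgt0Pr => e e0.
pose e1 := Num.min 1 (e / (B + 1)); have B1 : 0 < B + 1 by lra.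
have e10 : 0 < e1 by rewrite lt_min ltr01 divr_gt0.
have e11 : e1 <= 1 by rewrite ge_min lexx.
have e1B : e1 * (B + 1) <= e by rewrite -ler_pdivlMr// ge_min lexx orbT.
have [v [g [sv sg vg vu]]] := domain_dense su e10.
have svt := S_sq (ltW t0) sv.
have h1 := decay_domain sv sg vg t0; rewrite -/X in h1.
have e1b : 0 <= e1 <= 1 by rewrite (ltW e10) e11.
have h2 := near_q u v e1 su sv e1b vu.
have d1 : dd (S t u) (S t v) <= e1 by rewrite ddC//; apply: le_trans (S_contr (ltW t0) sv su) _.
have h3 : q (S t u) - q (S t v) <= (2 * nrm P (Wb (S t u)) + 3 * Kw) * e1.
 apply: le_trans (near_q _ _ e1 svt st e1b d1) _; rewrite ler_wpM2r ?(ltW e10)//.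
 have := nrm_sub_ge (sWb svt) (sWb st); rewrite ler_norml => /andP[_].
 have : dd (Wb (S t v)) (Wb (S t u)) <= Kw.
  by apply: le_trans (Wb_lip svt st) _; rewrite ddC// ler_piMr// (le_trans d1).
 by rewrite -/(dd _ _); move: (dd _ _) (nrm _ _) (nrm _ _) => x1 x2 x3; lra.
have h4 := ler_wpM2l (ltW X0) h2; rewrite mulrBr in h4.
apply: (@le_trans _ _ (X * q u + e1 * B)).
 rewrite /B; move: h1 h3 h4; move: (q _) (q _) (X * q _) (X * q _) (nrm _ _) (nrm _ _) => a1 a2 a3 a4 n1 n2 h1 h3 h4.
 have -> : e1 * (2 * n2 + 3 * Kw + X * (2 * n1 + Kw)) = (2 * n2 + 3 * Kw) * e1 + X * ((2 * n1 + Kw) * e1) by ring.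
 by lra.
by rewrite lerD2l; apply: le_trans e1B; rewrite ler_wpM2l ?(ltW e10)//; lra.
Qed.

End decay.

End semigroup_facts.

(** * Measurability on R^d and on configurations *)

Section poisson_configurations.
Context {R : realType} {d : nat}.
Local Notation E := 'rV[R]_d.
Local Notation M := (config R d).
Local Notation e_ := (delta_mx ord0).
Local Notation mat N := 'M[R]_(N, d).
Variables (rho : R) (P : probability M R).
Hypotheses (PP : is_poisson rho P) (rho0 : 0 < rho) (d_gt0 : (0 < d)%N).

Lemma open_measurable_mx (U : set E) : open U -> measurable U.
Proof. by move=> oU; exact: sub_sigma_algebra. Qed.

Lemma cts_mbl_mx (f : E -> R) : continuous f -> mbl f.
Proof.
move=> cf; apply: (measurability _ (RGenOpens.measurableE R)).
move=> _ [_ [a [b ->] <-]]; rewrite setTI; apply: open_measurable_mx.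
by apply: open_comp => // x _; exact: cf.
Qed.

Lemma mbl_coord (i : 'I_d) : mbl (fun x : E => x ord0 i).
Proof. by apply: cts_mbl_mx; exact: coord_continuous. Qed.

(** Sup-norm balls with rational centre and radius [1/(n+1)] are finite intersections of conditions
    on single coordinates, and countably many of them exhaust an open set. *)
Lemma mbl_rV dT (T : measurableType dT) (g : T -> E) :
 (forall i, mbl (fun t => g t ord0 i)) -> mbl g.
Proof.
move=> mg; apply: (@measurability _ _ _ _ _ _ (@open E)) => //.
move=> _ [U oU <-]; rewrite setTI.
pose dl n : R := n.+1%:R^-1.
have dl0 n : 0 < dl n by rewrite invr_gt0.
pose B (q : {ffun 'I_d -> rat}) (n : nat) :=
 [set x : E | forall i, `|ratr (q i) - x ord0 i| < dl n].
have -> : g @^-1` U = \bigcup_(p : {ffun 'I_d -> rat} * nat)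
  (if pselect (B p.1 p.2 `<=` U) then g @^-1` B p.1 p.2 else set0).
 apply/seteqP; split=> [t /= Ugt|t [p /= _]]; last first.
  by case: pselect => // pU; exact: pU.
 have /nbhs_ballP[e /= e0 eU] := open_nbhs_nbhs (conj oU Ugt).
 have [n ne] : exists n : nat, dl n < e / 2.
  have /ltr_add_invr[n] : (0 : R) < e / 2 by lra.
  by rewrite add0r => ?; exists n.
 have /choice[q qP] i : exists q : rat, `|ratr q - g t ord0 i| < dl n.
  have dn := dl0 n.
  have /rat_in_itvoo[q] : g t ord0 i - dl n < g t ord0 i + dl n by lra.
  rewrite in_itv/= => /andP[q1 q2]; exists q.
  by rewrite ltr_norml; apply/andP; split; lra.
 exists ([ffun i => q i], n) => //=; case: pselect => [_ i|[]]; first by rewrite ffunE.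
 move=> x Bx; apply: eU; split => // i j; rewrite (ord1 i) /ball/=.
 have := Bx j; rewrite ffunE => h1; have h2 := qP j.
 have -> : g t 0 j - x 0 j = (ratr (q j) - x ord0 j) - (ratr (q j) - g t ord0 j) by ring.
 by apply: le_lt_trans (ler_normB _ _) _; lra.
apply: countable_bigcupT_measurable => // p; case: (pselect (B p.1 p.2 `<=` U)) => /= [_|_]; last exact: measurable0.
rewrite (_ : g @^-1` B p.1 p.2 =
  \bigcap_(i in [set: 'I_d]) (fun t => g t ord0 i) @^-1`
   [set y | `|ratr (p.1 i) - y| < dl p.2]); last first.
 apply/seteqP; split=> [t Bt i _|t Bt i]; [exact: Bt|exact: (Bt i I)].
apply: fin_bigcap_measurable => // i _; rewrite -[X in measurable X]setTI; apply: mg => //.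
rewrite (_ : [set y | _] = ball (ratr (p.1 i) : R) (dl p.2)); last by apply/seteqP; split.
by apply: open_measurable; apply: ball_open.
Qed.

Lemma cube_mbl (r : R) : measurable (@cube R d r).
Proof.
rewrite (_ : cube r = \bigcap_(i in [set: 'I_d]) (fun x : E => x ord0 i) @^-1`
  [set` `[- (r / 2), r / 2]]).
 apply: fin_bigcap_measurable => // i _.
 by rewrite -[X in measurable X]setTI; apply: mbl_coord.
by apply/seteqP; split=> [x Bx i _|x Bx i]; [have := Bx i|have := Bx i I]; rewrite /= in_itv.
Qed.

Lemma cube_compact n (r : R) : compact (@cube R n r).
Proof.
rewrite (_ : cube r = [set v : 'rV[R]_n | forall i, [set` `[- (r / 2), r / 2]] (v ord0 i)]).
 by apply: (@rV_compact _ _ (fun=> [set` `[- (r / 2), r / 2]])) => i; exact: segment_compact.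
by apply/seteqP; split=> x Bx i; have := Bx i; rewrite /= in_itv.
Qed.

Lemma sub_cube (r s : R) : r <= s -> cube r `<=` @cube R d s.
Proof. by move=> rs x Bx i; have /andP[h1 h2] := Bx i; apply/andP; split; lra. Qed.

Definition bnd (B : set E) := exists r, B `<=` cube r.

Lemma cube_bnd (r : R) : bnd (cube r). Proof. by exists r. Qed.

Lemma compact_bnd (V : set E) : compact V -> bnd V.
Proof.
move=> /compact_bounded[M [_ MP]]; have /MP VM : M < M + 1 by rewrite ltrDl.
 exists (2 * (M + 1)) => x Vx i.
have : `|x ord0 i| <= M + 1.
 apply: le_trans (VM _ Vx); rewrite [leRHS]mx_normrE.
 by apply: (le_bigmax _ (fun ij => `|x ij.1 ij.2|) (ord0, i)).
by rewrite ler_norml => /andP[h1 h2]; apply/andP; split; lra.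
Qed.

Lemma cube_cover (x : E) : exists n : nat, cube n%:R x.
Proof.
have [r] : bnd [set x] by apply: compact_bnd; exact: compact_set1.
move=> /(_ x erefl) rx; exists (Num.truncn `|r|).+1; apply: sub_cube rx.
by apply/ltW/(le_lt_trans (ler_norm r)); rewrite truncnS_gt.
Qed.

Lemma config_ext (mu nu : M) : (forall A, mu A = nu A) -> mu = nu.
Proof.
case: mu nu => [m mP] [n nP] /= mn; have mn' : m = n by apply/funext.
by subst n; congr Config; exact: Prop_irrelevance.
Qed.

Lemma le_config (mu : M) (A B : set E) : A `<=` B -> (mu A <= mu B)%E.
Proof.
have [[I [x muE]] _] := configP mu => AB; rewrite !muE; apply: le_esum => i _.
rewrite !diracE lee_fin ler_nat; case: (boolP (_ \in A)) => // /set_mem Ax.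
by rewrite mem_set//; exact: AB.
Qed.

Lemma config_bnd_lty (mu : M) (B : set E) : bnd B -> (mu B < +oo)%E.
Proof.
move=> [r Br]; apply: le_lt_trans (le_config mu Br) _.
by have [_] := configP mu; apply; exact: cube_compact.
Qed.

(** The mass of a bounded set is finite, so only finitely many indices fall in it. Every local
    question about a configuration becomes one about the rows of a matrix. *)
Lemma config_enum (mu : M) (B : set E) : bnd B ->
 exists N (X : mat N), (forall i, B (row i X)) /\ restr mu B = sum_config X.
Proof.
move=> bB; have := config_bnd_lty mu bB.
have [[I [x muE]] _] := configP mu; rewrite muE.
pose J := I `&` x @^-1` B => muB.
have EJ A : (\esum_(i in I) \d_(x i) (A `&` B) = \esum_(i in J) \d_(x i) A :> \bar R)%E.
 rewrite esum_mkcondr; apply: eq_esum => i _; rewrite !diracE in_setI.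
 rewrite (_ : (i \in x @^-1` B) = (x i \in B)) ?mem_setE//.
 by case: (x i \in B); rewrite ?andbT ?andbF.
have finJ : finite_set J.
 apply: contrapT => infJ; move: muB; apply/negP; rewrite -leNgt leye_eq.
 apply/eqP/eqyP => r _; rewrite -[B]setTI EJ.
 have [F FJ Fr] := infinite_set_fset (Num.truncn `|r|).+1 infJ.
 apply: esum_ge; exists [set` F]; first by split => //.
 rewrite fsbig_finite//= set_fsetK.
 rewrite (eq_bigr (fun=> 1%E)); last by move=> i _; rewrite diracE in_setT.
 rewrite sumEFin lee_fin big_const_seq count_predT iter_addr_0.
 apply: le_trans (ler_norm r) _; apply/ltW/(lt_le_trans (truncnS_gt _)).
 by rewrite ler_nat.
have /finite_fsetP[F JF] := finJ.
pose s := enum_fset F.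
pose X : 'M[R]_(size s, d) := \matrix_(i, j) x (nth 0%N s i) ord0 j.
have rX i : row i X = x (nth 0%N s i) by apply/rowP => j; rewrite !mxE.
exists (size s), X; split=> [i|].
 have : nth 0%N s i \in F by apply: mem_nth.
 rewrite rX => sF; have [] : J (nth 0%N s i) by rewrite JF.
 by [].
apply: config_ext => A /=; rewrite muE EJ JF esum_fset; last 2 first.
- exact: finite_fset.
- by [].
rewrite fsbig_finite//= set_fsetK -/s (big_nth 0%N) big_mkord.
by apply: eq_bigr => i _; rewrite rX.
Qed.

Lemma config_nat (mu : M) (B : set E) : bnd B -> exists n : nat, mu B = n%:R%:E.
Proof.
move=> bB; have [N [X [XB muX]]] := config_enum mu bB; exists N.
have : restr mu B setT = sum_config X setT by rewrite muX.
rewrite /= setTI => ->; rewrite (eq_bigr (fun=> 1%E)); last first.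
 by move=> i _; rewrite diracE in_setT.
by rewrite sumEFin sumr_const card_ord.
Qed.

Lemma mbl_count (V : set E) : measurable V ->
 mbl (fun mu : M => mu V).
Proof.
move=> mV _ B mB; rewrite setTI; apply: sub_sigma_algebra.
by exists V, B; split.
Qed.

Lemma mbl_config dT (T : measurableType dT) (g : T -> M) :
 (forall V, measurable V -> mbl (fun t => g t V)) ->
 mbl g.
Proof.
move=> mg; apply: (@measurability _ _ _ _ _ _ (sigF_gen setT)) => //.
move=> _ [_ [V [B [mV _ mB ->]] <-]].
exact: mg.
Qed.

(** The count of [V] in the restriction is the count of the intersection of [V] and [U], a generator
    of [sigF U]. *)
Lemma restr_sigF (U : set E) (A : set M) : measurable U -> measurable A ->
 sigF U ((@restr R d)^~ U @^-1` A).
Proof.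
move=> mU mA.
pose T := g_sigma_algebraType (sigF_gen U).
suff : mbl (fun mu : T => restr (mu : M) U).
 by move=> /(_ measurableT _ mA); rewrite setTI.
apply: mbl_config => V mV _ B mB; rewrite setTI.
apply: sub_sigma_algebra; exists (V `&` U), B; split => //.
exact: measurableI.
Qed.

Lemma sigF_mbl (U : set E) (A : set M) : sigF U A -> measurable A.
Proof.
apply: smallest_sub; first exact: sigma_algebra_measurable.
move=> _ [V [B [mV VU mB ->]]]; apply: sub_sigma_algebra.
by exists V, B; split.
Qed.

Section kernel.
Context {dT} {T : measurableType dT} (c : T -> M).
Hypothesis mc : mbl c.

Definition config_kernel (t : T) : {measure set E -> \bar R} := c t.

Let mbl_kernel_config U : measurable U ->
 mbl (config_kernel ^~ U).
Proof. by move=> mU; exact: mcomp (mbl_count mU) mc. Qed.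

HB.instance Definition _ := isKernel.Build _ _ _ _ _ config_kernel
 mbl_kernel_config.

(** Configurations may be infinite: measurability is obtained on cubes, where masses are finite, and
    passed to the increasing limit. *)
Lemma mbl_cfg_xsection (A : set (T * E)) : measurable A ->
 mbl (fun t => c t (xsection A t)).
Proof.
move=> mA.
have h (n : nat) : mbl (fun t => c t (xsection A t `&` cube n%:R)).
 have mQ := @cube_mbl n%:R.
 have := @measurable_prod_subset_xsection_kernel _ _ T E R config_kernel _ mQ.
 move=> h; apply: (proj2 (h _ A mA)) => t.
 exists (fine (c t (cube n%:R)) + 1) => X mX.
 rewrite EFinD fineK; last first.
  by rewrite ge0_fin_numE//; exact: config_bnd_lty (cube_bnd _).
 apply: (@le_lt_trans _ _ (c t (cube n%:R))).
  by apply: le_config => x [].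
 rewrite lteDl// ?lte01//.
 by rewrite ge0_fin_numE//; exact: config_bnd_lty (cube_bnd _).
apply: (emeasurable_fun_cvg _ _ h) => t _.
have E0 : xsection A t = \bigcup_n (xsection A t `&` cube n%:R).
 rewrite -setI_bigcupr (_ : \bigcup_n cube n%:R = setT) ?setIT//.
 by apply/seteqP; split => // x _; have [n nx] := cube_cover x; exists n.
rewrite [in X in _ --> X]E0; apply: nondecreasing_cvg_mu => //.
- by move=> n; apply: measurableI; [exact: measurable_xsection|exact: cube_mbl].
- apply: bigcup_measurable => n _.
 by apply: measurableI; [exact: measurable_xsection|exact: cube_mbl].
- by move=> m n mn; apply/subsetPset; apply: setIS; apply: sub_cube; rewrite ler_nat.
Qed.

Lemma mbl_cfg_integral (f : T * E -> \bar R) :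
 (forall p, 0 <= f p)%E -> mbl f ->
 mbl (fun t => \int[c t]_x f (t, x))%E.
Proof.
move=> f0 mf; pose f_ := nnsfun_approx measurableT mf.
apply: (@measurable_fun_xsection_integral _ _ _ _ _ f (fun t => c t) f_).
- by move=> a b ab; exact/nd_nnsfun_approx.
- by move=> z; exact/cvg_nnsfun_approx.
- move=> n r; apply: mbl_cfg_xsection; rewrite -[X in measurable X]setTI.
 have mfn : mbl (f_ n) by [].
 by apply: mfn => //; exact: measurable_set1.
Qed.

End kernel.

Lemma config_integral_enum (mu : M) (B : set E) N (X : mat N) (f : E -> \bar R) :
 measurable B -> restr mu B = sum_config X -> (forall x, 0 <= f x)%E ->
 mbl f -> (forall x, ~ B x -> f x = 0)%E ->
 (\int[mu]_x f x = \sum_(i < N) f (row i X))%E.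
Proof.
move=> mB muX f0 mf fB.
have -> : (\int[mu]_x f x = \int[mu]_(x in B) f x)%E.
 rewrite [RHS]integral_mkcond; apply: eq_integral => x _; rewrite patchE.
 by case: ifPn => // /negP xB; rewrite fB// => Bx; apply: xB; exact: mem_set.
pose m (n : nat) : {measure set E -> \bar R} :=
 if insub n is Some i then \d_(row (i : 'I_N) X) else mzero.
rewrite (eq_measure_integral (msum m N)); last first.
 move=> A mA AB; have : restr mu B A = sum_config X A by rewrite muX.
 rewrite /= (setIidl AB) => ->; rewrite /msum; apply: eq_bigr => i _.
 by rewrite /m valK.
rewrite ge0_integral_measure_sum//; last exact: measurable_funS mf.
apply: eq_bigr => i _; rewrite /m valK integral_dirac//; last exact: measurable_funS mf.
rewrite diracE; case: (boolP (_ \in _)) => [|/negP iB]; first by rewrite mul1e.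
by rewrite mul0e fB// => Bi; apply: iB; exact: mem_set.
Qed.

Lemma mbl_addE dT (T : measurableType dT) (f g : T -> E) :
 mbl f -> mbl g ->
 mbl (fun t => f t + g t).
Proof.
move=> mf mg; apply: mbl_rV => i; under eq_fun do rewrite mxE.
by apply: measurable_funD; exact: mcomp (mbl_coord i) _.
Qed.

Lemma mbl_oppE dT (T : measurableType dT) (f : T -> E) :
 mbl f -> mbl (fun t => - f t).
Proof.
move=> mf; apply: mbl_rV => i; under eq_fun do rewrite mxE.
by apply: mcomp => //; exact: mcomp (mbl_coord i) _.
Qed.

(** The count of [V] after the shift is the integral of the indicator of [V] at [y - x] against
    [mu(dy)], jointly measurable in [mu] and [x]. *)
Lemma mbl_shift : mbl (fun p : M * E => Defs.shift (- p.2) p.1).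
Proof.
apply: mbl_config => V mV.
rewrite (_ : (fun t => _) = fun p : M * E =>
  (\int[p.1]_y (\1_V (y - p.2))%:E)%E); last first.
 apply/funext => p /=.
 have mVp : measurable [set y | V (y - p.2)].
  rewrite -[X in measurable X]setTI.
  have : mbl (fun y : E => y - p.2).
   by apply: mbl_addE => //; exact: measurable_cst.
  exact.
 by rewrite -(setIT [set y | V (y - p.2)]) -integral_indic.
apply: (@mbl_cfg_integral _ _ (fun p : M * E => p.1) _
 (fun q : (M * E) * E => (\1_V (q.2 - q.1.2))%:E)) => //.
 exact: measurable_fst.
apply/mEFin; apply: mcomp; first exact: mindic.
apply: mbl_addE; first exact: measurable_snd.
apply: mbl_oppE; exact: mcomp measurable_snd measurable_fst.
Qed.

Lemma set1_mbl (x : E) : measurable [set x].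
Proof.
rewrite (_ : [set x] = \bigcap_(i in [set: 'I_d]) (fun y : E => y ord0 i) @^-1` [set x ord0 i]).
 apply: fin_bigcap_measurable => // i _.
 by rewrite -[X in measurable X]setTI; apply: mbl_coord.
apply/seteqP; split=> [_ -> //|y h]; apply/rowP => i; exact: (h i I).
Qed.

Lemma mbl_atom : mbl (fun p : M * E => p.1 [set p.2]).
Proof.
have mD : measurable [set q : (M * E) * E | q.2 = q.1.2].
 rewrite (_ : [set q | _] = \bigcap_(i in [set: 'I_d])
   (fun q : (M * E) * E => q.2 ord0 i - q.1.2 ord0 i) @^-1` [set 0]).
  apply: fin_bigcap_measurable => // i _.
  rewrite -[X in measurable X]setTI.
  have : mbl (fun q : (M * E) * E => q.2 ord0 i - q.1.2 ord0 i).
   apply: mfunB.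
    exact: mcomp (mbl_coord i) measurable_snd.
   apply: mcomp (mbl_coord i) _.
   exact: mcomp measurable_snd measurable_fst.
  exact.
 apply/seteqP; split=> [q /= qE i _|q h]; first by rewrite /= qE subrr.
 by apply/rowP => i; apply/eqP; rewrite -subr_eq0; apply/eqP; exact: (h i I).
rewrite (_ : (fun p => _) = fun p : M * E =>
  (\int[p.1]_y (\1_[set q : (M * E) * E | q.2 = q.1.2] (p, y))%:E)%E); last first.
 apply/funext => p /=; rewrite -[in LHS](setIT [set p.2]) -integral_indic//; last exact: set1_mbl.
apply: (@mbl_cfg_integral _ _ (fun p : M * E => p.1) _
 (fun q : (M * E) * E => (\1_[set q : (M * E) * E | q.2 = q.1.2] q)%:E)) => //.
 exact: measurable_fst.
by apply/mEFin; exact: mindic.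
Qed.

Lemma moveE (mu : M) (x y : E) (A : set E) : move mu x y A =
 (if mu [set x] == 0 then mu A else mu A - \d_x A + \d_y A)%E.
Proof.
rewrite /move; case: pselect => [mux|]; first by rewrite (negbTE mux).
by move=> /negP; rewrite negbK => ->.
Qed.

Lemma mbl_move (v : E) :
 mbl (fun p : M * E => move p.1 p.2 (p.2 + v)).
Proof.
apply: mbl_config => V mV.
under eq_fun do rewrite moveE.
have mdirac (g : M * E -> E) : mbl g ->
  mbl (fun p => \d_(g p) V : \bar R).
 move=> mg; under eq_fun do rewrite diracE -indicE.
 by apply/mEFin; apply: mcomp => //; exact: mindic.
have m1 : mbl (fun p : M * E => p.1 V).
 exact: mcomp (mbl_count mV) measurable_fst.
apply: measurable_fun_if => //.
- apply: (measurable_fun_bool true); rewrite setTI.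
 rewrite (_ : _ @^-1` _ = (fun p : M * E => p.1 [set p.2]) @^-1` [set 0%E]).
  by rewrite -[X in measurable X]setTI; apply: mbl_atom.
 by apply/seteqP; split=> p /= /eqP.
- exact: measurable_funS m1.
- apply: (@measurable_funS _ _ _ _ setT) => //.
 apply: emeasurable_funD; last first.
  apply: mdirac; apply: mbl_addE => //; exact: measurable_cst.
 by apply: emeasurable_funB => //; apply: mdirac.
Qed.

(** * The Campbell measure *)

Section campbell.
Local Open Scope ereal_scope.

(** The measure [mu(dx) P(dmu)] on pairs. Gradients are square-integrable fields for it, so that the
    L^2 theory above applies to them as well. *)
Definition campbell_fun (A : set (M * E)) : \bar R := \int[P]_mu mu (xsection A mu).

Let mbl_sec (A : set (M * E)) : measurable A ->
 mbl (fun mu : M => mu (xsection A mu)).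
Proof. by move=> mA; apply: (mbl_cfg_xsection (c := id)). Qed.

Let campbell0 : campbell_fun set0 = 0.
Proof.
by rewrite /campbell_fun; under eq_integral do rewrite xsection0 measure0;
 rewrite integral0.
Qed.

Let campbell_ge0 A : 0 <= campbell_fun A.
Proof. by apply: integral_ge0 => mu _; exact: measure_ge0. Qed.

Let campbell_sigma_additive : semi_sigma_additive campbell_fun.
Proof.
move=> F mF tF mUF; rewrite [X in _ --> X](_ : _ =
  \int[P]_mu (\sum_(n <oo) (mu (xsection (F n) mu)))); last first.
 apply: eq_integral => mu _; rewrite xsection_bigcup.
 apply/esym/cvg_lim => //; apply: measure_semi_sigma_additive.
 - by move=> n; exact: measurable_xsection.
 - exact: trivIset_xsection.
 - by apply: bigcup_measurable => n _; exact: measurable_xsection.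
rewrite integral_nneseries//; last by move=> n; exact: mbl_sec.
by apply: is_cvg_nneseries => n _ _; exact: campbell_ge0.
Qed.

HB.instance Definition _ := isMeasure.Build _ _ _ campbell_fun
 campbell0 campbell_ge0 campbell_sigma_additive.

Definition campbell : {measure set (M * E) -> \bar R} := campbell_fun.

(** For simple functions this is the definition of the measure; monotone convergence in the three
    integrals gives the rest. *)
Lemma campbell_integral (f : M * E -> \bar R) :
 (forall p, 0 <= f p) -> mbl f ->
 \int[campbell]_p f p = \int[P]_mu \int[mu]_x f (mu, x).
Proof.
move=> f0 mf.
pose f_ := nnsfun_approx measurableT mf.
have mg n : mbl (fun p : M * E => (f_ n p)%:E).
 by apply/mEFin.
have mgx n mu : mbl (fun x : E => (f_ n (mu, x))%:E).
 exact: mcomp (mg n) (measurable_pair1 _).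
have nd mu x a b : (a <= b)%N -> (f_ a (mu, x))%:E <= (f_ b (mu, x))%:E.
 by move=> ab; rewrite lee_fin; apply/lefP/nd_nnsfun_approx.
have mA n r : measurable (f_ n @^-1` [set r]).
 by apply: measurable_funPTI => //; exact: measurable_set1.
have mAx n r (mu : M) : measurable (xsection (f_ n @^-1` [set r]) mu).
 exact: measurable_xsection.
have fE n : \int[campbell]_p (f_ n p)%:E = \int[P]_mu \int[mu]_x (f_ n (mu, x))%:E.
 under [in LHS]eq_integral do rewrite fimfunE -fsumEFin//.
 rewrite ge0_integral_fsum//; last 2 first.
  - by move=> r; exact/mEFin/mcomp.
  - by move=> r z _; rewrite EFinM nnfun_muleindic_ge0.
 rewrite [RHS](_ : _ = \int[P]_mu (\sum_(r \in range (f_ n))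
   (r%:E * mu (xsection (f_ n @^-1` [set r]) mu)))); last first.
  apply: eq_integral => mu _.
  under eq_integral do rewrite fimfunE -fsumEFin//.
  rewrite ge0_integral_fsum//; last 2 first.
  - move=> r; rewrite (_ : (fun x => _) = fun x => (r * \1_(xsection (f_ n @^-1` [set r]) mu) x)%:E).
    by apply/mEFin/mfunM => //; exact: mindic.
   by apply/funext => x; rewrite !indicE mem_xsection.
  - by move=> r z _; rewrite EFinM nnfun_muleindic_ge0.
  apply: eq_fsbigr => r _.
  rewrite (_ : (fun x => _) = fun x => (r * \1_(xsection (f_ n @^-1` [set r]) mu) x)%:E).
   rewrite (@integralZl_indic _ _ _ _ _ measurableT
    (fun r => xsection (f_ n @^-1` [set r]) mu)) ?integral_indic ?setIT//.
   by move=> r0; rewrite preimage_nnfun0// xsection0.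
  by apply/funext => x; rewrite !indicE mem_xsection.
 rewrite ge0_integral_fsum//; last 2 first.
 - by move=> r; apply: measurable_funeM; exact: mbl_sec.
 - move=> r mu _; case: (leP 0%R r) => r0; first by rewrite mule_ge0// lee_fin.
  by rewrite preimage_nnfun0// xsection0 measure0 mule0.
 apply: eq_fsbigr => r _.
 rewrite (@integralZl_indic _ _ _ _ _ measurableT (fun r => f_ n @^-1` [set r]))//; last first.
  by move=> r0; rewrite preimage_nnfun0.
 rewrite integral_indic// setIT /= /campbell_fun.
 have [r0|r0] := leP 0%R r; first by rewrite ge0_integralZl//; exact: mbl_sec.
 rewrite !integral0_eq ?mule0// => mu _; rewrite preimage_nnfun0// xsection0 measure0 ?mule0//.
transitivity (limn (fun n => \int[campbell]_p (f_ n p)%:E)).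
 rewrite -monotone_convergence//.
 - by apply: eq_integral => p _; apply/esym/cvg_lim => //; exact: cvg_nnsfun_approx.
 - by move=> n p _; rewrite lee_fin.
 - by move=> [mu x] _ a b; exact: nd.
under eq_fun do rewrite fE.
have mi n : mbl (fun mu : M => \int[mu]_x (f_ n (mu, x))%:E).
 by apply: (mbl_cfg_integral (c := id) _ _ (mg n)) => // p; rewrite lee_fin.
rewrite -monotone_convergence//; last 2 first.
- by move=> n mu _; apply: integral_ge0 => x _; rewrite lee_fin.
- move=> mu _ a b ab; apply: ge0_le_integral => //.
 + by move=> x _; rewrite lee_fin.
 + by move=> x _; exact: nd.
apply: eq_integral => mu _; rewrite -monotone_convergence//.
- by apply: eq_integral => x _; apply/cvg_lim => //; exact: cvg_nnsfun_approx.
- by move=> n x _; rewrite lee_fin.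
- by move=> x _ a b; exact: nd.
Qed.

End campbell.

(** * Linear statistics of configurations *)

Section linear_statistics.
Implicit Types (f g l : E -> R) (mu : M).

Definition lin f mu : R := \int[mu]_x f x.

Definition bsupp f := exists r, forall x, ~ cube r x -> f x = 0.

Lemma integral_enum mu (B : set E) N (X : mat N) f :
 measurable B -> restr mu B = sum_config X -> mbl f ->
 (forall x, ~ B x -> f x = 0) ->
 (\int[mu]_x (f x)%:E)%E = (\sum_(i < N) f (row i X))%:E.
Proof.
move=> mB muX mf fB.
rewrite integralE !(config_integral_enum mB muX)//; last 4 first.
- by apply: measurable_funeneg; apply/mEFin.
- by move=> x xB; rewrite funenegE fB//= oppr0 maxxx.
- by apply: measurable_funepos; apply/mEFin.
- by move=> x xB; rewrite funeposE fB//= maxxx.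
under eq_bigr do rewrite funeposE -EFin_max.
under [X in (_ - X)%E]eq_bigr do rewrite funenegE -EFinN -EFin_max.
rewrite !sumEFin -EFinB -sumrB; congr (_%:E); apply: eq_bigr => i _.
by rewrite /Num.max; case: ifPn; case: ifPn; rewrite -?leNgt; lra.
Qed.

Lemma lin_enum mu (B : set E) N (X : mat N) f :
 measurable B -> restr mu B = sum_config X -> mbl f ->
 (forall x, ~ B x -> f x = 0) -> lin f mu = \sum_(i < N) f (row i X).
Proof. by move=> *; rewrite /lin /Rintegral (@integral_enum mu B N X). Qed.

Lemma lin_integrable mu f : mbl f -> bsupp f ->
 intg mu f.
Proof.
move=> mf [r rP]; apply/integrableP; split; first exact/mEFin.
have [N [X [_ XP]]] := config_enum mu (cube_bnd r).
rewrite (config_integral_enum (cube_mbl r) XP)//=.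
- by rewrite sumEFin ltry.
- apply: (@measurableT_comp _ _ _ _ _ _ (fun x : R => `|x|%:E)) => //.
 by apply/mEFin; exact: normr_measurable.
- by move=> x /rP ->; rewrite normr0.
Qed.

Lemma linE mu f : mbl f -> bsupp f ->
 (\int[mu]_x (f x)%:E)%E = (lin f mu)%:E.
Proof.
move=> mf bf; rewrite /lin /Rintegral fineK//.
exact/integrable_fin_num/lin_integrable.
Qed.

Lemma linD mu f g : mbl f -> mbl g ->
 bsupp f -> bsupp g -> lin (fun x => f x + g x) mu = lin f mu + lin g mu.
Proof.
by move=> mf mg bf bg; rewrite /lin RintegralD//; exact: lin_integrable.
Qed.

Lemma linZ mu c f : mbl f -> bsupp f ->
 lin (fun x => c * f x) mu = c * lin f mu.
Proof. by move=> mf bf; rewrite /lin RintegralZl//; exact: lin_integrable. Qed.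

Lemma le_lin mu f g : mbl f -> mbl g ->
 bsupp f -> bsupp g -> (forall x, f x <= g x) -> lin f mu <= lin g mu.
Proof.
by move=> mf mg bf bg fg; apply: le_Rintegral => //; exact: lin_integrable.
Qed.

Lemma lin_ge0 mu f : (forall x, 0 <= f x) -> 0 <= lin f mu.
Proof. by move=> f0; exact: Rintegral_ge0. Qed.

Lemma lin_indic mu (A : set E) : measurable A -> lin (\1_A) mu = fine (mu A).
Proof. by move=> mA; rewrite /lin /Rintegral integral_indic ?setIT. Qed.

Lemma mbl_lin f : mbl f -> mbl (lin f).
Proof.
move=> mf; apply: mcomp => //.
under eq_fun do rewrite integralE.
apply: emeasurable_funB.
 apply: (mbl_cfg_integral (c := id) _ (f := fun p : M * E => (EFin \o f)^\+ p.2)%E) => //.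
 by apply: mcomp measurable_snd; apply/measurable_funepos/mEFin.
apply: (mbl_cfg_integral (c := id) _ (f := fun p : M * E => (EFin \o f)^\- p.2)%E) => //.
by apply: mcomp measurable_snd; apply/measurable_funeneg/mEFin.
Qed.

Lemma sigF_restr (U : set E) (g : M -> R) : measurable U -> mbl g ->
 (forall mu, g (restr mu U) = g mu) -> measurable_wrt (sigF U) g.
Proof.
move=> mU mg gU B mB.
rewrite (_ : g @^-1` B = (@restr R d)^~ U @^-1` (g @^-1` B)).
 by apply: restr_sigF => //; rewrite -[X in measurable X]setTI; exact: mg.
by apply/seteqP; split=> mu /=; rewrite gU.
Qed.

Lemma restr_restr mu (U V : set E) : V `<=` U -> restr (restr mu U) V = restr mu V.
Proof.
move=> VU; apply: config_ext => A /=; rewrite -setIA.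
by rewrite (setIidl VU).
Qed.

Lemma lin_restr mu (U : set E) f : measurable U -> mbl f -> bsupp f ->
 (forall x, ~ U x -> f x = 0) -> lin f (restr mu U) = lin f mu.
Proof.
move=> mU mf [r rP] fU; pose B := U `&` cube r.
have mB : measurable B by apply: measurableI => //; exact: cube_mbl.
have bB : bnd B by exists r => x [].
have fB x : ~ B x -> f x = 0.
 by move=> /not_andP[/fU|/rP].
have [N [X [_ XP]]] := config_enum mu bB.
rewrite (lin_enum mB XP mf fB).
by rewrite (@lin_enum _ B N X)// restr_restr// => x [].
Qed.

End linear_statistics.

(** * Poisson counts: moments and independence *)

Lemma volume_ge0 (A : set E) : (0 <= volume A :> \bar R)%E.
Proof.
apply: le_ereal_inf_tmp => _ [ab _ <-]; apply: nneseries_ge0 => k _ _.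
by rewrite lee_fin; apply: prodr_ge0 => i _; rewrite le_max lexx.
Qed.

Lemma volume_bnd (A : set E) : bnd A -> (volume A < +oo :> \bar R)%E.
Proof.
move=> [r Ar]; pose c : R := r / 2.
pose b := (const_mx (- c) : E, const_mx c : E).
(* After the first box come empty ones, of volume 0 because [d] is positive: an empty product would
   be 1. *)
pose ab (k : nat) := if k is 0 then b else (const_mx 1 : E, const_mx 0 : E).
apply: (@le_lt_trans _ _ (\sum_(0 <= k <oo) (box_volume (ab k).1 (ab k).2)%:E)%E).
 apply: ereal_inf_lbound; exists ab => // x /Ar rx; exists 0%N => // i /=.
 by rewrite !mxE; exact: rx.
rewrite (@nneseries_split _ _ 0 1)//; last first.
 by move=> k _; rewrite lee_fin; apply: prodr_ge0 => i _; rewrite le_max lexx.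
rewrite add0n big_nat1 -nneseries_addn; last first.
 by move=> k; rewrite lee_fin; apply: prodr_ge0 => i _; rewrite le_max lexx.
rewrite (eq_eseriesr (g := fun=> 0%E)); first by rewrite eseries0// adde0 ltry.
move=> k _; rewrite addn1; congr (_%:E); rewrite /box_volume (bigD1 (Ordinal d_gt0))// [(ab _).1]/= [(ab _).2]/= !mxE.
have -> : Num.max 0 (0 - 1 : R) = 0 by apply/max_idPl; lra.
exact: mul0r.
Qed.

Definition mcount (A : set E) : R := rho * fine (volume A).

Lemma mcount_ge0 A : 0 <= mcount A.
Proof. by rewrite mulr_ge0 ?(ltW rho0)// fine_ge0// volume_ge0. Qed.

Lemma count_pmf (A : set E) k : measurable A -> bnd A ->
 P [set mu | mu A = k%:R%:E] =
  (mcount A ^+ k / k`!%:R * expR (- mcount A))%:E.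
Proof. by move=> mA bA; rewrite PP.1//; exact: volume_bnd. Qed.

Lemma mbl_count_eq (A : set E) (k : nat) : measurable A ->
 measurable [set mu : M | mu A = k%:R%:E].
Proof.
move=> mA; have := mbl_count mA.
move=> /(_ measurableT [set k%:R%:E] (emeasurable_set1 _)); rewrite setTI.
exact.
Qed.

(** Splits an expectation according to the count in [A]. The factor [Y] is carried along so that
    independence can be applied to each term. *)
Lemma count_sum (A : set E) (phi : \bar R -> R) (Y : M -> \bar R) :
 measurable A -> bnd A -> (forall x, 0 <= phi x) ->
 (forall mu, 0 <= Y mu)%E -> mbl Y ->
 (\int[P]_mu ((phi (mu A))%:E * Y mu) =
  \sum_(k <oo) (phi k%:R%:E)%:E * \int[P]_mu ((\1_[set mu : M | mu A = k%:R%:E] mu)%:E * Y mu))%E.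
Proof.
move=> mA bA phi0 Y0 mY.
pose I (k : nat) (mu : M) : R := \1_[set mu : M | mu A = k%:R%:E] mu.
have mI k : mbl (I k) by apply: mindic; exact: mbl_count_eq.
have mIY k : mbl (fun mu => (I k mu)%:E * Y mu)%E.
 by apply: emeasurable_funM => //; apply/mEFin.
have IY0 k mu : (0 <= (I k mu)%:E * Y mu)%E by rewrite mule_ge0// lee_fin.
rewrite [RHS](eq_eseriesr (g := fun k =>
  (\int[P]_mu ((phi k%:R%:E)%:E * ((I k mu)%:E * Y mu)))%E)); last first.
 by move=> k _; rewrite ge0_integralZl// lee_fin.
rewrite -integral_nneseries//; last 2 first.
- by move=> k; apply: measurable_funeM.
- by move=> k mu _; rewrite mule_ge0// lee_fin.
apply: eq_integral => mu _.
have [n nE] := config_nat mu bA.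
rewrite (@nneseriesD1 _ _ n xpredT)//; last by move=> k _; rewrite mule_ge0// lee_fin.
rewrite eseries0 ?adde0; last first.
 move=> k _ /= kn; rewrite /I indicE memNset ?mul0e ?mule0//= nE => -[] /eqP.
 by rewrite eqr_nat eq_sym (negbTE kn).
by rewrite /I indicE mem_set//= mul1e nE.
Qed.

Lemma expR_series (x : R) : 0 <= x ->
 (\sum_(k <oo) (x ^+ k / k`!%:R)%:E = (expR x)%:E)%E.
Proof.
move=> x0; rewrite expRE -EFin_lim; last first.
 rewrite /pseries/=; under eq_fun do rewrite mulrC.
 exact: is_cvg_series_exp_coeff.
apply/congr_lim/funext => n/=; rewrite /pseries/= /series/= -sumEFin//.
by under eq_bigr do rewrite mulrC.
Qed.

Lemma pgf (A : set E) (z : R) : measurable A -> bnd A -> 0 <= z ->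
 (\sum_(k <oo) (z ^+ k)%:E * P [set mu | mu A = k%:R%:E] =
  (expR (- (mcount A * (1 - z))))%:E)%E.
Proof.
move=> mA bA z0.
rewrite (eq_eseriesr (g := fun k =>
  (expR (- mcount A))%:E * ((z * mcount A) ^+ k / k`!%:R)%:E)%E); last first.
 move=> k _; rewrite count_pmf// -!EFinM; congr (_%:E); rewrite (exprMn k z (mcount A)); move: (expR _) (mcount A ^+ k) (z ^+ k) (k`!%:R^-1) => e a zz f; ring.
rewrite nneseriesZl; last first.
 by move=> k _; rewrite lee_fin divr_ge0// exprn_ge0// mulr_ge0// mcount_ge0.
rewrite expR_series; last by rewrite mulr_ge0// mcount_ge0.
by rewrite -EFinM -expRD; congr (expR _)%:E; ring.
Qed.

Definition expcount (c : R) (x : \bar R) : R := expR (c * fine x).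

Lemma expcountE c (n : nat) : expcount c n%:R%:E = expR c ^+ n.
Proof. by rewrite /expcount /= mulrC expRM_natl. Qed.

Lemma mbl_expcount (A : set E) c : measurable A ->
 mbl (fun mu : M => expcount c (mu A)).
Proof.
move=> mA; rewrite /expcount; apply: (mcomp (@measurable_expR R)).
apply: mfunM => //.
apply: mcomp => //; exact: mbl_count.
Qed.

Lemma expcount_integral (A : set E) c : measurable A -> bnd A ->
 (\int[P]_mu (expcount c (mu A))%:E = (expR (- (mcount A * (1 - expR c))))%:E)%E.
Proof.
move=> mA bA.
have := count_sum mA bA (fun x => expR_ge0 _) (fun mu : M => lee01) (measurable_cst 1%E)
 (phi := expcount c).
under eq_integral do rewrite mule1.
move=> ->; rewrite -(pgf mA bA (expR_ge0 c)); apply: eq_eseriesr => k _.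
rewrite expcountE; congr (_ * _)%E; under eq_integral do rewrite mule1.
by rewrite integral_indic ?setIT//; exact: mbl_count_eq.
Qed.

Lemma count_integral (A : set E) : measurable A -> bnd A ->
 (\int[P]_mu mu A = (mcount A)%:E)%E.
Proof.
move=> mA bA.
have muE (mu : M) : mu A = (fine (mu A))%:E.
 by have [n ->] := config_nat mu bA.
have := count_sum (phi := fun x => `|fine x|) mA bA _ (fun mu : M => lee01) (measurable_cst 1%E).
move=> /(_ (fun x => normr_ge0 _)).
under eq_integral => mu _ do rewrite mule1 ger0_norm ?fine_ge0// -muE.
move=> ->.
rewrite nneseries_recl//; last first.
 by move=> k _; rewrite mule_ge0 ?lee_fin// integral_ge0// => mu _; rewrite mule1 lee_fin.
rewrite /= normr0 mul0e add0e -nneseries_addn; last first.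
 by move=> k; rewrite mule_ge0 ?lee_fin// integral_ge0// => mu _; rewrite mule1 lee_fin.
rewrite (eq_eseriesr (g := fun k =>
  (mcount A * expR (- mcount A))%:E * (mcount A ^+ k / k`!%:R)%:E)%E); last first.
 move=> k _; rewrite (eq_integral (fun mu => (\1_[set mu : M | mu A = (k + 1)%N%:R%:E] mu)%:E)); last first.
  by move=> mu _; rewrite mule1.
 rewrite integral_indic ?setIT//; last exact: mbl_count_eq.
 rewrite addn1 [X in (_ * X)%E](_ : _ = (mcount A ^+ k.+1 / k.+1`!%:R * expR (- mcount A))%:E).
  rewrite -!EFinM normr_nat factS natrM; congr (_%:E).

  by rewrite exprS; field; rewrite -(natrD _ 1) !pnatr_eq0 -lt0n fact_gt0.
 exact: count_pmf.
rewrite nneseriesZl; last first.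
 by move=> k _; rewrite lee_fin divr_ge0// exprn_ge0// mcount_ge0.
rewrite expR_series ?mcount_ge0// -EFinM -mulrA -expRD.
by rewrite addNr expR0 mulr1.
Qed.

(** Independence is given for events only. Indicators are replaced by exponentials one index at a
    time: in [key j] the first [j] factors are exponentials and the others indicators of arbitrary
    sets, and [count_sum] reduces an exponential to singletons. *)
Lemma count_indep n (A : 'I_n -> set E) (c : 'I_n -> R) :
 (forall i, measurable (A i)) -> (forall i, bnd (A i)) -> trivIset setT A ->
 (\int[P]_mu (\prod_(i < n) expcount (c i) (mu (A i)))%:E =
  (\prod_(i < n) expR (- (mcount (A i) * (1 - expR (c i)))))%:E)%E.
Proof.
move=> mA bA tA.
have key j : (j <= n)%N -> forall B : 'I_n -> set (\bar R), (forall i, measurable (B i)) ->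
 let psi (i : 'I_n) (mu : M) := if (i < j)%N then expcount (c i) (mu (A i))
   else \1_(B i) (mu (A i)) in
 (\int[P]_mu (\prod_(i < n) psi i mu)%:E = \prod_(i < n) \int[P]_mu (psi i mu)%:E)%E.
 have mAB (B : 'I_n -> set (\bar R)) i : (forall i, measurable (B i)) ->
   measurable [set mu : M | B i (mu (A i))].
  move=> mB; have := mbl_count (mA i).
  by move=> /(_ measurableT (B i) (mB i)); rewrite setTI.
 elim: j => [_ B mB psi|j ih jn B mB psi].
  transitivity (P [set mu : M | forall i, B i (mu (A i))]).
   rewrite (_ : (fun mu => _) = fun mu : M => (\1_[set mu : M | forall i, B i (mu (A i))] mu)%:E).
    rewrite integral_indic ?setIT//.
    rewrite (_ : mkset _ = \bigcap_(i in [set: 'I_n]) [set mu : M | B i (mu (A i))]).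
     by apply: fin_bigcap_measurable => // i _; exact: mAB.
    by apply/seteqP; split=> mu h i => [_|]; exact: h.
   apply/funext => mu; congr (_%:E); rewrite /psi /= indicE.
   case: (boolP (_ \in _)) => [/set_mem/= h|/negP h].
    by rewrite big1// => i _; rewrite indicE mem_set.
   have [i Bi] : exists i, ~ B i (mu (A i)).
    by apply/existsNP => h'; apply: h; exact: mem_set.
   by rewrite (bigD1 i)//= indicE memNset ?mul0r.
  rewrite (PP.2 n A B mA tA mB); apply: eq_bigr => i _.
  transitivity (\int[P]_mu (\1_[set mu : M | B i (mu (A i))] mu)%:E)%E.
   by rewrite integral_indic ?setIT//; exact: mAB.
  by apply: eq_integral => mu _; rewrite !indicE; congr (_%:R%:E); apply/idP/idP; rewrite !inE.
 pose j0 := Ordinal jn.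
 pose Y mu := (\prod_(i < n | i != j0) psi i mu)%:E.
 have psi0 i mu : 0 <= psi i mu by rewrite /psi; case: ifP => _; [exact: expR_ge0|].
 have mpsi i : mbl (psi i).
  rewrite /psi; case: (i < j.+1)%N; first exact: mbl_expcount.
  apply: mcomp; first exact: mindic.
  exact: mbl_count.
 have Y0 mu : (0 <= Y mu)%E by rewrite lee_fin prodr_ge0.
 have mY : mbl Y.
  by apply/mEFin; exact: mbl_prod_cond.
 have ihk (k : nat) : (\int[P]_mu ((\1_[set mu : M | mu (A j0) = k%:R%:E] mu)%:E * Y mu) =
   \int[P]_mu ((\1_[set mu : M | mu (A j0) = k%:R%:E] mu)%:E) *
    \prod_(i < n | i != j0) \int[P]_mu (psi i mu)%:E)%E.
  pose B' i := if i == j0 then [set k%:R%:E] else B i.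
  have mB' i : measurable (B' i) by rewrite /B'; case: ifP.
  have h1 mu : (\1_[set mu : M | mu (A j0) = k%:R%:E] mu : R) = \1_(B' j0) (mu (A j0)).
   rewrite !indicE /B' eqxx; congr (_%:R); apply/idP/idP => /set_mem h; exact: mem_set.
  have h2 i : i != j0 -> (i < j)%N = (i < j.+1)%N.
   by move=> ij; rewrite ltnS [RHS]leq_eqVlt -[_ == _ in RHS]/(i == j0) (negbTE ij).
  have := ih (ltnW jn) B' mB'; rewrite /= (bigD1 j0)//= ltnn.
  under eq_integral do rewrite (bigD1 j0)//= ltnn -h1.
  under eq_integral => mu _.
   rewrite EFinM (eq_bigr (fun i => psi i mu)); last first.
    by move=> i ij; rewrite /psi h2// /B' (negbTE ij).
   over.
  move=> ->; congr (_ * _)%E; first by apply: eq_integral => mu _; rewrite h1.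
  apply: eq_bigr => i ij.
  by apply: eq_integral => mu _; rewrite /psi h2// /B' (negbTE ij).
 under eq_integral do rewrite (bigD1 j0)//= EFinM.
 rewrite (bigD1 j0)//=.
 have psij mu : psi j0 mu = expcount (c j0) (mu (A j0)) by rewrite /psi ltnSn.
 under eq_integral do rewrite psij.
 under [in RHS]eq_integral do rewrite psij.
 have := count_sum (mA j0) (bA j0) (fun x => expR_ge0 _) Y0 mY (phi := expcount (c j0)).
 move=> ->.
 have -> : (\int[P]_mu (expcount (c j0) (mu (A j0)))%:E =
   \int[P]_mu ((expcount (c j0) (mu (A j0)))%:E * cst 1 mu))%E.
  by apply: eq_integral => mu _; rewrite mule1.
 rewrite (count_sum (mA j0) (bA j0) (fun x => expR_ge0 _) (fun mu : M => lee01)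
  (measurable_cst 1%E) (phi := expcount (c j0))).
 pose Q := (\prod_(i < n | i != j0) \int[P]_mu (psi i mu)%:E)%E.
 have Q0 : (0 <= Q)%E by apply: prode_ge0 => i _; apply: integral_ge0 => mu _; rewrite lee_fin.
 have [q qE] : exists q, Q = q%:E.
  rewrite /Q; apply: (big_ind (fun x : \bar R => exists q, x = q%:E)).
  - by exists 1.
  - by move=> _ _ [x ->] [y ->]; exists (x * y).
  move=> i _; exists (fine (\int[P]_mu (psi i mu)%:E)); rewrite fineK//.
  rewrite ge0_fin_numE ?integral_ge0//; last by move=> mu _; rewrite lee_fin.
  rewrite /psi; have := mpsi i; rewrite /psi; case: (i < j.+1)%N => mpsii; first by rewrite expcount_integral ?ltry.
  apply: (@le_lt_trans _ _ (\int[P]_mu 1%E)%E).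
   apply: ge0_le_integral => //.
    exact/mEFin.
   by move=> mu _; rewrite lee_fin indicE; case: (_ \in _).
  by rewrite (prob_integral_cst P 1) ltry.
 rewrite -/Q qE muleC -nneseriesZl; last first.
  move=> k _; apply: mule_ge0; first by rewrite lee_fin expR_ge0.
  by apply: integral_ge0 => mu _; apply: mule_ge0 => //; rewrite lee_fin.
 apply: eq_eseriesr => k _; rewrite ihk -/Q qE muleA muleC; congr (_ * (_ * _))%E.
 by apply: eq_integral => mu _; exact/esym/mule1.
have := key n (leqnn n) (fun=> setT) (fun=> measurableT); rewrite /=.
under eq_integral do under eq_bigr do rewrite ltn_ord.
move=> ->; rewrite -prodEFin; apply: eq_bigr => i _.
by under eq_integral do rewrite ltn_ord; rewrite expcount_integral.
Qed.

(** * Test functions and the intensity measure *)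

Section test_functions.
Implicit Types f g : E -> R.

Definition tf g :=
 [/\ mbl g, exists b, forall x, `|g x| <= b & bsupp g].

Lemma tf_box g : tf g -> exists2 r, 0 <= r &
 exists2 b, 0 <= b & forall x, `|g x| <= b * \1_(cube r) x.
Proof.
move=> [_ [b bP] [r rP]]; exists `|r| => //; exists `|b| => // x.
rewrite indicE; case: (boolP (_ \in _)) => [_|/negP xr].
 by rewrite mulr1 (le_trans (bP x))// ler_norm.
rewrite rP ?normr0 ?mulr0// => rx; apply: xr; apply: mem_set.
exact: sub_cube (ler_norm r) _ rx.
Qed.

Lemma tf_indic (A : set E) : measurable A -> bnd A -> tf (\1_A).
Proof.
move=> mA [r Ar]; split; first exact: mindic.
 by exists 1 => x; rewrite indicE; case: (_ \in _); rewrite ?normr1 ?normr0.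
by exists r => x xr; rewrite indicE memNset// => /Ar.
Qed.

Lemma tfD f g : tf f -> tf g -> tf (fun x => f x + g x).
Proof.
move=> [mf [b bP] [r rP]] [mg [c cP] [s sP]]; split.
- exact: measurable_funD.
- by exists (b + c) => x; apply: le_trans (ler_normD _ _) _; rewrite lerD.
- exists (Num.max r s) => x xrs; rewrite rP ?sP ?addr0// => xr; apply: xrs;
 by apply: sub_cube xr; rewrite le_max lexx ?orbT.
Qed.

Lemma tfM f g : tf f -> mbl g -> (exists b, forall x, `|g x| <= b) ->
 tf (fun x => f x * g x).
Proof.
move=> [mf [b bP] [r rP]] mg [c cP]; split; first exact: mfunM.
- exists (b * c) => x; rewrite normrM ler_pM//.
- by exists r => x /rP ->; rewrite mul0r.
Qed.

Lemma tf0 : tf (fun=> 0).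
Proof.
split; first exact: measurable_cst.
 by exists 0 => x; rewrite normr0.
by exists 0.
Qed.

Lemma tfZ c f : tf f -> tf (fun x => c * f x).
Proof.
move=> tf_f; under eq_fun do rewrite mulrC; apply: tfM => //.
by exists `|c|.
Qed.

Lemma tf_mul f g : tf f -> tf g -> tf (fun x => f x * g x).
Proof. by move=> tf_f [mg bg _]; exact: tfM. Qed.

Lemma tf_sum (I : Type) (s : seq I) (F : I -> E -> R) : (forall i, tf (F i)) ->
 tf (fun x => \sum_(i <- s) F i x).
Proof.
move=> tF; elim: s => [|i s ih]; first by under eq_fun do rewrite big_nil; exact: tf0.
by under eq_fun do rewrite big_cons; exact: tfD.
Qed.

Lemma tf_mbl f : tf f -> mbl f. Proof. by case. Qed.
Lemma tf_bsupp f : tf f -> bsupp f. Proof. by case. Qed.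

(** By [x <= 2 exp (x / 2)] the square of the count is dominated by an exponential moment, already
    computed. *)
Lemma L2_count (A : set E) : measurable A -> bnd A -> L2 P (fun mu => fine (mu A)).
Proof.
move=> mA bA.
have mN : mbl (fun mu : M => fine (mu A)).
 by apply: mcomp => //; exact: mbl_count.
split => //.
apply: (@le_lt_trans _ _ (\int[P]_mu (4 * expcount 1 (mu A))%:E)%E).
 apply: ge0_le_integral => //.
 - by move=> mu _; rewrite lee_fin sqr_ge0.
 - by apply/mEFin/mfunX.
 - apply/mEFin/mfunM => //; exact: mbl_expcount.
 move=> mu _; rewrite lee_fin /expcount mul1r.
 have := @fine_ge0 _ (mu A) (measure_ge0 _ _); move: (fine (mu A)) => x x0.
 have -> : expR x = expR (x / 2) ^+ 2 by rewrite -expRM_natl; congr expR; field.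
 have h := expR_ge1Dx (x / 2).
 have h2 : x <= 2 * expR (x / 2) by lra.
 have := expR_gt0 (x / 2); nra.
under eq_integral do rewrite EFinM.
rewrite ge0_integralZl//; last 2 first.
- by apply/mEFin; exact: mbl_expcount.
- by move=> mu _; rewrite lee_fin expR_ge0.
by rewrite (expcount_integral)// -EFinM ltry.
Qed.

Lemma lin_le_count g r b mu : mbl g ->
 (forall x, `|g x| <= b * \1_(cube r) x) -> `|lin g mu| <= b * fine (mu (cube r)).
Proof.
move=> mg gb; have mQ := @cube_mbl r.
have gr x : ~ cube r x -> g x = 0.
 move=> xr; have := gb x; rewrite indicE memNset// mulr0 => h.
 by apply/eqP; rewrite -normr_eq0 eq_le h normr_ge0.
have [N [X [_ XP]]] := config_enum mu (cube_bnd r).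
rewrite (lin_enum mQ XP)// -lin_indic// (lin_enum mQ XP) ?mulr_sumr//; last first.
 by move=> x xr; rewrite indicE memNset.
by apply: le_trans (ler_norm_sum _ _ _) _; apply: ler_sum.
Qed.

Lemma L2_lin g : tf g -> L2 P (lin g).
Proof.
move=> tg; have [r r0 [b b0 gb]] := tf_box tg.
have mQ := @cube_mbl r.
have sN : L2 P (fun mu : M => b * fine (mu (cube r))).
 by apply: L2Z; apply: L2_count => //; exact: cube_bnd.
have hb mu : `|lin g mu| <= `|b * fine (mu (cube r))|.
 apply: le_trans (lin_le_count _ (tf_mbl tg) gb) _; exact: ler_norm.
exact: (le_nrm (mbl_lin (tf_mbl tg)) sN hb).1.
Qed.

Lemma L2_cst (c : R) : L2 P (fun=> c).
Proof. by apply: (@L2_bounded _ _ _ P _ `|c|) => //; exact: measurable_cst. Qed.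

Lemma L2_integrable (f : M -> R) : L2 P f -> intg P f.
Proof.
move=> sf; have := L2_mul sf (L2_cst 1); apply: eq_integrable => // x _ /=.
by rewrite mulr1.
Qed.

(* Sealed, since unfolding it makes failing conversions very slow. *)
Fact mI_key : unit. Proof. exact: tt. Qed.

Definition mI : (E -> R) -> R := locked_with mI_key (fun g => \int[P]_mu lin g mu).

Lemma mIE g : mI g = \int[P]_mu lin g mu.
Proof. by rewrite /mI unlock. Qed.

Lemma mID f g : tf f -> tf g -> mI (fun x => f x + g x) = mI f + mI g.
Proof.
move=> tf_f tf_g; rewrite !mIE -RintegralD//; try exact/L2_integrable/L2_lin.
apply: eq_Rintegral => mu _; rewrite linD//; by [exact: tf_mbl|exact: tf_bsupp].
Qed.

Lemma mIZ c f : tf f -> mI (fun x => c * f x) = c * mI f.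
Proof.
move=> tf_f; rewrite !mIE -RintegralZl//; try exact/L2_integrable/L2_lin.
apply: eq_Rintegral => mu _; rewrite linZ//; by [exact: tf_mbl|exact: tf_bsupp].
Qed.

Lemma eq_mI f g : f =1 g -> mI f = mI g.
Proof. by move=> /funext ->. Qed.

Lemma mI0 : mI (fun=> 0) = 0.
Proof.
rewrite (@eq_mI _ (fun x => 0 * (fun=> 0) x)); last by move=> x; rewrite mul0r.
by rewrite (mIZ 0 tf0) mul0r.
Qed.

Lemma mI_sum (I : Type) (s : seq I) (F : I -> E -> R) : (forall i, tf (F i)) ->
 mI (fun x => \sum_(i <- s) F i x) = \sum_(i <- s) mI (F i).
Proof.
move=> tF; elim: s => [|i s ih].
 by rewrite big_nil (@eq_mI _ (fun=> 0)) ?mI0// => x; rewrite big_nil.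
rewrite big_cons -ih -(mID (tF i) (tf_sum s tF)).
by apply: eq_mI => x; rewrite big_cons.
Qed.

Lemma mI_ge0 f : (forall x, 0 <= f x) -> 0 <= mI f.
Proof. by move=> f0; rewrite mIE; apply: Rintegral_ge0 => mu _; exact: lin_ge0. Qed.

(** Identifies [mI] as integration against the intensity [rho dx], here obtained as the expectation
    of a linear statistic. *)
Lemma mI_indic (A : set E) : measurable A -> bnd A -> mI (\1_A) = mcount A.
Proof.
move=> mA bA; rewrite mIE /Rintegral -[RHS]/(fine (mcount A)%:E) -(count_integral mA bA).
congr fine; apply: eq_integral => mu _; rewrite lin_indic// fineK//.
by rewrite ge0_fin_numE//; exact: config_bnd_lty.
Qed.

Lemma lin_cvg (gn : nat -> E -> R) g (B : set E) mu : measurable B -> bnd B ->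
 (forall n, mbl (gn n)) -> mbl g ->
 (forall n x, ~ B x -> gn n x = 0) -> (forall x, ~ B x -> g x = 0) ->
 (forall x, gn n x @[n --> \oo] --> g x) -> lin (gn n) mu @[n --> \oo] --> lin g mu.
Proof.
move=> mB bB mgn mg gnB gB gng; have [N [X [_ XP]]] := config_enum mu bB.
rewrite (lin_enum mB XP)// (_ : (fun n => _) = fun n => \sum_(i < N) gn n (row i X)); last first.
 by apply/funext => n; rewrite (lin_enum mB XP (mgn n) (gnB n)).
by apply: cvg_sumr => i; exact: gng.
Qed.

Lemma dominated_Rintegral (fn : nat -> M -> R) (f G : M -> R) :
 (forall n, mbl (fn n)) -> L2 P G ->
 (forall n x, `|fn n x| <= G x) -> (forall x, fn n x @[n --> \oo] --> f x) ->
 (\int[P]_x fn n x) @[n --> \oo] --> (\int[P]_x f x : R).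
Proof.
move=> mfn sG fnG fnf; have [sf h] := L2_dominated mfn sG fnG fnf.
have sfn n : L2 P (fn n).
 by apply: (le_nrm (mfn n) sG _).1 => x; exact: le_trans (fnG n x) (ler_norm _).
have c1 : L2cvg P (fun=> (fun=> 1 : R)) (fun=> 1) by exact: L2cvg_cst.
have E1 (g : M -> R) : ip P g (fun=> 1) = \int[P]_x g x.
 by apply: eq_Rintegral => x _; rewrite mulr1.
have := cvg_ip sfn (fun=> L2_cst 1) sf (L2_cst 1) h c1.
by rewrite E1; under eq_fun do rewrite E1.
Qed.

(** The linear statistics are dominated by [b] times the count of a cube, which is
    square-integrable. *)
Lemma mI_cvg (gn : nat -> E -> R) g (r b : R) :
 (forall n, mbl (gn n)) ->
 (forall n x, `|gn n x| <= b * \1_(cube r) x) ->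
 (forall x, gn n x @[n --> \oo] --> g x) ->
 tf g /\ mI (gn n) @[n --> \oo] --> mI g.
Proof.
move=> mgn gnb gng; have mQ := @cube_mbl r.
have mg : mbl g by apply: (measurable_fun_cvg mgn) => x _; exact: gng.
have gb x : `|g x| <= b * \1_(cube r) x.
 have h : `|gn n x| @[n --> \oo] --> `|g x| by apply: cvg_norm; exact: gng.
 rewrite -(cvg_lim _ h)//; apply: limr_le; first exact: cvgP h.
 exact: nearW.
have out (f : E -> R) : (forall x, `|f x| <= b * \1_(cube r) x) -> forall x, ~ cube r x -> f x = 0.
 move=> fb x xr; have := fb x; rewrite indicE memNset// mulr0 => h.
 by apply/eqP; rewrite -normr_eq0 eq_le h normr_ge0.
have tg : tf g.
 split => //; last by exists r; exact: out.
 exists `|b| => x; apply: le_trans (gb x) _; rewrite indicE.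
 by case: (_ \in _); rewrite ?mulr1 ?mulr0// ler_norm.
split => //; rewrite mIE; under eq_fun do rewrite mIE.
have sN : L2 P (fun mu : M => b * fine (mu (cube r))).
 by apply: L2Z; apply: L2_count => //; exact: cube_bnd.
exact: (dominated_Rintegral (fn := fun n => lin (gn n))
 (fun n => mbl_lin (mgn n)) sN (fun n mu => lin_le_count mu (mgn n) (gnb n))
 (fun mu => lin_cvg mQ (cube_bnd r) mgn mg (fun n => out _ (gnb n)) (out _ gb) gng)).
Qed.

End test_functions.

(** * Exponentials of configurations: Laplace functional and Mecke's formula *)

Section exponentials.
Implicit Types f g h : E -> R.

(** The lower bound keeps [ln (1 + h)] bounded, so that the exponential is defined; the upper bound
    keeps its values below 1. *)
Definition adm h := tf h /\ exists2 c : R, 0 < c & forall x, c <= 1 + h x <= 1.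

(** The product of the factors [1 + h x] over the points of [mu]. Written through a linear statistic
    it makes sense on infinite configurations and is visibly measurable. *)
Definition ex h (mu : M) : R := expR (lin (fun x => ln (1 + h x)) mu).

Lemma adm_tf h : adm h -> tf h. Proof. by case. Qed.

Lemma adm_gt0 h x : adm h -> 0 < 1 + h x.
Proof. by move=> [_ [c c0 /(_ x)/andP[+ _]]]; exact: lt_le_trans. Qed.

Lemma adm_le1 h x : adm h -> 1 + h x <= 1.
Proof. by move=> [_ [c c0 /(_ x)/andP[]]]. Qed.

Lemma tf_ln h : adm h -> tf (fun x => ln (1 + h x)).
Proof.
move=> [[mh [b hb] [r hr]] [c c0 hc]]; split.
- apply: (mcomp (@measurable_ln R)).
 exact: measurable_funD.
- exists (- ln c) => x; have /andP[h1 h2] := hc x.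
 have h3 : ln (1 + h x) <= 0.
  by rewrite -ln1 ler_ln// ?posrE//; exact: lt_le_trans h1.
 rewrite ler0_norm// lerN2 ler_ln// posrE//; exact: lt_le_trans h1.
- by exists r => x /hr ->; rewrite addr0 ln1.
Qed.

Lemma ex_ge0 h mu : 0 <= ex h mu. Proof. exact: expR_ge0. Qed.

Lemma ex_le1 h mu : adm h -> ex h mu <= 1.
Proof.
move=> ah; rewrite -[leRHS](@expR0 R) ler_expR.
have -> : (0 : R) = lin (fun=> 0 : R) mu.
 by rewrite /lin /Rintegral integral0.
apply: le_lin; try by [apply: tf_mbl; exact: tf_ln|apply: tf_bsupp; exact: tf_ln|exists 0|exact: measurable_cst].
move=> x; rewrite -ln1 ler_ln ?posrE//; [exact: adm_le1|exact: adm_gt0].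
Qed.

Lemma mbl_ex h : adm h -> mbl (ex h).
Proof.
move=> ah; apply: (mcomp (@measurable_expR R)).
exact: mbl_lin (tf_mbl (tf_ln ah)).
Qed.

Lemma ex_enum mu (B : set E) N (X : mat N) h : measurable B ->
 restr mu B = sum_config X -> adm h -> (forall x, ~ B x -> h x = 0) ->
 ex h mu = \prod_(i < N) (1 + h (row i X)).
Proof.
move=> mB XP ah hB; rewrite /ex (lin_enum mB XP).
- rewrite expR_sum; apply: eq_bigr => i _.
 by rewrite lnK// posrE; exact: adm_gt0.
- exact: tf_mbl (tf_ln ah).
- by move=> x /hB ->; rewrite addr0 ln1.
Qed.

Lemma adm0 : adm (fun=> 0).
Proof. by split; [exact: tf0|exists 1 => // x; rewrite addr0 lexx]. Qed.

Lemma ex0 mu : ex (fun=> 0) mu = 1.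
Proof.
rewrite /ex /lin /Rintegral integral0_eq ?expR0// => x _.
by rewrite addr0 ln1.
Qed.

Definition pmul h h' : E -> R := fun x => h x + h' x + h x * h' x.

Lemma pmulE h h' x : 1 + pmul h h' x = (1 + h x) * (1 + h' x).
Proof. by rewrite /pmul; ring. Qed.

Lemma adm_pmul h h' : adm h -> adm h' -> adm (pmul h h').
Proof.
move=> ah ah'; split.
 by apply: tfD; [apply: tfD; exact: adm_tf|apply: tf_mul; exact: adm_tf].
have [[_ [c c0 hc]] [_ [c' c'0 hc']]] := (ah, ah').
exists (c * c') => [|x]; first exact: mulr_gt0.
have /andP[h1 h2] := hc x; have /andP[h3 h4] := hc' x.
rewrite pmulE ler_pM ?(ltW c0) ?(ltW c'0)//=.
have := adm_gt0 x ah; have := adm_gt0 x ah'; nra.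
Qed.

Lemma exM h h' mu : adm h -> adm h' -> ex h mu * ex h' mu = ex (pmul h h') mu.
Proof.
move=> ah ah'; rewrite /ex -expRD; congr expR.
rewrite -linD; try by [apply: tf_mbl; exact: tf_ln|apply: tf_bsupp; exact: tf_ln].
congr lin; apply/funext => x; rewrite pmulE lnM// posrE; exact: adm_gt0.
Qed.

Lemma adm_scale h (phi : E -> R) : adm h -> mbl phi ->
 (forall x, 0 <= phi x <= 1) -> adm (fun x => phi x * h x).
Proof.
move=> [th [c c0 hc]] mphi phi01; split.
 rewrite (_ : (fun x => _) = fun x => h x * phi x); last by apply/funext => x; rewrite mulrC.
 apply: tfM => //; exists 1 => x; have /andP[h1 h2] := phi01 x.
 by rewrite ger0_norm.
exists c => // x; have /andP[h1 h2] := phi01 x; have /andP[h3 h4] := hc x.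
by apply/andP; split; nra.
Qed.

Lemma L2_ex h : adm h -> L2 P (ex h).
Proof.
move=> ah; apply: (@L2_bounded _ _ _ P _ 1); first exact: mbl_ex.
by move=> mu; rewrite ger0_norm ?ex_ge0// ex_le1.
Qed.

(** The level sets of [s] inside the cube are disjoint, hence their counts are independent and
    [count_indep] applies. *)
Lemma laplace_simple (s : {nnsfun E >-> R}) (r : R) : (forall x, ~ cube r x -> s x = 0) ->
 \int[P]_mu expR (- lin s mu) = expR (mI (fun x => expR (- s x) - 1)).
Proof.
move=> sr; pose ys : seq R := fset_set (range s).
have ysP x : s x \in ys.
 by rewrite /ys in_fset_set; [apply: mem_set; exists x|exact: fimfunP].
pose n := size ys; pose y (i : 'I_n) := nth 0 ys i.
pose A (i : 'I_n) := s @^-1` [set y i] `&` cube r.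
have mA i : measurable (A i).
 by apply: measurableI; [exact: measurable_funPTI|exact: cube_mbl].
have bA i : bnd (A i) by exists r => x [].
have uys : uniq ys by exact: fset_uniq.
have tA : trivIset setT A.
 move=> i j _ _ [x [[/= si _] [sj _]]]; apply/val_inj/eqP.
 by rewrite -(nth_uniq 0 (ltn_ord i) (ltn_ord j) uys) -/(y i) -/(y j) -si -sj.
have sumE (phi : R -> R) x : phi 0 = 0 -> phi (s x) = \sum_(i < n) phi (y i) * \1_(A i) x.
 move=> phi0; case: (pselect (cube r x)) => xr; last first.
  rewrite sr// phi0 big1// => i _; rewrite indicE memNset ?mulr0//.
  by case.
 have iP : (index (s x) ys < n)%N by rewrite index_mem.
 rewrite (bigD1 (Ordinal iP))//= big1 ?addr0.
  rewrite indicE mem_set ?mulr1; first by rewrite /y/= nth_index.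
  by split => //=; rewrite /y/= nth_index.
 move=> i ij; rewrite indicE memNset ?mulr0// => -[/= si _]; move/eqP: ij; apply.
 by apply/val_inj; rewrite /= si index_uniq.
have tA' i (c : R) : tf (fun x => c * \1_(A i) x) by apply: tfZ; exact: tf_indic.
have linE mu : lin s mu = \sum_(i < n) y i * fine (mu (A i)).
 rewrite (_ : lin s mu = lin (fun x => \sum_(i < n) y i * \1_(A i) x) mu); last first.
  by congr lin; apply/funext => x; rewrite (sumE id).
 have mQ := @cube_mbl r.
 have [N [X [_ XP]]] := config_enum mu (cube_bnd r).
 rewrite (lin_enum mQ XP); last 2 first.
 - by apply: tf_mbl; apply: tf_sum => i.
 - by move=> x xr; rewrite big1// => i _; rewrite indicE memNset ?mulr0// => -[].
 rewrite exchange_big; apply: eq_bigr => i _; rewrite -mulr_sumr; congr (_ * _).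
 rewrite -lin_indic// (lin_enum mQ XP)//.
 by move=> x xr; rewrite indicE memNset// => -[].
transitivity (\prod_(i < n) expR (- (mcount (A i) * (1 - expR (- y i))))).
 have := count_indep (fun i => - y i) mA bA tA.
 move=> /(congr1 fine)/= <-; rewrite /Rintegral; congr fine; apply: eq_integral => mu _; congr (_%:E).
 rewrite linE -sumrN expR_sum; apply: eq_bigr => i _.
 by rewrite /expcount mulNr.
rewrite -expR_sum; congr expR.
rewrite (@eq_mI _ (fun x => \sum_(i < n) (expR (- y i) - 1) * \1_(A i) x)); last first.
 by move=> x; rewrite -(sumE (fun z => expR (- z) - 1))// oppr0 expR0 subrr.
rewrite (mI_sum)//; apply: eq_bigr => i _.
rewrite (mIZ _ (tf_indic (mA i) (bA i))) (mI_indic)//; ring.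
Qed.

(** [- ln (1 + h)] is a nonnegative function, increasing limit of simple ones; both sides pass to
    the limit by domination. *)
Lemma laplace h : adm h -> \int[P]_mu ex h mu = expR (mI h).
Proof.
move=> ah; pose l x := - ln (1 + h x).
have tl : tf l by move: (tfZ (-1) (tf_ln ah)); under eq_fun do rewrite mulN1r.
have l0 x : 0 <= l x.
 rewrite oppr_ge0 -ln1 ler_ln ?posrE//; [exact: adm_le1|exact: adm_gt0].
have mlE : mbl (EFin \o l) by apply/mEFin; exact: tf_mbl.
pose s := nnsfun_approx measurableT mlE.
have sc x : s n x @[n --> \oo] --> l x.
 have h1 : (EFin \o s ^~ x) n @[n --> \oo] --> (l x)%:E.
  by apply: (@cvg_nnsfun_approx _ _ _ setT measurableT (EFin \o l)) => // y _; rewrite lee_fin.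
 by move/fine_cvg: h1.
have sl n x : s n x <= l x.
 have nd : nondecreasing_seq (s ^~ x).
  by move=> m k mk; have /lefP := nd_nnsfun_approx measurableT mlE mk; exact.
 have := nondecreasing_cvgn_le nd (cvgP _ (sc x)) n.
 by rewrite (cvg_lim _ (sc x)).
have [r r0 [b b0 lb]] := tf_box tl.
have sr n x : ~ cube r x -> s n x = 0.
 move=> xr; apply/eqP; rewrite eq_le fun_ge0 andbT; apply: le_trans (sl n x) _.
 by have := lb x; rewrite indicE memNset// mulr0 ger0_norm.
have L1 : \int[P]_mu expR (- lin (s n) mu) @[n --> \oo] --> \int[P]_mu ex h mu.
 have := @dominated_Rintegral (fun n mu => expR (- lin (s n) mu)) (ex h) (fun=> 1).
 apply.
 - move=> n; apply: (mcomp (@measurable_expR R)); apply: mcomp => //.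
  exact: mbl_lin.
 - exact: L2_cst.
 - by move=> n mu; rewrite ger0_norm ?expR_ge0// -[leRHS](@expR0 R) ler_expR oppr_le0 lin_ge0.
 - move=> mu.
  have h1 : - lin (s n) mu @[n --> \oo] --> - lin l mu.
   apply: cvgN; apply: (lin_cvg (cube_mbl r) (cube_bnd r)) => //.
    exact: tf_mbl.
   by move=> x xr; have := lb x; rewrite indicE memNset// mulr0 normr_le0 => /eqP.
  rewrite /ex (_ : lin (fun x => ln (1 + h x)) mu = - lin l mu).
   exact: (cvg_comp _ _ h1 (@continuous_expR R _)).
  rewrite -mulN1r -linZ; [|exact: tf_mbl|exact: tf_bsupp].
  by congr lin; apply/funext => x; rewrite mulN1r opprK.
have [_ lim2] : tf h /\ mI (fun x => expR (- s n x) - 1) @[n --> \oo] --> mI h.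
 apply: (mI_cvg (gn := fun n x => expR (- s n x) - 1) (r := r) (b := b)).
 - move=> n; apply: mfunB => //; apply: (mcomp (@measurable_expR R)).
  exact: mcomp.
 - move=> n x; have := lb x; rewrite ger0_norm// => lbx.
  have s0 : 0 <= s n x by exact: fun_ge0.
  rewrite distrC ger0_norm ?subr_ge0 -?[leRHS](@expR0 R) ?ler_expR ?oppr_le0//.
  have := expR_ge1Dx (- s n x); have := sl n x; lra.
 - move=> x; rewrite (_ : h x = expR (- l x) - 1); last first.
   by rewrite opprK lnK ?posrE ?adm_gt0// addrAC subrr add0r.
  apply: cvgB; last exact: cvg_cst.
  exact: (cvg_comp _ _ (cvgN (sc x)) (@continuous_expR R _)).
have L3 : expR (mI (fun x => expR (- s n x) - 1)) @[n --> \oo] --> expR (mI h).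
 exact: (cvg_comp _ _ lim2 (@continuous_expR R _)).
apply: (cvg_unique _ L1) => //.
rewrite (_ : (fun n => _) = fun n => expR (mI (fun x => expR (- s n x) - 1)))//.
by apply/funext => n; exact: laplace_simple (sr n).
Qed.

Lemma ip_ex h h' : adm h -> adm h' -> ip P (ex h) (ex h') = expR (mI (pmul h h')).
Proof.
move=> ah ah'; rewrite -laplace; last exact: adm_pmul.
by apply: eq_Rintegral => mu _; rewrite exM.
Qed.

(** Differentiates [laplace] at [l = 0] along the factors [(1 + h) exp (- l g)], whose exponential
    is that of [h] times [exp (- l lin g)]. The functions [hn] are these factors minus 1 for
    [l = 1/(n+1)]. *)
Lemma mecke_ge0 g h : tf g -> (forall x, 0 <= g x) -> adm h ->
 \int[P]_mu (lin g mu * ex h mu) = mI (fun x => g x * (1 + h x)) * expR (mI h).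
Proof.
move=> tg g0 ah; pose l n : R := n.+1%:R^-1.
have l0 n : 0 < l n by rewrite invr_gt0.
have lc : l n @[n --> \oo] --> 0 by exact: cvg_harmonic.
have [mg [bg bgP] _] := tg.
have [r r0 [b b0 gb]] := tf_box tg.
pose hn n x := (1 + h x) * expR (- (l n * g x)) - 1.
have e1 n x : expR (- (l n * g x)) <= 1.
 by rewrite -[leRHS](@expR0 R) ler_expR oppr_le0 mulr_ge0// ltW.
pose qn n x := (1 - expR (- (l n * g x))) / l n.
have mqn n : mbl (qn n).
 apply: mfunM => //; apply: mfunB => //.
 apply: (mcomp (@measurable_expR R)); apply: mcomp => //.
 exact: mfunM.
have qn0 n x : 0 <= qn n x by rewrite divr_ge0 ?subr_ge0// ltW.
have qng n x : qn n x <= g x.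
 rewrite ler_pdivrMr// (mulrC (g x)).
 have /expRN_ge/andP[_] : 0 <= l n * g x by rewrite mulr_ge0// ltW.
 exact.
have tqn n : tf (qn n).
 split => //; last by case: tg => _ _ [s sP]; exists s => x /sP; rewrite /qn => ->; rewrite mulr0 oppr0 expR0 subrr mul0r.
 by exists bg => x; rewrite ger0_norm//; apply: le_trans (qng n x) (le_trans (ler_norm _) (bgP x)).
have hnE n x : hn n x = h x - l n * (qn n x * (1 + h x)).
 by rewrite /hn /qn; field; apply: lt0r_neq0.
have [mh [bh bhP] _] := ah.1.
have m1h : mbl (fun x => 1 + h x) by exact: measurable_funD.
have b1h : exists b, forall x, `|1 + h x| <= b.
 by exists 1 => x; rewrite ger0_norm ?adm_le1// ltW// adm_gt0.
have thn n : tf (hn n).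
 rewrite (_ : hn n = fun x => h x + - l n * (qn n x * (1 + h x))); last first.
  by apply/funext => x; rewrite hnE mulNr.
 exact: tfD ah.1 (tfZ (- l n) (tfM (tqn n) m1h b1h)).
have ahn n : adm (hn n).
 split => //; have [_ [c c0 hc]] := ah.
 exists (c * expR (- (l n * bg))) => [|x]; first by rewrite mulr_gt0// expR_gt0.
 have /andP[h1 h2] := hc x.
 rewrite /hn addrC subrK; apply/andP; split.
  apply: ler_pM => //; [exact: ltW|].
  rewrite ler_expR lerN2 ler_wpM2l ?(ltW (l0 n))//.
  exact: le_trans (ler_norm _) (bgP x).
 have := adm_gt0 x ah; have := expR_ge0 (- (l n * g x)); have := e1 n x; nra.
have exn n mu : ex (hn n) mu = ex h mu * expR (- (l n * lin g mu)).
 rewrite /ex -expRD -mulNr -linZ; [|exact: tf_mbl|exact: tf_bsupp].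
 have t2 := tfZ (- l n) tg.
 rewrite -linD; [|exact: tf_mbl (tf_ln ah)|exact: tf_mbl t2|exact: tf_bsupp (tf_ln ah)|exact: tf_bsupp t2].
 rewrite (_ : (fun x => ln (1 + hn n x)) = fun x => ln (1 + h x) + - l n * g x)//.
 apply/funext => x; have h1 := adm_gt0 x ah.
 by rewrite /hn addrC subrK lnM ?posrE ?expR_gt0// expRK mulNr.
pose Qn n := mI (fun x => qn n x * (1 + h x)).
have mIhn n : mI (hn n) = mI h - l n * Qn n.
 rewrite -mulNr -(mIZ _ (tfM (tqn n) m1h b1h)).
 rewrite -(mID ah.1 (tfZ _ (tfM (tqn n) m1h b1h))).
 by apply: eq_mI => x; rewrite hnE mulNr.
have L1 : \int[P]_mu (ex h mu * ((1 - expR (- (l n * lin g mu))) / l n)) @[n --> \oo] -->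
  \int[P]_mu (lin g mu * ex h mu).
 apply: (@dominated_Rintegral
  (fun n mu => ex h mu * ((1 - expR (- (l n * lin g mu))) / l n)) _ (lin g)).
 - move=> n; apply: mfunM; first exact: mbl_ex.
  apply: mfunM => //; apply: mfunB => //.
  apply: (mcomp (@measurable_expR R)); apply: mcomp => //.
  by apply: mfunM => //; exact: mbl_lin.
 - exact: (L2_lin tg).
 - move=> n mu; have lg0 : 0 <= lin g mu by exact: lin_ge0.
  have /expRN_ge/andP[_ h2] : 0 <= l n * lin g mu by rewrite mulr_ge0// ltW.
  have h3 : 0 <= (1 - expR (- (l n * lin g mu))) / l n <= lin g mu.
   rewrite divr_ge0 ?subr_ge0 ?(ltW (l0 n))//=; last first.
    by rewrite -[leRHS](@expR0 R) ler_expR oppr_le0 mulr_ge0// ltW.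
   by rewrite ler_pdivrMr// (mulrC (lin g mu)).
  have /andP[h4 h5] := h3; rewrite ger0_norm; last by apply: mulr_ge0 => //; exact: ex_ge0.
  have := ex_le1 mu ah; have := ex_ge0 h mu; nra.
 - move=> mu; rewrite mulrC; apply: cvgM; first exact: cvg_cst.
  apply: cvg_difference_quotient => //; last exact: cvg_cst.
  by move=> _; exact: lin_ge0.
have [_ lim2] : tf (fun x => g x * (1 + h x)) /\
  mI (fun x => qn n x * (1 + h x)) @[n --> \oo] --> mI (fun x => g x * (1 + h x)).
 apply: (mI_cvg (gn := fun n x => qn n x * (1 + h x)) (r := r) (b := b)).
 - by move=> n; exact: mfunM.
 - move=> n x; have := gb x; rewrite ger0_norm// => gbx.
  have h1 := adm_gt0 x ah; have h2 := adm_le1 x ah; have h3 := qn0 n x; have h4 := qng n x.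
  have h5 : 0 <= qn n x * (1 + h x) by apply: mulr_ge0 => //; exact: ltW.
  by rewrite ger0_norm//; apply: le_trans gbx; nra.
 - move=> x; apply: cvgM; last exact: cvg_cst.
  by apply: cvg_difference_quotient => //; exact: cvg_cst.
have Qn0 n : 0 <= Qn n by apply: mI_ge0 => x; rewrite mulr_ge0// ltW// adm_gt0.
have L3 : (1 - expR (- (l n * Qn n))) / l n * expR (mI h) @[n --> \oo] -->
  mI (fun x => g x * (1 + h x)) * expR (mI h).
 by apply: cvgM; [exact: cvg_difference_quotient|exact: cvg_cst].
apply: (cvg_unique _ L1) => //; apply: cvg_trans L3; apply: near_eq_cvg; apply: nearW => n.
have E1 : \int[P]_mu (ex h mu * ((1 - expR (- (l n * lin g mu))) / l n)) =
  \int[P]_mu ((l n)^-1 * (ex h mu - ex (hn n) mu)).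
 by apply: eq_Rintegral => mu _; rewrite exn; ring.
rewrite E1 RintegralZl//; last exact/L2_integrable/L2B/L2_ex/ahn/L2_ex.
rewrite RintegralB//; try exact/L2_integrable/L2_ex.
rewrite !laplace// mIhn expRD; ring.
Qed.

(** Linearity from the nonnegative case, with [g = |g| - (|g| - g)]. *)
Lemma mecke g h : tf g -> adm h ->
 \int[P]_mu (lin g mu * ex h mu) = mI (fun x => g x * (1 + h x)) * expR (mI h).
Proof.
move=> tg ah; have [mg [bg bgP] [r rP]] := tg.
have tn : tf (fun x => `|g x|).
 split; first by apply: mcomp => //; exact: normr_measurable.
  by exists bg => x; rewrite normr_id.
 by exists r => x /rP ->; rewrite normr0.
have tB : tf (fun x => `|g x| - g x).
 by have := tfD tn (tfZ (-1) tg); under eq_fun do rewrite mulN1r.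
have m1h : mbl (fun x => 1 + h x) by apply: measurable_funD => //; exact: tf_mbl ah.1.
have b1h : exists b, forall x, `|1 + h x| <= b.
 by exists 1 => x; rewrite ger0_norm ?adm_le1// ltW// adm_gt0.
have B0 x : 0 <= `|g x| - g x by rewrite subr_ge0 ler_norm.
have E1 := mecke_ge0 tn (fun x => normr_ge0 _) ah; have E2 := mecke_ge0 tB B0 ah.
have linB mu : lin g mu = lin (fun x => `|g x|) mu - lin (fun x => `|g x| - g x) mu.
 rewrite (_ : lin g mu = lin (fun x => `|g x| + (-1) * (`|g x| - g x)) mu); last first.
  by congr lin; apply/funext => x; ring.
 have t2 := tfZ (-1) tB.
 rewrite linD; [|exact: tf_mbl tn|exact: tf_mbl t2|exact: tf_bsupp tn|exact: tf_bsupp t2].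
 rewrite linZ; [|exact: tf_mbl tB|exact: tf_bsupp tB]; ring.
have s1 f : tf f -> intg P (fun mu => lin f mu * ex h mu).
 by move=> tf_f; apply: L2_mul; [exact: (L2_lin tf_f)|exact: L2_ex].
rewrite (_ : (\int[P]_mu (lin g mu * ex h mu)) =
  \int[P]_mu (lin (fun x => `|g x|) mu * ex h mu) -
  \int[P]_mu (lin (fun x => `|g x| - g x) mu * ex h mu)); last first.
 rewrite -RintegralB//; [|exact: s1|exact: s1].
 by apply: eq_Rintegral => mu _; rewrite linB mulrBl.
rewrite E1 E2 -mulrBl; congr (_ * _).
have t3 := tfM tn m1h b1h; have t4 := tfZ (-1) (tfM tB m1h b1h).
rewrite -mulN1r -(mIZ _ (tfM tB m1h b1h)) -(mID t3 t4).
by apply: eq_mI => x; ring.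
Qed.

End exponentials.

(** * Density of exponentials in L^2 and independence of disjoint regions *)

Section span.
Variables (I : Type) (h : I -> E -> R).
Implicit Types s t : seq (R * I).

Definition spn s (mu : M) : R := \sum_(a <- s) a.1 * ex (h a.2) mu.

Lemma spn_cat s t mu : spn (s ++ t) mu = spn s mu + spn t mu.
Proof. by rewrite /spn big_cat. Qed.

Definition scl (c : R) s : seq (R * I) := [seq (c * a.1, a.2) | a <- s].

Lemma spn_scl c s mu : spn (scl c s) mu = c * spn s mu.
Proof.
by rewrite /spn big_map mulr_sumr; apply: eq_bigr => a _ /=; rewrite mulrA.
Qed.

End span.

Section density.
Variable U : set E.

Definition expU := {h : E -> R | adm h /\ forall x, ~ U x -> h x = 0}.

Definition valU (i : expU) : E -> R := proj1_sig i.

Lemma admU i : adm (valU i). Proof. by case: i => h []. Qed.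

Lemma offU i x : ~ U x -> valU i x = 0. Proof. by case: i => h [? /=]; exact. Qed.

Let sp := spn valU.

Lemma L2_spn s : L2 P (sp s).
Proof.
by apply: L2_sum => a; apply: L2Z; apply: L2_ex; exact: admU.
Qed.

Lemma spn_bounded s : exists b, forall mu, `|sp s mu| <= b.
Proof.
exists (\sum_(a <- s) `|a.1|) => mu; apply: le_trans (ler_norm_sum _ _ _) _.
apply: ler_sum => a _; rewrite normrM (ger0_norm (ex_ge0 _ _)) ler_piMr//.
exact: ex_le1 (admU _).
Qed.

Lemma adm_pmulU (i j : expU) :
 adm (pmul (valU i) (valU j)) /\ forall x, ~ U x -> pmul (valU i) (valU j) x = 0.
Proof.
split; first by apply: adm_pmul; exact: admU.
by move=> x Ux; rewrite /pmul !offU// mul0r !addr0.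
Qed.

Definition mulU (i j : expU) : expU := exist _ _ (adm_pmulU i j).

Lemma spnM s t : exists w, forall mu, sp s mu * sp t mu = sp w mu.
Proof.
exists [seq (a.1 * b.1, mulU a.2 b.2) | a <- s, b <- t] => mu.
rewrite /sp /spn big_allpairs_dep mulr_suml; apply: eq_bigr => a _.
rewrite mulr_sumr; apply: eq_bigr => b _ /=.
by rewrite mulrACA (exM _ (admU _) (admU _)).
Qed.

Definition oneU : expU := exist _ _ (conj adm0 (fun x (_ : ~ U x) => erefl)).

Lemma spn1 c mu : sp [:: (c, oneU)] mu = c.
Proof. by rewrite /sp /spn big_seq1 ex0 mulr1. Qed.

Lemma spnX s k : exists w, forall mu, sp s mu ^+ k = sp w mu.
Proof.
elim: k => [|k [w wE]]; first by exists [:: (1, oneU)] => mu; rewrite spn1.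
by have [w' w'E] := spnM s w; exists w' => mu; rewrite exprS wE w'E.
Qed.

Definition app (f : M -> R) := L2 P f /\
 forall e, 0 < e -> exists s, nrm P (fun mu => f mu - sp s mu) < e.

Lemma app_spn s : app (sp s).
Proof.
split => [|e e0]; first exact: L2_spn.
exists s; rewrite (_ : (fun mu => _) = fun=> 0) ?nrm0//.
by apply/funext => mu; rewrite subrr.
Qed.

Lemma app_lim (fn : nat -> M -> R) f : (forall n, app (fn n)) -> L2 P f ->
 L2cvg P fn f -> app f.
Proof.
move=> afn sf /L2cvgP fnf; split => // e e0.
have e20 : 0 < e / 2 by rewrite divr_gt0.
have [N /(_ _ (leqnn N)) NP] := fnf _ e20.
have [sN /(_ _ e20)[s sP]] := afn N; exists s.
apply: le_lt_trans (nrm_distD sf sN (L2_spn s)) _.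
by rewrite nrm_distC//; have := ltrD NP sP; rewrite -splitr.
Qed.

Lemma appD f g : app f -> app g -> app (fun mu => f mu + g mu).
Proof.
move=> [sf af] [sg ag]; split => [|e e0]; first exact: L2D.
have e20 : 0 < e / 2 by rewrite divr_gt0.
have [[s sP] [t tP]] := (af _ e20, ag _ e20); exists (s ++ t).
have -> : (fun mu => f mu + g mu - sp (s ++ t) mu) =
  fun mu => (f mu - sp s mu) + (g mu - sp t mu).
 by apply/funext => mu; rewrite /sp spn_cat; ring.
apply: le_lt_trans (nrmD (L2B sf (L2_spn s)) (L2B sg (L2_spn t))) _.
by have := ltrD sP tP; rewrite -splitr.
Qed.

(** A product is not controlled by L^2 distances alone. First [t] is chosen close to [g]; its sup
    bound [c'] then dictates how close [s] must be to [f]. *)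
Lemma app_bounded_mul f g b : app f -> app g -> (forall mu, `|f mu| <= b) ->
 mbl g -> (exists c, forall mu, `|g mu| <= c) ->
 app (fun mu => f mu * g mu).
Proof.
move=> [sf af] [sg ag] fb mg [c gc].
have sfg : L2 P (fun mu => f mu * g mu).
 apply: (@L2_bounded _ _ _ P _ (b * c)).
  by apply: mfunM => //; exact: L2_mbl sf.
 by move=> mu; rewrite normrM ler_pM.
have b0 : 0 <= b by apply: le_trans (fb point).
split=> // e e0.
have e1 : 0 < e / (b + 1) / 2 by rewrite !divr_gt0// ltr_pwDr.
have [t tP] := ag _ e1; have [c' tc] := spn_bounded t.
have c'0 : 0 <= c' by apply: le_trans (tc point).
have e2 : 0 < e / (c' + 1) / 2 by rewrite !divr_gt0// ltr_pwDr.
have [s sP] := af _ e2; have [w wE] := spnM s t; exists w.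
have st := L2_spn t; have ss := L2_spn s.
have -> : (fun mu => f mu * g mu - sp w mu) =
  fun mu => f mu * (g mu - sp t mu) + sp t mu * (f mu - sp s mu).
 by apply/funext => mu; rewrite -wE; ring.
have bmul (k : R) (p q : M -> R) : mbl p -> L2 P q ->
  (forall mu, `|p mu| <= k) ->
  L2 P (fun mu => p mu * q mu) /\ nrm P (fun mu => p mu * q mu) <= k * nrm P q.
 move=> mp sq pk; have k0 : 0 <= k by apply: le_trans (pk point).
 have [||h1 h2] := le_nrm (f := fun mu => p mu * q mu) (g := fun mu => k * q mu) _ (L2Z k sq).
 - by apply: mfunM => //; exact: L2_mbl sq.
 - by move=> mu; rewrite !normrM (ger0_norm k0) ler_wpM2r.
 by split => //; rewrite -(ger0_norm k0) -nrmZ.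
have [h1 h2] := bmul b f _ (L2_mbl sf) (L2B sg st) fb.
have [h3 h4] := bmul c' _ _ (L2_mbl st) (L2B sf ss) tc.
apply: le_lt_trans (nrmD h1 h3) _.
move: (nrm P (fun mu => g mu - _)) (nrm P (fun mu => f mu - _)) tP sP h2 h4 => x y xP yP h2 h4.
have h5 : b * x <= e / 2.
 apply: le_trans (_ : b * (e / (b + 1) / 2) <= _); first by rewrite ler_wpM2l// ltW.
 rewrite mulrA ler_pM2r// mulrCA ler_piMr ?(ltW e0)// ler_pdivrMr ?ltr_pwDr// mul1r.
 by rewrite lerDl.
have h6 : c' * y < e / 2.
 apply: le_lt_trans (_ : c' * (e / (c' + 1) / 2) < _); first by rewrite ler_wpM2l// ltW.
 rewrite mulrA ltr_pM2r// mulrCA gtr_pMr// ltr_pdivrMr ?ltr_pwDr// mul1r.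
 by rewrite ltrDl.
lra.
Qed.

Definition appset (A : set M) := measurable A /\ app (\1_A).

Lemma indic_bound (A : set M) mu : `|\1_A mu : R| <= 1.
Proof. by rewrite indicE; case: (_ \in _); rewrite ?normr1 ?normr0. Qed.

Lemma app_dominated (fn : nat -> M -> R) f g : (forall n, app (fn n)) -> L2 P g ->
 (forall n mu, `|fn n mu| <= g mu) -> (forall mu, fn n mu @[n --> \oo] --> f mu) -> app f.
Proof.
move=> afn sg fng fnf.
have [] := L2_dominated (fun n => L2_mbl (afn n).1) sg fng fnf.
exact: app_lim.
Qed.

Lemma appset0 : appset set0.
Proof.
split => //; rewrite (_ : \1_set0 = sp [::]); first exact: app_spn.
by apply/funext => mu; rewrite indic0 /sp /spn big_nil.
Qed.

Lemma appsetC A : appset A -> appset (~` A).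
Proof.
move=> [mA aA]; split; first exact: measurableC.
rewrite (_ : \1_(~` A) = fun mu => sp [:: (1, oneU)] mu + (sp [:: (-1, oneU)] mu * \1_A mu)).
 apply: appD; first exact: app_spn.
 apply: (@app_bounded_mul _ _ 1) => //; first exact: app_spn.
 - by move=> mu; rewrite spn1 normrN1.
 - by exists 1; exact: indic_bound.
apply/funext => mu; rewrite !spn1 !indicE in_setC.
by case: (mu \in A) => /=; ring.
Qed.

Lemma appsetI A B : appset A -> appset B -> appset (A `&` B).
Proof.
move=> [mA aA] [mB aB]; split; first exact: measurableI.
rewrite indicI; apply: (@app_bounded_mul _ _ 1) => //; first exact: indic_bound.
by exists 1; exact: indic_bound.
Qed.

Lemma appsetU A B : appset A -> appset B -> appset (A `|` B).
Proof.
by move=> aA aB; rewrite -[A `|` B]setCK setCU; apply/appsetC/appsetI; exact: appsetC.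
Qed.

Lemma appset_bigcup (F : nat -> set M) : (forall n, appset (F n)) -> appset (\bigcup_n F n).
Proof.
move=> aF; split; first by apply: bigcup_measurable => n _; exact: (aF n).1.
pose G n := \big[setU/set0]_(i < n) F i.
have aG n : appset (G n).
 by rewrite /G; elim/big_ind: _ => //; [exact: appset0|exact: appsetU].
apply: (@app_dominated (fun n => \1_(G n)) _ (fun=> 1)).
- by move=> n; exact: (aG n).2.
- exact: L2_cst.
- by move=> n mu; exact: indic_bound.
move=> mu; rewrite indicE; case: (boolP (_ \in _)) => [/set_mem[k _ Fk]|Fmu].
 apply: cvg_near_cst; exists k.+1 => // n /= kn; rewrite indicE mem_set//.
 by rewrite /G -bigcup_mkord; exists k.
apply: cvg_near_cst; apply: nearW => n; rewrite indicE memNset//.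
rewrite /G -bigcup_mkord => -[k _ Fk]; move/negP: Fmu; apply; apply: mem_set.
by exists k.
Qed.

Lemma sigma_algebra_appset : sigma_algebra setT appset.
Proof.
split; first exact: appset0.
 by move=> A aA; rewrite setTD; exact: appsetC.
exact: appset_bigcup.
Qed.

(** With the factor 1/2 on [V] the exponential is [2^-n], where [n] is the count, and high powers of
    [1 - (2^-n - 2^-k)^2] converge to the indicator of [n = k]. *)
Lemma app_count (V : set E) (k : nat) : measurable V -> bnd V -> V `<=` U ->
 appset [set mu | mu V = k%:R%:E].
Proof.
move=> mV bV VU; pose A : set M := [set mu : M | mu V = k%:R%:E].
suff aA : app (\1_A) by split; first exact: mbl_count_eq.
pose q : E -> R := fun x => - 2^-1 * \1_V x.
have aq : adm q.
 split; first by apply: tfZ; exact: tf_indic.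
 exists 2^-1 => [|x]; first by rewrite invr_gt0.
 rewrite /q indicE; case: (_ \in _); rewrite ?mulr1 ?mulr0; apply/andP; split; lra.
have qU x : ~ U x -> q x = 0.
 by move=> Ux; rewrite /q indicE memNset ?mulr0// => /VU.
pose i : expU := exist _ q (conj aq qU).
have qE (mu : M) (n : nat) : mu V = n%:R%:E -> ex q mu = 2^-1 ^+ n.
 move=> muV; rewrite /ex (_ : (fun x => ln (1 + q x)) = fun x => ln (2^-1) * \1_V x).
  rewrite linZ; [|exact: mindic|by apply: tf_bsupp; exact: tf_indic].
  by rewrite lin_indic// muV /= mulrC expRM_natl lnK// posrE invr_gt0.
 apply/funext => x; rewrite /q indicE; case: (_ \in _).
  by rewrite !mulr1; congr ln; lra.
 by rewrite !mulr0 addr0 ln1.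
pose s : seq (R * expU) := [:: (1, i); (- 2^-1 ^+ k, oneU)].
have sE mu : sp s mu = ex q mu - 2^-1 ^+ k.
 by rewrite /sp /spn !big_cons big_nil /= ex0 mul1r addr0 mulr1.
have [s2 s2E] := spnX s 2.
pose t : seq (R * expU) := (1, oneU) :: scl (-1) s2.
have tE mu : sp t mu = 1 - (ex q mu - 2^-1 ^+ k) ^+ 2.
 by rewrite -sE s2E /sp /spn big_cons /= ex0 -/(spn _ _ _) spn_scl mulN1r mulr1.
have h01 (n : nat) : 0 < (2^-1 : R) ^+ n <= 1.
 by rewrite exprn_gt0 ?invr_gt0//= exprn_ile1 ?invr_ge0// invf_le1// ler1n.
apply: (@app_dominated (fun n mu => sp t mu ^+ n) _ (fun=> 1)).
- by move=> n; have [w wE] := spnX t n; under eq_fun do rewrite wE; exact: app_spn.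
- exact: L2_cst.
- move=> n mu; rewrite tE; have [m mE] := config_nat mu bV; rewrite (qE _ _ mE).
 rewrite normrX exprn_ile1// ger0_norm.
  by have := sqr_ge0 (2^-1 ^+ m - 2^-1 ^+ k : R); lra.
 have /andP[h1 h2] := h01 m; have /andP[h3 h4] := h01 k; nra.
move=> mu; rewrite indicE; have [m mE] := config_nat mu bV.
have -> : (mu \in A) = (m == k).
 apply/idP/eqP => [/set_mem|mk]; last by apply: mem_set; rewrite /A /= mE mk.
 by rewrite /A /= mE => -[/eqP]; rewrite eqr_nat => /eqP.
under eq_fun do rewrite tE (qE _ _ mE).
have [->|mk] := eqVneq m k.
 rewrite subrr expr0n subr0; under eq_fun do rewrite expr1n; exact: cvg_cst.
apply: cvg_expr; have /andP[h1 h2] := h01 m; have /andP[h3 h4] := h01 k.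
have h5 : 2^-1 ^+ m - 2^-1 ^+ k != 0 :> R.
 rewrite subr_eq0; apply: contra mk => /eqP/(congr1 (@GRing.inv R)).
 rewrite -!exprVn !invrK => /eqP; rewrite -!natrX eqr_nat => /eqP.
 by move/expnI => ->.
have h6 : 0 < (2^-1 ^+ m - 2^-1 ^+ k : R) ^+ 2 by rewrite exprn_even_gt0.
by rewrite ger0_norm; [lra|nra].
Qed.

(** For an unbounded generator [V] the count is the limit of the counts in bounded parts, and
    measurability with respect to the sigma-algebra [appset] passes to limits. *)
Lemma sigF_appset A : sigF U A -> appset A.
Proof.
apply: smallest_sub; first exact: sigma_algebra_appset.
move=> _ [V [B [mV VU mB ->]]].
pose T := g_sigma_algebraType appset.
have aT (C : set T) : measurable C -> appset C.
 exact: (smallest_sub sigma_algebra_appset (fun _ => id)).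
have mT (C : set M) : appset C -> measurable (C : set T).
 exact: sub_sigma_algebra.
suff : measurable_fun (setT : set T) (fun mu : T => (mu : M) V).
 by move=> /(_ measurableT B mB); rewrite setTI => /aT.
apply: (emeasurable_fun_cvg (fun n (mu : T) => (mu : M) (V `&` cube n%:R))).
 move=> n _ C mC; rewrite setTI; apply: mT.
 pose Wn := V `&` @cube R d n%:R.
 have mW : measurable Wn by apply: measurableI => //; exact: cube_mbl.
 have bW : bnd Wn by exists n%:R => x [].
 rewrite (_ : _ @^-1` C = \bigcup_(k in [set k : nat | C k%:R%:E]) [set mu : M | mu Wn = k%:R%:E]).
  rewrite bigcup_mkcond; apply: appset_bigcup => k; case: ifP => _; last exact: appset0.
  by apply: app_count => // x [/VU].
 apply/seteqP; split => [mu /= Cmu|mu [k /= Ck]]; last by rewrite -/Wn => ->.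
 by have [k kE] := config_nat mu bW; exists k; rewrite //= -kE.
move=> mu _; rewrite [X in _ --> (mu : M) X](_ : V = \bigcup_n (V `&` cube n%:R)).
 apply: (nondecreasing_cvg_mu (mu := (mu : M))).
 - by move=> n; apply: measurableI => //; exact: cube_mbl.
 - by apply: bigcup_measurable => n _; apply: measurableI => //; exact: cube_mbl.
 - move=> m n mn; apply/subsetPset => x [Vx xm]; split => //; apply: sub_cube xm.
  by rewrite ler_nat.
rewrite -setI_bigcupr (_ : \bigcup_n _ = setT) ?setIT//.
by apply/seteqP; split => // x _; have [n xn] := cube_cover x; exists n.
Qed.

(** Positive and negative parts are dominated limits of simple functions, each a combination of
    indicators covered by [sigF_appset]. *)
Lemma app_sigF (Z : M -> R) : L2 P Z -> measurable_wrt (sigF U) Z -> app Z.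
Proof.
move=> sZ mZ; pose T := g_sigma_algebraType (sigF_gen U).
have mZT : measurable_fun (setT : set T) (Z : T -> R).
 by move=> _ B mB; rewrite setTI; exact: mZ.
have key (Y : M -> R) : measurable_fun (setT : set T) (Y : T -> R) -> L2 P Y ->
  (forall mu, 0 <= Y mu) -> app Y.
 move=> mY sY Y0.
 pose YT : T -> R := Y.
 have mYE : measurable_fun (setT : set T) (EFin \o YT) by apply/mEFin.
 pose s := nnsfun_approx measurableT mYE.
 have sc x : s n x @[n --> \oo] --> Y x.
  have h1 : (EFin \o s ^~ x) n @[n --> \oo] --> (Y x)%:E.
   by apply: (@cvg_nnsfun_approx _ _ _ setT measurableT (EFin \o YT)) => // y _; rewrite lee_fin.
  by move/fine_cvg: h1.
 have sY' n x : s n x <= Y x.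
  have nd : nondecreasing_seq (s ^~ x).
   by move=> m k mk; have /lefP := nd_nnsfun_approx measurableT mYE mk; exact.
  have := nondecreasing_cvgn_le nd (cvgP _ (sc x)) n.
  by rewrite (cvg_lim _ (sc x)).
 apply: (@app_dominated (fun n => s n : M -> R) _ Y) => //.
  move=> n; pose ys : seq R := fset_set (range (s n)).
  have -> : (s n : M -> R) = fun mu => \sum_(y <- ys) y * \1_(s n @^-1` [set y]) mu.
   by apply/funext => mu; rewrite [LHS](fimfunE (s n)) fsbig_finite.
  have aA y : appset (s n @^-1` [set y]).
   by apply: sigF_appset; apply: (measurable_funPTI (s n)).
  elim: ys => [|y ys ih].
   under eq_fun do rewrite big_nil; have := app_spn [::].
   by rewrite /sp /spn; under eq_fun do rewrite big_nil.
  under eq_fun do rewrite big_cons; apply: appD => //.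
  rewrite (_ : (fun mu => _) = fun mu => sp [:: (y, oneU)] mu * \1_(s n @^-1` [set y]) mu).
   apply: (@app_bounded_mul _ _ `|y|); [exact: app_spn|exact: (aA y).2| | |].
   - by move=> mu; rewrite spn1.
   - by apply: mindic; exact: (aA y).1.
   - by exists 1; exact: indic_bound.
  by apply/funext => mu; rewrite spn1.
 by move=> n mu; rewrite ger0_norm.
have le_pos (f g : R) : `|Num.max f g| <= `|f| + `|g|.
 by rewrite /Num.max; case: ifP => _; rewrite ?lerDl ?lerDr.
have mp : L2 P (fun mu => Num.max (Z mu) 0).
 have mm : mbl (fun mu => Num.max (Z mu) 0).
  by apply: measurable_maxr; [exact: L2_mbl sZ|exact: measurable_cst].
 apply: (le_nrm mm sZ _).1 => mu.
 by apply: le_trans (le_pos _ _) _; rewrite normr0 addr0.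
have mn : L2 P (fun mu => Num.max (- Z mu) 0).
 have mm : mbl (fun mu => Num.max (- Z mu) 0).
  by apply: measurable_maxr; [exact: L2_mbl (L2N sZ)|exact: measurable_cst].
 apply: (le_nrm mm sZ _).1 => mu.
 by apply: le_trans (le_pos _ _) _; rewrite normr0 addr0 normrN.
have ap : app (fun mu => Num.max (Z mu) 0).
 apply: key => //; last by move=> mu; rewrite le_max lexx orbT.
 by apply: measurable_maxr => //; exact: measurable_cst.
have an : app (fun mu => Num.max (- Z mu) 0).
 apply: key => //; last by move=> mu; rewrite le_max lexx orbT.
 by apply: measurable_maxr; [exact: mcomp|exact: measurable_cst].
rewrite (_ : Z = fun mu => Num.max (Z mu) 0 + sp [:: (-1, oneU)] mu * Num.max (- Z mu) 0).
 apply: appD => //; split => [|e /(an.2 _)[s sP]].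
  by under eq_fun do rewrite spn1; exact: L2Z.
 exists (scl (-1) s); rewrite (_ : (fun mu => _) = fun mu => - (Num.max (- Z mu) 0 - sp s mu)).
  by rewrite nrmN//; exact: L2B (L2_spn s).
 by apply/funext => mu; rewrite spn1 /sp spn_scl; ring.
apply/funext => mu; rewrite spn1 /Num.max; case: ifPn; case: ifPn; rewrite -?leNgt; lra.
Qed.

End density.

(** For an exponential supported in [U] the product term of [pmul] vanishes, so the Laplace
    functional factorizes; density gives general [Z]. *)
Lemma independence (U : set 'rV[R]_d) (Z : config R d -> R) (k : 'rV[R]_d -> R) :
 L2 P Z -> measurable_wrt (sigF U) Z -> adm k ->
 (forall x, U x -> k x = 0) ->
 ip P Z (ex k) = (\int[P]_mu Z mu) * expR (mI k).
Proof.
move=> sZ mZ ak kU; have [_ aZ] := app_sigF sZ mZ.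
have choice_s n : exists s, nrm P (fun mu => Z mu - spn (valU (U := U)) s mu) < n.+1%:R^-1.
 by apply: aZ; rewrite invr_gt0.
pose s n := proj1_sig (cid (choice_s n)).
have sP n : nrm P (fun mu => Z mu - spn (valU (U := U)) (s n) mu) < n.+1%:R^-1.
 by rewrite /s; case: cid.
have ss n := L2_spn (s n).
have c : L2cvg P (fun n => spn (valU (U := U)) (s n)) Z.
 apply: (@cvg_bound _ _ (fun n => n.+1%:R^-1)); last exact: cvg_harmonic.
 by move=> n; rewrite sub0r normrN ger0_norm ?nrm_ge0// nrm_distC// ltW.
have L1 := cvg_ip ss (fun=> L2_ex ak) sZ (L2_ex ak) c (L2cvg_cst _ _).
have lim2 := cvg_ip ss (fun=> L2_cst 1) sZ (L2_cst 1) c (L2cvg_cst _ _).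
have E1 (g : config R d -> R) : ip P g (fun=> 1) = \int[P]_x g x.
 by apply: eq_Rintegral => x _; rewrite mulr1.
have key n : ip P (spn (valU (U := U)) (s n)) (ex k) =
  ip P (spn (valU (U := U)) (s n)) (fun=> 1) * expR (mI k).
 rewrite /spn !ip_suml; try by [move=> a; apply: L2Z; apply: L2_ex; exact: admU|exact: L2_ex|exact: L2_cst].
 rewrite mulr_suml; apply: eq_bigr => a _.
 have se := L2_ex (admU a.2).
 rewrite (ipZl _ se (L2_ex ak)) (ipZl _ se (L2_cst 1)).
 rewrite -mulrA; congr (_ * _); rewrite E1 (laplace (admU _)).
 rewrite (ip_ex (admU _) ak) -expRD; congr expR.
 rewrite -(mID (admU _).1 ak.1); apply: eq_mI => x; rewrite /pmul.
 case: (pselect (U x)) => Ux; first by rewrite kU// mulr0 addr0.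
 by rewrite offU// mul0r addr0.
apply: (cvg_unique _ L1) => //; rewrite -E1.
rewrite (_ : (fun n => _) = fun n => ip P (spn (valU (U := U)) (s n)) (fun=> 1) * expR (mI k)); last first.
 by apply/funext => n; exact: key.
by apply: cvgM; [exact: lim2|exact: cvg_cst].
Qed.

Lemma ex_restr (Q : set 'rV[R]_d) (h : 'rV[R]_d -> R) mu :
 measurable Q -> adm h -> (forall x, ~ Q x -> h x = 0) -> ex h (restr mu Q) = ex h mu.
Proof.
move=> mQ al hQ; rewrite /ex lin_restr//.
- exact: tf_mbl (tf_ln al).
- exact: tf_bsupp (tf_ln al).
- by move=> x Qx; rewrite hQ// addr0 ln1.
Qed.

(** * Thinning operators and the positivity of their kernels *)

Section poisson_kernels.
Variables (I : Type).
Implicit Types (K : I -> I -> R) (s t : seq (R * I)) (phi g : E -> R).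

Definition nnbounded g := mbl g /\ exists b, forall x, 0 <= g x <= b.

Lemma tf_weight g f f' : nnbounded g -> tf f -> tf f' -> tf (fun x => g x * (f x * f' x)).
Proof.
move=> [mg [b gb]] tf_f tf_f'; under eq_fun do rewrite mulrC.
apply: tfM => //; first exact: tf_mul.
by exists b => x; have /andP[g0 gbx] := gb x; rewrite ger0_norm.
Qed.

(** A Schur product with a Gram kernel: at each [x] the kernel is [K] conjugated by the numbers
    [v i x], and these are integrated with a nonnegative weight. *)
Lemma psd_feature K (v : I -> E -> R) g : psd K -> (forall i, tf (v i)) -> nnbounded g ->
 psd (fun i j => K i j * mI (fun x => g x * (v i x * v j x))).
Proof.
move=> pK tv gb s.
have tg i j := tf_weight gb (tv i) (tv j).
rewrite (_ : qf _ s s = mI (fun x => \sum_(a <- s) \sum_(b <- s)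
  a.1 * b.1 * K a.2 b.2 * (g x * (v a.2 x * v b.2 x)))).
 apply: mI_ge0 => x; have [mg [b /(_ x)/andP[g0 _]]] := gb.
 rewrite (_ : \sum_(a <- s) _ = g x * qf K [seq (a.1 * v a.2 x, a.2) | a <- s]
   [seq (a.1 * v a.2 x, a.2) | a <- s]); first by rewrite mulr_ge0.
 rewrite /qf big_map mulr_sumr; apply: eq_bigr => a _; rewrite big_map mulr_sumr.
 by apply: eq_bigr => b' _ /=; ring.
rewrite (mI_sum); last first.
 by move=> a; apply: tf_sum => b; apply: tfZ.
apply: eq_bigr => a _; rewrite (mI_sum); last first.
 by move=> b; apply: tfZ.
by apply: eq_bigr => b _; rewrite (mIZ) ?mulrA.
Qed.

Definition weight phi := mbl phi /\ forall x, 0 <= phi x <= 1.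

Lemma weight_nnbounded phi : weight phi -> nnbounded phi.
Proof. by move=> [mphi phi01]; split => //; exists 1. Qed.

Variable h : I -> E -> R.
Hypothesis ah : forall i, adm (h i).

Definition mh phi i j := mI (fun x => phi x * (h i x * h j x)).

Lemma tf_h i : tf (h i). Proof. exact: (ah i).1. Qed.

Lemma mhC phi i j : mh phi i j = mh phi j i.
Proof. by apply: eq_mI => x; rewrite (mulrC (h i x)). Qed.

Lemma mhB phi phi' i j : weight phi -> weight phi' ->
 mh (fun x => phi' x - phi x) i j = mh phi' i j - mh phi i j.
Proof.
move=> wp wp'; have t1 := tf_weight (weight_nnbounded wp) (tf_h i) (tf_h j).
have t2 := tf_weight (weight_nnbounded wp') (tf_h i) (tf_h j).
rewrite -mulN1r /mh -(mIZ _ t1) -(mID t2 (tfZ _ t1)).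
by apply: eq_mI => x; ring.
Qed.

Lemma psd_mhX phi K k : weight phi -> psd K -> psd (fun i j => K i j * mh phi i j ^+ k).
Proof.
move=> wp pK; elim: k => [|k ih]; first by apply: eq_psd pK => i j; rewrite expr0 mulr1.
apply: eq_psd (psd_feature ih tf_h (weight_nnbounded wp)) => i j.
by rewrite exprSr mulrA.
Qed.

(** The exponential series has nonnegative coefficients and each power of the Gram kernel [mh phi]
    is a Schur product. The cases [m = 0, 1, 2] yield the exponential, its increments, and the
    remainders of first order of these increments. *)
Lemma psd_expR_tail phi K m : weight phi -> psd K ->
 psd (fun i j => K i j * (expR (mh phi i j) - \sum_(0 <= k < m) mh phi i j ^+ k / k`!%:R)).
Proof.
move=> wp pK.
apply: (@psd_lim _ _ (fun N i j => K i j * (\sum_(0 <= k < N + m) mh phi i j ^+ k / k`!%:R -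
  \sum_(0 <= k < m) mh phi i j ^+ k / k`!%:R))).
 elim => [|N ih].
  apply: (@eq_psd _ _ (fun i j => 0 * K i j)) (psdZ (lexx 0) pK) => i j.
  by rewrite add0n subrr mulr0 mul0r.
 have f0 : 0 <= (N + m)`!%:R^-1 :> R by rewrite invr_ge0.
 apply: eq_psd (psdD ih (psdZ f0 (psd_mhX (N + m) wp pK))) => i j.
 by rewrite addSn big_nat_recr//=; ring.
move=> i j; apply: cvgM; first exact: cvg_cst.
apply: cvgB; last exact: cvg_cst.
rewrite (cvg_shiftn m (fun N => \sum_(0 <= k < N) mh phi i j ^+ k / k`!%:R)).
exact: is_cvg_series_exp_coeff.
Qed.

Lemma psd_expR phi K : weight phi -> psd K -> psd (fun i j => K i j * expR (mh phi i j)).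
Proof.
move=> wp pK; apply: eq_psd (psd_expR_tail 0 wp pK) => i j.
by rewrite big_geq// subr0.
Qed.

Lemma weightB phi phi' : weight phi -> weight phi' -> (forall x, phi x <= phi' x) ->
 weight (fun x => phi' x - phi x).
Proof.
move=> [mp p01] [mp' p01'] pp'; split; first exact: mfunB.
move=> x; have := pp' x; have /andP[h1 h2] := p01 x; have /andP[h3 h4] := p01' x.
by move=> h5; apply/andP; split; lra.
Qed.

Lemma psd_expRB phi phi' K : weight phi -> weight phi' -> (forall x, phi x <= phi' x) ->
 psd K -> psd (fun i j => K i j * (expR (mh phi' i j) - expR (mh phi i j))).
Proof.
move=> wp wp' pp' pK.
apply: eq_psd (psd_expR_tail 1 (weightB wp wp' pp') (psd_expR wp pK)) => i j.
rewrite big_nat1 (mhB _ _ wp wp') expr0 fact0 divr1 -mulrA; congr (_ * _).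
move: (mh phi i j) (mh phi' i j) => a b.
by rewrite mulrBr mulr1 -expRD; congr (expR _ - _); ring.
Qed.

(** Kernel version of [exp b - exp a >= (b - a) exp a]. *)
Lemma psd_expRB1 phi phi' K : weight phi -> weight phi' -> (forall x, phi x <= phi' x) ->
 psd K -> psd (fun i j => K i j * (expR (mh phi' i j) - expR (mh phi i j) -
  mh (fun x => phi' x - phi x) i j * expR (mh phi i j))).
Proof.
move=> wp wp' pp' pK.
apply: eq_psd (psd_expR_tail 2 (weightB wp wp' pp') (psd_expR wp pK)) => i j.
rewrite big_nat_recr//= big_nat1 expr1 expr0 !factE !divr1 -mulrA; congr (_ * _).
rewrite (mhB _ _ wp wp'); move: (mh phi i j) (mh phi' i j) => a b.
rewrite (_ : expR b = expR a * expR (b - a)); first by move: (expR a) (expR (b - a)) => u v; ring.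
by rewrite -expRD; congr expR; ring.
Qed.

Lemma mI_pmul f g : tf f -> tf g -> mI (pmul f g) = mI f + mI g + mI (fun x => f x * g x).
Proof.
move=> tf_f tf_g; rewrite /pmul (mID (tfD tf_f tf_g) (tf_mul tf_f tf_g)).
by rewrite (mID tf_f tf_g).
Qed.

(* [gam phi] thins a configuration with retention probability [phi] and adds
  an independent Poisson process of intensity [rho * (1 - phi)]; for [phi]
  the indicator function of U this is the conditional expectation given F_U. *)
Definition gam phi s (mu : M) : R :=
 \sum_(a <- s) a.1 * (expR (mI (h a.2) - mI (fun x => phi x * h a.2 x)) *
   ex (fun x => phi x * h a.2 x) mu).

Lemma L2_gam phi s : weight phi -> L2 P (gam phi s).
Proof.
move=> [mp p01]; apply: L2_sum => a; do 2 apply: L2Z.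
by apply: L2_ex; exact: adm_scale.
Qed.

Lemma L2_sp s : L2 P (spn h s).
Proof. by apply: L2_sum => a; apply: L2Z; exact: L2_ex. Qed.

Definition eK i j := expR (mI (h i)) * expR (mI (h j)).

Lemma psd_eK : psd eK.
Proof. by apply: eq_psd (psd_conj (fun i => expR (mI (h i))) psd1) => i j; rewrite mulr1. Qed.

Definition gK phi i j := eK i j * expR (mh phi i j).

Lemma gKC phi i j : gK phi i j = gK phi j i.
Proof. by rewrite /gK /eK mhC (mulrC (expR (mI (h i)))). Qed.

Lemma weight1 : weight (fun=> 1).
Proof. by split; [exact: measurable_cst|move=> x; rewrite lexx ler01]. Qed.

(** Thinning by [phi] and then by [phi'] is thinning by the product: the normalizing factors of
    [gam] cancel the terms of first order in the Laplace functional and only the cross term is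
    left. *)
Lemma ip_gam phi phi' s t : weight phi -> weight phi' ->
 ip P (gam phi s) (gam phi' t) = qf (gK (fun x => phi x * phi' x)) s t.
Proof.
move=> [mp p01] [mp' p01'].
have aph i : adm (fun x => phi x * h i x) by exact: adm_scale.
have aph' i : adm (fun x => phi' x * h i x) by exact: adm_scale.
rewrite /gam ip_suml; last 2 first.
- by move=> a; do 2 apply: L2Z; exact: L2_ex.
- by apply: L2_gam.
apply: eq_bigr => a _; rewrite ipC ip_suml; last 2 first.
- by move=> b; do 2 apply: L2Z; exact: L2_ex.
- by do 2 apply: L2Z; exact: L2_ex.
apply: eq_bigr => b _.
have sa := L2_ex (aph a.2); have sb := L2_ex (aph' b.2).
rewrite (ipZl _ (L2Z _ sb) (L2Z _ (L2Z _ sa))) (ipZl _ sb (L2Z _ (L2Z _ sa))).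
rewrite (ipZr _ (L2Z _ sa) sb) (ipZr _ sa sb).
rewrite (ip_ex (aph' _) (aph _)) (mI_pmul (aph' _).1 (aph _).1).
have -> : mI (fun x => phi' x * h b.2 x * (phi x * h a.2 x)) = mh (fun x => phi x * phi' x) a.2 b.2.
 by apply: eq_mI => x; ring.
rewrite /gK /eK; move: (mI (h a.2)) (mI (h b.2)) (mI (fun x => phi x * h a.2 x))
 (mI (fun x => phi' x * h b.2 x)) (mh _ _ _) => x y z w m.
have <- : expR (x - z) * expR (y - w) * expR (w + z + m) = expR x * expR y * expR m.
 by rewrite -!expRD; congr expR; ring.
move: (expR (x - z)) (expR (y - w)) (expR (w + z + m)) => u v q; ring.
Qed.

Lemma gam1 s : gam (fun=> 1) s = spn h s.
Proof.
apply/funext => mu; apply: eq_bigr => a _; congr (_ * _).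
have -> : (fun x => 1 * h a.2 x) = h a.2 by apply/funext => x; rewrite mul1r.
by rewrite subrr expR0 mul1r.
Qed.

Lemma eq_gK phi phi' i j : phi =1 phi' -> gK phi i j = gK phi' i j.
Proof. by move=> /funext ->. Qed.

Lemma ip_spn s t : ip P (spn h s) (spn h t) = qf (gK (fun=> 1)) s t.
Proof.
rewrite -!gam1 ip_gam; [|exact: weight1|exact: weight1].
by apply: eq_qf => i j; apply: eq_gK => x; rewrite mulr1.
Qed.

Lemma ip_spn_gam phi s t : weight phi -> ip P (spn h s) (gam phi t) = qf (gK phi) s t.
Proof.
move=> wp; rewrite -gam1 ip_gam//; last exact: weight1.
by apply: eq_qf => i j; apply: eq_gK => x; rewrite mul1r.
Qed.

Lemma psd_gK phi : weight phi -> psd (gK phi).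
Proof. by move=> wp; exact: psd_expR psd_eK. Qed.

Lemma le_gK phi phi' s : weight phi -> weight phi' -> (forall x, phi x <= phi' x) ->
 qf (gK phi) s s <= qf (gK phi') s s.
Proof.
move=> wp wp' pp'; apply: le_qf; apply: eq_psd (psd_expRB wp wp' pp' psd_eK) => i j.
by rewrite /gK mulrBr.
Qed.

Lemma weight_le1 phi x : weight phi -> phi x <= 1.
Proof. by move=> [_ /(_ x)/andP[]]. Qed.

(** The norm of [gam phi] involves the weight [phi^2], below 1, so [le_gK] applies. *)
Lemma nrm_gam phi s : weight phi -> nrm P (gam phi s) <= nrm P (spn h s).
Proof.
move=> wp; rewrite /nrm ler_wsqrtr// ip_gam// ip_spn.
have w2 : weight (fun x => phi x * phi x).
 have [mp p01] := wp; split; first exact: mfunM.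
 by move=> x; have /andP[h1 h2] := p01 x; apply/andP; split; nra.
by apply: le_gK; [exact: w2|exact: weight1|move=> x; exact: (weight_le1 x w2)].
Qed.

(* On functions of the restriction to {phi = 1}, [gam phi] is the identity. *)
Lemma gam_id phi s : (forall a x, phi x * h a x = h a x) -> gam phi s = spn h s.
Proof.
move=> ph; rewrite -[RHS]gam1; apply/funext => mu; apply: eq_bigr => a _.
rewrite (_ : (fun x => phi x * h a.2 x) = fun x => 1 * h a.2 x)//.
by apply/funext => x; rewrite ph mul1r.
Qed.

Lemma gam_sigF (Q : set E) s : measurable Q -> measurable_wrt (sigF Q) (gam (\1_Q) s).
Proof.
move=> mQ; have wQ : weight (\1_Q).
 split; first exact: mindic.
 by move=> x; rewrite indicE; case: (_ \in _); rewrite ?lexx ?ler01.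
apply: sigF_restr => //; first exact: L2_mbl (L2_gam s wQ).
move=> mu; apply: eq_bigr => a _; do 2 congr (_ * _).
have al := adm_scale (ah a.2) wQ.1 wQ.2.
rewrite ex_restr// => x Qx.
by rewrite indicE memNset// mul0r.
Qed.

Section weighted_operator.
Variables (n : nat) (phi : nat -> E -> R) (al : nat -> R).
Hypotheses (wphi : forall j, weight (phi j)) (al0 : 0 <= al 0%N)
(al_nd : forall j, al j <= al j.+1).

(** By summation by parts this is [al_0 gam_0 + \sum_(j < n) al_(j+1) (gam_(j+1) - gam_j) + al_n (1
    - gam_n)]: the dependence on farther points is given a larger weight. *)
Definition Wop s (mu : M) : R :=
 al n * spn h s mu - \sum_(0 <= j < n) (al j.+1 - al j) * gam (phi j) s mu.

Definition WK i j := al n * gK (fun=> 1) i j -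
 \sum_(0 <= k < n) (al k.+1 - al k) * gK (phi k) i j.

Lemma L2_Wop s : L2 P (Wop s).
Proof.
apply: L2B; first by apply: L2Z; exact: L2_sp.
by apply: L2_sum => j; apply: L2Z; exact: L2_gam.
Qed.

Lemma ip_spn_Wop s t : ip P (spn h s) (Wop t) = qf WK s t.
Proof.
have ss := L2_sp s; have st := L2_sp t.
rewrite ipBr//; last 2 first.
- exact: L2Z.
- by apply: L2_sum => j; apply: L2Z; exact: L2_gam.
rewrite ipZr// ip_spn ipC ip_suml//; last by move=> j; apply: L2Z; exact: L2_gam.
rewrite qfB qfZ qf_sum; congr (_ - _); apply: eq_bigr => j _.
have sg := L2_gam t (wphi j).
by rewrite ipC (ipZr _ sg ss) ip_spn_gam// qfZ.
Qed.

Lemma Wop_sym s t : ip P (spn h s) (Wop t) = ip P (Wop s) (spn h t).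
Proof.
rewrite ip_spn_Wop ipC ip_spn_Wop qfC// => i j.
by rewrite /WK gKC; congr (_ - _); apply: eq_bigr => k _; rewrite gKC.
Qed.

Lemma al_ge0 j : 0 <= al j.
Proof. by elim: j => // j /le_trans; apply. Qed.

Lemma telescope_al m : \sum_(0 <= j < m) (al j.+1 - al j) = al m - al 0%N.
Proof. by rewrite telescope_sumr. Qed.

Lemma Wop_ge0 s : 0 <= ip P (spn h s) (Wop s).
Proof.
rewrite ip_spn_Wop qfB qfZ qf_sum subr_ge0.
have g0 := psd_gK weight1 s.
apply: (@le_trans _ _ ((al n - al 0%N) * qf (gK (fun=> 1)) s s)); last first.
 by rewrite ler_wpM2r// gerBl.
rewrite -telescope_al mulr_suml; apply: ler_sum => j _; rewrite qfZ.
rewrite ler_wpM2l ?subr_ge0//; apply: le_gK => //; first exact: weight1.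
by move=> x; exact: weight_le1.
Qed.

Lemma nrm_Wop s : nrm P (Wop s) <= 2 * al n * nrm P (spn h s).
Proof.
have ss := L2_sp s.
have sG j : L2 P (fun mu => (al j.+1 - al j) * gam (phi j) s mu).
 by apply: L2Z; exact: L2_gam.
apply: le_trans (nrmB (L2Z _ ss) (L2_sum _ sG)) _.
rewrite nrmZ// ger0_norm ?al_ge0// mulrDl mul1r mulrDl lerD2l.
apply: le_trans (_ : (al n - al 0%N) * nrm P (spn h s) <= _); last first.
 by rewrite ler_wpM2r ?nrm_ge0// gerBl.
rewrite -telescope_al; elim: (index_iota 0 n) => [|j r ih].
 by under eq_fun do rewrite big_nil; rewrite big_nil mul0r nrm0.
under eq_fun do rewrite big_cons.
apply: le_trans (nrmD (sG j) (L2_sum _ sG)) _; rewrite big_cons mulrDl lerD//.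
have sg := L2_gam s (wphi j).
by rewrite nrmZ// ger0_norm ?subr_ge0// ler_wpM2l ?subr_ge0// nrm_gam.
Qed.

Lemma Wop_id s : (forall j a x, phi j x * h a x = h a x) ->
 Wop s = (fun mu => al 0%N * spn h s mu).
Proof.
move=> ph; apply/funext => mu; rewrite /Wop.
under eq_bigr do rewrite gam_id//.
by rewrite -mulr_suml telescope_al; ring.
Qed.

(** [gam (\1_Q)] is a projection, so the left side is [al n] times the difference of the forms of 1
    and of [gam (\1_Q)]; and the form of each [gam (phi j)] is below that of [gam (\1_Q)]. *)
Lemma Wop_condexp (Q : set E) s : measurable Q ->
 (forall j x, (j < n)%N -> phi j x <= \1_Q x) ->
 al n * ip P (fun mu => spn h s mu - gam (\1_Q) s mu) (fun mu => spn h s mu - gam (\1_Q) s mu)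
  <= ip P (spn h s) (Wop s).
Proof.
move=> mQ phQ; have wQ : weight (\1_Q).
 split; first exact: mindic.
 by move=> x; rewrite indicE; case: (_ \in _); rewrite ?lexx ?ler01.
have ss := L2_sp s; have sg := L2_gam s wQ.
rewrite ip_spn_Wop ipBl// ?ipBr//; try exact: L2B.
rewrite ip_spn ip_spn_gam// (ipC _ (gam _ _) (spn _ _)) ip_spn_gam// ip_gam//.
have -> : qf (gK (fun x => \1_Q x * \1_Q x)) s s = qf (gK (\1_Q)) s s.
 by apply: eq_qf => i j; apply: eq_gK => x; rewrite indicE; case: (_ \in _); rewrite ?mulr1 ?mulr0.
rewrite subrr subr0 qfB qfZ qf_sum mulrBr lerD2l lerN2.
have g0 := psd_gK wQ s.
apply: (@le_trans _ _ ((al n - al 0%N) * qf (gK (\1_Q)) s s)); last first.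
 by rewrite ler_wpM2r// gerBl.
rewrite -telescope_al mulr_suml [leLHS]big_nat [leRHS]big_nat; apply: ler_sum => j jn.
by rewrite qfZ ler_wpM2l ?subr_ge0//; apply: le_gK => // x; exact: phQ.
Qed.

End weighted_operator.

End poisson_kernels.

(** * Bilinear forms, vector fields and localized energies *)

Lemma bilinE (u v : 'rV[R]_d) A :
 bilin u A v = \sum_(l < d) \sum_(k < d) u ord0 k * A k l * v ord0 l.
Proof.
by rewrite /bilin mxE; apply: eq_bigr => l _; rewrite !mxE mulr_suml.
Qed.

Section bilinear.
Implicit Types (u v w : E) (A : 'M[R]_d).

Lemma bilinDl u v w A : bilin (u + v) A w = bilin u A w + bilin v A w.
Proof. by rewrite /bilin !mulmxDl mxE. Qed.

Lemma bilinDr u v w A : bilin w A (u + v) = bilin w A u + bilin w A v.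
Proof. by rewrite /bilin linearD /= mulmxDr mxE. Qed.

Lemma bilinZl c u v A : bilin (c *: u) A v = c * bilin u A v.
Proof. by rewrite /bilin -!scalemxAl mxE. Qed.

Lemma bilinZr c u v A : bilin u A (c *: v) = c * bilin u A v.
Proof. by rewrite /bilin linearZ /= -scalemxAr mxE. Qed.

Lemma bilin0l v A : bilin 0 A v = 0.
Proof. by rewrite /bilin !mul0mx mxE. Qed.

Lemma bilin0r v A : bilin v A 0 = 0.
Proof. by rewrite /bilin trmx0 mulmx0 mxE. Qed.

Lemma bilinNl u v A : bilin (- u) A v = - bilin u A v.
Proof. by rewrite -scaleN1r bilinZl mulN1r. Qed.

Lemma bilinNr u v A : bilin u A (- v) = - bilin u A v.
Proof. by rewrite -scaleN1r bilinZr mulN1r. Qed.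

Lemma bilin_sym u v A : A^T = A -> bilin u A v = bilin v A u.
Proof.
move=> AT; rewrite /bilin -[in RHS](trmxK (v *m A *m u^T)) [in RHS]mxE.
by rewrite !trmx_mul trmxK AT mulmxA.
Qed.

Lemma sqnorm_ge0 u : 0 <= sqnorm u.
Proof. by apply: sumr_ge0 => i _; rewrite sqr_ge0. Qed.

Lemma bilin1 u v : bilin u 1%:M v = \sum_(k < d) u ord0 k * v ord0 k.
Proof. by rewrite /bilin mulmx1 mxE; apply: eq_bigr => k _; rewrite mxE. Qed.

Lemma bilin1_sqnorm u : bilin u 1%:M u = sqnorm u.
Proof. by rewrite bilin1; apply: eq_bigr => k _; rewrite expr2. Qed.

End bilinear.

Section vector_fields.
Local Notation C := (campbell).
Implicit Types (F G H : M -> E -> E) (w : E -> R).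

Definition vL2 F := forall k, L2 C (fun p => F p.1 p.2 ord0 k).

Lemma vL2D F G : vL2 F -> vL2 G -> vL2 (fun mu x => F mu x + G mu x).
Proof. by move=> sF sG k; under eq_fun do rewrite mxE; exact: L2D. Qed.

Lemma vL2Z c F : vL2 F -> vL2 (fun mu x => c *: F mu x).
Proof. by move=> sF k; under eq_fun do rewrite mxE; exact: L2Z. Qed.

Lemma vL2N F : vL2 F -> vL2 (fun mu x => - F mu x).
Proof. by move=> sF k; under eq_fun do rewrite mxE; exact: L2N. Qed.

Lemma vL2B F G : vL2 F -> vL2 G -> vL2 (fun mu x => F mu x - G mu x).
Proof. by move=> sF sG; exact: vL2D sF (vL2N sG). Qed.

Lemma vL2_0 : vL2 (fun _ _ => 0).
Proof. by move=> k; under eq_fun do rewrite mxE; exact: L20. Qed.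

Lemma vL2_sum (J : Type) (s : seq J) (F : J -> M -> E -> E) : (forall j, vL2 (F j)) ->
 vL2 (fun mu x => \sum_(j <- s) F j mu x).
Proof.
move=> sF; elim: s => [|j s ih].
 by move=> k; under eq_fun do rewrite big_nil mxE; exact: L20.
by move=> k; under eq_fun do rewrite big_cons mxE; exact: L2D (sF j k) (ih k).
Qed.

Variables (A : M * E -> 'M[R]_d) (L : R).

(** Covers both the identity and the coefficient field. Only nonnegativity is asked from below; the
    lower ellipticity bound is a separate hypothesis where it enters. *)
Definition mfield := [/\ forall k l, mbl (fun p => A p k l),
 forall p, (A p)^T = A p & forall p v, 0 <= bilin v (A p) v <= L * sqnorm v].

Hypothesis mA : mfield.

Definition en w F G : R := \int[C]_p (w p.2 * bilin (F p.1 p.2) (A p) (G p.1 p.2)).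

Lemma bilin_AMGM p u v : `|bilin u (A p) v| <= (bilin u (A p) u + bilin v (A p) v) / 2.
Proof.
have [_ sA A0] := mA; have /andP[h1 _] := A0 p (u + v); have /andP[h2 _] := A0 p (u - v).
move: h1 h2; rewrite !(bilinDl, bilinDr, bilinNl, bilinNr) (bilin_sym v u (sA p)) => h1 h2.
by rewrite ler_norml; apply/andP; split; lra.
Qed.

Lemma sum_integrable (J : Type) (s : seq J) (f : J -> M * E -> R) :
 (forall j, intg C (f j)) ->
 intg C (fun p => \sum_(j <- s) f j p).
Proof.
move=> fi; elim: s => [|j s ih].
 by under eq_fun do rewrite big_nil; exact: integrable0.
under eq_fun do rewrite big_cons.
exact: (integrableD measurableT (fi j) ih).
Qed.

Lemma sqnorm_integrable F : vL2 F -> intg C (fun p => sqnorm (F p.1 p.2)).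
Proof. by move=> sF; apply: sum_integrable => k; exact: L2_sqr (sF k). Qed.

Lemma mbl_bilin F G : vL2 F -> vL2 G ->
 mbl (fun p => bilin (F p.1 p.2) (A p) (G p.1 p.2)).
Proof.
move=> sF sG; under eq_fun do rewrite bilinE.
apply: measurable_sum => l; apply: measurable_sum => k.
apply: mfunM; last exact: (sG l).1.
apply: mfunM; first exact: (sF k).1.
by have [mA' _ _] := mA.
Qed.

Lemma en_integrable w F G : weight w -> vL2 F -> vL2 G ->
 intg C (fun p => w p.2 * bilin (F p.1 p.2) (A p) (G p.1 p.2)).
Proof.
move=> [mw w01] sF sG.
have i1 := integrableZl measurableT L (sqnorm_integrable sF).
have i2 := integrableZl measurableT L (sqnorm_integrable sG).
apply: (le_integrable measurableT _ _ (integrableD measurableT i1 i2)).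
 apply/mEFin/mfunM; last exact: mbl_bilin.
 exact: mcomp mw measurable_snd.
move=> p _ /=; rewrite lee_fin normrM; have /andP[w0 w1] := w01 p.2.
rewrite (ger0_norm w0); apply: le_trans (ler_norm _).
apply: le_trans (_ : `|bilin (F p.1 p.2) (A p) (G p.1 p.2)| <= _); first by rewrite ler_piMl.
apply: le_trans (bilin_AMGM _ _ _) _.
have [_ _ A0] := mA; have /andP[h1 h2] := A0 p (F p.1 p.2); have /andP[h3 h4] := A0 p (G p.1 p.2).
lra.
Qed.

Lemma enC w F G : en w F G = en w G F.
Proof.
by apply: eq_Rintegral => p _; have [_ sA _] := mA; rewrite (bilin_sym _ _ (sA p)).
Qed.

Lemma enDl w F G H : weight w -> vL2 F -> vL2 G -> vL2 H ->
 en w (fun mu x => F mu x + G mu x) H = en w F H + en w G H.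
Proof.
move=> ww sF sG sH; rewrite /en -RintegralD//; try exact: en_integrable.
by apply: eq_Rintegral => p _; rewrite bilinDl mulrDr.
Qed.

Lemma enZl c w F G : weight w -> vL2 F -> vL2 G ->
 en w (fun mu x => c *: F mu x) G = c * en w F G.
Proof.
move=> ww sF sG; rewrite /en -RintegralZl//; try exact: en_integrable.
by apply: eq_Rintegral => p _; rewrite bilinZl mulrCA.
Qed.

Lemma enNl w F G : weight w -> vL2 F -> vL2 G ->
 en w (fun mu x => - F mu x) G = - en w F G.
Proof.
move=> ww sF sG; rewrite -mulN1r -enZl//.
by apply: eq_Rintegral => p _; rewrite scaleN1r.
Qed.

Lemma enBl w F G H : weight w -> vL2 F -> vL2 G -> vL2 H ->
 en w (fun mu x => F mu x - G mu x) H = en w F H - en w G H.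
Proof. by move=> ww sF sG sH; rewrite enDl// ?enNl//; exact: vL2N. Qed.

Lemma enDr w F G H : weight w -> vL2 F -> vL2 G -> vL2 H ->
 en w H (fun mu x => F mu x + G mu x) = en w H F + en w H G.
Proof. by move=> ww sF sG sH; rewrite enC enDl// !(enC w H). Qed.

Lemma enZr c w F G : weight w -> vL2 F -> vL2 G ->
 en w G (fun mu x => c *: F mu x) = c * en w G F.
Proof. by move=> ww sF sG; rewrite enC enZl// enC. Qed.

Lemma enBr w F G H : weight w -> vL2 F -> vL2 G -> vL2 H ->
 en w H (fun mu x => F mu x - G mu x) = en w H F - en w H G.
Proof. by move=> ww sF sG sH; rewrite enC enBl// !(enC w H). Qed.

Lemma en_suml (J : Type) (s : seq J) w (F : J -> M -> E -> E) G : weight w ->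
 (forall j, vL2 (F j)) -> vL2 G ->
 en w (fun mu x => \sum_(j <- s) F j mu x) G = \sum_(j <- s) en w (F j) G.
Proof.
move=> ww sF sG; elim: s => [|j s ih].
 rewrite big_nil /en /Rintegral integral0_eq// => p _.
 by rewrite big_nil bilin0l mulr0.
rewrite big_cons -ih -enDl//; last exact: vL2_sum.
by apply: eq_Rintegral => p _; rewrite big_cons.
Qed.

Lemma en_sumr (J : Type) (s : seq J) w (F : J -> M -> E -> E) G : weight w ->
 (forall j, vL2 (F j)) -> vL2 G ->
 en w G (fun mu x => \sum_(j <- s) F j mu x) = \sum_(j <- s) en w G (F j).
Proof.
by move=> ww sF sG; rewrite enC en_suml//; apply: eq_bigr => j _; rewrite enC.
Qed.

Lemma en_ge0 w F : weight w -> 0 <= en w F F.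
Proof.
move=> [mw w01]; apply: Rintegral_ge0 => p _; have /andP[w0 _] := w01 p.2.
by have [_ _ A0] := mA; have /andP[h _] := A0 p (F p.1 p.2); rewrite mulr_ge0.
Qed.

Lemma en_young w F G (eta : R) : weight w -> 0 < eta -> vL2 F -> vL2 G ->
 en w F G <= eta / 2 * en w F F + (2 * eta)^-1 * en w G G.
Proof.
move=> ww eta0 sF sG; have sFG := vL2B (vL2Z eta sF) sG.
have := en_ge0 (fun mu x => eta *: F mu x - G mu x) ww.
have seF := vL2Z eta sF.
rewrite enBl// !enBr// !enZl// !enZr// (enC w G F) => h.
have -> : eta / 2 * en w F F + (2 * eta)^-1 * en w G G =
  en w F G + (2 * eta)^-1 * (eta * (eta * en w F F) - eta * en w F G - (eta * en w F G - en w G G)).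
 by field; apply: lt0r_neq0.
by rewrite lerDl mulr_ge0// invr_ge0 mulr_ge0// ltW.
Qed.

Lemma en_addw w w' w'' F G : weight w -> weight w' -> weight w'' ->
 (forall p, (w p.2 + w' p.2) * bilin (F p.1 p.2) (A p) (G p.1 p.2) =
       w'' p.2 * bilin (F p.1 p.2) (A p) (G p.1 p.2)) ->
 vL2 F -> vL2 G ->
 en w F G + en w' F G = en w'' F G.
Proof.
move=> ww ww' ww'' ww1 sF sG; rewrite /en -RintegralD//; try exact: en_integrable.
by apply: eq_Rintegral => p _; rewrite -mulrDl ww1.
Qed.

End vector_fields.

Section comparison.
Implicit Types (F G H : M -> E -> E) (w : E -> R).

Definition idf (p : M * E) : 'M[R]_d := 1%:M.

Lemma mfield_id : mfield idf 1.
Proof.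
split=> [k l||p v]; first exact: measurable_cst.
- by move=> p; rewrite trmx1.
- by rewrite bilin1_sqnorm sqnorm_ge0 mul1r lexx.
Qed.

Lemma en_le A (L : R) w F : mfield A L -> weight w -> vL2 F ->
 en A w F F <= L * en idf w F F.
Proof.
move=> mA [mw w01] sF; have ww : weight w by [].
rewrite /en -RintegralZl//; last exact: (en_integrable mfield_id).
apply: le_Rintegral => //; first exact: (en_integrable mA).
 exact: (integrableZl measurableT L (en_integrable mfield_id ww sF sF)).
move=> p _; rewrite bilin1_sqnorm mulrCA; have /andP[w0 _] := w01 p.2.
by rewrite ler_wpM2l//; have [_ _ /(_ p (F p.1 p.2))/andP[]] := mA.
Qed.

Lemma en_ge A (L : R) w F : mfield A L -> (forall p v, sqnorm v <= bilin v (A p) v) ->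
 weight w -> vL2 F -> en idf w F F <= en A w F F.
Proof.
move=> mA A1 [mw w01] sF; have ww : weight w by [].
apply: le_Rintegral => //.
- exact: (en_integrable mfield_id).
- exact: (en_integrable mA).
move=> p _; rewrite bilin1_sqnorm; have /andP[w0 _] := w01 p.2.
by rewrite ler_wpM2l.
Qed.

End comparison.

(** * Fields of exponential type and their energies *)

Section exponential_fields.
Local Notation C := (campbell).
Implicit Types (k f w : E -> R) (v : E -> E).

Lemma bounded_sec (f : M * E -> R) (r b : R) mu : mbl f -> 0 <= b ->
 (forall p, `|f p| <= b * \1_(cube r) p.2) -> tf (fun x => f (mu, x)).
Proof.
move=> mf b0 fb; split.
- exact: mcomp mf (measurable_pair1 mu).
- exists b => x; apply: le_trans (fb (mu, x)) _; rewrite indicE.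
 by case: (_ \in _); rewrite ?mulr1 ?mulr0.
- exists r => x xr; have := fb (mu, x); rewrite indicE memNset// mulr0.
 by rewrite normr_le0 => /eqP.
Qed.

Lemma campbell_ge0 (f : M * E -> R) (r b : R) : mbl f -> 0 <= b ->
 (forall p, 0 <= f p) -> (forall p, `|f p| <= b * \1_(cube r) p.2) ->
 (\int[C]_p (f p)%:E = \int[P]_mu (lin (fun x => f (mu, x)) mu)%:E)%E /\
 (\int[C]_p (f p)%:E < +oo)%E.
Proof.
move=> mf b0 f0 fb; have mQ := @cube_mbl r.
have E1 : (\int[C]_p (f p)%:E = \int[P]_mu (lin (fun x => f (mu, x)) mu)%:E)%E.
 rewrite campbell_integral//; last exact/mEFin.
 apply: eq_integral => mu _; have [m1 _ b1] := bounded_sec mu mf b0 fb.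
 exact: linE.
split => //; apply: (@le_lt_trans _ _ (\int[C]_p (b * \1_(cube r) p.2)%:E)%E).
 apply: ge0_le_integral => //.
 - by move=> p _; rewrite lee_fin.
 - exact/mEFin.
 - apply/mEFin/mfunM => //.
  exact: mcomp (mindic mQ) measurable_snd.
 - by move=> p _; rewrite lee_fin -(ger0_norm (f0 p)).
rewrite campbell_integral; last 2 first.
- by move=> p; rewrite lee_fin mulr_ge0// indicE.
- apply/mEFin/mfunM => //.
 exact: mcomp (mindic mQ) measurable_snd.
under eq_integral => mu _.
 under eq_integral do rewrite EFinM.
 rewrite ge0_integralZl//; last by apply/mEFin; exact: mindic.
 rewrite integral_indic// setIT; over.
rewrite ge0_integralZl//; last exact: mbl_count.
by rewrite (count_integral mQ (cube_bnd r)) -EFinM ltry.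
Qed.

Lemma campbell_integrable (f : M * E -> R) (r b : R) : mbl f -> 0 <= b ->
 (forall p, `|f p| <= b * \1_(cube r) p.2) -> intg C f.
Proof.
move=> mf b0 fb; apply/integrableP; split; first exact/mEFin.
have [|||_] := @campbell_ge0 (fun p => `|f p|) r b _ b0 => //.
- by apply: mcomp => //; exact: normr_measurable.
- by move=> p; rewrite normr_id.
Qed.

Lemma campbell_Rintegral (f : M * E -> R) (r b : R) : mbl f -> 0 <= b ->
 (forall p, `|f p| <= b * \1_(cube r) p.2) ->
 \int[C]_p f p = \int[P]_mu lin (fun x => f (mu, x)) mu.
Proof.
move=> mf b0 fb.
pose fp p := Num.max (f p) 0; pose fn p := Num.max (- f p) 0.
have fE p : f p = fp p - fn p.
 by rewrite /fp /fn /Num.max; case: ifPn; case: ifPn; rewrite -?leNgt; lra.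
have mfp : mbl fp by apply: measurable_maxr => //; exact: measurable_cst.
have mfn : mbl fn.
 by apply: measurable_maxr; [exact: mcomp|exact: measurable_cst].
have fp0 p : 0 <= fp p by rewrite le_max lexx orbT.
have fn0 p : 0 <= fn p by rewrite le_max lexx orbT.
have fpb p : `|fp p| <= b * \1_(cube r) p.2.
 apply: le_trans (fb p); rewrite ger0_norm// /fp ge_max ler_norm normr_ge0//.
have fnb p : `|fn p| <= b * \1_(cube r) p.2.
 by apply: le_trans (fb p); rewrite ger0_norm// /fn ge_max -normrN ler_norm normr_ge0.
have ip := campbell_integrable mfp b0 fpb; have ifn := campbell_integrable mfn b0 fnb.
have [ep fp_fin] := campbell_ge0 mfp b0 fp0 fpb; have [en fn_fin] := campbell_ge0 mfn b0 fn0 fnb.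
have -> : \int[C]_p f p = \int[C]_p fp p - \int[C]_p fn p.
 by rewrite -RintegralB//; apply: eq_Rintegral => p _; rewrite fE.
have tp mu := bounded_sec mu mfp b0 fpb; have tn mu := bounded_sec mu mfn b0 fnb.
have I1 (g : M -> R) : (\int[P]_mu (g mu)%:E < +oo)%E -> (forall mu, 0 <= g mu) ->
  mbl g -> intg P g.
 move=> gfin g0 mg; apply/integrableP; split; first exact/mEFin.
 by under eq_integral do rewrite /= ger0_norm//.
have mlin (g : M * E -> R) : mbl g -> (forall p, 0 <= g p) ->
  mbl (fun mu => lin (fun x => g (mu, x)) mu).
 move=> mg g0; apply: mcomp => //.
 apply: (mbl_cfg_integral (c := id) _ (f := EFin \o g)) => //.
 exact/mEFin.
have -> : \int[C]_p fp p = \int[P]_mu lin (fun x => fp (mu, x)) mu by rewrite /Rintegral ep.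
have -> : \int[C]_p fn p = \int[P]_mu lin (fun x => fn (mu, x)) mu by rewrite /Rintegral en.
rewrite -RintegralB//; last 2 first.
- by apply: I1; [rewrite -ep|move=> mu; exact: lin_ge0|exact: mlin].
- by apply: I1; [rewrite -en|move=> mu; exact: lin_ge0|exact: mlin].
apply: eq_Rintegral => mu _.
have t2 := tfZ (-1) (tn mu).
rewrite -mulN1r -linZ; [|exact: tf_mbl (tn mu)|exact: tf_bsupp (tn mu)].
rewrite -linD; [|exact: tf_mbl (tp mu)|exact: tf_mbl t2|exact: tf_bsupp (tp mu)|exact: tf_bsupp t2].
by congr lin; apply/funext => x; rewrite fE mulN1r.
Qed.

Lemma L2_campbell (f : M * E -> R) (r b : R) : mbl f -> 0 <= b ->
 (forall p, `|f p| <= b * \1_(cube r) p.2) -> L2 C f.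
Proof.
move=> mf b0 fb; split => //.
have [||||_] := @campbell_ge0 (fun p => f p ^+ 2) r (b ^+ 2) => //.
- exact: mfunX.
- exact: sqr_ge0.
- by move=> p; exact: sqr_ge0.
move=> p; rewrite normrX; have := fb p; have := normr_ge0 (f p); rewrite indicE.
by case: (_ \in _); rewrite ?mulr1 ?mulr0 => h1 h2; nra.
Qed.

Definition tfv v := forall l : 'I_d, tf (fun x => v x ord0 l).

(** The gradient of [ex k] when [v] is the gradient of [k]: at the point [x] the factor [1 + k x] of
    the product is replaced by [v x]. *)
Definition vx (v : E -> E) (k : E -> R) (mu : M) (x : E) : E :=
 ex k mu *: ((1 + k x)^-1 *: v x).

Lemma tf_quot (f k : E -> R) : tf f -> adm k -> tf (fun x => (1 + k x)^-1 * f x).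
Proof.
move=> tf_f [[mk _ _] [c c0 kc]]; under eq_fun do rewrite mulrC; apply: tfM => //.
 rewrite (_ : (fun x => (1 + k x)^-1) = fun x => expR (- ln (1 + k x))).
  apply: (mcomp (@measurable_expR R)); apply: mcomp => //.
  by apply: (mcomp (@measurable_ln R)); exact: measurable_funD.
 apply/funext => x; rewrite expRN lnK// posrE.
 by have /andP[h1 _] := kc x; exact: lt_le_trans h1.
exists c^-1 => x; have /andP[h1 h2] := kc x.
have h3 : 0 < 1 + k x by exact: lt_le_trans h1.
by rewrite ger0_norm ?invr_ge0 ?(ltW h3)// lef_pV2 ?posrE.
Qed.

Lemma vxE v k p (l : 'I_d) : vx v k p.1 p.2 ord0 l = ex k p.1 * ((1 + k p.2)^-1 * v p.2 ord0 l).
Proof. by rewrite !mxE. Qed.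

Lemma vL2_vx v k : tfv v -> adm k -> vL2 (vx v k).
Proof.
move=> tv ak l; under eq_fun do rewrite vxE.
have tq := tf_quot (tv l) ak; have [r r0 [b b0 qb]] := tf_box tq.
apply: (@L2_campbell _ r b) => //.
 apply: mfunM; first exact: mcomp (mbl_ex ak) measurable_fst.
 exact: mcomp (tf_mbl tq) measurable_snd.
move=> p; rewrite normrM ger0_norm ?ex_ge0//.
apply: le_trans (qb p.2); rewrite ler_piMl//; exact: ex_le1.
Qed.

(** One bound serves the fields with and without their exponential factors, which are at most 1.
    Both are needed to pull these factors out of the integral over [x]. *)
Lemma vx_box A (L : R) w v k v' k' : mfield A L -> weight w -> tfv v -> tfv v' -> adm k -> adm k' ->
 exists r, exists2 b, 0 <= b & forall p,
  `|w p.2 * bilin (vx v k p.1 p.2) (A p) (vx v' k' p.1 p.2)| <= b * \1_(cube r) p.2 /\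
  `|w p.2 * bilin ((1 + k p.2)^-1 *: v p.2) (A p) ((1 + k' p.2)^-1 *: v' p.2)| <= b * \1_(cube r) p.2.
Proof.
move=> mA ww tv tv' ak ak'.
have tq l := tf_quot (tv l) ak; have tq' l := tf_quot (tv' l) ak'.
have [mw w01] := ww.
have box_l l : exists rb : R * R, 0 <= rb.2 /\ forall x,
  `|((1 + k x)^-1 *: v x) ord0 l| <= rb.2 * \1_(cube rb.1) x /\
  `|((1 + k' x)^-1 *: v' x) ord0 l| <= rb.2 * \1_(cube rb.1) x.
 have [r r0 [b b0 rb]] := tf_box (tq l); have [r' r'0 [b' b'0 rb']] := tf_box (tq' l).
 exists (Num.max r r', b + b'); split=> /= [|x]; first exact: addr_ge0.
 have ind (y y' z : R) : y <= Num.max r r' -> z <= b + b' -> 0 <= z ->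
   z * \1_(cube y) x <= (b + b') * \1_(cube (Num.max r r')) x.
  move=> yr zb z0; rewrite !indicE; case: (boolP (_ \in cube y)) => [/set_mem xy|_].
   by rewrite mem_set ?mulr1//; exact: sub_cube yr _ xy.
  by rewrite mulr0 mulr_ge0// addr_ge0.
 by rewrite !mxE; split; [apply: le_trans (rb x) _|apply: le_trans (rb' x) _];
   apply: (ind _ 0); rewrite ?le_max ?lexx ?orbT ?lerDl ?lerDr.
pose rb l := proj1_sig (cid (box_l l)).
have rbP l : 0 <= (rb l).2 /\ forall x,
  `|((1 + k x)^-1 *: v x) ord0 l| <= (rb l).2 * \1_(cube (rb l).1) x /\
  `|((1 + k' x)^-1 *: v' x) ord0 l| <= (rb l).2 * \1_(cube (rb l).1) x.
 by rewrite /rb; case: cid.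
pose r := \sum_(l < d) `|(rb l).1|; pose b := \sum_(l < d) (rb l).2 ^+ 2.
have b0 : 0 <= b by apply: sumr_ge0 => l _; exact: sqr_ge0.
have sq x : sqnorm ((1 + k x)^-1 *: v x) <= b * \1_(cube r) x /\
      sqnorm ((1 + k' x)^-1 *: v' x) <= b * \1_(cube r) x.
 have one (y : R) l : `|y| <= (rb l).2 * \1_(cube (rb l).1) x -> y ^+ 2 <= (rb l).2 ^+ 2 * \1_(cube r) x.
  rewrite !indicE => yb; rewrite -real_normK ?num_real//; have := normr_ge0 y; have [h0 _] := rbP l.
  move: yb; case: (boolP (_ \in cube (rb l).1)) => [/set_mem xl|_].
   rewrite mulr1 mem_set ?mulr1; first by move=> h1 h2; nra.
   apply: sub_cube xl; rewrite /r (bigD1 l)//=; apply: le_trans (ler_norm _) _.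
   by rewrite lerDl sumr_ge0.
  rewrite mulr0 => h1 h2; have y0 : `|y| = 0 by apply/eqP; rewrite eq_le h1 h2.
  by rewrite y0 expr2 mul0r mulr_ge0 ?sqr_ge0 ?ler0n.
 by rewrite /sqnorm /b !mulr_suml; split; apply: ler_sum => l _; apply: one; have [_ /(_ x)[]] := rbP l.
have [_ _ A0] := mA.
have gen p (u u' : E) : sqnorm u <= b * \1_(cube r) p.2 -> sqnorm u' <= b * \1_(cube r) p.2 ->
  `|w p.2 * bilin u (A p) u'| <= (`|L| * b) * \1_(cube r) p.2.
 move=> hu hu'; have /andP[w0 w1] := w01 p.2; rewrite normrM (ger0_norm w0).
 apply: le_trans (_ : `|bilin u (A p) u'| <= _); first by rewrite ler_piMl.
 apply: le_trans (bilin_AMGM mA _ _ _) _.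
 have /andP[_ h1] := A0 p u; have /andP[_ h2] := A0 p u'.
 have g (z : E) : sqnorm z <= b * \1_(cube r) p.2 -> L * sqnorm z <= `|L| * b * \1_(cube r) p.2.
  move=> hz; rewrite -mulrA; apply: le_trans (_ : `|L| * sqnorm z <= _).
   by rewrite ler_wpM2r ?sqnorm_ge0// ler_norm.
  by rewrite ler_wpM2l.
 have := g _ hu; have := g _ hu'; lra.
exists r, (`|L| * b); first by rewrite mulr_ge0.
move=> p; have [s1 s2] := sq p.2; split; last exact: gen.
have small (kk : E -> R) (z : E) : adm kk -> sqnorm z <= b * \1_(cube r) p.2 ->
  sqnorm (ex kk p.1 *: z) <= b * \1_(cube r) p.2.
 move=> akk; apply: le_trans; rewrite /sqnorm; apply: ler_sum => l _.
 rewrite mxE exprMn ler_piMl ?sqr_ge0//.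
 have := ex_le1 p.1 akk; have := ex_ge0 kk p.1; nra.
by apply: gen; apply: small.
Qed.

Lemma mbl_quot_form A (L : R) w v k v' k' : mfield A L -> weight w -> tfv v -> tfv v' ->
 adm k -> adm k' -> mbl (fun p : M * E =>
  w p.2 * bilin ((1 + k p.2)^-1 *: v p.2) (A p) ((1 + k' p.2)^-1 *: v' p.2)).
Proof.
move=> [mA _ _] [mw _] tv tv' ak ak'.
have tq l := tf_quot (tv l) ak; have tq' l := tf_quot (tv' l) ak'.
apply: mfunM; first exact: mcomp mw measurable_snd.
under eq_fun do rewrite bilinE.
apply: measurable_sum => l; apply: measurable_sum => j.
apply: mfunM; last first.
 under eq_fun do rewrite mxE.
 exact: mcomp (tf_mbl (tq' l)) measurable_snd.
apply: mfunM => //; under eq_fun do rewrite mxE.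
exact: mcomp (tf_mbl (tq j)) measurable_snd.
Qed.

Lemma en_vx A (L : R) w v k v' k' : mfield A L -> weight w -> tfv v -> tfv v' -> adm k -> adm k' ->
 en A w (vx v k) (vx v' k') =
 \int[P]_mu (lin (fun x => w x * bilin ((1 + k x)^-1 *: v x) (A (mu, x)) ((1 + k' x)^-1 *: v' x)) mu
   * ex (pmul k k') mu).
Proof.
move=> mA ww tv tv' ak ak'.
have [mw w01] := ww.
have [r [b b0 bP]] := vx_box mA ww tv tv' ak ak'.
have mvx : mbl (fun p : M * E => w p.2 * bilin (vx v k p.1 p.2) (A p) (vx v' k' p.1 p.2)).
 apply: mfunM; first exact: mcomp mw measurable_snd.
 by apply: (mbl_bilin mA); apply: vL2_vx.
rewrite /en (campbell_Rintegral mvx b0 (fun p => (bP p).1)).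
apply: eq_Rintegral => mu _.
have tb := bounded_sec mu (mbl_quot_form mA ww tv tv' ak ak') b0 (fun p => (bP p).2).
rewrite mulrC -linZ; [|exact: tf_mbl tb|exact: tf_bsupp tb].
congr lin; apply/funext => x /=; rewrite /vx -(exM mu ak ak').
rewrite (bilinZl (ex k mu)) (bilinZr (ex k' mu)).
move: (ex _ _) (ex _ _) (bilin _ _ _) (w x) => a1 a2 a3 a4; ring.
Qed.

(** Mecke's formula adds a point at [x], hence a factor [(1 + k x) (1 + k' x)], which cancels the
    two denominators. *)
Lemma en_vx_id w v k v' k' : weight w -> tfv v -> tfv v' -> adm k -> adm k' ->
 en (@idf) w (vx v k) (vx v' k') =
 mI (fun x => w x * \sum_(l < d) v x ord0 l * v' x ord0 l) * expR (mI (pmul k k')).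
Proof.
move=> ww tv tv' ak ak'; rewrite (en_vx (@mfield_id) ww tv tv' ak ak').
have tg : tf (fun x => w x * \sum_(l < d) ((1 + k x)^-1 * v x ord0 l) * ((1 + k' x)^-1 * v' x ord0 l)).
 have [mw w01] := ww; under eq_fun do rewrite mulrC.
 apply: tfM => //.
  by apply: tf_sum => l; apply: tf_mul; [exact: tf_quot (tv l) ak|exact: tf_quot (tv' l) ak'].
 by exists 1 => x; have /andP[h1 h2] := w01 x; rewrite ger0_norm.
have := mecke tg (adm_pmul ak ak').
have -> : (fun x => w x * (\sum_(l < d) (1 + k x)^-1 * v x ord0 l * ((1 + k' x)^-1 * v' x ord0 l)) * (1 + pmul k k' x)) =
  fun x => w x * \sum_(l < d) v x ord0 l * v' x ord0 l.
 apply/funext => x; rewrite pmulE -mulrA; congr (_ * _); rewrite mulr_suml.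
 apply: eq_bigr => l _; field; rewrite !lt0r_neq0//; exact: adm_gt0.
move=> <-; apply: eq_Rintegral => mu _; congr (lin _ _ * _); apply/funext => x.
by rewrite bilin1; congr (_ * _); apply: eq_bigr => l _; rewrite !mxE.
Qed.

End exponential_fields.

(** * The coefficient field and its locality *)

Section coefficient_field.
Variables (Lambda : R) (a0 : M -> 'M[R]_d).
Hypothesis aa : admissible Lambda a0.

Definition cof (p : M * E) : 'M[R]_d := coef a0 p.1 p.2.

Lemma mfield_coef : mfield cof Lambda.
Proof.
have [ma sa ea _] := aa; split => [k l|p|p v].
- exact: mcomp (ma k l) mbl_shift.
- exact: sa.
- have /andP[h1 h2] := ea (Defs.shift (- p.2) p.1) v.
 by apply/andP; split => //; exact: le_trans (sqnorm_ge0 v) h1.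
Qed.

Lemma coef_ge (p : M * E) (v : E) : sqnorm v <= bilin v (cof p) v.
Proof. by have [_ _ ea _] := aa; have /andP[] := ea (Defs.shift (- p.2) p.1) v. Qed.

Lemma coef_local (U : set E) mu x : (forall y, unit_ball (y - x) -> U y) ->
 cof (restr mu U, x) = cof (mu, x).
Proof.
move=> xU; have [_ _ _ la] := aa; rewrite /cof /coef la [RHS]la; congr a0.
apply: config_ext => A /=; congr (mu _); apply/seteqP; split=> y /=; first by case.
by move=> [Ay By]; split => //; exact: xU.
Qed.

End coefficient_field.

(** * The energy inequality for the weighted operator *)

Section energy_inequality.
Variables (I : Type) (h : I -> E -> R) (v : I -> E -> E).
Hypotheses (ah : forall i, adm (h i)) (tv : forall i, tfv (v i)).
Implicit Types (s t : seq (R * I)) (phi w : E -> R) (g : E -> E).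

Let mI_D := mID.
Let mI_Z := mIZ.

Let mI_B (f g : E -> R) : tf f -> tf g -> mI (fun x => f x - g x) = mI f - mI g.
Proof.
move=> tf_f tg; rewrite -mulN1r -(mI_Z _ tg) -(mI_D tf_f (tfZ _ tg)).
by apply: eq_mI => x; rewrite mulN1r.
Qed.

Definition fF i := vx (v i) (h i).

(** By the product rule the gradient of the exponential of [phi h] splits in two: [fY] carries
    [phi grad h], and [fB] carries [h grad phi]. *)
Definition fY phi i := vx (fun x => phi x *: v i x) (fun x => phi x * h i x).

Definition fB phi g i := vx (fun x => h i x *: g x) (fun x => phi x * h i x).

Definition gF s (mu : M) (x : E) : E := \sum_(a <- s) a.1 *: fF a.2 mu x.

(** The normalization in [gam], which leaves the expectation unchanged. *)
Definition kap phi i := expR (mI (h i) - mI (fun x => phi x * h i x)).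

Definition gY phi s (mu : M) (x : E) : E := \sum_(a <- s)
 (a.1 * kap phi a.2) *: fY phi a.2 mu x.

Definition gB phi g s (mu : M) (x : E) : E := \sum_(a <- s)
 (a.1 * kap phi a.2) *: fB phi g a.2 mu x.

Definition bv g := forall l, mbl (fun x => g x ord0 l) /\
 exists b, forall x, `|g x ord0 l| <= b.

Lemma tfv_scale phi i : weight phi -> tfv (fun x => phi x *: v i x).
Proof.
move=> [mp p01] l; under eq_fun do rewrite mxE mulrC.
apply: (tfM (tv i l)) => //; exists 1 => x; have /andP[h1 h2] := p01 x.
by rewrite ger0_norm.
Qed.

Lemma tfv_hg g i : bv g -> tfv (fun x => h i x *: g x).
Proof.
move=> bg l; under eq_fun do rewrite mxE; have [mg bgl] := bg l.
exact: tfM (ah i).1 mg bgl.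
Qed.

Lemma admw phi i : weight phi -> adm (fun x => phi x * h i x).
Proof. by move=> [mp p01]; exact: adm_scale. Qed.

Lemma vL2_F s : vL2 (gF s).
Proof.
by apply: vL2_sum => a; apply: vL2Z; exact: (vL2_vx (tv a.2) (ah a.2)).
Qed.

Lemma vL2_Y phi s : weight phi -> vL2 (gY phi s).
Proof.
move=> wp; apply: vL2_sum => a; apply: vL2Z.
exact: (vL2_vx (tfv_scale a.2 wp) (admw a.2 wp)).
Qed.

Lemma vL2_B phi g s : weight phi -> bv g -> vL2 (gB phi g s).
Proof.
move=> wp bg; apply: vL2_sum => a; apply: vL2Z.
exact: (vL2_vx (tfv_hg a.2 bg) (admw a.2 wp)).
Qed.

Lemma gY1 s : gY (fun=> 1) s = gF s.
Proof.
apply/funext => mu; apply/funext => x; apply: eq_bigr => a _.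
rewrite /kap /fY (_ : (fun x => 1 * h a.2 x) = h a.2); last by apply/funext => y; rewrite mul1r.
rewrite subrr expR0 mulr1; congr (_ *: vx _ _ _ _).
by apply/funext => y; rewrite scale1r.
Qed.

Lemma en_sum2 A (L : R) w (f f' : I -> R) (F F' : I -> M -> E -> E) s t : mfield A L -> weight w ->
 (forall i, vL2 (F i)) -> (forall i, vL2 (F' i)) ->
 en A w (fun mu x => \sum_(a <- s) (a.1 * f a.2) *: F a.2 mu x)
   (fun mu x => \sum_(a <- t) (a.1 * f' a.2) *: F' a.2 mu x) =
 qf (fun i j => f i * f' j * en A w (F i) (F' j)) s t.
Proof.
move=> mA ww sF sF'; rewrite (en_suml mA _ ww); last 2 first.
- by move=> a; exact: vL2Z.
- by apply: vL2_sum => a; exact: vL2Z.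
apply: eq_bigr => a _; rewrite (enZl mA _ ww)//; last by apply: vL2_sum => b; exact: vL2Z.
rewrite (en_sumr mA _ ww)//; last by move=> b; exact: vL2Z.
rewrite mulr_sumr; apply: eq_bigr => b _; rewrite (enZr mA _ ww)//.
move: (en _ _ _ _) => e; ring.
Qed.

Definition uno (i : I) : R := 1.

Lemma gFE s : gF s = fun mu x => \sum_(a <- s) (a.1 * uno a.2) *: fF a.2 mu x.
Proof. by apply/funext => mu; apply/funext => x; apply: eq_bigr => a _; rewrite mulr1. Qed.

Definition mv w i j := mI (fun x => w x * \sum_(l < d) v i x ord0 l * v j x ord0 l).

Lemma kap_exp phi phi' i j : weight phi -> weight phi' ->
 kap phi i * kap phi' j * expR (mI (pmul (fun x => phi x * h i x) (fun x => phi' x * h j x))) =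
 eK h i j * expR (mh h (fun x => phi x * phi' x) i j).
Proof.
move=> wp wp'; rewrite (mI_pmul (admw i wp).1 (admw j wp').1) /kap /eK.
have -> : mI (fun x => phi x * h i x * (phi' x * h j x)) = mh h (fun x => phi x * phi' x) i j.
 by apply: eq_mI => x; ring.
by rewrite -!expRD; congr expR; ring.
Qed.

Lemma weightM phi phi' : weight phi -> weight phi' -> weight (fun x => phi x * phi' x).
Proof.
move=> [mp p01] [mp' p01']; split; first exact: mfunM.
by move=> x; have /andP[h1 h2] := p01 x; have /andP[h3 h4] := p01' x; apply/andP; split; nra.
Qed.

Lemma en_Y_id w phi s : weight w -> weight phi ->
 en (@idf) w (gY phi s) (gY phi s) =
 qf (fun i j => eK h i j * mv (fun x => w x * (phi x * phi x)) i j *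
   expR (mh h (fun x => phi x * phi x) i j)) s s.
Proof.
move=> ww wp; rewrite (en_sum2 (kap phi) (kap phi) s s (@mfield_id) ww); last 2 first.
- by move=> i; exact: (vL2_vx (tfv_scale i wp) (admw i wp)).
- by move=> i; exact: (vL2_vx (tfv_scale i wp) (admw i wp)).
apply: eq_qf => i j.
rewrite (en_vx_id ww (tfv_scale i wp) (tfv_scale j wp) (admw i wp) (admw j wp)).
have -> : mI (fun x => w x * \sum_(l < d) (phi x *: v i x) ord0 l * (phi x *: v j x) ord0 l) =
  mv (fun x => w x * (phi x * phi x)) i j.
 apply: eq_mI => x; rewrite -mulrA; congr (_ * _); rewrite mulr_sumr.
 by apply: eq_bigr => l _; rewrite !mxE; ring.
by rewrite mulrCA kap_exp//; move: (mv _ _ _) (eK _ _ _) (expR _) => x y z; ring.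
Qed.

Lemma psd_mv K w : weight w -> psd K -> psd (fun i j => K i j * mv w i j).
Proof.
move=> ww pK; have wb := weight_nnbounded ww.
apply: eq_psd (psd_sum (index_enum 'I_d) (fun l => psd_feature pK
  (v := fun i x => v i x ord0 l) (fun i => tv i l) wb)) => i j.
rewrite -mulr_sumr; congr (_ * _); rewrite -(mI_sum).
 by apply: eq_mI => x; rewrite mulr_sumr.
by move=> l; exact: tf_weight wb (tv i l) (tv j l).
Qed.

Lemma tf_dot i j w : weight w -> tf (fun x => w x * \sum_(l < d) v i x ord0 l * v j x ord0 l).
Proof.
move=> ww; have wb := weight_nnbounded ww.
under eq_fun do rewrite mulr_sumr.
by apply: tf_sum => l; exact: tf_weight wb (tv i l) (tv j l).
Qed.

Lemma mvB w w' i j : weight w -> weight w' -> mv (fun x => w' x - w x) i j = mv w' i j - mv w i j.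
Proof.
move=> ww ww'; rewrite /mv -(mI_B (tf_dot i j ww') (tf_dot i j ww)).
by apply: eq_mI => x; move: (\sum_(l < d) _) => y; ring.
Qed.

(** Two monotonicities of kernels are added: the weight [w phi^2] against [w] in the gradient
    factor, and [phi^2] against 1 in the exponent. *)
Lemma le_en_Y w phi s : weight w -> weight phi ->
 en (@idf) w (gY phi s) (gY phi s) <= en (@idf) w (gF s) (gF s).
Proof.
move=> ww wp; have w1 := @weight1; have wpp := weightM wp wp.
have w11 := weightM w1 w1.
have wwpp := weightM ww wpp; have ww11 := weightM ww w11.
have le1 x : phi x * phi x <= 1 * 1 by rewrite mul1r; exact: (weight_le1 x wpp).
have le2 x : w x * (phi x * phi x) <= w x * (1 * 1).
 by rewrite ler_wpM2l//; have [_ /(_ x)/andP[]] := ww.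
rewrite -gY1 !en_Y_id//; apply: le_qf.
apply: eq_psd (psdD (psd_expR ah w11 (psd_mv (weightB wwpp ww11 le2) (psd_eK h)))
  (psd_expRB ah wpp w11 le1 (psd_mv wwpp (psd_eK h)))) => i j.
rewrite (mvB i j wwpp ww11); move: (mv _ _ _) (mv _ _ _) (eK _ _ _) (expR _) (expR _) => a b c e f.
ring.
Qed.

(** Three kernel inequalities are added: [|g|^2 <= Cg (phi' - phi)] in the Gram factor, then
    [phi^2 <= phi] in the exponent, then the convexity bound [psd_expRB1]. Squares of gradients of
    cutoffs are thus paid by increments of [gam]. *)
Lemma le_en_B w phi phi' g (Cg : R) s : weight w -> weight phi -> weight phi' -> bv g -> 0 <= Cg ->
 (forall x, phi x <= phi' x) -> (forall x, sqnorm (g x) <= Cg * (phi' x - phi x)) ->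
 en (@idf) w (gB phi g s) (gB phi g s) <=
  Cg * (qf (gK h phi') s s - qf (gK h phi) s s).
Proof.
move=> ww wp wp' bg Cg0 pp' gC.
have wpp := weightM wp wp.
rewrite (en_sum2 (kap phi) (kap phi) s s (@mfield_id) ww); last 2 first.
- by move=> i; exact: (vL2_vx (tfv_hg i bg) (admw i wp)).
- by move=> i; exact: (vL2_vx (tfv_hg i bg) (admw i wp)).
pose q x := w x * sqnorm (g x).
rewrite (@eq_qf _ _ _ (fun i j => eK h i j * mh h q i j * expR (mh h (fun x => phi x * phi x) i j))); last first.
 move=> i j; rewrite (en_vx_id ww (tfv_hg i bg) (tfv_hg j bg) (admw i wp) (admw j wp)).
 have -> : mI (fun x => w x * \sum_(l < d) (h i x *: g x) ord0 l * (h j x *: g x) ord0 l) = mh h q i j.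
  apply: eq_mI => x; rewrite /q /sqnorm -mulrA; congr (_ * _); rewrite mulr_suml.
  by apply: eq_bigr => l _; rewrite !mxE; ring.
 by rewrite mulrCA kap_exp//; move: (mh _ _ _ _) (eK _ _ _) (expR _) => x y z; ring.
have mq : mbl q.
 apply: mfunM; first by case: ww.
 by apply: measurable_sum => l; apply: mfunX; exact: (bg l).1.
have qC x : 0 <= q x <= Cg * (phi' x - phi x).
 have [_ /(_ x)/andP[w0 w1]] := ww; rewrite /q mulr_ge0 ?sqnorm_ge0//=.
 by apply: le_trans (gC x); rewrite ler_piMl// sqnorm_ge0.
have D01 x : 0 <= phi' x - phi x <= 1 by have [_] := weightB wp wp' pp'; exact.
have mD : mbl (fun x => phi' x - phi x) by case: (weightB wp wp' pp').
have nq : nnbounded (fun x => Cg * (phi' x - phi x) - q x).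
 split; first by apply: mfunB => //; exact: mfunM.
 exists Cg => x; have /andP[h1 h2] := qC x; have /andP[h3 h4] := D01 x; apply/andP; split; nra.
have nD : nnbounded (fun x => phi' x - phi x) by split => //; exists 1.
have nqq : nnbounded q.
 by split => //; exists Cg => x; have /andP[h1 h2] := qC x; have /andP[h3 h4] := D01 x; apply/andP; split; nra.
have le1 x : phi x * phi x <= phi x.
 by have [_ /(_ x)/andP[h1 h2]] := wp; rewrite ler_piMl.
rewrite -qfB -qfZ; apply: le_qf.
have p1 := psd_expR ah wpp (psd_feature (psd_eK h) (tf_h ah) nq).
have pD := psdZ Cg0 (psd_feature (psd_eK h) (tf_h ah) nD).
have p2 := psd_expRB ah wpp wp le1 pD.
have p3 := psdZ Cg0 (psd_expRB1 ah wp wp' pp' (psd_eK h)).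
apply: eq_psd (psdD (psdD p1 p2) p3) => i j.
have -> : mI (fun x => (Cg * (phi' x - phi x) - q x) * (h i x * h j x)) =
  Cg * mh h (fun x => phi' x - phi x) i j - mh h q i j.
 have t1 := tf_weight nD (tf_h ah i) (tf_h ah j); have t2 := tf_weight nqq (tf_h ah i) (tf_h ah j).
 rewrite -(mI_Z Cg t1) -(mI_B (tfZ _ t1) t2).
 by apply: eq_mI => x; ring.
rewrite /gK -/(mh h (fun x => phi' x - phi x) i j).
move: (mh h (fun x => phi' x - phi x) i j) (mh h q i j) (expR (mh h phi' i j)) (expR (mh h phi i j))
 (expR (mh h (fun x => phi x * phi x) i j)) (eK h i j) => a b c e f k.
ring.
Qed.

Section local_part.
Variables (A : M * E -> 'M[R]_d) (L : R) (D U : set E) (phi : E -> R).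
Hypotheses (mA : mfield A L) (mD : measurable D) (mU : measurable U) (DU : D `<=` U)
(locA : forall mu x, D x -> A (restr mu U, x) = A (mu, x)).

Lemma weight_indic (B : set E) : measurable B -> weight (\1_B).
Proof.
move=> mB; split; first exact: mindic.
by move=> x; rewrite indicE; case: (_ \in _); rewrite ?lexx ?ler01.
Qed.

Definition fU i := vx (v i) (fun x => \1_U x * h i x).

(** The factor of the pairing that depends only on the configuration in [U]: the exponents are
    truncated to [U]. *)
Definition z i j := en A (\1_D) (fU i) (fU j).

Let wU := weight_indic mU.
Let wUc := weight_indic (measurableC mU).
Let wD := weight_indic mD.

Lemma psd_z : psd z.
Proof.
move=> s; have := en_ge0 mA (fun mu x => \sum_(a <- s) (a.1 * uno a.2) *: fU a.2 mu x) wD.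
rewrite (en_sum2 uno uno s s mA wD); last 2 first.
- by move=> i; exact: (vL2_vx (tv i) (admw i wU)).
- by move=> i; exact: (vL2_vx (tv i) (admw i wU)).
by rewrite (eq_qf (K' := z))// => i j; rewrite !mul1r.
Qed.

Lemma L2_lin_kernel (Q : M * E -> R) (r b : R) : mbl Q -> 0 <= b ->
 (forall p, `|Q p| <= b * \1_(cube r) p.2) -> L2 P (fun mu => lin (fun x => Q (mu, x)) mu).
Proof.
move=> mQ b0 Qb.
have sN : L2 P (fun mu : M => b * fine (mu (cube r))).
 by apply: L2Z; apply: (L2_count (cube_mbl r) (cube_bnd r)).
apply: (le_nrm _ sN _).1 => [|mu]; last first.
 apply: le_trans (ler_norm _); apply: lin_le_count => [|x]; last exact: Qb (mu, x).
 exact: mcomp mQ (measurable_pair1 mu).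
rewrite (_ : (fun mu => _) = fun mu : M => fine (\int[mu]_x ((EFin \o Q)^\+ (mu, x)) - \int[mu]_x ((EFin \o Q)^\- (mu, x)))%E).
 apply: mcomp => //; apply: emeasurable_funB.
  apply: (mbl_cfg_integral (c := id) _ (f := (EFin \o Q)^\+%E)) => //.
  exact/measurable_funepos/mEFin.
 apply: (mbl_cfg_integral (c := id) _ (f := (EFin \o Q)^\-%E)) => //.
 exact/measurable_funeneg/mEFin.
by apply/funext => mu; rewrite /lin /Rintegral integralE; congr (fine (_ - _)%E);
 apply: eq_integral => x _; rewrite ?funeposE ?funenegE.
Qed.

(** On [D] the coefficient sees only the configuration in [U], where moreover [phi = 1]. The
    integrand is thus a function of that configuration, of mean [z i j], times the exponential of
    [kc] supported off [U], which is independent of it. *)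
Lemma en_vx_local i j : weight phi -> (forall x, U x -> phi x = 1) ->
 kap phi j * en A (\1_D) (vx (v i) (h i)) (vx (fun x => phi x *: v j x) (fun x => phi x * h j x)) =
 expR (mI (fun x => \1_(~` U) x * h i x)) * expR (mI (fun x => \1_(~` U) x * h j x)) * z i j *
  expR (mh h (fun x => \1_(~` U) x * phi x) i j).
Proof.
move=> wp phiU.
have aUi := admw i wU; have aUj := admw j wU.
pose Q (p : M * E) := \1_D p.2 * bilin ((1 + \1_U p.2 * h i p.2)^-1 *: v i p.2) (A p)
 ((1 + \1_U p.2 * h j p.2)^-1 *: v j p.2).
have mQ : mbl Q by exact: mbl_quot_form mA wD (tv i) (tv j) aUi aUj.
have [r [b b0 bP]] := vx_box mA wD (tv i) (tv j) aUi aUj.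
have Qb p : `|Q p| <= b * \1_(cube r) p.2 by exact: (bP p).2.
have sQ := L2_lin_kernel mQ b0 Qb.
pose e := ex (pmul (fun x => \1_U x * h i x) (fun x => \1_U x * h j x)).
have ae := adm_pmul aUi aUj.
pose Z mu := lin (fun x => Q (mu, x)) mu * e mu.
have sZ : L2 P Z.
 apply: (le_nrm _ sQ _).1 => [|mu].
  by apply: mfunM; [exact: L2_mbl sQ|exact: mbl_ex].
 by rewrite normrM ler_piMr// ger0_norm ?ex_ge0// ex_le1.
have QD p : ~ D p.2 -> Q p = 0 by move=> pD; rewrite /Q indicE memNset// mul0r.
have mZ : measurable_wrt (sigF U) Z.
 apply: sigF_restr => //; first exact: L2_mbl sZ.
 move=> mu; rewrite /Z /e ex_restr//; last first.
  by move=> x xU; rewrite /pmul indicE memNset// !mul0r !addr0.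
 congr (_ * _).
 have tq := bounded_sec mu mQ b0 Qb.
 rewrite -[RHS](@lin_restr mu U _ mU (tf_mbl tq) (tf_bsupp tq)); last first.
  by move=> x xU; apply: QD => /DU.
 congr lin; apply/funext => x; case: (pselect (D x)) => Dx; last by rewrite !QD.
 by rewrite /Q /= locA.
pose kc x := \1_(~` U) x * pmul (h i) (fun x => phi x * h j x) x.
have akc : adm kc.
 by apply: adm_scale; [exact: adm_pmul (ah i) (admw j wp)|exact: wUc.1|exact: wUc.2].
have kcU x : U x -> kc x = 0 by move=> xU; rewrite /kc indicE memNset ?mul0r// => nU; exact: nU.
have cases x : (\1_U x = 1 :> R /\ \1_(~` U) x = 0 :> R /\ phi x = 1) \/ (\1_U x = 0 :> R /\ \1_(~` U) x = 1 :> R).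
 rewrite !indicE in_setC; case: (boolP (x \in U)) => [/set_mem/phiU|] ; by [left|right].
have eE mu : ex (pmul (h i) (fun x => phi x * h j x)) mu = e mu * ex kc mu.
 rewrite /e (exM _ ae akc); congr (ex _ mu); apply/funext => x; rewrite /kc /pmul.
 by case: (cases x) => [[-> [-> ->]]|[-> ->]]; ring.
rewrite (en_vx mA wD (tv i) (tfv_scale j wp) (ah i) (admw j wp)).
have -> : \int[P]_mu (lin (fun x => \1_D x * bilin ((1 + h i x)^-1 *: v i x) (A (mu, x))
   ((1 + phi x * h j x)^-1 *: (phi x *: v j x))) mu * ex (pmul (h i) (fun x => phi x * h j x)) mu) = ip P Z (ex kc).
 apply: eq_Rintegral => mu _; rewrite eE mulrA.
 rewrite (_ : (fun x => \1_D x * _) = fun x => Q (mu, x))//; apply/funext => x.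
 case: (pselect (D x)) => Dx; last by rewrite QD// indicE memNset// mul0r.
 have Ux := DU Dx; have U1 : \1_U x = 1 :> R by rewrite indicE mem_set.
 by rewrite /Q /= U1 (phiU x Ux) scale1r !mul1r.
rewrite (independence sZ mZ akc kcU).
have -> : \int[P]_mu Z mu = z i j by rewrite /z /fU (en_vx mA wD (tv i) (tv j) aUi aUj).
have tUi := (admw i wUc).1; have tUj := (admw j wUc).1.
have wUp := weightM wUc wp.
have -> : mI kc = mI (fun x => \1_(~` U) x * h i x) + mI (fun x => \1_(~` U) x * phi x * h j x) +
  mh h (fun x => \1_(~` U) x * phi x) i j.
 rewrite /mh -(mI_D tUi (admw j wUp).1).
 rewrite -(mI_D (tfD tUi (admw j wUp).1) (tf_weight (weight_nnbounded wUp) (tf_h ah i) (tf_h ah j))).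
 by apply: eq_mI => x; rewrite /kc /pmul; ring.
have -> : kap phi j = expR (mI (fun x => \1_(~` U) x * h j x) - mI (fun x => \1_(~` U) x * phi x * h j x)).
 rewrite /kap -(mI_B (tf_h ah j) (admw j wp).1) -(mI_B tUj (admw j wUp).1); congr expR.
 apply: eq_mI => x; case: (cases x) => [[_ [-> ->]]|[_ ->]]; ring.
move: (mI _) (mI _) (mI _) (mh _ _ _ _) (z i j) => x1 x2 x3 x4 x5.
rewrite mulrCA -expRD -!expRD mulrAC -expRD mulrC; congr (expR _ * _); ring.
Qed.

Lemma en_FY_local s : weight phi -> (forall x, U x -> phi x = 1) ->
 en A (\1_D) (gF s) (gY phi s) =
 qf (fun i j => expR (mI (fun x => \1_(~` U) x * h i x)) * expR (mI (fun x => \1_(~` U) x * h j x)) * z i j *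
  expR (mh h (fun x => \1_(~` U) x * phi x) i j)) s s.
Proof.
move=> wp phiU; rewrite gFE (en_sum2 uno (kap phi) s s mA wD); last 2 first.
- by move=> i; exact: (vL2_vx (tv i) (ah i)).
- by move=> i; exact: (vL2_vx (tfv_scale i wp) (admw i wp)).
by apply: eq_qf => i j; rewrite mul1r en_vx_local.
Qed.

End local_part.

(** By [en_FY_local] the weight [phi] enters only through an exponential of a Gram kernel,
    multiplied by the positive kernel [z]; hence monotonicity in [phi], and [phi <= 1]. *)
Lemma le_en_FY A (L : R) (D U : set E) phi s : mfield A L -> measurable D -> measurable U ->
 D `<=` U -> (forall mu x, D x -> A (restr mu U, x) = A (mu, x)) ->
 weight phi -> (forall x, U x -> phi x = 1) ->
 en A (\1_D) (gF s) (gY phi s) <= en A (\1_D) (gF s) (gF s).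
Proof.
move=> mA mD mU DU locA wp phiU; have w1 := @weight1.
rewrite -[X in en _ _ _ X <= _]/(gY phi s) -[X in _ <= en _ _ _ X](gY1 s).
rewrite (en_FY_local mA mD mU DU locA s wp phiU) (en_FY_local mA mD mU DU locA s w1)//.
have wUc := weight_indic (measurableC mU).
apply: le_qf; have pK := psd_conj (fun i => expR (mI (fun x => \1_(~` U) x * h i x))) (psd_z mA mD mU).
apply: eq_psd (psd_expRB ah (weightM wUc wp) (weightM wUc w1) _ pK) => [i j|x].
 by rewrite mulrBr.
by rewrite ler_wpM2l ?(weight_le1 x wp)//; have [_ /(_ x)/andP[]] := wUc.
Qed.

Section weighted_inequality.
Variables (A : M * E -> 'M[R]_d) (L : R).
Hypotheses (mA : mfield A L) (A_ge1 : forall p u, sqnorm u <= bilin u (A p) u) (L1 : 1 <= L).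
Variables (n : nat) (phi : nat -> E -> R) (g : nat -> E -> E) (D U T : nat -> set E).
Variables (al : nat -> R) (kp Cg eta : R).
Hypotheses (wphi : forall j, weight (phi j)) (bg : forall j, bv (g j))
(mD : forall j, measurable (D j)) (mU : forall j, measurable (U j))
(mT : forall j, measurable (T j)) (DU : forall j, D j `<=` U j)
(locA : forall j mu x, D j x -> A (restr mu (U j), x) = A (mu, x))
(phiU : forall j x, U j x -> phi j x = 1) (DT : forall j x, D j x -> ~ T j x)
(phi_out : forall j x, ~ D j x -> ~ T j x -> phi j x = 0)
(g_out : forall j x, ~ T j x -> g j x = 0) (phi_nd : forall j x, phi j x <= phi j.+1 x)
(Cg0 : 0 <= Cg) (g_bound : forall j x, sqnorm (g j x) <= Cg * (phi j.+1 x - phi j x))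
(al0 : 0 <= al 0%N) (kp1 : 1 <= kp) (al_S : forall j, al j.+1 = kp * al j) (eta0 : 0 < eta).
Hypothesis pointwise : forall x, \sum_(0 <= j < n) (al j.+1 - al j) *
 (\1_(D j) x + ((1 + L) / 2 + eta / 2) * \1_(T j) x) <= al n.

(** The gradient of [Wop], as [gF_wl] confirms for smooth exponentials. *)
Definition gW s (mu : M) (x : E) : E := al n *: gF s mu x -
 \sum_(0 <= j < n) (al j.+1 - al j) *: (gY (phi j) s mu x + gB (phi j) (g j) s mu x).

Let al_nd j : al j <= al j.+1.
Proof.
have al_pos k : 0 <= al k by elim: k => // k ih; rewrite al_S mulr_ge0// (le_trans ler01).
by rewrite al_S ler_peMl.
Qed.

Let vF s := vL2_F s.
Let vY j s := vL2_Y s (wphi j).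
Let vB j s := vL2_B s (wphi j) (bg j).
Let w1 := @weight1.
Let wD j := weight_indic (mD j).
Let wT j := weight_indic (mT j).

Lemma le_FY j s : en A (fun=> 1) (gF s) (gY (phi j) s) <=
 en A (\1_(D j)) (gF s) (gF s) + (1 + L) / 2 * en A (\1_(T j)) (gF s) (gF s).
Proof.
rewrite -(en_addw mA (wD j) (wT j) w1 _ (vF s) (vY j s)); last first.
 move=> p; rewrite !indicE; case: (boolP (_ \in D j)) => [/set_mem Dp|Dp].
  by rewrite memNset ?addr0//; exact: DT.
 case: (boolP (_ \in T j)) => [_|Tp]; first by rewrite add0r.
 rewrite (_ : gY (phi j) s p.1 p.2 = 0) ?bilin0r ?mulr0//.
 rewrite /gY big1// => a _; rewrite /fY /vx phi_out ?scale0r ?scaler0//.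
  by move=> /mem_set Dp'; rewrite Dp' in Dp.
 by move=> /mem_set Tp'; rewrite Tp' in Tp.
apply: lerD; first exact: (le_en_FY s mA (mD j) (mU j) (@DU j) (@locA j) (wphi j) (@phiU j)).
apply: le_trans (en_young mA (wT j) ltr01 (vF s) (vY j s)) _.
have h1 := en_le mA (wT j) (vY j s); have h2 := le_en_Y s (wT j) (wphi j).
have h3 := en_ge mA A_ge1 (wT j) (vF s).
move: h1 h2 h3; move: (en A _ (gY _ _) _) (en (@idf) _ (gY _ _) _) (en A _ (gF s) _)
 (en (@idf) _ (gF s) _) => a b c e h1 h2 h3.
have h4 : L * b <= L * c by rewrite ler_pM2l ?(lt_le_trans ltr01)// (le_trans h2).
lra.
Qed.

(** The field lives on [T]. Young's inequality leaves a share [eta / 2] of the energy there, and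
    [le_en_B] turns the other term into an increment of forms. *)
Lemma le_FB j s : - en A (fun=> 1) (gF s) (gB (phi j) (g j) s) >=
 - (eta / 2 * en A (\1_(T j)) (gF s) (gF s) +
   L * Cg / (2 * eta) * (qf (gK h (phi j.+1)) s s - qf (gK h (phi j)) s s)).
Proof.
rewrite lerN2.
have -> : en A (fun=> 1) (gF s) (gB (phi j) (g j) s) = en A (\1_(T j)) (gF s) (gB (phi j) (g j) s).
 apply: eq_Rintegral => p _; rewrite indicE; case: (boolP (_ \in T j)) => // Tp.
 rewrite (_ : gB (phi j) (g j) s p.1 p.2 = 0) ?bilin0r ?mulr0//.
 rewrite /gB big1// => a _; rewrite /fB /vx g_out ?scaler0//.
 by move=> /mem_set Tp'; rewrite Tp' in Tp.
apply: le_trans (en_young mA (wT j) eta0 (vF s) (vB j s)) _; rewrite lerD2l.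
have h1 := en_le mA (wT j) (vB j s).
have h2 := le_en_B s (wT j) (wphi j) (wphi j.+1) (bg j) Cg0 (@phi_nd j) (@g_bound j).
have L0 : 0 < L by exact: lt_le_trans L1.
apply: le_trans (_ : (2 * eta)^-1 * (L * (Cg * (qf (gK h (phi j.+1)) s s - qf (gK h (phi j)) s s))) <= _).
 by rewrite ler_pM2l ?invr_gt0 ?mulr_gt0//; apply: le_trans h1 _; rewrite ler_pM2l.
by rewrite le_eqVlt; apply/orP; left; apply/eqP; rewrite mulrC !mulrA mulrAC.
Qed.

(** Brings the weighted sum under one integral, so that it can be compared point by point through
    [pointwise]. Integrability is carried in the same induction. *)
Lemma sum_en (r : seq nat) (c : nat -> R) (th : R) s :
 \sum_(j <- r) c j * (en A (\1_(D j)) (gF s) (gF s) + th * en A (\1_(T j)) (gF s) (gF s)) =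
 \int[campbell]_p ((\sum_(j <- r) c j * (\1_(D j) p.2 + th * \1_(T j) p.2)) *
   bilin (gF s p.1 p.2) (A p) (gF s p.1 p.2)) /\
 (campbell).-integrable setT (EFin \o (fun p => (\sum_(j <- r) c j * (\1_(D j) p.2 + th * \1_(T j) p.2)) *
   bilin (gF s p.1 p.2) (A p) (gF s p.1 p.2))).
Proof.
pose b p := bilin (gF s p.1 p.2) (A p) (gF s p.1 p.2).
elim: r => [|j r [ih1 ih2]].
 rewrite big_nil (_ : (fun p => _) = fun=> 0); last by apply/funext => p; rewrite big_nil mul0r.
 split; last exact: integrable0.
 rewrite /Rintegral integral0_eq// => p _; by rewrite big_nil mul0r.
have iD := en_integrable mA (wD j) (vF s) (vF s); have iT := en_integrable mA (wT j) (vF s) (vF s).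
have iDT := integrableZl measurableT (c j) (integrableD measurableT iD (integrableZl measurableT th iT)).
have E1 p : (\sum_(k <- j :: r) c k * (\1_(D k) p.2 + th * \1_(T k) p.2)) * b p =
  c j * (\1_(D j) p.2 * b p + th * (\1_(T j) p.2 * b p)) +
  (\sum_(k <- r) c k * (\1_(D k) p.2 + th * \1_(T k) p.2)) * b p.
 by rewrite big_cons; move: (\sum_(_ <- _) _) (b p) => x y; ring.
have -> : (fun p => (\sum_(k <- j :: r) c k * (\1_(D k) p.2 + th * \1_(T k) p.2)) * bilin (gF s p.1 p.2) (A p) (gF s p.1 p.2)) =
  (fun p => c j * (\1_(D j) p.2 * b p + th * (\1_(T j) p.2 * b p)) +
  (\sum_(k <- r) c k * (\1_(D k) p.2 + th * \1_(T k) p.2)) * b p).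
 by apply/funext => p; exact: E1.
split; last exact: (integrableD measurableT iDT ih2).
have iDT' : (campbell).-integrable setT (EFin \o (fun p => c j * (\1_(D j) p.2 * b p + th * (\1_(T j) p.2 * b p)))) by exact: iDT.
rewrite (RintegralD measurableT iDT' ih2).
rewrite big_cons ih1; congr (_ + _).
rewrite RintegralZl//; last exact: (integrableD measurableT iD (integrableZl measurableT th iT)).
rewrite RintegralD//; last exact: (integrableZl measurableT th iT).
by rewrite RintegralZl.
Qed.

(** The weights are geometric: [al_(j+1) - al_j = (kp - 1) al_j]. Summation by parts then bounds the
    sum of [al_(j+1) (G_(j+1) - G_j)] by the form of [Wop]. *)
Lemma abel_sum s : \sum_(0 <= j < n) (al j.+1 - al j) *
  (qf (gK h (phi j.+1)) s s - qf (gK h (phi j)) s s) <=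
 (kp - 1) * ip P (spn h s) (Wop h n phi al s).
Proof.
pose G j := qf (gK h (phi j)) s s.
have G0 j : 0 <= G j by exact: (psd_gK ah (wphi j)).
have Gnd j : G j <= G j.+1 by apply: (le_gK ah s (wphi j) (wphi j.+1)); exact: phi_nd.
have Gle : G n <= qf (gK h (fun=> 1)) s s.
 by apply: (le_gK ah s (wphi n) w1) => x; exact: weight_le1.
have al_pos k : 0 <= al k by elim: k => // k ih; rewrite al_S mulr_ge0// (le_trans ler01).
rewrite (ip_spn_Wop ah n al wphi) qfB qfZ qf_sum.
have -> : \sum_(0 <= k < n) qf (fun i j => (al k.+1 - al k) * gK h (phi k) i j) s s =
  \sum_(0 <= k < n) (al k.+1 - al k) * G k by apply: eq_bigr => k _; rewrite qfZ.
apply: le_trans (_ : (kp - 1) * \sum_(0 <= j < n) al j.+1 * (G j.+1 - G j) <= _).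
 rewrite mulr_sumr; apply: ler_sum => j _; rewrite mulrA -/(G j.+1) -/(G j) ler_wpM2r ?subr_ge0//.
 have -> : al j.+1 - al j = (kp - 1) * al j by rewrite al_S; ring.
 by rewrite ler_wpM2l ?subr_ge0.
rewrite ler_wpM2l ?subr_ge0//.
have -> : \sum_(0 <= j < n) al j.+1 * (G j.+1 - G j) = al n * G n - al 0%N * G 0%N - \sum_(0 <= k < n) (al k.+1 - al k) * G k.
 elim: n => [|m ih]; first by rewrite !big_geq// subrr subr0.
 by rewrite !big_nat_recr//= ih; ring.
have h1 : al n * G n <= al n * qf (gK h (fun=> 1)) s s by rewrite ler_wpM2l.
have h2 : 0 <= al 0%N * G 0%N by rewrite mulr_ge0.
lra.
Qed.

(** By [pointwise] the energies on the sets [D] and [T] are absorbed in the leading term [al n].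
    What is left over are increments of forms, and [abel_sum] returns them to the form of [Wop]
    itself. *)
Theorem energy_ge s : en A (fun=> 1) (gF s) (gW s) >=
 - (L * Cg / (2 * eta) * (kp - 1) * ip P (spn h s) (Wop h n phi al s)).
Proof.
have vYB j : vL2 (fun mu x => gY (phi j) s mu x + gB (phi j) (g j) s mu x) by apply: vL2D.
rewrite /gW (enBr mA w1); last 3 first.
- by apply: vL2Z.
- by apply: vL2_sum => j; exact: (vL2Z _ (vYB j)).
- exact: vF.
rewrite (enZr mA _ w1 (vF s) (vF s)) (en_sumr mA _ w1 (fun j => vL2Z _ (vYB j)) (vF s)).
have -> : \sum_(0 <= j < n) en A (fun=> 1) (gF s)
  (fun mu x => (al j.+1 - al j) *: (gY (phi j) s mu x + gB (phi j) (g j) s mu x)) =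
 \sum_(0 <= j < n) (al j.+1 - al j) * (en A (fun=> 1) (gF s) (gY (phi j) s) +
   en A (fun=> 1) (gF s) (gB (phi j) (g j) s)).
 by apply: eq_bigr => j _; rewrite (enZr mA _ w1)// (enDr mA w1).
pose th := (1 + L) / 2 + eta / 2; pose c := L * Cg / (2 * eta).
have step : \sum_(0 <= j < n) (al j.+1 - al j) * (en A (fun=> 1) (gF s) (gY (phi j) s) +
   en A (fun=> 1) (gF s) (gB (phi j) (g j) s)) <=
  \sum_(0 <= j < n) (al j.+1 - al j) * (en A (\1_(D j)) (gF s) (gF s) + th * en A (\1_(T j)) (gF s) (gF s)) +
  c * \sum_(0 <= j < n) (al j.+1 - al j) * (qf (gK h (phi j.+1)) s s - qf (gK h (phi j)) s s).
 rewrite mulr_sumr -big_split; apply: ler_sum => j _ /=.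
 rewrite mulrCA -mulrDr ler_wpM2l ?subr_ge0//.
 have hB := le_FB j s; rewrite lerN2 -/c in hB.
 apply: le_trans (lerD (le_FY j s) hB) _; rewrite le_eqVlt; apply/orP; left; apply/eqP; rewrite /th.
 move: (en A (\1_(D j)) _ _) (en A (\1_(T j)) _ _) (qf _ _ _ - qf _ _ _) => a b q; ring.
have [sE si] := sum_en (index_iota 0 n) (fun j => al j.+1 - al j) th s.
have main : \sum_(0 <= j < n) (al j.+1 - al j) * (en A (\1_(D j)) (gF s) (gF s) + th * en A (\1_(T j)) (gF s) (gF s)) <=
  al n * en A (fun=> 1) (gF s) (gF s).
 rewrite sE /en -RintegralZl//; last exact: (en_integrable mA w1 (vF s) (vF s)).
 apply: le_Rintegral => //; first exact: (integrableZl measurableT _ (en_integrable mA w1 (vF s) (vF s))).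
 move=> p _; rewrite mul1r ler_wpM2r ?pointwise//.
 exact: le_trans (sqnorm_ge0 _) (A_ge1 _ _).
have c0 : 0 <= c by rewrite /c divr_ge0 ?mulr_ge0 ?(ltW eta0)// (le_trans ler01).
have := ler_wpM2l c0 (abel_sum s); rewrite mulrA => h1.
rewrite -/c; lra.
Qed.

End weighted_inequality.

End energy_inequality.

Lemma sm_row N (i : 'I_N) (f : E -> R) :
 sm f -> sm (fun X : 'M[R]_(N, d) => f (row i X)).
Proof.
elim=> {f} [c|k l|f g _ sf _ sg|f g _ sf _ sg|u g uu _ sg|g _ sg g0|g _ sg g0].
- exact: sm_cst.
- by under eq_fun do rewrite mxE; exact: sm_coord.
- exact: sm_add.
- exact: sm_mul.
- exact: (sm_comp uu sg).
- by apply: sm_inv => // X.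
- by apply: sm_ln => // X.
Qed.

(** * A smooth sup norm and the cutoffs built on it *)

Section radial.
Implicit Types x y : E.

(** Chosen so that [eps ln (2 d) = 1]: the soft maximum of the [2 d] numbers [x_k] and [-x_k]
    exceeds their maximum by at most 1, in every dimension. *)
Definition eps : R := (ln (2 * d%:R))^-1.

Lemma ln2d_gt0 : 0 < ln (2 * d%:R : R).
Proof.
apply: ln_gt0; have : 1 <= d%:R :> R by rewrite ler1n.
lra.
Qed.

Lemma eps_gt0 : 0 < eps. Proof. by rewrite invr_gt0 ln2d_gt0. Qed.

Definition expsum x : R := \sum_(k < d) (expR (x ord0 k / eps) + expR (- (x ord0 k / eps))).

Lemma expsum_gt0 x : 0 < expsum x.
Proof.
rewrite /expsum (bigD1 (Ordinal d_gt0))//= ltr_pwDl ?addr_gt0 ?expR_gt0//.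
by apply: sumr_ge0 => k _; rewrite addr_ge0// expR_ge0.
Qed.

(* A smooth version of the sup norm: its gradient has Euclidean norm at most 1
  whatever the dimension. *)
Definition rr x : R := eps * ln (expsum x).

Lemma sm_expterm (k : 'I_d) (c : R) : sm (fun x => expR (c * x ord0 k)).
Proof.
apply: sm_comp; first exact: usmooth_expR.
by apply: sm_mul; [exact: sm_cst|exact: sm_coord].
Qed.

Lemma sm_expsum : sm expsum.
Proof.
apply: sm_sum => k; apply: sm_add.
 by under eq_fun do rewrite mulrC; exact: sm_expterm.
by under eq_fun do rewrite mulrC -mulNr; exact: sm_expterm.
Qed.

Lemma sm_rr : sm rr.
Proof.
apply: sm_mul; first exact: sm_cst.
by apply: sm_ln; [exact: sm_expsum|exact: expsum_gt0].
Qed.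

Lemma rr_ge x (k : 'I_d) : `|x ord0 k| <= rr x.
Proof.
rewrite /rr -ler_pdivrMl ?eps_gt0// -(expRK (eps^-1 * _)) ler_ln ?posrE ?expR_gt0 ?expsum_gt0//.
rewrite /expsum (bigD1 k)//=.
have h : 0 <= \sum_(i < d | i != k) (expR (x ord0 i / eps) + expR (- (x ord0 i / eps))).
 by apply: sumr_ge0 => i _; rewrite addr_ge0// expR_ge0.
have h1 := expR_ge0 (x ord0 k / eps); have h2 := expR_ge0 (- (x ord0 k / eps)).
by case: (ger0P (x ord0 k)) => _; rewrite mulrC ?mulNr; lra.
Qed.

Lemma rr_le x (c : R) : (forall k, `|x ord0 k| <= c) -> rr x <= c + 1.
Proof.
move=> xc; have e0 := eps_gt0.
have i0 : 0 < eps^-1 by rewrite invr_gt0.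
have h : expsum x <= 2 * d%:R * expR (c / eps).
 rewrite -mulrA mulrCA mulr_natl -[in leRHS](card_ord d) -sumr_const; apply: ler_sum => k _.
 have := xc k; rewrite ler_norml => /andP[h1 h2].
 have h3 : expR (x ord0 k / eps) <= expR (c / eps) by rewrite ler_expR (ler_pM2r i0).
 have h4 : expR (- (x ord0 k / eps)) <= expR (c / eps).
  by rewrite ler_expR -mulNr (ler_pM2r i0); lra.
 lra.
apply: le_trans (_ : eps * ln (2 * d%:R * expR (c / eps)) <= _).
 rewrite /rr ler_pM2l// ler_ln ?posrE ?expsum_gt0//; exact: lt_le_trans (expsum_gt0 x) h.
rewrite lnM ?posrE ?expR_gt0//; last by rewrite mulr_gt0// ltr0n.
by rewrite expRK mulrDr /eps mulVf ?gt_eqF ?ln2d_gt0// mulrCA -/eps mulfV ?gt_eqF// mulr1 addrC.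
Qed.

Lemma rr_lip x y : (forall k, `|y ord0 k - x ord0 k| <= 1) -> rr y <= rr x + 1.
Proof.
move=> xy; have e0 := eps_gt0.
have i0 : 0 < eps^-1 by rewrite invr_gt0.
have h : expsum y <= expsum x * expR (eps^-1).
 rewrite /expsum mulr_suml; apply: ler_sum => k _; rewrite mulrDl -!expRD.
 have := xy k; rewrite ler_norml => /andP[h1 h2].
 by apply: lerD; rewrite ler_expR; nra.
apply: le_trans (_ : eps * ln (expsum x * expR (eps^-1)) <= _).
 by rewrite /rr ler_pM2l// ler_ln ?posrE ?expsum_gt0// mulr_gt0 ?expsum_gt0 ?expR_gt0.
rewrite lnM ?posrE ?expR_gt0 ?expsum_gt0//.
by rewrite expRK mulrDr mulfV ?gt_eqF.
Qed.

Definition drr (k : 'I_d) x : R :=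
 (expR (x ord0 k / eps) - expR (- (x ord0 k / eps))) / expsum x.

Lemma der_rr (k : 'I_d) x : is_derive x (e_ k) rr (drr k x).
Proof.
have dterm (i : 'I_d) : is_derive x (e_ k : E)
  (fun y : E => expR (y ord0 i / eps) + expR (- (y ord0 i / eps)))
  ((i == k)%:R * (expR (x ord0 i / eps) - expR (- (x ord0 i / eps))) / eps).
 have dc := der_coord x ord0 i (e_ k : E).
 have d1 := der_mul dc (der_const eps^-1 x (e_ k : E)).
 have d2 : is_derive x (e_ k : E) (fun y : E => - (y ord0 i / eps)) (- ((i == k)%:R / eps)).
  have := der_mul (der_const (-1) x (e_ k : E)) d1.
  have -> : (fun y : E => -1 * (y ord0 i / eps)) = fun y : E => - (y ord0 i / eps).
   by apply/funext => y; rewrite mulN1r.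
  by move=> hd; apply: (der_val hd); rewrite !mxE /= eq_sym mul0r mulr0 add0r addr0 mulN1r.
 have := der_add (der_chain (is_derive_expR _) d1) (der_chain (is_derive_expR _) d2).
 move=> hd; apply: (der_val hd); rewrite !mxE /= mulr0 addr0 eq_sym; ring.
have dS : is_derive x (e_ k : E) expsum ((expR (x ord0 k / eps) - expR (- (x ord0 k / eps))) / eps).
 have := @is_derive_sum R E R d (fun i y => expR (y ord0 i / eps) + expR (- (y ord0 i / eps))) x (e_ k) _ dterm.
 have -> : \sum_(i < d) (fun y : E => expR (y ord0 i / eps) + expR (- (y ord0 i / eps))) = expsum.
  by apply/funext => y; rewrite fct_sumE.
 move=> hd; apply: (der_val hd); rewrite (bigD1 k)//= eqxx mul1r big1 ?addr0// => i /negbTE ->.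
 by rewrite !mul0r.
have := der_mul (der_const eps x (e_ k : E)) (der_chain (is_derive1_ln (expsum_gt0 x)) dS).
move=> hd; apply: (der_val hd); rewrite /drr mul0r add0r; field.
by rewrite (lt0r_neq0 eps_gt0) (lt0r_neq0 (expsum_gt0 x)).
Qed.

(** [|drr k x|] is at most the share [p k] of the coordinate [k], and the squares of a probability
    vector sum to at most 1. *)
Lemma sum_drr x : \sum_(k < d) drr k x ^+ 2 <= 1.
Proof.
pose p (k : 'I_d) := (expR (x ord0 k / eps) + expR (- (x ord0 k / eps))) / expsum x.
have p1 : \sum_(k < d) p k = 1 by rewrite -mulr_suml divff// gt_eqF// expsum_gt0.
rewrite -[leRHS]p1; apply: ler_sum => k _.
have S0 := expsum_gt0 x.
have h1 := expR_ge0 (x ord0 k / eps); have h2 := expR_ge0 (- (x ord0 k / eps)).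
have pk1 : p k <= 1.
 rewrite -p1 (bigD1 k)//= lerDl sumr_ge0// => i _.
 by rewrite divr_ge0 ?(ltW S0)// addr_ge0// expR_ge0.
have h : `|drr k x| <= p k.
 rewrite /drr /p normrM (gtr0_norm (x := (expsum x)^-1)) ?invr_gt0// ler_pM2r ?invr_gt0//.
 by rewrite ler_norml; apply/andP; split; lra.
rewrite -real_normK ?num_real//; have := normr_ge0 (drr k x); nra.
Qed.

Definition lam (s : R) x : R := step (4 * (rr x - s)).

(** The square makes the gradient carry a factor [lam], so that its squared norm is bounded by a
    multiple of [lam^2 = 1 - phs]. With [1 - lam] no such bound would hold near the inner edge with
    the same ease. *)
Definition phs (s : R) x : R := 1 - lam s x * lam s x.

Definition dphs (s : R) x : E :=
 \row_k (- (2 * lam s x * (dstep (4 * (rr x - s)) * (4 * drr k x)))).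

Lemma sm_lam s : sm (lam s).
Proof.
apply: sm_step; apply: sm_mul; first exact: sm_cst.
by apply: sm_sub; [exact: sm_rr|exact: sm_cst].
Qed.

Lemma sm_phs s : sm (phs s).
Proof. by apply: sm_sub; [exact: sm_cst|apply: sm_mul; exact: sm_lam]. Qed.

Lemma der_phs s (k : 'I_d) x : is_derive x (e_ k) (phs s) (dphs s x ord0 k).
Proof.
have d1 := der_mul (der_const 4 x (e_ k : E))
 (der_add (der_rr k x) (der_const (- s) x (e_ k : E))).
have d2 := der_chain (g := fun y : E => 4 * (rr y + - s)) (der_step (4 * (rr x - s))) d1.
have d3 := der_mul d2 d2.
have d4 := der_add (der_const 1 x (e_ k : E))
 (der_mul (der_const (-1) x (e_ k : E)) d3).
have -> : phs s = fun y => 1 + -1 * (step (4 * (rr y + - s)) * step (4 * (rr y + - s))).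
 by apply/funext => y; rewrite mulN1r.
by apply: (der_val d4); rewrite mxE /lam; ring.
Qed.

Lemma lam01 s x : 0 <= lam s x <= 1. Proof. by rewrite step_ge0 step_le1. Qed.

Lemma phs01 s x : 0 <= phs s x <= 1.
Proof. by have /andP[h1 h2] := lam01 s x; rewrite /phs; apply/andP; split; nra. Qed.

Lemma phs1 s x : rr x <= s -> phs s x = 1.
Proof. by move=> h; rewrite /phs /lam step0 ?mul0r ?subr0//; lra. Qed.

Lemma phs0 s x : s + 4^-1 <= rr x -> phs s x = 0.
Proof. by move=> h; rewrite /phs /lam step1 ?mul1r ?subrr//; lra. Qed.

Lemma dphs0 s x : rr x <= s \/ s + 4^-1 <= rr x -> dphs s x = 0.
Proof.
move=> h; apply/rowP => k; rewrite !mxE dstep_out ?mul0r ?mulr0 ?oppr0//.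
by case: h => h; [left|right]; lra.
Qed.

Lemma phs_nd s s' x : s <= s' -> phs s x <= phs s' x.
Proof.
move=> ss; have h : lam s' x <= lam s x by apply: step_nd; lra.
by have /andP[h1 h2] := lam01 s x; have /andP[h3 h4] := lam01 s' x; rewrite /phs; nra.
Qed.

(** Throughout the transition of [phs s] the next cutoff is 1, so the difference is exactly [lam^2].
    The 64 is [(2 * 4)^2]: the 2 comes from the square, the 4 from the slope of [lam]. *)
Lemma sqnorm_dphs s x (C : R) : 0 <= C -> (forall y : R, `|dstep y| <= C) ->
 sqnorm (dphs s x) <= 64 * C ^+ 2 * (phs (s + 4^-1) x - phs s x).
Proof.
move=> C0 dC.
have [h|h] := boolP ((rr x <= s) || (s + 4^-1 <= rr x)).
 have -> : sqnorm (dphs s x) = 0.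
  by rewrite dphs0 /sqnorm ?big1//; [move=> i _; rewrite mxE expr0n|case/orP: h; [left|right]].
 rewrite mulr_ge0 ?mulr_ge0 ?sqr_ge0// subr_ge0 phs_nd//; lra.
move: h; rewrite negb_or -!ltNge => /andP[h1 h2].
have -> : phs (s + 4^-1) x - phs s x = lam s x * lam s x.
 by rewrite (@phs1 (s + 4^-1)) /phs; [ring|exact: ltW].
have -> : sqnorm (dphs s x) = 64 * (lam s x * lam s x) * dstep (4 * (rr x - s)) ^+ 2 * \sum_(k < d) drr k x ^+ 2.
 rewrite /sqnorm mulr_sumr; apply: eq_bigr => k _; rewrite mxE; ring.
have h3 : dstep (4 * (rr x - s)) ^+ 2 <= C ^+ 2.
 by rewrite -[leLHS]real_normK ?num_real// lerXn2r ?nnegrE.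
have h4 := sum_drr x; have h5 : 0 <= \sum_(k < d) drr k x ^+ 2 by apply: sumr_ge0 => k _; exact: sqr_ge0.
have h6 : 0 <= 64 * (lam s x * lam s x) by have /andP[? _] := lam01 s x; apply: mulr_ge0 => //; exact: mulr_ge0.
rewrite -mulrA [leRHS](_ : _ = 64 * (lam s x * lam s x) * C ^+ 2); last ring.
rewrite ler_wpM2l//; apply: le_trans (_ : dstep (4 * (rr x - s)) ^+ 2 * 1 <= _); last by rewrite mulr1.
by rewrite ler_wpM2l// sqr_ge0.
Qed.

End radial.

(** * Moving one point, and the gradient as a derivative in finitely many variables *)

Section moving_points.
Implicit Types (f : M -> R) (mu : M) (x y : E) (V : set E).

(** The sets that do not separate [mu] from its restriction form a sigma-algebra containing the
    generators; it is applied to a level set of [f]. *)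
Lemma sigF_inv V f mu : measurable_wrt (sigF V) f -> f (restr mu V) = f mu.
Proof.
move=> mf; pose G := [set A : set M | A (restr mu V) <-> A mu].
have sG : sigma_algebra setT G.
 split; first by split.
  by move=> A [h1 h2]; rewrite setTD; split => nA A'; apply: nA; [exact: h2|exact: h1].
 move=> A GA; split=> -[n _ An]; exists n => //; by have [] := GA n; auto.
have sub : sigF V `<=` G.
 apply: smallest_sub => // _ [W [B [mW WV mB ->]]]; rewrite /G /=.
 by rewrite (setIidl WV); split.
have [h1 _] := sub _ (mf [set f mu] (measurable_set1 _)).
by have [_ ->] := sub _ (mf [set f mu] (measurable_set1 _)).
Qed.

Lemma mbl_wrtT V f : measurable_wrt (sigF V) f -> mbl f.
Proof. by move=> mf _ B mB; rewrite setTI; apply: (@sigF_mbl V); exact: mf. Qed.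

Lemma sigF_inv_sub V (B : set E) f mu : measurable_wrt (sigF V) f -> V `<=` B ->
 f (restr mu B) = f mu.
Proof.
by move=> mf VB; rewrite -(sigF_inv _ mf) restr_restr// sigF_inv.
Qed.

Lemma moved_enum mu x (r : R) : mu [set x] != 0%E -> cube r x ->
 exists N (X : mat N) i0, [/\ row i0 X = x, restr mu (cube r) = sum_config X &
  forall (k : 'I_d) (t : R), cube r (x + t *: delta_mx ord0 k) ->
  restr (move mu x (x + t *: delta_mx ord0 k)) (cube r) = sum_config (t *: delta_mx i0 k + X)].
Proof.
move=> mux rx; have [N [X [XQ XP]]] := config_enum mu (cube_bnd r).
have [i0 i0x] : exists i0, row i0 X = x.
 apply: contrapT => nX; move/negP: mux; apply.
 have : restr mu (cube r) [set x] = sum_config X [set x] by rewrite XP.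
 rewrite /= (setIidl (_ : [set x] `<=` cube r)); last by move=> _ ->.
 move=> ->; rewrite big1// => i _; rewrite diracE memNset//= => Xi; apply: nX.
 by exists i.
exists N, X, i0; split => // k t ry; set y := x + _.
apply: config_ext => A.
change ((move mu x y (A `&` cube r)) = \sum_(i < N) \d_(row i (t *: delta_mx i0 k + X)) A)%E.
rewrite moveE (negbTE mux).
pose S : \bar R := (\sum_(i < N | i != i0) \d_(row i X) A)%E.
have -> : mu (A `&` cube r) = (\d_x A + S)%E.
 by rewrite -[LHS]/(restr mu (cube r) A) XP /= (bigD1 i0)//= i0x.
have yE : row i0 (t *: delta_mx i0 k + X) = y.
 by apply/rowP => j; rewrite /y -i0x !mxE !eqxx addrC.
have -> : (\sum_(i < N) \d_(row i (t *: delta_mx i0 k + X)) A = \d_y A + S)%E.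
 rewrite (bigD1 i0)//= yE; congr (_ + _)%E; apply: eq_bigr => i ii0.
 rewrite (_ : row i _ = row i X)//.
 by apply/rowP => j; rewrite !mxE (negbTE ii0) mulr0 add0r.
have dI (z : E) : cube r z -> \d_z (A `&` cube r) = \d_z A :> \bar R.
 by move=> rz; rewrite !diracE in_setI (mem_set rz) andbT.
by rewrite !dI// (addeC (\d_x A)) addeK 1?addeC// diracE.
Qed.

Lemma cube_move x (k : 'I_d) (r t : R) : cube (r - 2) x -> `|t| <= 1 ->
 cube r (x + t *: delta_mx ord0 k).
Proof.
move=> rx; rewrite ler_norml => /andP[t1 t2] i; have /andP[h1 h2] := rx i; rewrite !mxE eqxx /=.
by case: (i == k); rewrite ?mulr1 ?mulr0; apply/andP; split; lra.
Qed.

(* The difference quotients defining the gradient at an atom of [mu] are those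
  of the function of finitely many variables X |-> f (sum_config X). *)
Lemma move_fun f V (r : R) mu x : measurable_wrt (sigF V) f -> V `<=` cube r ->
 cube (r - 2) x -> mu [set x] != 0%E ->
 exists N (X : mat N) i0, [/\ row i0 X = x, restr mu (cube r) = sum_config X,
  f mu = f (sum_config X) &
  forall (k : 'I_d) (t : R), `|t| <= 1 ->
   f (move mu x (x + t *: delta_mx ord0 k)) = f (sum_config (t *: delta_mx i0 k + X))].
Proof.
move=> mf Vr rx mux; have rx' : cube r x by apply: sub_cube rx; lra.
have [N [X [i0 [Xx XP Xm]]]] := moved_enum mux rx'.
exists N, X, i0; split => //; first by rewrite -XP (sigF_inv_sub _ mf Vr).
move=> k t t1; rewrite -Xm; last exact: cube_move.
by rewrite (sigF_inv_sub _ mf Vr).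
Qed.

Lemma partial_cvg f V (r : R) mu x (k : 'I_d) N (X : mat N) i0 c :
 (forall t : R, `|t| <= 1 ->
   f (move mu x (x + t *: delta_mx ord0 k)) = f (sum_config (t *: delta_mx i0 k + X))) ->
 f mu = f (sum_config X) ->
 is_derive X (delta_mx i0 k) (fun Y : 'M[R]_(N, d) => f (sum_config Y)) c ->
 (fun h : R => h^-1 * (f (move mu x (x + h *: delta_mx ord0 k)) - f mu)) @ 0^' --> c.
Proof.
move=> fm fX [/cvg_ex[l lc] <-].
have -> : 'D_(delta_mx i0 k) (fun Y : 'M[R]_(N, d) => f (sum_config Y)) X = l by apply: cvg_lim.
apply: cvg_trans lc; apply: near_eq_cvg; near=> h => /=.
rewrite fm ?fX//; near: h; exact: dnbhs0_le.
Unshelve. all: by end_near. Qed.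

Lemma partial_move0 f mu x (k : 'I_d) : mu [set x] = 0%E ->
 (fun h : R => h^-1 * (f (move mu x (x + h *: delta_mx ord0 k)) - f mu)) = fun=> 0.
Proof.
move=> mux; apply/funext => h; rewrite /move; case: pselect => [mx|_].
 by exfalso; move: mx; rewrite mux eqxx.
by rewrite subrr mulr0.
Qed.

Lemma Cc_infty_cvg f mu x (k : 'I_d) : Cc_infty f ->
 (fun h : R => h^-1 * (f (move mu x (x + h *: delta_mx ord0 k)) - f mu)) @ 0^' --> partial k f mu x.
Proof.
move=> [_ [V cV mf] sf].
have [mux|mux] := eqVneq (mu [set x]) 0%E.
 by rewrite /partial partial_move0// lim_cst//; exact: cvg_cst.
have [r1 V1] := compact_bnd cV; have [n xn] := cube_cover x.
pose r := `|r1| + n%:R + 2.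
have [N [X [i0 [Xx XP fX fm]]]] : exists N (X : mat N) i0, [/\ row i0 X = x, restr mu (cube r) = sum_config X,
  f mu = f (sum_config X) &
  forall (k : 'I_d) (t : R), `|t| <= 1 ->
   f (move mu x (x + t *: delta_mx ord0 k)) = f (sum_config (t *: delta_mx i0 k + X))].
 apply: (@move_fun f V r mu x mf _ _ mux) => [y /V1|]; first apply: sub_cube; rewrite /r.
  by rewrite -addrA (le_trans (ler_norm r1))// lerDl addr_ge0.
 by apply: sub_cube xn; rewrite addrK lerDr.
have [_ /(_ i0 k)[/(_ X) df _]] := sf N 1%N.
have h := partial_cvg V r (fm k) fX (derivableP df).
by rewrite /partial (cvg_lim _ h).
Qed.

(** For these functions the limit defining the gradient exists at every pair, so the gradient is the
    pointwise limit of the measurable quotients with [h = 1/(n+1)]. *)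
Lemma mbl_grad f : Cc_infty f ->
 forall k, mbl (fun p : M * E => grad f p.1 p.2 ord0 k).
Proof.
move=> cf k; under eq_fun do rewrite mxE.
have mf : mbl f by have [_ [V _ /mbl_wrtT]] := cf.
pose q (n : nat) (p : M * E) : R := n.+1%:R^-1^-1 *
 (f (move p.1 p.2 (p.2 + n.+1%:R^-1 *: delta_mx ord0 k)) - f p.1).
have mq n : mbl (q n).
 apply: mfunM => //; apply: mfunB.
  exact: mcomp mf (mbl_move _).
 exact: mcomp mf measurable_fst.
apply: (measurable_fun_cvg mq) => p _.
have /cvgr_dnbhsP := @Cc_infty_cvg f p.1 p.2 k cf.
move=> /(_ (fun n : nat => n.+1%:R^-1 : R)); apply; split; last exact: cvg_harmonic.
by move=> n; rewrite invr_eq0 pnatr_eq0.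
Qed.

End moving_points.

(** * The Sobolev norm and the energy through the Campbell measure *)

Section sobolev_norm.
Local Notation C := (campbell).
Implicit Types (f : M -> R) (F G : M -> E -> E).

Definition ven F G : R := en (@idf) (fun=> 1) F G.

Lemma integral_sqnorm F : (forall k, mbl (fun p : M * E => F p.1 p.2 ord0 k)) ->
 (\int[P]_mu \int[mu]_x (sqnorm (F mu x))%:E = \int[C]_p (sqnorm (F p.1 p.2))%:E)%E.
Proof.
move=> mF; rewrite (@campbell_integral (fun p => (sqnorm (F p.1 p.2))%:E))//.
 by move=> p; rewrite lee_fin sqnorm_ge0.
by apply/mEFin/measurable_sum => k; apply: mfunX.
Qed.

Lemma vL2P F : (forall k, mbl (fun p : M * E => F p.1 p.2 ord0 k)) ->
 (\int[C]_p (sqnorm (F p.1 p.2))%:E < +oo)%E -> vL2 F.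
Proof.
move=> mF Ffin k; split => //; apply: le_lt_trans Ffin; apply: ge0_le_integral => //.
- by move=> p _; rewrite lee_fin sqr_ge0.
- by apply/mEFin/mfunX.
- by apply/mEFin/measurable_sum => l; apply: mfunX.
- move=> p _; rewrite lee_fin /sqnorm (bigD1 k)//= lerDl sumr_ge0// => l _.
 exact: sqr_ge0.
Qed.

Lemma venE F : vL2 F -> (\int[C]_p (sqnorm (F p.1 p.2))%:E = (ven F F)%:E)%E.
Proof.
move=> sF; rewrite /ven /en /Rintegral fineK; last first.
 exact: integrable_fin_num (en_integrable (@mfield_id) (@weight1) sF sF).
by apply: eq_integral => p _; rewrite mul1r bilin1_sqnorm.
Qed.

Lemma H1sqE f F : L2 P f -> vL2 F -> H1sq P f F = (ip P f f + ven F F)%:E.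
Proof.
move=> sf sF; rewrite /H1sq expectation_sqr// integral_sqnorm ?venE// => k.
exact: (sF k).1.
Qed.

Lemma H1sq_fin f F : mbl f ->
 (forall k, mbl (fun p : M * E => F p.1 p.2 ord0 k)) ->
 (H1sq P f F < +oo)%E -> L2 P f /\ vL2 F.
Proof.
move=> mf mF; rewrite /H1sq integral_sqnorm// unlock => h.
have h1 : (0 <= \int[P]_mu (f mu ^+ 2)%:E)%E by apply: integral_ge0 => mu _; rewrite lee_fin sqr_ge0.
have h2 : (0 <= \int[C]_p (sqnorm (F p.1 p.2))%:E)%E.
 by apply: integral_ge0 => p _; rewrite lee_fin sqnorm_ge0.
split; first by split => //; apply: le_lt_trans h; rewrite leeDl.
by apply: vL2P => //; apply: le_lt_trans h; rewrite leeDr.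
Qed.

Lemma campbell_fubini (g : M * E -> R) : intg C g ->
 (\int[P]_mu \int[mu]_x (g (mu, x))%:E = (\int[C]_p g p)%:E)%E.
Proof.
move=> ig; have [mg gfin] := integrableP _ _ _ ig.
have mgp := measurable_funepos mg; have mgn := measurable_funeneg mg.
rewrite /Rintegral fineK ?integrable_fin_num// integralE.
rewrite !campbell_integral//.
have fin (h : M * E -> \bar R) : (forall p, 0 <= h p)%E -> mbl h ->
  (\int[C]_p h p < +oo)%E -> P.-integrable setT (fun mu => \int[mu]_x h (mu, x))%E.
 move=> h0 mh hfin; apply/integrableP; split.
  exact: (mbl_cfg_integral (c := id) _ h0 mh).
 under eq_integral do rewrite gee0_abs ?integral_ge0//.
 by rewrite -campbell_integral.
rewrite -integralB//.
- apply: eq_integral => mu _; rewrite integralE; congr (_ - _)%E;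
  apply: eq_integral => x _; by rewrite ?funeposE ?funenegE.
- apply: fin => //; exact: integrable_lty (integrable_funepos _ ig).
- apply: fin => //; exact: integrable_lty (integrable_funeneg _ ig).
Qed.

Lemma energyE (a0 : M -> 'M[R]_d) (L : R) F G : mfield (cof a0) L -> vL2 F -> vL2 G ->
 energy P a0 F G = (en (cof a0) (fun=> 1) F G)%:E.
Proof.
move=> ma sF sG; have i1 := en_integrable ma (@weight1) sF sG.
rewrite /en -(campbell_fubini i1); apply: eq_integral => mu _; apply: eq_integral => x _.
by rewrite mul1r.
Qed.

(** A gradient is meaningful only at the points of the configuration; the other pairs are
    negligible, so fields may be compared at atoms only. *)
Lemma campbell_nonatom : C [set p : M * E | p.1 [set p.2] = 0%E] = 0%E.
Proof.
rewrite /campbell /= /campbell_fun (eq_integral (fun=> 0%E)) ?integral0// => mu _.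
set B := xsection _ mu.
have BE : B = [set x | mu [set x] = 0%E].
 by apply/seteqP; split => [x /set_mem//|x xmu]; apply: mem_set.
have [[I [x muE]] _] := configP mu.
rewrite muE esum1// => i Ii; rewrite diracE memNset// BE /= muE => h.
have : (\d_(x i) [set x i] <= \esum_(j in I) \d_(x j) [set x i] :> \bar R)%E.
 apply: (@le_trans _ _ (\esum_(j in [set i]) \d_(x j) [set x i])%E).
  by rewrite esum_set1// measure_ge0.
 rewrite [leRHS](esumID [set i]); last by move=> j _; exact: measure_ge0.
 rewrite (_ : I `&` [set i] = [set i]); last by apply/seteqP; split=> [j []//|j ->].
 by rewrite leeDl// esum_ge0// => j _; exact: measure_ge0.
by rewrite h diracE mem_set// lee_fin ler10.
Qed.

Lemma atom_ae : {ae C, forall p : M * E, p.1 [set p.2] != 0%E}.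
Proof.
exists [set p : M * E | p.1 [set p.2] = 0%E]; split; last 1 first.
- by move=> p /= /negP; rewrite negbK => /eqP.
- have := mbl_atom measurableT (emeasurable_set1 0%E).
 by rewrite setTI.
- exact: campbell_nonatom.
Qed.

End sobolev_norm.

(** * Smooth exponentials and their gradients *)

Section smooth_exponentials.
Implicit Types (mu : M) (x y : E).

Definition expS := {h : E -> R | adm h /\ sm h}.

Definition hS (i : expS) : E -> R := proj1_sig i.

Lemma admS i : adm (hS i). Proof. by case: i => h []. Qed.

Lemma smS i : sm (hS i). Proof. by case: i => h []. Qed.

Definition vS (i : expS) x : E := \row_k ('D_(e_ k) (hS i) x).

Lemma der_hS i (k : 'I_d) x : is_derive x (e_ k) (hS i) (vS i x ord0 k).
Proof.
have [f' sf' df] := sm_derive ord0 k (smS i).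
by rewrite mxE; have [_ ->] := df x; exact: df.
Qed.

Lemma compact_bounded_fun n (f : 'rV[R]_n -> R) (r : R) : continuous f ->
 exists b, forall x : 'rV[R]_n, cube r x -> `|f x| <= b.
Proof.
move=> cf; have : compact (f @` cube r).
 apply: continuous_compact; last exact: cube_compact.
 exact: continuous_subspaceT.
move=> /compact_bounded[B [_ BP]]; exists (B + 1) => x rx.
by apply: (BP (B + 1)); [rewrite ltrDl|exists x].
Qed.

Lemma tfv_vS i : tfv (vS i).
Proof.
move=> k; have [f' sf' df] := sm_derive ord0 k (smS i).
have E1 : (fun x => vS i x ord0 k) = f'.
 by apply/funext => x; rewrite mxE; have [_ ->] := df x.
rewrite E1; have [_ _ [r hr]] := (admS i).1.
have f0 x : ~ cube r x -> f' x = 0.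
 move=> xr; have [_ <-] := df x.
 have clo : closed (@cube R d r) by apply: compact_closed; [exact: norm_hausdorff|exact: cube_compact].
 have near0 : \forall y \near x, (fun=> 0 : R) y = hS i y.
  have := open_nbhs_nbhs (conj (closed_openC clo) xr : open_nbhs x (~` cube r)).
  by apply: filterS => y yr; rewrite hr.
 by rewrite -(near_eq_derive _ near0) derive_cst.
have [b fb] := compact_bounded_fun r (sm_continuous sf').
split; first exact: cts_mbl_mx (sm_continuous sf').
 exists `|b| => x; case: (pselect (cube r x)) => xr; first exact: le_trans (fb x xr) (ler_norm b).
 by rewrite f0// normr0.
by exists r.
Qed.

Lemma ex_sum_config h N (X : mat N) : adm h ->
 ex h (sum_config X) = \prod_(i < N) (1 + h (row i X)).
Proof.
move=> ah; apply: (ex_enum measurableT) => //; last by move=> x /(_ Logic.I).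
by apply: config_ext => A /=; rewrite setIT.
Qed.

Lemma ex_move i mu x (r : R) (k : 'I_d) (t : R) : mu [set x] != 0%E ->
 (forall y, ~ cube r y -> hS i y = 0) -> cube (r - 2) x -> `|t| <= 1 ->
 ex (hS i) (move mu x (x + t *: delta_mx ord0 k)) =
 ex (hS i) mu * (1 + hS i x)^-1 * (1 + hS i (x + t *: delta_mx ord0 k)).
Proof.
move=> mux hr rx t1; have rx' : cube r x by apply: sub_cube rx; lra.
have [N [X [i0 [Xx XP Xm]]]] := moved_enum mux rx'.
have mQ := @cube_mbl r; have ai := admS i.
rewrite (ex_enum mQ (Xm k t (cube_move k rx t1)) ai hr) (ex_enum mQ XP ai hr).
rewrite (bigD1 i0)//= [in RHS](bigD1 i0)//= Xx.
have -> : row i0 (t *: delta_mx i0 k + X) = x + t *: delta_mx ord0 k.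
 by apply/rowP => j; rewrite -Xx !mxE !eqxx addrC.
have -> : \prod_(j < N | j != i0) (1 + hS i (row j (t *: delta_mx i0 k + X))) =
  \prod_(j < N | j != i0) (1 + hS i (row j X)).
 apply: eq_bigr => j ji0; rewrite (_ : row j (t *: delta_mx i0 k + X) = row j X)//.
 by apply/rowP => l; rewrite !mxE (negbTE ji0) mulr0 add0r.
have h0 : 1 + hS i x != 0 by rewrite gt_eqF// (adm_gt0 x ai).
by field.
Qed.

(** Moving an atom changes one factor of the product, so the quotient is that of [hS i] at [x] times
    the remaining factors. *)
Lemma cvg_ex_quotient i mu x (k : 'I_d) : mu [set x] != 0%E ->
 (fun t : R => t^-1 * (ex (hS i) (move mu x (x + t *: delta_mx ord0 k)) - ex (hS i) mu)) @ 0^' -->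
 fF hS vS i mu x ord0 k.
Proof.
move=> mux; have [_ _ [r1 hr1]] := (admS i).1; have [n xn] := cube_cover x.
pose r := `|r1| + n%:R + 2.
have hr y : ~ cube r y -> hS i y = 0.
 move=> yr; apply: hr1 => yr1; apply: yr; apply: sub_cube yr1.
 by rewrite /r -addrA (le_trans (ler_norm r1))// lerDl addr_ge0.
have rx : cube (r - 2) x by apply: sub_cube xn; rewrite addrK lerDr.
have := der_hS i k x; case=> /cvg_ex[l lc] dl.
have ll : l = vS i x ord0 k by rewrite -dl; apply/esym; apply: cvg_lim.
have c0 : 1 + hS i x != 0 by rewrite gt_eqF// (adm_gt0 x (admS i)).
have lc' : ex (hS i) mu * (1 + hS i x)^-1 * (h^-1 *: (hS i (h *: delta_mx ord0 k + x) - hS i x)) @[h --> 0^']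
  --> fF hS vS i mu x ord0 k.
 rewrite /fF (vxE _ _ (mu, x)) /= mulrA -ll; apply: cvgM; first exact: cvg_cst.
 exact: lc.
apply: cvg_trans lc'; apply: near_eq_cvg; near=> t => /=.
rewrite (ex_move k mux hr rx); last by near: t; exact: dnbhs0_le.
rewrite [t *: _ + x]addrC /GRing.scale/=.
by move: (hS i (x + _)) (ex _ _) (hS i x) t^-1 c0 => a b c e c0; field.
Unshelve. all: by end_near. Qed.

Implicit Types s : seq (R * expS).

Lemma cvg_spn_quotient s mu x (k : 'I_d) : mu [set x] != 0%E ->
 (fun t : R => t^-1 * (spn hS s (move mu x (x + t *: delta_mx ord0 k)) - spn hS s mu)) @ 0^' -->
 gF hS vS s mu x ord0 k.
Proof.
move=> mux; elim: s => [|a s ih].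
 rewrite (_ : (fun t => _) = fun=> 0); last first.
  by apply/funext => t; rewrite /spn !big_nil subrr mulr0.
 by rewrite /gF big_nil mxE; exact: cvg_cst.
rewrite /gF big_cons mxE mxE -/(gF hS vS s mu x).
rewrite (_ : (fun t => _) = fun t : R => a.1 * (t^-1 * (ex (hS a.2) (move mu x (x + t *: delta_mx ord0 k)) - ex (hS a.2) mu)) +
  t^-1 * (spn hS s (move mu x (x + t *: delta_mx ord0 k)) - spn hS s mu)); last first.
 by apply/funext => t; rewrite /spn !big_cons; ring.
by apply: cvgD => //; apply: cvgM; [exact: cvg_cst|exact: cvg_ex_quotient].
Qed.

Lemma grad_spn s mu x : mu [set x] != 0%E -> grad (spn hS s) mu x = gF hS vS s mu x.
Proof.
move=> mux; apply/rowP => k; rewrite mxE.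
by apply: cvg_lim => //; exact: cvg_spn_quotient.
Qed.

Lemma spn_restr s : exists r : R, forall r' mu, r <= r' -> spn hS s (restr mu (cube r')) = spn hS s mu.
Proof.
elim: s => [|a s [r ih]]; first by exists 0 => r' mu _; rewrite /spn !big_nil.
have [_ _ [r1 hr1]] := (admS a.2).1.
exists (Num.max r r1) => r' mu; rewrite ge_max => /andP[rr' r1r'].
rewrite /spn !big_cons -!/(spn _ _ _) ih// ex_restr//; first exact: cube_mbl.
 exact: admS.
by move=> x xr'; apply: hr1 => xr1; apply: xr'; exact: sub_cube r1r' _ xr1.
Qed.

Lemma mbl_spn s : mbl (spn hS s).
Proof.
by apply: measurable_sum => a; apply: mfunM => //; apply: mbl_ex; exact: admS.
Qed.

Lemma Cc_infty_spn s : Cc_infty (spn hS s).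
Proof.
split.
- exists (\sum_(a <- s) `|a.1|) => mu; apply: le_trans (ler_norm_sum _ _ _) _.
 apply: ler_sum => a _; rewrite normrM (ger0_norm (ex_ge0 _ _)) ler_piMr//.
 exact: ex_le1 (admS _).
- have [r rP] := spn_restr s; exists (cube r); first exact: cube_compact.
 by apply: sigF_restr; [exact: cube_mbl|exact: mbl_spn|move=> mu; exact: rP].
move=> N; apply: sm_smooth.
rewrite (_ : (fun X => _) = fun X : 'M[R]_(N, d) => \sum_(a <- s) a.1 * \prod_(i < N) (1 + hS a.2 (row i X))).
 apply: sm_sum => a; apply: sm_mul; first exact: sm_cst.
 apply: sm_prod => i; apply: sm_add; first exact: sm_cst.
 exact: sm_row (smS a.2).
by apply/funext => X; apply: eq_bigr => a _; rewrite ex_sum_config//; exact: admS.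
Qed.

Lemma H1sq_ae f (F G : M -> E -> E) :
 (forall k, mbl (fun p : M * E => F p.1 p.2 ord0 k)) ->
 (forall k, mbl (fun p : M * E => G p.1 p.2 ord0 k)) ->
 (forall mu x, mu [set x] != 0%E -> F mu x = G mu x) -> H1sq P f F = H1sq P f G.
Proof.
move=> mF mG FG; rewrite /H1sq !integral_sqnorm//; congr (_ + _)%E.
apply: ae_eq_integral => //.
- by apply/mEFin/measurable_sum => k; apply: mfunX.
- by apply/mEFin/measurable_sum => k; apply: mfunX.
apply: filterS (atom_ae) => p patom _ /=; by rewrite FG.
Qed.

(** A constant approximating sequence. The true gradient and the explicit field agree at atoms,
    which is enough by [H1sq_ae]. *)
Lemma H10_spn s : H10 P (spn hS s) (gF hS vS s).
Proof.
have sf := L2_sp admS s; have sF := vL2_F admS tfv_vS s.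
have mF k := (sF k).1.
have mg k := mbl_grad (Cc_infty_spn s) k.
split; first exact/Lfun2_L2.
- exact: mF.
- by rewrite H1sqE// ltry.
exists (fun=> spn hS s); split.
 move=> _; split; first exact: Cc_infty_spn.
 rewrite (H1sq_ae _ mg mF); first by rewrite H1sqE// ltry.
 by move=> mu x; exact: grad_spn.
rewrite (_ : (fun n : nat => _) = fun=> 0%E); first exact: cvg_cst.
apply/funext => _; rewrite (@H1sq_ae _ _ (fun _ _ => 0)).
- rewrite (_ : (fun mu => _) = fun=> 0); last by apply/funext => mu; rewrite subrr.
 rewrite H1sqE; [|exact: L20|exact: vL2_0].
 rewrite /ip /Rintegral integral0_eq ?add0e => [|? _]; last by rewrite mul0r.
 rewrite /ven /en /Rintegral integral0_eq/= ?addr0// => ? _.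
 by rewrite bilin0l mulr0.
- by move=> k; under eq_fun do rewrite mxE [X in _ + X]mxE; exact: mfunB.
- by move=> k; under eq_fun do rewrite mxE; exact: measurable_cst.
by move=> mu x /(grad_spn s) ->; rewrite subrr.
Qed.

Section weighted.
Variables (n : nat) (phi : nat -> E -> R) (g : nat -> E -> E) (al : nat -> R).
Hypotheses (wphi : forall j, weight (phi j)) (sphi : forall j, sm (phi j))
(dphi : forall j (k : 'I_d) x, is_derive x (e_ k) (phi j) (g j x ord0 k)).

Definition mulS (j : nat) (i : expS) : expS := exist _ (fun x => phi j x * hS i x)
 (conj (admw admS i (wphi j)) (sm_mul (sphi j) (smS i))).

Lemma vS_mulS j i x : vS (mulS j i) x = phi j x *: vS i x + hS i x *: g j x.
Proof.
apply/rowP => k; rewrite mxE !mxE.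
have := der_mul (dphi j k x) (der_hS i k x).
by case=> _ ->; rewrite mxE addrC (mulrC (g j x _ _)).
Qed.

(** Writes [Wop s] again as a finite combination of smooth exponentials. This puts it in H^1_0 with
    a known gradient. *)
Definition wl s : seq (R * expS) := scl (al n) s ++
 flatten [seq scl (- (al j.+1 - al j)) [seq (a.1 * kap hS (phi j) a.2, mulS j a.2) | a <- s] | j <- index_iota 0 n].

Lemma spn_wl s : spn hS (wl s) = Wop hS n phi al s.
Proof.
apply/funext => mu; rewrite /wl spn_cat spn_scl /Wop; congr (_ + _).
rewrite {1}/spn big_flatten big_map -sumrN; apply: eq_bigr => j _.
rewrite -/(spn _ _ _) spn_scl mulNr; congr (- (_ * _)).
by rewrite /spn big_map; apply: eq_bigr => a _ /=; rewrite mulrA.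
Qed.

Lemma gF_cat s t mu x : gF hS vS (s ++ t) mu x = gF hS vS s mu x + gF hS vS t mu x.
Proof. by rewrite /gF big_cat. Qed.

Lemma gF_scl c s mu x : gF hS vS (scl c s) mu x = c *: gF hS vS s mu x.
Proof. by rewrite /gF big_map scaler_sumr; apply: eq_bigr => a _ /=; rewrite scalerA. Qed.

Lemma gF_wl s : gF hS vS (wl s) = gW hS vS n phi g al s.
Proof.
apply/funext => mu; apply/funext => x; rewrite /wl gF_cat gF_scl /gW; congr (_ + _).
rewrite {1}/gF big_flatten big_map -sumrN; apply: eq_bigr => j _.
rewrite -/(gF _ _ _ _ _) gF_scl scaleNr; congr (- (_ *: _)).
rewrite /gF big_map /gY /gB -big_split; apply: eq_bigr => a _ /=.
rewrite -scalerDr; congr (_ *: _).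
by rewrite /fF /fY /fB /vx vS_mulS !scalerDr.
Qed.

Lemma H10_Wop s : H10 P (Wop hS n phi al s) (gW hS vS n phi g al s).
Proof. by rewrite -spn_wl -gF_wl; exact: H10_spn. Qed.

End weighted.

End smooth_exponentials.

(** * Tensor splines on a grid *)

Section grid.
Variables (c : R) (K : nat).
Hypotheses (c0 : 0 < c) (K0 : (0 < K)%N).
Local Notation ff := {ffun 'I_d -> 'I_(2 * K).+1}.
Implicit Types (x : E) (k l j : 'I_d) (f : ff).

(** The extra cell [None] receives the points out of range of the grid. Its node is a corner, which
    the function to be approximated does not see. *)
Definition cell : finType := option {ffun 'I_d -> 'I_(2 * K).+1}.

Definition node (z : cell) : E := if z is Some f then
 \row_l (((f l)%:R - K%:R) / c) else const_mx (K%:R / c).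

Definition spl k (f : {ffun 'I_d -> 'I_(2 * K).+1}) x : R :=
 \prod_j (if j == k then dhat else hat) (c * x ord0 j - ((f j)%:R - K%:R)).

Definition spl0 (f : {ffun 'I_d -> 'I_(2 * K).+1}) x : R :=
 \prod_j hat (c * x ord0 j - ((f j)%:R - K%:R)).

(** The probability that a point at [x] is sent to the node of [z]. *)
Definition eta (z : cell) x : R := if z is Some f then spl0 f x else 1 - \sum_f spl0 f x.

Definition deta k (z : cell) x : R :=
 if z is Some f then c * spl k f x else - \sum_f c * spl k f x.

Lemma big_cell (F : cell -> R) : \sum_z F z = F None + \sum_f F (Some f).
Proof.
rewrite (bigD1 None)//=; congr (_ + _).
rewrite (reindex_omap Some (fun z => z)) /=; last by case.
by apply: eq_bigl => f; rewrite eqxx.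
Qed.

Lemma sum_eta x : \sum_z eta z x = 1.
Proof. by rewrite big_cell /= subrK. Qed.

Lemma sum_deta k x : \sum_z deta k z x = 0.
Proof. by rewrite big_cell /= addNr. Qed.

Lemma sum_spl0 x : \sum_f spl0 f x =
 \prod_j \sum_(i < (2 * K).+1) hat (c * x ord0 j - (i%:R - K%:R)).
Proof. by rewrite bigA_distr_bigA. Qed.

Lemma spl0_ge0 f x : 0 <= spl0 f x.
Proof. by apply: prodr_ge0 => j _; exact: hat_ge0. Qed.

Lemma sum_spl0_le1 x : \sum_f spl0 f x <= 1.
Proof.
rewrite sum_spl0; apply: prodr_ile1 => j _; rewrite sum_hat_le1 andbT.
by apply: sumr_ge0 => i _; exact: hat_ge0.
Qed.

Lemma eta_ge0 z x : 0 <= eta z x.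
Proof. by case: z => [f|] /=; [exact: spl0_ge0|rewrite subr_ge0 sum_spl0_le1]. Qed.

Lemma sum_normr_spl k x : \sum_f `|spl k f x| <= 2.
Proof.
rewrite (eq_bigr (fun f : ff => \prod_j `|(if j == k then dhat else hat) (c * x ord0 j - ((f j)%:R - K%:R))|)) => [|f _]; last by rewrite normr_prod.
rewrite -(bigA_distr_bigA (fun j (i : 'I_(2 * K).+1) => `|(if j == k then dhat else hat) (c * x ord0 j - (i%:R - K%:R))|)).
rewrite (bigD1 k)//= -[leRHS]mulr1; apply: ler_pM.
- exact: sumr_ge0.
- by apply: prodr_ge0 => j _; exact: sumr_ge0.
- by rewrite eqxx sum_normr_dhat.
apply: prodr_ile1 => j /negbTE ->; rewrite sumr_ge0//=.
by under eq_bigr do rewrite ger0_norm ?hat_ge0//; exact: sum_hat_le1.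
Qed.

Lemma sum_normr_deta k x : \sum_z `|deta k z x| <= 4 * c.
Proof.
have h : \sum_f `|c * spl k f x| <= 2 * c.
 under eq_bigr do rewrite normrM (gtr0_norm c0).
 by rewrite -mulr_sumr mulrC ler_wpM2r ?(ltW c0)// sum_normr_spl.
rewrite big_cell /= normrN; have := ler_norm_sum (index_enum _) (fun f => c * spl k f x) xpredT.
by move: h; lra.
Qed.

Definition inner x := forall l, `|c * x ord0 l| <= K%:R - 1.

Lemma eta_None x : inner x -> eta None x = 0.
Proof. by move=> ix; rewrite /= sum_spl0 big1 ?subrr// => j _; exact: sum_hat1. Qed.

Lemma sum_spl k x : inner x -> \sum_f spl k f x = 0.
Proof.
move=> ix; rewrite -(bigA_distr_bigA (fun j (i : 'I_(2 * K).+1) => (if j == k then dhat else hat) (c * x ord0 j - (i%:R - K%:R)))).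
by rewrite (bigD1 k)//= eqxx sum_dhat0 ?mul0r.
Qed.

Lemma deta_None k x : inner x -> deta k None x = 0.
Proof. by move=> ix; rewrite /= -mulr_sumr sum_spl// mulr0 oppr0. Qed.

(** Reproduction of affine functions: it makes the derivative of the interpolation converge, and not
    only the interpolation. *)
Lemma sum_node_deta k l x : inner x ->
 \sum_z deta k z x * (node z ord0 l - x ord0 l) = (k == l)%:R.
Proof.
move=> ix; under eq_bigr do rewrite mulrBr.
rewrite big_split /= sumrN -mulr_suml sum_deta mul0r subr0.
rewrite big_cell deta_None// mul0r add0r /=.
transitivity (\sum_(f : ff) \prod_j ((if j == k then dhat else hat) (c * x ord0 j - ((f j)%:R - K%:R)) *
  (if j == l then (f j)%:R - K%:R else 1))).
 apply: eq_bigr => f _; rewrite big_split /= -/(spl k f x) mxE.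
 rewrite [X in _ = _ * X](bigD1 l)//= eqxx big1 ?mulr1 => [|j /negbTE ->]//.
 by move: (spl k f x) (_ - _) => a b; field; rewrite gt_eqF.
rewrite -(bigA_distr_bigA (fun j (i : 'I_(2 * K).+1) => (if j == k then dhat else hat) (c * x ord0 j - (i%:R - K%:R)) *
  (if j == l then i%:R - K%:R else 1))).
rewrite (bigD1 k)//= eqxx; have [<-|kl] := eqVneq k l.
 under eq_bigr do rewrite mulrC.
 rewrite sum_node_dhat// mul1r big1// => j /negbTE jk.
 by under eq_bigr do rewrite jk mulr1; exact: sum_hat1.
by under eq_bigr do rewrite mulr1; rewrite sum_dhat0// mul0r.
Qed.

Lemma hat_near f x j : hat (c * x ord0 j - ((f j)%:R - K%:R)) != 0 \/
 dhat (c * x ord0 j - ((f j)%:R - K%:R)) != 0 ->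
 `|node (Some f) ord0 j - x ord0 j| <= 2 / c.
Proof.
move=> h; rewrite mxE distrC ler_pdivlMr// -{2}(gtr0_norm c0) -normrM mulrBl divfK ?gt_eqF//.
rewrite mulrC ltW// ltNge; apply/negP => h2.
by case: h; rewrite ?hat_out ?dhat_out ?eqxx.
Qed.

Lemma eta_near f x : eta (Some f) x != 0 -> forall j, `|node (Some f) ord0 j - x ord0 j| <= 2 / c.
Proof. by move=> /prodf_neq0 h j; apply: hat_near; left; exact: h. Qed.

Lemma deta_near k f x : deta k (Some f) x != 0 -> forall j, `|node (Some f) ord0 j - x ord0 j| <= 2 / c.
Proof.
rewrite /= mulf_eq0 negb_or => /andP[_ /prodf_neq0 h] j; apply: hat_near.
by have := h j isT; case: ifP; [right|left].
Qed.

Lemma node_le z l : `|node z ord0 l| <= K%:R / c.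
Proof.
case: z => [f|]; rewrite mxE normrM (gtr0_norm (x := c^-1)) ?invr_gt0// ler_pM2r ?invr_gt0//; last first.
 by rewrite ger0_norm.
have : (f l)%:R <= 2 * K%:R :> R by rewrite -natrM ler_nat -ltnS ltn_ord.
have : 0 <= (f l)%:R :> R by [].
by rewrite ler_norml => h1 h2; apply/andP; split; lra.
Qed.

Lemma eta_out f x : ~ cube (2 * ((K%:R + 2) / c)) x -> eta (Some f) x = 0.
Proof.
move=> nx; apply/eqP/negPn/negP => h; apply: nx => l; have := eta_near h l; have := node_le (Some f) l.
rewrite [X in X / 2]mulrC mulfK// -ler_norml (mulrDl K%:R) => h1 h2.
rewrite -[x _ _](subKr (node (Some f) ord0 l)).
by rewrite (le_trans (ler_normB _ _))// lerD.
Qed.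

Lemma der_spl0 k f x : is_derive x (e_ k) (spl0 f) (c * spl k f x).
Proof.
apply/der_line.
pose C := \prod_(j | j != k) hat (c * x ord0 j - ((f j)%:R - K%:R)).
rewrite (_ : (fun t => _) = fun t : R => hat (c * t + (c * x ord0 k - ((f k)%:R - K%:R))) * C); last first.
 apply/funext => t; rewrite /spl0 (bigD1 k)//=; congr (hat _ * _).
  by rewrite !mxE !eqxx mulr1 mulrDr addrA.
 by apply: eq_bigr => j /negbTE jk; rewrite !mxE jk andbF mulr0 add0r.
have da : is_derive (0 : R) (1 : R) (fun t : R => c * t + (c * x ord0 k - ((f k)%:R - K%:R))) c.
 have := der_add (der_mul (der_const c 0 (1 : R)) (is_derive_id (0 : R) (1 : R)))
  (der_const (c * x ord0 k - ((f k)%:R - K%:R)) (0 : R) (1 : R)).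
 by move=> hd; apply: (der_val hd); rewrite mul0r add0r addr0 mulr1.
have := der_mul (der_chain (g := fun t : R => c * t + (c * x ord0 k - ((f k)%:R - K%:R)))
 (der_hat _) da) (der_const C (0 : R) (1 : R)).
move=> hd; apply: (der_val hd); rewrite !mulr0 add0r addr0 (mulrC _ c) -mulrA; congr (_ * _).
rewrite /spl (bigD1 k)//= eqxx; congr (_ * _).
by apply: eq_bigr => j /negbTE ->.
Qed.

Lemma der_eta k z x : is_derive x (e_ k) (eta z) (deta k z x).
Proof.
case: z => [f|]; first exact: der_spl0.
have ds := der_bigsum (index_enum _) (fun f => der_spl0 k f x).
have := der_add (der_const 1 x (e_ k))
 (der_mul (der_const (-1) x (e_ k)) ds).
rewrite mul0r !add0r mulN1r => hd; apply: (der_val _ (erefl _)).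
by move: hd; congr (is_derive _ _ _ _); apply/funext => y; rewrite mulN1r.
Qed.

Lemma sm_spl0 f : sm (spl0 f).
Proof.
apply: sm_prod => j; apply: sm_hat; apply: sm_sub; last exact: sm_cst.
by apply: sm_mul; [exact: sm_cst|exact: sm_coord].
Qed.

Lemma inner_far x : ~ inner x -> exists l, K%:R - 1 < `|c * x ord0 l|.
Proof.
move=> nx; apply: contrapT => h; apply: nx => l; rewrite leNgt; apply/negP => hl.
by apply: h; exists l.
Qed.

End grid.

(** * Exponentials interpolating characters *)

Section exponentials_of_characters.
Variables (c : R) (K : nat).
Hypothesis c0 : 0 < c.
Local Notation ff := {ffun 'I_d -> 'I_(2 * K).+1}.
Local Notation cell := (@cell K).
Local Notation eta := (@eta c K).
Local Notation deta := (@deta c K).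
Implicit Types (k : ff -> nat) (x : E) (mu : M).

Definition wt k (z : cell) : R := if z is Some f then 2^-1 ^+ k f else 1.

Lemma wt_gt0 k z : 0 < wt k z.
Proof. by case: z => [f|] //=; rewrite exprn_gt0// invr_gt0. Qed.

Lemma wt_le1 k z : wt k z <= 1.
Proof. by case: z => [f|] //=; rewrite exprn_ile1 ?invr_ge0// invf_le1// ler1n. Qed.

(** [1 + hk k] interpolates the weights [wt k] of the cells ([hkE]). Subtracting 1 removes the cell
    [None], whose weight is 1, and yields bounded support. *)
Definition hk k x : R := \sum_(f : ff) (wt k (Some f) - 1) * eta (Some f) x.

Lemma hkE k x : 1 + hk k x = \sum_z wt k z * eta z x.
Proof.
rewrite big_cell mul1r /= /hk [in RHS]addrAC -addrA; congr (_ + _).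
by rewrite -sumrB; apply: eq_bigr => f _; rewrite mulrBl mul1r.
Qed.

Lemma sm_hk k : sm (hk k).
Proof. by apply: sm_sum => f; apply: sm_mul; [exact: sm_cst|exact: sm_spl0]. Qed.

Lemma hk_out k x : ~ cube (2 * ((K%:R + 2) / c)) x -> hk k x = 0.
Proof. by move=> nx; rewrite /hk big1// => f _; rewrite eta_out ?mulr0. Qed.

Lemma adm_hk k : adm (hk k).
Proof.
have h1 x : \prod_(z : cell) wt k z <= 1 + hk k x <= 1.
 rewrite hkE; apply/andP; split.
  rewrite -[leLHS]mulr1 -[X in _ * X <= _](sum_eta c K x) mulr_sumr; apply: ler_sum => z _.
  rewrite ler_wpM2r ?eta_ge0//; rewrite (bigD1 z)//= -[leRHS]mulr1 ler_wpM2l ?(ltW (wt_gt0 _ _))//.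
  by apply: prodr_ile1 => y _; rewrite (ltW (wt_gt0 _ _)) wt_le1.
 rewrite -(sum_eta c K x).
 by apply: ler_sum => z _; rewrite -[leRHS]mul1r ler_wpM2r ?eta_ge0// wt_le1.
split; last by exists (\prod_(z : cell) wt k z) => //; apply: prodr_gt0 => z _; exact: wt_gt0.
split.
- exact: cts_mbl_mx (sm_continuous (sm_hk k)).
- exists 1 => x; have := h1 x; have : 0 <= \prod_(z : cell) wt k z.
  by apply: prodr_ge0 => z _; exact/ltW/wt_gt0.
 by move=> p0 /andP[h2 h3]; rewrite ler_norml; apply/andP; split; lra.
by exists (2 * ((K%:R + 2) / c)) => x; exact: hk_out.
Qed.

Definition kS k : expS := exist _ (hk k) (conj (adm_hk k) (sm_hk k)).

Lemma vS_kS k x (j : 'I_d) : vS (kS k) x ord0 j = \sum_z wt k z * deta j z x.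
Proof.
have dh := der_bigsum (index_enum _) (fun f : ff =>
 der_mul (der_const (wt k (Some f) - 1) x (e_ j)) (der_eta c j (Some f) x)).
have [_ E1] := dh; have [_ E2] := der_hS (kS k) j x.
apply: etrans (esym E2) _; apply: etrans E1 _; rewrite big_cell mul1r /= addrC -sumrB.
by apply: eq_bigr => f _; rewrite mul0r add0r mulrBl mul1r.
Qed.

Lemma vS_kS_out k x : ~ cube (2 * ((K%:R + 2) / c)) x -> vS (kS k) x = 0.
Proof.
move=> nx; have d0 (j : 'I_d) (f : ff) : deta j (Some f) x = 0.
 apply/eqP/negPn/negP => h; apply: nx => l; have := deta_near c0 h l; have := node_le c0 (Some f) l.
 rewrite [X in X / 2]mulrC mulfK// -ler_norml (mulrDl K%:R) => h1 h2.
 rewrite -[x _ _](subKr (node c (Some f) ord0 l)).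
 by rewrite (le_trans (ler_normB _ _))// lerD.
apply/rowP => j; rewrite vS_kS mxE big_cell big1 => [|f _]; last by rewrite d0 mulr0.
rewrite addr0 mul1r; have := sum_deta c K j x; rewrite big_cell big1 ?addr0// => f _; exact: d0.
Qed.

Definition es (s : seq (R * (ff -> nat))) : seq (R * expS) := [seq (a.1, kS a.2) | a <- s].

Definition counts N (t : {ffun 'I_N -> cell}) (f : ff) : nat := #|[pred j | t j == Some f]|.

Lemma chr_counts N (t : {ffun 'I_N -> cell}) k : chr k (counts t) = \prod_j wt k (t j) :> R.
Proof.
rewrite (partition_big t predT)//= (bigD1 None)//= [X in X * _]big1 => [|j /eqP ->//].
rewrite mul1r (reindex_omap Some (fun z => z)) /=; last by case.
apply: eq_big => [f|f _]; first by rewrite eqxx.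
rewrite exprM (eq_bigr (fun=> 2^-1 ^+ k f)) => [|j /eqP ->//].
by rewrite prodr_const.
Qed.

Section on_a_configuration.
Variables (mu : M) (r : R) (N : nat) (X : mat N).
Hypotheses (rK : 2 * ((K%:R + 2) / c) <= r) (XP : restr mu (cube r) = sum_config X).

Lemma ex_kS k : ex (hS (kS k)) mu = \prod_j \sum_z wt k z * eta z (row j X).
Proof.
have hr x : ~ cube r x -> hk k x = 0.
 by move=> xr; apply: hk_out => // xr'; apply: xr; exact: sub_cube rK _ xr'.
rewrite (ex_enum (@cube_mbl r) XP (admS (kS k)) hr).
by apply: eq_bigr => j _; rewrite hkE.
Qed.

(** Expanding the product over the points of sums over cells, the exponential becomes the mean of
    the character over random assignments of the points to cells. *)
Lemma spn_es s : spn hS (es s) mu =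
 mlsum (fun j z => eta z (row j X)) (fun t : {ffun 'I_N -> cell} => chrspn s (counts t)).
Proof.
rewrite /spn big_map /chrspn mlsum_sum; apply: eq_bigr => a _ /=.
rewrite mlsumZ; congr (_ * _); rewrite ex_kS -mlsum_prod; congr mlsum.
by apply/funext => t; rewrite chr_counts.
Qed.

Lemma gF_es s i0 (j0 : 'I_d) x : row i0 X = x -> gF hS vS (es s) mu x ord0 j0 =
 mlsum (fun j z => (if j == i0 then deta j0 z else eta z) (row j X))
  (fun t : {ffun 'I_N -> cell} => chrspn s (counts t)).
Proof.
move=> Xx; rewrite /gF big_map summxE /chrspn mlsum_sum; apply: eq_bigr => a _ /=.
rewrite mxE mlsumZ; congr (_ * _); rewrite (vxE _ _ (mu, x)) /= vS_kS ex_kS (bigD1 i0)//= -hkE Xx.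
have h0 : 1 + hk a.2 x != 0 by rewrite gt_eqF// (adm_gt0 x (admS (kS a.2))).
transitivity ((\sum_z wt a.2 z * deta j0 z x) * \prod_(i < N | i != i0) \sum_z wt a.2 z * eta z (row i X)).
 by move: (\sum_z _) (\prod_(_ | _) _) h0; rewrite /hS /=; move: (hk _ _) => h A B h0; field.
rewrite (_ : (fun t => _) = fun t : {ffun 'I_N -> cell} => \prod_j wt a.2 (t j)); last first.
 by apply/funext => t; rewrite chr_counts.
rewrite (mlsum_prod _ (fun=> wt a.2)) [in RHS](bigD1 i0)//=; congr (_ * _); first by apply: eq_bigr => z _; rewrite eqxx Xx.
by apply: eq_bigr => j /negbTE ->.
Qed.

End on_a_configuration.

End exponentials_of_characters.

(** * Approximation by exponentials of functions that ignore crowded configurations *)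

Section approximation.
Variables (g : M -> R) (V : set E) (v L b : R).
Variable D : forall N, 'I_N -> 'I_d -> 'M[R]_(N, d) -> R.
Hypotheses (VQ : V `<=` cube v) (gV : forall mu, g (restr mu V) = g mu)
(g_mult : forall p, V p -> exists B : nat, forall mu : M, (B%:R%:E <= mu [set p])%E -> g mu = 0)
(gb : forall mu, `|g mu| <= b)
(gC : forall N, continuous (fun X : 'M[R]_(N, d) => g (sum_config X))).
Hypothesis gD : forall N (i : 'I_N) k X,
 is_derive X (delta_mx i k) (fun X => g (sum_config X)) (D i k X).
Hypotheses (cD : forall N (i : 'I_N) k, continuous (D i k))
(DL : forall N (i : 'I_N) k X, `|D i k X| <= L).

Lemma row_entry m n (X : 'M[R]_(m, n)) j l : row j X ord0 l = X j l.
Proof. by rewrite mxE. Qed.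

Lemma g_see N (X Y : mat N) :
 (forall j, row j X = row j Y \/ ~ V (row j X) /\ ~ V (row j Y)) ->
 g (sum_config X) = g (sum_config Y).
Proof.
move=> h; rewrite -gV -[RHS]gV; congr g; apply: config_ext => A /=.
apply: eq_bigr => j _; case: (h j) => [->//|[nX nY]].
by rewrite !diracE !memNset// => -[].
Qed.

Lemma out_V (x : E) (l : 'I_d) : v / 2 < `|x ord0 l| -> ~ V x.
Proof. by move=> xl /VQ/(_ l); rewrite -ler_norml leNgt xl. Qed.

Section cells.
Variables (c : R) (K : nat).
Hypotheses (c1 : 1 <= c) (K0 : (0 < K)%N) (vK : v / 2 + 4 <= K%:R / c).
Local Notation ff := {ffun 'I_d -> 'I_(2 * K).+1}.
Local Notation cell := (@cell K).
Local Notation node := (@node c K).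
Local Notation inner := (@inner c K).

Let c0 : 0 < c. Proof. exact: lt_le_trans c1. Qed.

Let c2 : 2 / c <= 2. Proof. by rewrite ler_pdivrMr// ler_peMr. Qed.

Lemma node_None_out : ~ V (node None).
Proof.
apply: (@out_V _ (Ordinal d_gt0)); rewrite mxE; apply: lt_le_trans (ler_norm _).
by move: vK; lra.
Qed.

(** The margin 4 in [vK] covers the displacement [2 / c], at most 2, and the outer mesh [1 / c], at
    most 1. *)
Lemma not_inner_out (x y : E) : ~ inner x -> (forall l, `|y ord0 l - x ord0 l| <= 2 / c) -> ~ V y.
Proof.
move=> /inner_far[l xl] /(_ l) yl; apply: (@out_V _ l).
have h : `|x ord0 l| <= `|y ord0 l| + `|y ord0 l - x ord0 l|.
 by rewrite -{1}(subKr (y ord0 l) (x ord0 l)) ler_normB.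
have : (K%:R - 1) / c < `|x ord0 l|.
 by rewrite ltr_pdivrMr// mulrC -[X in X * _](gtr0_norm c0) -normrM.
rewrite mulrBl; have : 1 / c <= 1 by rewrite ler_pdivrMr// mul1r.
by move: vK c2 h yl; lra.
Qed.

Lemma not_inner_outV (x : E) : ~ inner x -> ~ V x.
Proof.
by move=> xi; apply: (not_inner_out xi) => l; rewrite subrr normr0 divr_ge0// ltW.
Qed.

Definition cells_mx N (t : {ffun 'I_N -> cell}) : 'M[R]_(N, d) := \matrix_(j, l) node (t j) ord0 l.

Lemma row_cells N (t : {ffun 'I_N -> cell}) j : row j (cells_mx t) = node (t j).
Proof. by apply/rowP => l; rewrite !mxE. Qed.

Definition cell_seq (n : ff -> nat) : seq ff := flatten [seq nseq (n f) f | f <- enum {: ff}].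

(** Puts [n f] points at each node [f]: on grid configurations [g] becomes a function of counts
    alone. *)
Definition cell_cfg (n : ff -> nat) : M :=
 sum_config (\matrix_(i < size (cell_seq n), l < d)
  node (Some (nth [ffun=> ord0] (cell_seq n) i)) ord0 l).

Lemma cell_cfgE n (A : set E) : cell_cfg n A = (\sum_(f : ff) \1_A (node (Some f)) *+ n f)%:E.
Proof.
rewrite /cell_cfg /=.
rewrite (eq_bigr (fun i : 'I_(size (cell_seq n)) => (\1_A (node (Some (nth [ffun=> ord0] (cell_seq n) i))))%:E)); last first.
 move=> i _; rewrite diracE indicE; congr ((_ \in A)%:R%:E).
 by apply/rowP => l; rewrite !mxE.
rewrite sumEFin; congr _%:E.
rewrite -(big_mkord xpredT (fun i => \1_A (node (Some (nth [ffun=> ord0] (cell_seq n) i))))).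
rewrite -(big_nth [ffun=> ord0] xpredT (fun f => \1_A (node (Some f)))).
rewrite big_flatten big_map big_enum; apply: eq_bigr => f _.
by rewrite big_nseq iter_addr_0.
Qed.

Lemma cells_mxE N (t : {ffun 'I_N -> cell}) (A : set E) : sum_config (cells_mx t) A =
 (\1_A (node None) *+ #|[pred j | t j == None]| + \sum_(f : ff) \1_A (node (Some f)) *+ counts t f)%:E.
Proof.
rewrite /= (eq_bigr (fun j => (\1_A (node (t j)))%:E)) => [|j _]; last by rewrite row_cells diracE indicE.
rewrite sumEFin (partition_big t predT)//= big_cell; congr (_ + _)%:E.
 rewrite (eq_bigr (fun=> \1_A (node None))) => [|j /eqP ->//].
 by rewrite sumr_const.
apply: eq_bigr => f _; rewrite (eq_bigr (fun=> \1_A (node (Some f)))) => [|j /eqP ->//].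
by rewrite sumr_const.
Qed.

Lemma g_cells N (t : {ffun 'I_N -> cell}) : g (sum_config (cells_mx t)) = g (cell_cfg (counts t)).
Proof.
rewrite -gV -[RHS]gV; congr g; apply: config_ext => A.
apply: etrans (cells_mxE t (A `&` V)) _; apply: etrans _ (esym (cell_cfgE (counts t) (A `&` V))).
rewrite indicE memNset ?mul0rn ?add0r// => -[_].
exact: node_None_out.
Qed.

(** Nodes outside [V] are not seen, and by [g_mult] the function vanishes as soon as a visible node
    is crowded, so [capp_finite] applies. *)
Lemma capp_cells : capp (fun n => g (cell_cfg n)).
Proof.
pose A := [set f : ff | `[< V (node (Some f)) >]]%SET.
have /choice[Bf BfP] : forall f : ff, exists B : nat, V (node (Some f)) ->
  forall mu : M, (B%:R%:E <= mu [set node (Some f)])%E -> g mu = 0.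
 by move=> f; have [/g_mult[B]|nV] := pselect (V (node (Some f))); [exists B|exists 0%N].
apply: (@capp_finite _ _ _ A (\max_f Bf f)) => [n n' nn'|n f].
 rewrite -gV -[RHS]gV; congr g; apply: config_ext => B.
 apply: etrans (cell_cfgE n (B `&` V)) _; apply: etrans _ (esym (cell_cfgE n' (B `&` V))).
 congr _%:E; apply: eq_bigr => f _; have [fV|fV] := pselect (V (node (Some f))).
  by rewrite nn'// inE; exact/asboolP.
 by rewrite indicE memNset ?mul0rn// => -[].
rewrite inE => /asboolP fV nB; apply: (BfP f fV); rewrite cell_cfgE lee_fin.
rewrite (bigD1 f)//= indicE mem_set// -[leLHS]addr0 lerD ?ler_nat ?(leq_trans _ nB) ?leq_bigmax//.
by apply: sumr_ge0 => f' _; rewrite mulrn_wge0// indicE.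
Qed.

Variables (N : nat) (X : mat N).
Implicit Types t : {ffun 'I_N -> cell}.

Definition near_mx (Y : mat N) := forall j l, `|Y j l - X j l| <= 2 / c.

Definition okc t := forall j, if t j is Some f then
 forall l, `|node (Some f) ord0 l - X j l| <= 2 / c else ~ inner (row j X).

Lemma okc_eta t : \prod_j eta c (t j) (row j X) != 0 -> okc t.
Proof.
move=> /prodf_neq0 h j; have := h j isT; case: (t j) => [f /(eta_near c0) hf l|].
 by have := hf l; rewrite row_entry.
by move=> h0 ij; rewrite (eta_None ij) eqxx in h0.
Qed.

Lemma okc_deta t i0 k :
 \prod_j (if j == i0 then deta c k (t j) else eta c (t j)) (row j X) != 0 -> okc t.
Proof.
move=> /prodf_neq0 h j; have := h j isT; case: ifP => _; case: (t j) => [f|].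
- by move=> /(deta_near c0) hf l; have := hf l; rewrite row_entry.
- by move=> h0 ij; rewrite (deta_None k ij) eqxx in h0.
- by move=> /(eta_near c0) hf l; have := hf l; rewrite row_entry.
by move=> h0 ij; rewrite (eta_None ij) eqxx in h0.
Qed.

(* Points outside [inner], which [g] does not see, are left where they are. *)
Definition inner_mx t : 'M[R]_(N, d) :=
 \matrix_(j, l) if `[< inner (row j X) >] then node (t j) ord0 l else X j l.

Lemma inner_mx_near t : okc t -> near_mx (inner_mx t).
Proof.
move=> ok j l; rewrite mxE; case: asboolP => ij; last by rewrite subrr normr0 divr_ge0// ltW.
by have := ok j; case: (t j) => [f|//]; apply.
Qed.

Lemma inner_mx_see t j : okc t ->
 row j (cells_mx t) = row j (inner_mx t) \/ ~ V (row j (cells_mx t)) /\ ~ V (row j (inner_mx t)).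
Proof.
move=> ok; have [ij|ij] := pselect (inner (row j X)).
 by left; apply/rowP => l; rewrite !mxE asboolT.
right; have -> : row j (inner_mx t) = row j X by apply/rowP => l; rewrite !mxE asboolF.
split; last exact: not_inner_outV.
rewrite row_cells; have := ok j; case: (t j) => [f h|_]; last exact: node_None_out.
by apply: (not_inner_out ij) => l; rewrite row_entry.
Qed.

Lemma g_inner_mx t : okc t -> g (sum_config (cells_mx t)) = g (sum_config (inner_mx t)).
Proof. by move=> ok; apply: g_see => j; exact: inner_mx_see. Qed.

(** The assignments of nonzero weight move each visible point by at most [2 / c], and the weights
    are nonnegative with sum 1. *)
Lemma mlsum_approx (w : R) : 0 <= w ->
 (forall Y, near_mx Y -> `|g (sum_config Y) - g (sum_config X)| <= w) ->
 `|mlsum (fun j z => eta c z (row j X)) (fun t => g (sum_config (cells_mx t))) - g (sum_config X)| <= w.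
Proof.
move=> w0 h.
have p1 : \prod_j \sum_z eta (K := K) c z (row j X) = 1 by rewrite big1// => j _; exact: sum_eta.
have E1 := mlsum_cst (fun j z => eta (K := K) c z (row j X)) (g (sum_config X)).
rewrite p1 mulr1 in E1; rewrite -[X in _ - X]E1 mlsumB.
have p2 : \prod_j \sum_z `|eta (K := K) c z (row j X)| = 1.
 rewrite -[RHS]p1; apply: eq_bigr => j _; apply: eq_bigr => z _.
 by rewrite ger0_norm// eta_ge0.
apply: le_trans (mlsum_le w0 _) _; last by rewrite p2 mulr1.
by move=> t /okc_eta ok; rewrite g_inner_mx//; apply: h; exact: inner_mx_near.
Qed.

Section gradient.
Variables (i0 : 'I_N) (k : 'I_d).
Local Notation F := (fun (j : 'I_N) (z : cell) => (if j == i0 then deta c k z else eta c z) (row j X)).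

Definition fixed_mx t : 'M[R]_(N, d) := \matrix_(j, l) if j == i0 then X j l else cells_mx t j l.

Definition inner_fixed_mx t : 'M[R]_(N, d) := \matrix_(j, l) if j == i0 then X j l else inner_mx t j l.

Lemma g_inner_fixed t : okc t -> g (sum_config (fixed_mx t)) = g (sum_config (inner_fixed_mx t)).
Proof.
move=> ok; apply: g_see => j; have [ji|/negbTE ji] := eqVneq j i0.
 by left; apply/rowP => l; rewrite !mxE ji eqxx.
rewrite (_ : row j (fixed_mx t) = row j (cells_mx t)); last by apply/rowP => l; rewrite !mxE ji.
rewrite (_ : row j (inner_fixed_mx t) = row j (inner_mx t)); last by apply/rowP => l; rewrite !mxE ji.
exact: inner_mx_see.
Qed.

Lemma sum_F_i0 : \sum_z F i0 z = 0.
Proof. by rewrite /= eqxx sum_deta. Qed.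

Lemma prod_F : \prod_(j | j != i0) \sum_z F j z = 1.
Proof. by apply: big1 => j /negbTE ->; rewrite sum_eta. Qed.

Lemma prod_normF : \prod_j \sum_z `|F j z| <= 4 * c.
Proof.
rewrite (bigD1 i0)//= eqxx -[leRHS]mulr1; apply: ler_pM.
- exact: sumr_ge0.
- by apply: prodr_ge0 => j _; exact: sumr_ge0.
- exact: sum_normr_deta.
rewrite big1// => j /negbTE ->; rewrite -(sum_eta c K (row j X)).
by apply: eq_bigr => z _; rewrite ger0_norm// eta_ge0.
Qed.

(** With row [i0] frozen, the vanishing sum of [deta] factors out. Subtracting this term leaves
    increments of size [2 / c], which compensate the factor [4 c] of [prod_normF]. *)
Lemma mlsum_fixed : mlsum F (fun t => g (sum_config (fixed_mx t))) = 0.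
Proof.
apply: (@mlsum_indep _ _ _ F _ i0) => [t z|]; last exact: sum_F_i0.
congr (g (sum_config _)); apply/matrixP => j l; rewrite !mxE ffunE.
by case: (j == i0).
Qed.

Lemma mlsum_not_inner : ~ inner (row i0 X) ->
 mlsum F (fun t => g (sum_config (cells_mx t))) = 0.
Proof.
move=> ni; rewrite -[LHS]subr0 -[X in _ - X = _]mlsum_fixed mlsumB; apply/normr0_eq0/eqP; rewrite eq_le normr_ge0 andbT.
apply: le_trans (mlsum_le (lexx 0) _) _; last by rewrite mul0r.
move=> t /okc_deta ok; rewrite normr_le0 subr_eq0; apply/eqP/g_see => j.
have [->|/negbTE ji] := eqVneq j i0; last by left; apply/rowP => l; rewrite !mxE ji.
right; rewrite (_ : row i0 (fixed_mx t) = row i0 X); last by apply/rowP => l; rewrite !mxE eqxx.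
split; last exact: not_inner_outV.
rewrite row_cells; have := ok i0; case: (t i0) => [f h|_]; last exact: node_None_out.
by apply: (not_inner_out ni) => l; rewrite row_entry.
Qed.

Lemma der_along (Y : mat N) l (s : R) :
 is_derive s (1 : R) (fun s : R => g (sum_config (s *: delta_mx i0 l + Y)))
  (D i0 l (s *: delta_mx i0 l + Y)).
Proof.
have /der_line h := gD i0 l (s *: delta_mx i0 l + Y).
have ds : is_derive s (1 : R) (fun y : R => y + - s) 1.
 by have := der_add (is_derive_id s (1 : R)) (der_const (- s) s (1 : R)); rewrite addr0.
rewrite -(subrr s) in h.
have := der_chain (g := fun y : R => y + - s) h ds; rewrite mulr1.
congr (is_derive _ _ _ _); apply/funext => y.
by rewrite addrA -scalerDl subrK.
Qed.

Definition path_mx (Y Y' : mat N) (m : nat) : 'M[R]_(N, d) :=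
 \matrix_(j, l) if (l < m)%N then Y' j l else Y j l.

(** Row [i0] is moved one coordinate at a time along [path_mx], with the mean value theorem on each
    segment. *)
Lemma path_bound (G : 'I_d -> R) (w : R) (Y Y' : mat N) : 0 <= w ->
 (forall Z, near_mx Z -> forall l, `|D i0 l Z - G l| <= w) ->
 near_mx Y -> near_mx Y' -> (forall j l, j != i0 -> Y j l = Y' j l) ->
 (forall l, `|Y' i0 l - Y i0 l| <= 2 / c) ->
 `|g (sum_config Y') - g (sum_config Y) - \sum_l G l * (Y' i0 l - Y i0 l)| <= d%:R * (w * (2 / c)).
Proof.
move=> w0 h nY nY' YY' Yi; pose U m := g (sum_config (path_mx Y Y' m)).
have -> : g (sum_config Y') - g (sum_config Y) = \sum_(l < d) (U l.+1 - U l).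
 rewrite -(big_mkord xpredT (fun l => U l.+1 - U l)) telescope_sumr// /U.
 rewrite (_ : path_mx Y Y' d = Y'); last by apply/matrixP => j l; rewrite mxE ltn_ord.
 by rewrite (_ : path_mx Y Y' 0 = Y)//; apply/matrixP => j l; rewrite mxE.
rewrite -sumrB (le_trans (ler_norm_sum _ _ _))// -[d in d%:R]card_ord mulr_natl -sumr_const.
apply: ler_sum => l _.
have [s sl E1] := MVT_line 0 (Y' i0 l - Y i0 l) (der_along (path_mx Y Y' l) l).
have -> : U l.+1 - U l = D i0 l (s *: delta_mx i0 l + path_mx Y Y' l) * (Y' i0 l - Y i0 l).
 move: E1; rewrite subr0 scale0r add0r => <-; congr (g (sum_config _) - _).
 apply/matrixP => j m; rewrite !mxE ltnS leq_eqVlt; have [->|jm] := eqVneq m l.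
  rewrite ltnn andbT; have [->|ji] := eqVneq j i0; first by rewrite mulr1 subrK eqxx.
  by rewrite mulr0 add0r YY' ?eqxx.
 by rewrite andbF mulr0 add0r (negbTE (_ : (m != l :> nat))).
rewrite -mulrBl normrM ler_pM//; apply: h => j m; rewrite !mxE.
have [->|jm] := eqVneq m l; last first.
 by rewrite andbF mulr0 add0r; case: ifP => _; [exact: nY'|exact: nY].
rewrite ltnn andbT; have [->|ji] := eqVneq j i0; last by rewrite mulr0 add0r; exact: nY.
rewrite mulr1; move: sl (nY i0 l) (nY' i0 l); rewrite !ler_norml.
case: (leP 0 (Y' i0 l - Y i0 l)) => ?; move=> /andP[? ?] /andP[? ?] /andP[? ?]; apply/andP; split; lra.
Qed.

(** The linear part with coefficients [G] is reproduced exactly ([EG]). The remainder is bounded by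
    [path_bound] times [4 c], that is [d w (2 / c)] times [4 c]. *)
Lemma mlsum_grad (G : 'I_d -> R) (w : R) : 0 <= w -> inner (row i0 X) ->
 (forall Z, near_mx Z -> forall l, `|D i0 l Z - G l| <= w) ->
 `|mlsum F (fun t => g (sum_config (cells_mx t))) - G k| <= 8 * d%:R * w.
Proof.
move=> w0 ii h.
have EG : mlsum F (fun t => \sum_l G l * (node (t i0) ord0 l - X i0 l)) = G k.
 rewrite mlsum_sum (bigD1 k)//= [X in _ + X]big1 ?addr0 => [|l lk]; rewrite mlsumZ.
  rewrite (mlsum_at F i0 (fun z => node z ord0 k - X i0 k)) prod_F mulr1 eqxx.
  have := sum_node_deta c0 k k ii; rewrite eqxx mxE => E1.
  by under eq_bigr do rewrite mulrC; rewrite E1 mulr1.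
 rewrite (mlsum_at F i0 (fun z => node z ord0 l - X i0 l)) prod_F mulr1 eqxx.
 have := sum_node_deta c0 k l ii; rewrite eq_sym (negbTE lk) mxE => E1.
 by under eq_bigr do rewrite mulrC; rewrite E1 mulr0.
rewrite -[X in _ - X]EG -[mlsum F (fun t => g (sum_config (cells_mx t)))]subr0 -[X in _ - X - _]mlsum_fixed !mlsumB.
have w20 : 0 <= d%:R * (w * (2 / c)) by apply: mulr_ge0 => //; apply: mulr_ge0 => //; rewrite divr_ge0// ltW.
apply: le_trans (mlsum_le w20 _) _.
 move=> t /okc_deta ok; rewrite g_inner_mx// g_inner_fixed//.
 have Ei l : inner_mx t i0 l = node (t i0) ord0 l by rewrite mxE asboolT.
 have Ef l : inner_fixed_mx t i0 l = X i0 l by rewrite mxE eqxx.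
 under eq_bigr do rewrite -Ei -Ef.
 have nI := inner_mx_near ok.
 apply: path_bound => //.
 - by move=> j l; rewrite mxE; case: ifP => _; [rewrite subrr normr0 divr_ge0// ltW|exact: nI].
 - by move=> j l /negbTE ji; rewrite mxE ji.
 by move=> l; rewrite Ef; exact: nI.
apply: le_trans (ler_wpM2l w20 prod_normF) _.
by rewrite le_eqVlt; apply/orP; left; apply/eqP; field; rewrite gt_eqF.
Qed.

End gradient.

End cells.

Lemma near_continuous N (f : 'M[R]_(N, d) -> R) (X : mat N) (e : R) : continuous f -> 0 < e ->
 exists2 r : R, 0 < r & forall Y : 'M[R]_(N, d), (forall j l, `|Y j l - X j l| <= r) -> `|f Y - f X| <= e.
Proof.
move=> cf e0; have /cvgrPdist_le/(_ e e0)/nbhs_ballP[r /= r0 rP] := cf X.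
exists (r / 2); first by rewrite divr_gt0.
move=> Y YX; rewrite distrC; apply: (rP Y); split=> // j l; rewrite /ball /= distrC.
by apply: le_lt_trans (YX j l) _; rewrite ltr_pdivrMr// ltr_pMr// ltr1n.
Qed.

Definition cell_rad : nat := ((Num.truncn `|v|).+1 + 4)%N.

Lemma rad_ge : v / 2 + 4 <= cell_rad%:R.
Proof.
have /ltW h : `|v| < (Num.truncn `|v|).+1%:R by rewrite truncnS_gt.
rewrite /cell_rad natrD; have := ler_norm v; have := normr_ge0 v.
by move: h; lra.
Qed.

Definition big_cube : set E := cube (2 * (cell_rad%:R + 2)).

Lemma approx_step (n : nat) : exists s : seq (R * expS),
 [/\ forall mu x, ~ big_cube x -> gF hS vS s mu x = 0,
   forall mu N (X : mat N), restr mu big_cube = sum_config X ->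
    `|spn hS s mu| <= b + 1 /\
    forall w : R, 0 <= w ->
     (forall Y, near_mx n.+1%:R X Y -> `|g (sum_config Y) - g (sum_config X)| <= w) ->
     `|spn hS s mu - g (sum_config X)| <= w + n.+1%:R^-1,
   forall mu N (X : mat N) i0 k, restr mu big_cube = sum_config X ->
    inner n.+1%:R (n.+1 * cell_rad) (row i0 X) -> forall (G : 'I_d -> R) (w : R), 0 <= w ->
    (forall Z, near_mx n.+1%:R X Z -> forall l, `|D i0 l Z - G l| <= w) ->
    `|gF hS vS s mu (row i0 X) ord0 k - G k| <= 8 * d%:R * w + n.+1%:R^-1 &
   forall mu N (X : mat N) i0 k, restr mu big_cube = sum_config X ->
    ~ inner n.+1%:R (n.+1 * cell_rad) (row i0 X) ->
    `|gF hS vS s mu (row i0 X) ord0 k| <= n.+1%:R^-1].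
Proof.
(* The mesh is [1 / c], and the number of nodes grows with [c] so that the grid always covers the
   same cube, of half side [K / c = cell_rad]. *)
pose c : R := n.+1%:R; pose K := (n.+1 * cell_rad)%N.
have c1 : 1 <= c by rewrite ler1n.
have c0 : 0 < c by exact: lt_le_trans c1.
have K0 : (0 < K)%N by rewrite muln_gt0.
have Kc : K%:R / c = cell_rad%:R by rewrite /K natrM mulrC mulKf// gt_eqF.
have vK : v / 2 + 4 <= K%:R / c by rewrite Kc rad_ge.
have ci1 : c^-1 <= 1 by rewrite invf_le1.
(* In the gradient the error on the characters is multiplied by up to [4 c]; this accuracy brings it
   down to [1 / c]. *)
pose e : R := (4 * c * c)^-1.
have e0 : 0 < e by rewrite invr_gt0 !mulr_gt0.
have ec : e * (4 * c) = c^-1 by rewrite /e; field; rewrite gt_eqF.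
have ec' : e <= c^-1 by rewrite -ec ler_peMr ?(ltW e0)//; lra.
have [s sP] := capp_cells c K e0.
have rK : 2 * ((K%:R + 2) / c) <= 2 * (cell_rad%:R + 2).
 by rewrite ler_wpM2l// mulrDl Kc lerD2l ler_pdivrMr// ler_peMr.
have sg N (t : {ffun 'I_N -> @cell K}) :
  `|chrspn s (counts t) - g (sum_config (cells_mx c t))| <= e.
 by rewrite distrC (g_cells vK) sP.
have eta1 N (X : mat N) : \prod_(j < N) \sum_z `|eta (K := K) c z (row j X)| = 1.
 rewrite big1// => j _; rewrite -(sum_eta c K (row j X)).
 by apply: eq_bigr => z _; rewrite ger0_norm// eta_ge0.
exists (es c0 s); split.
- move=> mu x nx; rewrite /gF big_map big1// => a _ /=.
 rewrite [X in _ *: X](_ : _ = 0) ?scaler0//; apply/rowP => l.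
 rewrite (vxE _ _ (mu, x)) /= vS_kS_out ?mxE ?mulr0//.
 by move=> x'; apply: nx; exact: sub_cube rK _ x'.
- move=> mu N X XP; rewrite (spn_es c0 rK XP); split.
  apply: le_trans (mlsum_le (w := b + 1) _ _) _.
  + by rewrite addr_ge0// (le_trans _ (gb mu)).
  + move=> t _; rewrite -(subrK (g (sum_config (cells_mx c t))) (chrspn _ _)).
   by rewrite (le_trans (ler_normD _ _))// addrC lerD// (le_trans (sg _ t)) ?(le_trans ec').
  by rewrite eta1 mulr1.
 move=> w w0 h; have := mlsum_approx c1 vK w0 h.
 have := mlsum_le (F := fun j z => eta c z (row j X)) (u := fun t : {ffun 'I_N -> @cell K} =>
  chrspn s (counts t) - g (sum_config (cells_mx c t))) (ltW e0) (fun t _ => sg _ t).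
 rewrite eta1 mulr1 -mlsumB; move: (mlsum _ _) (mlsum _ _) => A B h1 h2.
 rewrite -/c; move: h1 h2 ec'; move: (g (sum_config X)) (c^-1) (e) => a ? ?.
 by rewrite !ler_norml => /andP[? ?] /andP[? ?] ?; apply/andP; split; lra.
- move=> mu N X i0 k XP ii G w w0 h; rewrite (gF_es c0 rK XP s k (erefl _)).
 have := @mlsum_grad c K c1 vK N X i0 k G w w0 ii h.
 have := mlsum_le (F := fun j z => (if j == i0 then deta c k z else eta c z) (row j X))
  (u := fun t : {ffun 'I_N -> @cell K} =>
  chrspn s (counts t) - g (sum_config (cells_mx c t))) (ltW e0) (fun t _ => sg _ t).
 move=> /le_trans/(_ (ler_wpM2l (ltW e0) (prod_normF K c1 X i0 k))).
 rewrite ec -mlsumB; move: (mlsum _ _) (mlsum _ _) => A B h1 h2.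
 rewrite -/c; move: h1 h2; move: (G k) (c^-1) (8 * d%:R * w) => a ? ?.
 by rewrite !ler_norml => /andP[? ?] /andP[? ?]; apply/andP; split; lra.
move=> mu N X i0 k XP ii; rewrite (gF_es c0 rK XP s k (erefl _)).
have := @mlsum_not_inner c K c1 vK N X i0 k ii.
have := mlsum_le (F := fun j z => (if j == i0 then deta c k z else eta c z) (row j X))
 (u := fun t : {ffun 'I_N -> @cell K} =>
 chrspn s (counts t) - g (sum_config (cells_mx c t))) (ltW e0) (fun t _ => sg _ t).
move=> /le_trans/(_ (ler_wpM2l (ltW e0) (prod_normF K c1 X i0 k))).
rewrite ec -mlsumB; move: (mlsum _ _) (mlsum _ _) => A B h1 h2.
by move: h1; rewrite h2 subr0.
Qed.

Lemma exp_approximation : exists s : nat -> seq (R * expS),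
 [/\ forall n mu x, ~ big_cube x -> gF hS vS (s n) mu x = 0,
   forall n mu, `|spn hS (s n) mu| <= b + 1,
   forall mu, spn hS (s n) mu @[n --> \oo] --> g mu,
   forall n mu N (X : mat N) i0 k, restr mu big_cube = sum_config X ->
    `|gF hS vS (s n) mu (row i0 X) ord0 k| <= 8 * d%:R * L + 1 &
   forall mu N (X : mat N) i0 k, restr mu big_cube = sum_config X ->
    gF hS vS (s n) mu (row i0 X) ord0 k @[n --> \oo] --> D i0 k X].
Proof.
have /choice[s sP] := approx_step; exists s.
have ci1 n : n.+1%:R^-1 <= 1 :> R by rewrite invf_le1// ler1n.
have vb : V `<=` big_cube.
 move=> x /VQ; apply: sub_cube; have := rad_ge; lra.
have near_ev (r : R) : 0 < r -> \forall n \near \oo, 2 / n.+1%:R <= r.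
 move=> r0; exists (Num.truncn (2 / r)) => // n /= hn.
 rewrite ler_pdivrMr// mulrC -ler_pdivrMr//; apply/ltW/(lt_le_trans (truncnS_gt _)).
 by rewrite ler_nat.
have inv_ev (e : R) : 0 < e -> \forall n \near \oo, n.+1%:R^-1 <= e.
 move=> e0; have := near_ev (2 * e) (ltac:(by rewrite mulr_gt0)).
 by apply: filterS => n; rewrite ler_pM2l.
have enum (mu : M) := config_enum mu (cube_bnd (2 * (cell_rad%:R + 2))).
split.
- by move=> n; have [h _ _ _] := sP n.
- by move=> n mu; have [N [X [_ XP]]] := enum mu; have [_ h _ _] := sP n; exact: (h _ _ _ XP).1.
- move=> mu; have [N [X [_ XP]]] := enum mu.
 have -> : g mu = g (sum_config X) by rewrite -XP -gV -[RHS]gV restr_restr.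
 apply/cvgrPdist_le => e e0; have [r r0 rP] := near_continuous X (@gC N) (divr_gt0 e0 (ltr0n _ 2)).
 near=> n; have [_ h _ _] := sP n; rewrite distrC (splitr e).
 apply: le_trans ((h mu N X XP).2 (e / 2) _ _) _.
 + by rewrite divr_ge0// ltW.
 + move=> Y YX; apply: rP => j l; apply: le_trans (YX j l) _; near: n; exact: near_ev.
 + by rewrite lerD2l; near: n; apply: inv_ev; rewrite divr_gt0.
- move=> n mu N X i0 k XP; have [_ _ h1 h2] := sP n.
 have L0 : 0 <= L by exact: le_trans (DL i0 k X).
 case: (pselect (inner n.+1%:R (n.+1 * cell_rad) (row i0 X))) => ii.
  have /(_ (fun=> 0) L L0) := h1 _ _ _ _ k XP ii; rewrite subr0 => h.
  apply: le_trans (h _) _; last by rewrite lerD2l.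
  by move=> Z _ l; rewrite subr0.
 apply: le_trans (h2 _ _ _ _ k XP ii) _; apply: le_trans (ci1 n) _.
 by rewrite lerDr !mulr_ge0.
move=> mu N X i0 k XP.
case: (pselect (forall l, `|X i0 l| < cell_rad%:R)) => [ii|].
 have inner_ev : \forall n \near \oo, inner n.+1%:R (n.+1 * cell_rad) (row i0 X).
  have : \forall n \near \oo, forall l : 'I_d, n.+1%:R^-1 <= cell_rad%:R - `|X i0 l|.
   by apply: filter_forall => l; apply: inv_ev; rewrite subr_gt0.
  apply: filterS => n hn l; rewrite row_entry normrM ger0_norm// natrM.
  have := hn l; rewrite -[leLHS]mul1r ler_pdivrMr// mulrBl mulrC => h.
  by move: h; rewrite (mulrC `|_|); lra.
 apply/cvgrPdist_le => e e0.
 pose w := e / (2 * (8 * d%:R + 1)).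
 have q0 : 0 < 8 * d%:R + 1 :> R by rewrite ltr_wpDl// mulr_ge0.
 have w0 : 0 < w by rewrite divr_gt0// mulr_gt0.
 have : forall l : 'I_d, exists r : R, 0 < r /\
   forall Y : 'M[R]_(N, d), (forall j l', `|Y j l' - X j l'| <= r) -> `|D i0 l Y - D i0 l X| <= w.
  by move=> l; have [r r0 rP] := near_continuous X (@cD N i0 l) w0; exists r.
 move=> /choice[r rP].
 have r_ev : \forall n \near \oo, forall l : 'I_d, 2 / n.+1%:R <= r l.
  by apply: filter_forall => m; apply: near_ev; exact: (rP m).1.
 near=> n; have [_ _ h _] := sP n; rewrite distrC.
 apply: le_trans (h mu N X i0 k XP _ (fun l => D i0 l X) w (ltW w0) _) _.
 + by near: n.
 + move=> Z ZX l; apply: (rP l).2 => j l'; apply: le_trans (ZX j l') _.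
  have rn : forall l, 2 / n.+1%:R <= r l by near: n.
  exact: rn.
 rewrite (splitr e) lerD//; last by near: n; apply: inv_ev; rewrite divr_gt0.
 have E1 : e = 2 * (8 * d%:R + 1) * w by rewrite /w mulrC divfK// gt_eqF// mulr_gt0.
 by rewrite {1}E1; move: (ltW w0); move: (d%:R : R) => dd; lra.
(* The point sits on or beyond the edge of the grid, where [g] does not see it: both its derivative
   and the limit are 0. *)
move=> /existsNP[l /negP]; rewrite -leNgt => xl.
have D0 : D i0 k X = 0.
 have /der_line [_ <-] := gD i0 k X.
 have near0 : \forall t \near (0 : R), (fun=> g (sum_config X)) t = g (sum_config (t *: delta_mx i0 k + X)).
  have := @nbhsx_ballx _ _ (0 : R) 1 ltr01.
  apply: filterS => t; rewrite /ball /= sub0r normrN => t1; apply: g_see => j.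
  have [->|ji] := eqVneq j i0; last first.
   by left; apply/rowP => m; rewrite !mxE (negbTE ji) mulr0 add0r.
  have vr := rad_ge; right; split; apply: (@out_V _ l); rewrite !mxE; first by apply: lt_le_trans xl; lra.
  have h : `|X i0 l| <= `|t * (i0 == i0)%:R * (l == k)%:R + X i0 l| + `|t|.
   rewrite eqxx mulr1 -{1}(addKr (t * (l == k)%:R) (X i0 l)) addrC.
   rewrite (le_trans (ler_normB _ _))// lerD2l normrM ler_piMr//.
   by case: (l == k); rewrite ?normr1 ?normr0.
  by move: h; rewrite -mulrA -natrM mulnb; move: xl t1; lra.
 by rewrite -(near_eq_derive _ near0) derive_cst.
rewrite D0; apply/cvgr0Pnorm_le => e e0; near=> n.
have [_ _ _ h] := sP n; apply: le_trans (h _ _ _ _ k XP _) _.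
 move=> /(_ l); rewrite row_entry normrM ger0_norm// natrM => hl.
 have : n.+1%:R * cell_rad%:R <= n.+1%:R * `|X i0 l| by rewrite ler_pM2l.
 by move: hl; lra.
by near: n; exact: inv_ev.
Unshelve. all: by end_near. Qed.

End approximation.

(** * Partial derivatives of local smooth functions *)

Section partial_derivatives.
Implicit Types (mu : M) (x y : E) (k : 'I_d).

Variables (f : M -> R) (V : set E).
Hypothesis fV : forall mu, f (restr mu V) = f mu.

Lemma f_ext mu (nu : M) : (forall A, mu (A `&` V) = nu (A `&` V)) -> f mu = f nu.
Proof. by move=> h; rewrite -fV -[RHS]fV; congr f; exact: config_ext. Qed.

Lemma atom_sum N (X : mat N) i : sum_config X [set row i X] != 0%E.
Proof.
rewrite gt_eqF//= (bigD1 i)//= diracE mem_set//=.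
apply: (@lt_le_trans _ _ 1%E); rewrite ?lte01// leeDl//.
by apply: sume_ge0 => j _; rewrite diracE lee_fin.
Qed.

Lemma move_sum mu (Q : set E) N (X : mat N) i x k (t : R) : V `<=` Q -> Q x ->
 mu [set x] != 0%E -> restr mu Q = sum_config X -> row i X = x ->
 f (move mu x (x + t *: delta_mx ord0 k)) = f (sum_config (t *: delta_mx i k + X)).
Proof.
move=> VQ Qx mux XP Xx; apply: f_ext => A; rewrite moveE (negbTE mux).
have -> : mu (A `&` V) = sum_config X (A `&` V).
 by rewrite -XP /= -setIA (setIidl VQ).
have yE : row i (t *: delta_mx i k + X) = x + t *: delta_mx ord0 k.
 by apply/rowP => j; rewrite -Xx !mxE !eqxx addrC.
rewrite /= (bigD1 i)//= Xx [RHS](bigD1 i)//= yE.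
rewrite (addeC (\d_x _)) addeK; last by rewrite diracE.
rewrite addeC; congr (_ + _)%E; apply: eq_bigr => j ji.
rewrite (_ : row j (t *: delta_mx i k + X) = row j X)//.
by apply/rowP => l; rewrite !mxE (negbTE ji) mulr0 add0r.
Qed.

Lemma partial_sum mu (Q : set E) N (X : mat N) i x k : V `<=` Q -> Q x ->
 mu [set x] != 0%E -> restr mu Q = sum_config X -> row i X = x ->
 partial k f mu x = 'D_(delta_mx i k) (fun Y : 'M[R]_(N, d) => f (sum_config Y)) X.
Proof.
move=> VQ Qx mux XP Xx; rewrite /partial /derive.
have fX : f mu = f (sum_config X).
 by apply: f_ext => A; rewrite -XP /= -setIA (setIidl VQ).
rewrite (_ : (fun h : R => h^-1 * _) = fun h : R => h^-1 *:
 (((fun Y : 'M[R]_(N, d) => f (sum_config Y)) \o shift X) (h *: delta_mx i k) - f (sum_config X)))//.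
apply/funext => t.
by rewrite (move_sum _ _ VQ Qx mux XP Xx) fX.
Qed.

Lemma move_unseen mu x y : ~ V x -> ~ V y -> f (move mu x y) = f mu.
Proof.
move=> Vx Vy; apply: f_ext => A; rewrite moveE; case: ifP => // _.
by rewrite !diracE !memNset ?sube0 ?adde0// => -[].
Qed.

(** Half sides differ by 1, so a point outside [cube r] displaced by less than 1 stays outside
    [V]. *)
Lemma partial_unseen mu x k (r : R) : V `<=` cube (r - 2) -> ~ cube r x -> partial k f mu x = 0.
Proof.
move=> Vr nx; have [l xl] : exists l, r / 2 < `|x ord0 l|.
 apply: contrapT => h; apply: nx => l; rewrite -ler_norml leNgt; apply/negP => xl.
 by apply: h; exists l.
have nV (y : E) : (r - 2) / 2 < `|y ord0 l| -> ~ V y.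
 by move=> yl /Vr/(_ l); rewrite -ler_norml leNgt yl.
rewrite /partial; apply: cvg_lim => //.
have c0 : (fun=> 0 : R) t @[t --> (0 : R)^'] --> (0 : R) by exact: cvg_cst.
apply: cvg_trans c0; apply: near_eq_cvg; near=> t; rewrite /= move_unseen ?subrr ?mulr0//; first by apply: nV; lra.
apply: nV; rewrite !mxE eqxx /=.
have t1 : `|t * (l == k)%:R| <= 1.
 rewrite normrM; have : `|t| <= 1 by near: t; exact: dnbhs0_le.
 by case: (l == k); rewrite ?normr1 ?normr0 ?mulr1 ?mulr0.
have h : `|x ord0 l| <= `|x ord0 l + t * (l == k)%:R| + `|t * (l == k)%:R|.
 by rewrite -{1}(addrK (t * (l == k)%:R) (x ord0 l)) ler_normB.
by move: h t1 xl; lra.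
Unshelve. all: by end_near. Qed.

Lemma cts_vec_mx N : continuous (@vec_mx R N d).
Proof.
move=> v A /nbhs_ballP[e /= e0 eA]; apply/nbhs_ballP; exists e => //= w [_ vw].
by apply: eA; split => // i j; rewrite !mxE; exact: vw.
Qed.

Hypothesis sf : forall N, smooth (fun X : 'M[R]_(N, d) => f (sum_config X)).

Lemma smooth_derivable N (X : mat N) i k :
 is_derive X (delta_mx i k) (fun Y => f (sum_config Y)) ('D_(delta_mx i k) (fun Y => f (sum_config Y)) X).
Proof. by have [_ /(_ i k)[/(_ X) df _]] := sf N 1%N; exact: derivableP. Qed.

Lemma smooth_continuous N : continuous (fun X : 'M[R]_(N, d) => f (sum_config X)).
Proof. by have [] := sf N 0%N. Qed.

Lemma smooth_continuous_derive N i k :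
 continuous (fun X : 'M[R]_(N, d) => 'D_(delta_mx i k) (fun Y => f (sum_config Y)) X).
Proof. by have [_ /(_ i k)[_ []]] := sf N 1%N. Qed.

(** At most [m] visible points means finitely many matrix sizes, each with a compact set of
    positions. The bound depends on [m], which is why the number of points is truncated below. *)
Lemma partial_bounded (r : R) (m : nat) : V `<=` cube (r - 2) ->
 exists2 L : R, 0 <= L & forall mu x k, mu [set x] != 0%E -> (mu (cube r) <= m%:R%:E)%E ->
  `|partial k f mu x| <= L.
Proof.
move=> Vr.
have bN N : exists B : R, forall i k (X : mat N), (forall j, cube r (row j X)) ->
  `|'D_(delta_mx i k) (fun Y => f (sum_config Y)) X| <= B.
 have bik i k : exists B : R, forall (X : mat N), (forall j, cube r (row j X)) ->
   `|'D_(delta_mx i k) (fun Y => f (sum_config Y)) X| <= B.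
  have cD : continuous (fun v : 'rV[R]_(N * d) =>
    'D_(delta_mx i k) (fun Y : 'M[R]_(N, d) => f (sum_config Y)) (vec_mx v)).
   move=> v; apply: (@continuous_comp _ _ _ (@vec_mx R N d)
    (fun X : 'M[R]_(N, d) => 'D_(delta_mx i k) (fun Y => f (sum_config Y)) X)).
    exact: cts_vec_mx.
   exact: smooth_continuous_derive.
  have [B BP] := compact_bounded_fun r cD; exists B => X rX.
  rewrite -(mxvecK X); apply: BP => l; case/mxvec_indexP: l => j l.
  by rewrite mxvecE; have := rX j l; rewrite mxE.
 have /choice[B BP] : forall ik : 'I_N * 'I_d, exists B : R, forall (X : mat N), (forall j, cube r (row j X)) ->
   `|'D_(delta_mx ik.1 ik.2) (fun Y => f (sum_config Y)) X| <= B by move=> ik; exact: bik.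
 exists (\sum_ik `|B ik|) => i k X rX; apply: le_trans (BP (i, k) X rX) _.
 by rewrite (bigD1 (i, k))//= (le_trans (ler_norm _))// lerDl sumr_ge0.
have /choice[B BP] := bN.
exists (\sum_(N < m.+1) `|B N|) => [|mu x k mux mur]; first exact: sumr_ge0.
have [xr|xr] := pselect (cube r x); last first.
 by rewrite (partial_unseen _ _ Vr xr) normr0 sumr_ge0.
have [N [X [XQ XP]]] := config_enum mu (cube_bnd r).
have [i Xi] : exists i, row i X = x.
 apply: contrapT => nX; move/negP: mux; apply.
 have : restr mu (cube r) [set x] = sum_config X [set x] by rewrite XP.
 rewrite /= (setIidl (_ : [set x] `<=` cube r)); last by move=> _ ->.
 move=> ->; rewrite big1// => i _; rewrite diracE memNset//= => Xi; apply: nX.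
 by exists i.
have Vr' : V `<=` cube r by move=> y /Vr; apply: sub_cube; lra.
rewrite (partial_sum k Vr' xr mux XP Xi).
have Nm : (N < m.+1)%N.
 have : restr mu (cube r) setT = sum_config X setT by rewrite XP.
 rewrite /= setTI => muE; move: mur; rewrite muE.
 under eq_bigr do rewrite diracT.
 by rewrite sumEFin sumr_const card_ord lee_fin ler_nat.
apply: le_trans (BP N i k X XQ) _.
by rewrite (bigD1 (Ordinal Nm))//= (le_trans (ler_norm _))// lerDl sumr_ge0.
Qed.

End partial_derivatives.

(** * Dominated convergence for vector fields *)

Section dominated_fields.
Local Notation C := (campbell).

Lemma ven_ip (F : M -> E -> E) : vL2 F ->
 ven F F = \sum_k ip C (fun p => F p.1 p.2 ord0 k) (fun p => F p.1 p.2 ord0 k).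
Proof.
move=> sF; apply: EFin_inj; rewrite -venE// -sumEFin.
under eq_integral do rewrite /sqnorm -sumEFin.
rewrite ge0_integral_sum//.
- by apply: eq_bigr => k _; exact: ip_sqr.
- by move=> k; apply/mEFin/mfunX; exact: (sF k).1.
- by move=> k p _; rewrite lee_fin sqr_ge0.
Qed.

(** The bounds are asked at atoms only: the fields are multiplied by the indicator of the atoms,
    which carry the Campbell measure. *)
Lemma ven_dominated (F : nat -> M -> E -> E) (g : M * E -> R) :
 (forall n, vL2 (F n)) -> L2 C g -> (forall p, 0 <= g p) ->
 (forall n (mu : M) x k, mu [set x] != 0%E -> `|F n mu x ord0 k| <= g (mu, x)) ->
 (forall (mu : M) x k, mu [set x] != 0%E -> F n mu x ord0 k @[n --> \oo] --> (0 : R)) ->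
 ven (F n) (F n) @[n --> \oo] --> (0 : R).
Proof.
move=> sF sg g0 Fg F0; pose A := [set p : M * E | p.1 [set p.2] != 0%E].
have mA : measurable A.
 have -> : A = ~` [set p : M * E | p.1 [set p.2] = 0%E].
  by apply/seteqP; split => p /=; [move/eqP|move=> h; apply/eqP].
 apply: measurableC; have := mbl_atom measurableT (emeasurable_set1 0%E).
 by rewrite setTI.
pose h k n (p : M * E) : R := F n p.1 p.2 ord0 k * \1_A p.
have mh k n : mbl (h k n).
 by apply: mfunM; [exact: (sF n k).1|exact: mindic].
have hk k : L2cvg C (h k) (fun=> 0).
 suff [] : L2 C (fun=> 0) /\ L2cvg C (h k) (fun=> 0) by [].
 apply: (L2_dominated (mh k) sg).
  move=> n p; rewrite /h indicE; case: (boolP (p \in A)) => [/set_mem pA|_]; rewrite ?mulr1 ?mulr0 ?normr0//.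
  by have := Fg n p.1 p.2 k pA; case: p {pA}.
 move=> p; rewrite /h indicE; case: (boolP (p \in A)) => [/set_mem pA|_].
  by under eq_fun do rewrite mulr1; exact: F0.
 by under eq_fun do rewrite mulr0; exact: cvg_cst.
have E1 n : ven (F n) (F n) = \sum_k ip C (h k n) (h k n).
 rewrite ven_ip//; apply: eq_bigr => k _; rewrite /ip /Rintegral; congr fine.
 apply: ae_eq_integral => //.
 - by apply/mEFin/mfunM; exact: (sF n k).1.
 - by apply/mEFin/mfunM.
 apply: filterS (atom_ae) => p pA _ /=; by rewrite /h indicE mem_set// mulr1.
rewrite (_ : (fun n => _) = fun n => \sum_k ip C (h k n) (h k n)); last exact/funext.
have E0 : \sum_(k < d) (0 : R) = 0 by rewrite big1.
suff h0 : \sum_k ip C (h k n) (h k n) @[n --> \oo] --> \sum_(k < d) (0 : R) by rewrite E0 in h0.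
apply: cvg_sumr => k.
have := hk k; rewrite /L2cvg.
rewrite (_ : (fun n => nrm _ _) = fun n => nrm C (h k n)); last first.
 by apply/funext => n; congr nrm; apply/funext => p; rewrite subr0.
move=> hn; rewrite (_ : (fun n => _) = fun n => nrm C (h k n) * nrm C (h k n)).
 by rewrite -(mulr0 0); exact: cvgM.
by apply/funext => n; rewrite -nrm_sqr expr2.
Qed.

Lemma ven_triangle (F G : M -> E -> E) : vL2 F -> vL2 G ->
 ven (fun mu x => F mu x + G mu x) (fun mu x => F mu x + G mu x) <=
 2 * ven F F + 2 * ven G G.
Proof.
move=> sF sG; have w1 := @weight1; have mI := @mfield_id.
have sB := vL2B sF sG.
have := en_ge0 mI (fun mu x => F mu x - G mu x) w1.
rewrite /ven (enBl mI)// !(enBr mI)// (enDl mI)//; last exact: vL2D.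
by rewrite !(enDr mI)// (enC mI _ G F); lra.
Qed.

End dominated_fields.

(** * Smooth truncation of the number of points *)

Section cutoff.
Variables (f : M -> R) (V : set E) (r b : R).
Hypotheses (fV : forall mu, f (restr mu V) = f mu) (Vr : V `<=` cube (r - 2))
(sf : forall N, smooth (fun X : 'M[R]_(N, d) => f (sum_config X))) (fb : forall mu, `|f mu| <= b).
Implicit Types (mu : M) (x : E).

Let s := r / 2 + 1.

Definition psi x : R := phs s x.

Lemma psi1 x : cube r x -> psi x = 1.
Proof. by move=> xr; apply: phs1; apply: rr_le => // k; rewrite ler_norml; exact: xr. Qed.

(** The truncation looks at points beyond [V]; this is the region on which the truncated function
    depends. *)
Definition visible : set E := [set x | 0 < psi x].

Lemma psi_ge0 x : 0 <= psi x. Proof. by have /andP[] := phs01 s x. Qed.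

Lemma psi_out x : ~ visible x -> psi x = 0.
Proof. by move=> /negP; rewrite -leNgt => h; apply/le_anti; rewrite h psi_ge0. Qed.

Lemma V_visible : V `<=` visible.
Proof. by move=> x /Vr xr; rewrite /visible /= psi1//; apply: sub_cube xr; lra. Qed.

Lemma visible_cube : visible `<=` cube (2 * (s + 4^-1)).
Proof.
move=> x vx k; rewrite [X in X / 2]mulrC mulfK// -ler_norml; apply: le_trans (rr_ge x k) _.
by rewrite leNgt; apply/negP => /ltW h; move: vx; rewrite /visible /= /psi phs0// ltxx.
Qed.

Lemma mbl_psi : mbl psi.
Proof. exact: cts_mbl_mx (sm_continuous (sm_phs s)). Qed.

Lemma mbl_visible : measurable visible.
Proof.
have := mbl_psi measurableT (measurable_itv `]0, +oo[%R); rewrite setTI.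
by congr measurable; apply/seteqP; split => x /=; rewrite in_itv /= andbT.
Qed.

Lemma psi_bsupp : bsupp psi.
Proof.
by exists (2 * (s + 4^-1)) => x nx; apply: psi_out => vx; apply: nx; exact: visible_cube.
Qed.

Lemma lin_psi_restr mu Q : measurable Q -> visible `<=` Q -> lin psi (restr mu Q) = lin psi mu.
Proof.
move=> mQ vQ; apply: lin_restr => //; [exact: mbl_psi|exact: psi_bsupp|].
by move=> x nx; apply: psi_out => /vQ.
Qed.

Lemma restrT mu : restr mu setT = mu.
Proof. by apply: config_ext => A /=; rewrite setIT. Qed.

Lemma lin_psi_sum N (X : mat N) : lin psi (sum_config X) = \sum_(i < N) psi (row i X).
Proof.
by apply: (lin_enum measurableT (restrT _)); [exact: mbl_psi|move=> x /(_ Logic.I)].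
Qed.

Variable m : nat.

(** Truncation by a smoothed count of the points. It secures both the hypothesis [g_mult] of the
    approximation and bounded derivatives. *)
Definition tcut mu : R := f mu * (1 - step (lin psi mu - m%:R)).

Definition cut_grad mu x : E := (1 - step (lin psi mu - m%:R)) *: grad f mu x
 - (f mu * dstep (lin psi mu - m%:R)) *: dphs s x.

Definition Dcut N (i : 'I_N) (k : 'I_d) (X : mat N) : R :=
 cut_grad (sum_config X) (row i X) ord0 k.

Lemma cut_gradE mu x k : cut_grad mu x ord0 k = (1 - step (lin psi mu - m%:R)) * grad f mu x ord0 k
 - f mu * dstep (lin psi mu - m%:R) * dphs s x ord0 k.
Proof. by rewrite /cut_grad; move: (grad f mu x) (dphs s x) => G H; rewrite !mxE. Qed.

Lemma cut_visible mu : tcut (restr mu visible) = tcut mu.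
Proof.
rewrite /tcut lin_psi_restr//; last exact: mbl_visible.
by congr (_ * _); apply: (f_ext fV) => A /=; rewrite -setIA (setIidl V_visible).
Qed.

Lemma cut_bounded mu : `|tcut mu| <= b.
Proof.
rewrite /tcut normrM -[leRHS]mulr1 ler_pM//; have := step_ge0 (lin psi mu - m%:R).
by have := step_le1 (lin psi mu - m%:R); rewrite ler_norml => h1 h2; apply/andP; split; lra.
Qed.

Lemma cut_mult p : visible p ->
 exists B : nat, forall mu, (B%:R%:E <= mu [set p])%E -> tcut mu = 0.
Proof.
(* [B] points at [p] alone already raise the smoothed count to [m + 1]. *)
move=> vp; pose B := (Num.truncn ((m%:R + 1) / psi p)).+1; exists B => mu Bmu.
have [N [X [XQ XP]]] := config_enum mu (cube_bnd (2 * (s + 4^-1))).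
have pQ := visible_cube vp.
have mup : (mu [set p] = (\sum_(i < N) (row i X == p)%:R)%:E)%E.
 have : restr mu (cube (2 * (s + 4^-1))) [set p] = sum_config X [set p] by rewrite XP.
 rewrite /= (setIidl (_ : [set p] `<=` _)); last by move=> _ ->.
 move=> ->; rewrite -sumEFin; apply: eq_bigr => i _; rewrite diracE.
 by congr ((nat_of_bool _)%:R)%:E; apply/idP/eqP => [/set_mem//|->]; exact: mem_set.
move: Bmu; rewrite mup lee_fin => Bmu.
rewrite /tcut step1 ?subrr ?mulr0// lerBrDr addrC.
rewrite -(lin_psi_restr mu (@cube_mbl _) visible_cube) XP lin_psi_sum.
apply: (@le_trans _ _ (\sum_(i < N) psi p * (row i X == p)%:R)).
 rewrite -mulr_sumr mulrC -ler_pdivrMr//; apply: le_trans Bmu.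
 by apply/ltW; rewrite truncnS_gt.
apply: ler_sum => i _; case: eqP => [->|_]; first by rewrite mulr1.
by rewrite mulr0 psi_ge0.
Qed.

Lemma partial_sum_config N (X : mat N) i k : partial k f (sum_config X) (row i X) =
 'D_(delta_mx i k) (fun Y : 'M[R]_(N, d) => f (sum_config Y)) X.
Proof. exact: (partial_sum fV k (@subsetT _ V) Logic.I (atom_sum X i) (restrT _) erefl). Qed.

Lemma DcutE N (i : 'I_N) k X : Dcut i k X =
 'D_(delta_mx i k) (fun Y : 'M[R]_(N, d) => f (sum_config Y)) X *
  (1 - step (\sum_(j < N) psi (row j X) - m%:R)) -
 f (sum_config X) * dstep (\sum_(j < N) psi (row j X) - m%:R) * dphs s (row i X) ord0 k.
Proof. by rewrite /Dcut /cut_grad 3!mxE mulrC 2!mxE partial_sum_config lin_psi_sum mxE. Qed.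

Lemma cut_sum N (X : mat N) : tcut (sum_config X) =
 f (sum_config X) * (1 + -1 * step (\sum_(j < N) psi (row j X) + - m%:R)).
Proof. by rewrite /tcut lin_psi_sum mulN1r. Qed.

Lemma der_sum_psi N (i : 'I_N) k (X : mat N) :
 is_derive X (delta_mx i k) (fun Y => \sum_(j < N) psi (row j Y)) (dphs s (row i X) ord0 k).
Proof.
apply/der_line.
pose c := \sum_(j < N | j != i) psi (row j X).
rewrite (_ : (fun t => _) = fun t : R => psi (t *: delta_mx ord0 k + row i X) + c).
 have /der_line h := der_phs s k (row i X).
 by have := der_add h (der_const c (0 : R) (1 : R)); rewrite addr0.
apply/funext => t; have Ei : row i (t *: delta_mx i k + X) = t *: delta_mx ord0 k + row i X.
 by apply/rowP => l; rewrite !mxE !eqxx.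
rewrite -Ei; apply: (@sum_off _ N i (fun j => psi (row j (t *: delta_mx i k + X))) (fun j => psi (row j X))) => j ji.
have Ej : row j (t *: delta_mx i k + X) = row j X.
 by apply/rowP => l; rewrite !mxE (negbTE ji) mulr0 add0r.
by rewrite Ej.
Qed.

Lemma der_cut N (i : 'I_N) k (X : mat N) :
 is_derive X (delta_mx i k) (fun Y => tcut (sum_config Y)) (Dcut i k X).
Proof.
rewrite (_ : (fun Y => _) = fun Y : 'M[R]_(N, d) =>
 f (sum_config Y) * (1 + -1 * step (\sum_(j < N) psi (row j Y) + - m%:R))); last first.
 by apply/funext => Y; rewrite cut_sum.
have d1 := der_add (der_sum_psi i k X) (der_const (- m%:R : R) X (delta_mx i k)).
have d2 := der_chain (g := fun Y : 'M[R]_(N, d) => \sum_(j < N) psi (row j Y) + - m%:R)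
 (der_step _) d1.
have d3 := der_add (der_const 1 X (delta_mx i k))
 (der_mul (der_const (-1) X (delta_mx i k)) d2).
have := der_mul (smooth_derivable sf X i k) d3.
move=> hd; apply: (der_val hd); rewrite DcutE.
by move: ('D_ _ _ _) (step _) (dstep _) (dphs _ _ _ _) (f _) => a1 a2 a3 a4 a5; ring.
Qed.

Lemma cts_sum_psi N : continuous (fun X : 'M[R]_(N, d) => \sum_(j < N) psi (row j X) - m%:R).
Proof.
apply: sm_continuous; apply: sm_sub; last exact: sm_cst.
by apply: sm_sum => j; apply: sm_row; exact: sm_phs.
Qed.

Lemma cts_comp_R N (u : R -> R) (g : 'M[R]_(N, d) -> R) : continuous u -> continuous g ->
 continuous (fun X => u (g X)).
Proof. by move=> cu cg X; apply: (@continuous_comp _ _ _ g u); [exact: cg|exact: cu]. Qed.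

Lemma cts_step : continuous (@step R).
Proof. by move=> t; exact: is_derive1_continuous (der_step t). Qed.

Lemma cts_cut N : continuous (fun X : 'M[R]_(N, d) => tcut (sum_config X)).
Proof.
rewrite (_ : (fun Y => _) = fun Y : 'M[R]_(N, d) =>
 f (sum_config Y) * (1 - step (\sum_(j < N) psi (row j Y) - m%:R))); last first.
 by apply/funext => Y; rewrite cut_sum mulN1r.
apply: cts_mulR; first exact: (smooth_continuous sf).
apply: cts_subR; first exact: cst_continuous.
exact: (cts_comp_R cts_step (@cts_sum_psi N)).
Qed.

Lemma cts_dphs k : continuous (fun x => dphs s x ord0 k).
Proof.
have [f' sf' df] := sm_derive ord0 k (sm_phs s).
rewrite (_ : (fun x => _) = f'); first exact: sm_continuous.
by apply/funext => x; have [_ <-] := der_phs s k x; have [_ ->] := df x.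
Qed.

Lemma cts_row N (i : 'I_N) : continuous (row i : 'M[R]_(N, d) -> E).
Proof.
move=> X A /nbhs_ballP[e /= e0 eA]; apply/nbhs_ballP; exists e => //= Y [_ XY].
by apply: eA; split => // j k; rewrite !mxE; exact: XY.
Qed.

Lemma cts_Dcut N (i : 'I_N) k : continuous (@Dcut N i k).
Proof.
have -> : @Dcut N i k = fun X => 'D_(delta_mx i k) (fun Y : 'M[R]_(N, d) => f (sum_config Y)) X *
  (1 - step (\sum_(j < N) psi (row j X) - m%:R)) -
 f (sum_config X) * dstep (\sum_(j < N) psi (row j X) - m%:R) * dphs s (row i X) ord0 k.
 by apply/funext => X; exact: DcutE.
apply: cts_subR.
 apply: cts_mulR; first exact: (smooth_continuous_derive sf).
 apply: cts_subR; first exact: cst_continuous.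
 exact: (cts_comp_R cts_step (@cts_sum_psi N)).
apply: cts_mulR; last first.
 by move=> X; apply: (@continuous_comp _ _ _ (row i) (fun x => dphs s x ord0 k)); [exact: cts_row|exact: cts_dphs].
apply: cts_mulR; first exact: (smooth_continuous sf).
exact: (cts_comp_R (@cts_dstep R) (@cts_sum_psi N)).
Qed.

End cutoff.

(** * Density of smooth exponentials in H^1_0 *)

Section density.
Local Notation C := (campbell).
Implicit Types (mu : M) (x : E).

Lemma L2_normr (g : M * E -> R) : L2 C g -> L2 C (fun p => `|g p|).
Proof.
move=> sg; have [] : L2 C (fun p => `|g p|) /\ nrm C (fun p => `|g p|) <= nrm C g => //.
apply: le_nrm => //; last by move=> p; rewrite normr_id.
by apply: mcomp; [exact: normr_measurable|exact: sg.1].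
Qed.

Section approximate.
Variables (f : M -> R) (V : set E) (r b : R).
Hypotheses (Cf : Cc_infty f) (fV : forall mu, f (restr mu V) = f mu) (Vr : V `<=` cube (r - 2))
(fb : forall mu, `|f mu| <= b).

Let sf : forall N, smooth (fun X : 'M[R]_(N, d) => f (sum_config X)).
Proof. by have [_ _] := Cf. Qed.

Let mf : mbl f.
Proof. by have [_ [W _ /mbl_wrtT]] := Cf. Qed.

Let b0 : 0 <= b. Proof. exact: le_trans (fb (sum_config (0 : mat 0))). Qed.

Let q : R := 2 * (r / 2 + 1 + 4^-1).

Lemma grad_out mu x k : ~ cube q x -> grad f mu x ord0 k = 0.
Proof.
move=> nx; rewrite mxE (partial_unseen fV mu k Vr)// => xr; apply: nx.
by apply: sub_cube xr; rewrite /q; lra.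
Qed.

Lemma dphs_out x : ~ cube q x -> dphs (r / 2 + 1) x = 0.
Proof.
move=> nx; apply: dphs0 => //; right; rewrite leNgt; apply/negP => h; apply: nx => k.
rewrite /q [X in X / 2]mulrC mulfK// -ler_norml; apply: le_trans (rr_ge x k) _.
exact: ltW.
Qed.

Lemma dphs_bounded : exists2 B : R, 0 <= B & forall x k, `|dphs (r / 2 + 1) x ord0 k| <= B * \1_(cube q) x.
Proof.
have [D D0 dD] := @dstep_bounded R; exists (8 * D) => [|x k]; first by rewrite mulr_ge0.
rewrite indicE; case: (boolP (x \in cube q)) => [_|/negP xq]; last first.
 by rewrite dphs_out ?mxE ?normr0 ?mulr0// => xq'; apply: xq; exact: mem_set.
have h := sqnorm_dphs (r / 2 + 1) x D0 dD.
have h1 : dphs (r / 2 + 1) x ord0 k ^+ 2 <= sqnorm (dphs (r / 2 + 1) x).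
 by rewrite /sqnorm (bigD1 k)//= lerDl sumr_ge0// => l _; exact: sqr_ge0.
have h2 : sqnorm (dphs (r / 2 + 1) x) <= (8 * D) ^+ 2.
 apply: le_trans h _; have /andP[p0 _] := phs01 (r / 2 + 1) x.
 have /andP[_ p1] := phs01 (r / 2 + 1 + 4^-1) x.
 rewrite (_ : (8 * D) ^+ 2 = 64 * D ^+ 2 * 1); last by ring.
 by rewrite ler_wpM2l// ?mulr_ge0 ?sqr_ge0//; lra.
rewrite mulr1 -(@ler_pXn2r _ 2) ?nnegrE ?mulr_ge0// real_normK ?num_real//.
exact: le_trans h1 h2.
Qed.

Lemma cube_count mu : (mu (cube r) <= (lin (psi r) mu)%:E)%E.
Proof.
have [N [X [XQ XP]]] := config_enum mu (cube_bnd q).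
have rq : cube r `<=` @cube R d q by apply: sub_cube; rewrite /q; lra.
have : restr mu (cube q) (cube r) = sum_config X (cube r) by rewrite XP.
rewrite /= (setIidl rq) => ->.
rewrite -(lin_psi_restr mu (@cube_mbl q) (visible_cube (r := r))) XP.
rewrite lin_psi_sum// -sumEFin; apply: lee_sum => i _; rewrite diracE lee_fin.
case: (boolP (_ \in _)) => [/set_mem xr|_]; last exact: psi_ge0.
by rewrite psi1.
Qed.

Lemma cut_grad_bounded m : exists2 L : R, 0 <= L & forall mu x k,
 `|cut_grad f r m mu x ord0 k| <= L * \1_(cube q) x.
Proof.
have [L1 L10 L1P] := partial_bounded fV sf m.+1 Vr.
have [B B0 BP] := dphs_bounded; have [D D0 dD] := @dstep_bounded R.
exists (L1 + b * D * B) => [|mu x k]; first by rewrite addr_ge0// !mulr_ge0.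
rewrite indicE; case: (boolP (x \in cube q)) => [xq|/negP xq]; last first.
 have nx : ~ cube q x by move=> h; apply: xq; exact: mem_set.
 have e1 := grad_out mu k nx; have e2 : dphs (r / 2 + 1) x ord0 k = 0 by rewrite dphs_out// mxE.
 by rewrite cut_gradE e1 e2 !mulr0 subr0 normr0.
have e3 : grad f mu x ord0 k = partial k f mu x by rewrite mxE.
rewrite mulr1 cut_gradE e3.
apply: le_trans (ler_normD _ _) _; rewrite normrN; apply: lerD; last first.
 rewrite !normrM; apply: ler_pM => //; first exact: ler_pM.
 by apply: le_trans (BP x k) _; rewrite ler_piMr// indicE; case: (_ \in _).
rewrite normrM; have [mux|mux] := eqVneq (mu [set x]) 0%E.
 rewrite /partial partial_move0// (_ : lim _ = 0) ?normr0 ?mulr0//.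
 exact: lim_cst.
have s0 := step_ge0 (lin (psi r) mu - m%:R); have s1 := step_le1 (lin (psi r) mu - m%:R).
(* Above [m + 1] the factor of [grad f] vanishes. Below, [cube r] contains at most [m + 1] points
   and [partial_bounded] applies. *)
have [h|h] := leP (m%:R + 1) (lin (psi r) mu).
 by rewrite step1 ?subrr ?normr0 ?mul0r//; lra.
rewrite -[leRHS]mul1r; apply: ler_pM => //.
 by rewrite ger0_norm; lra.
apply: L1P => //; apply: le_trans (cube_count mu) _.
by rewrite lee_fin -natr1; exact: ltW.
Qed.

Lemma mbl_lin_psi : mbl (fun mu => lin (psi r) mu).
Proof. by apply: mbl_lin; exact: mbl_psi. Qed.

Lemma mbl_step : mbl (@step R).
Proof. by apply: continuous_measurable_fun => t; exact: is_derive1_continuous (der_step t). Qed.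

Lemma mbl_dstep : mbl (@dstep R).
Proof. by apply: continuous_measurable_fun; exact: cts_dstep. Qed.

Lemma mbl_cut m : mbl (tcut f r m).
Proof.
apply: mfunM => //; apply: mfunB; first exact: measurable_cst.
apply: mcomp; first exact: mbl_step.
by apply: mfunB; [exact: mbl_lin_psi|exact: measurable_cst].
Qed.

Lemma vL2_cut_grad m : vL2 (cut_grad f r m).
Proof.
have [L L0 LP] := cut_grad_bounded m => k.
apply: (L2_campbell (r := q) (b := L)) => [|//|p]; last exact: (LP p.1 p.2 k).
have ml : mbl (fun p : M * E => lin (psi r) p.1 - m%:R).
 apply: mfunB; last exact: measurable_cst.
 by apply: (mcomp mbl_lin_psi); exact: measurable_fst.
rewrite (_ : (fun p => _) = fun p : M * E => (1 - step (lin (psi r) p.1 - m%:R)) * grad f p.1 p.2 ord0 k -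
  f p.1 * dstep (lin (psi r) p.1 - m%:R) * dphs (r / 2 + 1) p.2 ord0 k); last first.
 by apply/funext => p; rewrite cut_gradE.
apply: mfunB; apply: mfunM.
- apply: mfunB; first exact: measurable_cst.
 exact: mcomp mbl_step ml.
- exact: mbl_grad.
- apply: mfunM; first by apply: (mcomp mf); exact: measurable_fst.
 exact: mcomp mbl_dstep ml.
apply: (@measurableT_comp _ _ _ _ _ _ (fun x : E => dphs (r / 2 + 1) x ord0 k)); last exact: measurable_snd.
exact: cts_mbl_mx (cts_dphs (r := r) (k := k)).
Qed.

Lemma L2_cut m : L2 P (tcut f r m).
Proof. by apply: L2_bounded; [exact: mbl_cut|exact: cut_bounded]. Qed.

Lemma cut_grad_restr m mu Q N (X : mat N) i x : measurable Q -> visible r `<=` Q -> Q x ->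
 mu [set x] != 0%E -> restr mu Q = sum_config X -> row i X = x ->
 cut_grad f r m mu x = cut_grad f r m (sum_config X) (row i X).
Proof.
move=> mQ vQ Qx mux XP Xx; have VQ : V `<=` Q by apply: subset_trans vQ; exact: V_visible.
rewrite /cut_grad -XP (lin_psi_restr mu mQ vQ) Xx.
have -> : f (restr mu Q) = f mu by apply: (f_ext fV) => A /=; rewrite -setIA (setIidl VQ).
congr (_ *: _ - _); apply/rowP => k; rewrite !mxE.
by rewrite XP (partial_sum fV k VQ Qx mux XP Xx) -[x in RHS]Xx (partial_sum_config fV).
Qed.

Lemma cut_approx m : exists s : nat -> seq (R * expS),
 L2cvg P (fun n => spn hS (s n)) (tcut f r m) /\
 ven (fun mu x => gF hS vS (s n) mu x - cut_grad f r m mu x)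
    (fun mu x => gF hS vS (s n) mu x - cut_grad f r m mu x) @[n --> \oo] --> (0 : R).
Proof.
have [L L0 LP] := cut_grad_bounded m.
have DL N (i : 'I_N) k X : `|Dcut f r m i k X| <= L.
 by apply: le_trans (LP _ _ _) _; rewrite ler_piMr// indicE; case: (_ \in _).
have [s [s1 s2 s3 s4 s5]] := exp_approximation (visible_cube (r := r))
 (cut_visible fV Vr m) (cut_mult f m (r := r)) (cut_bounded r fb m)
 (@cts_cut f r sf m) (der_cut r fV sf m)
 (@cts_Dcut f V r fV sf m) DL.
exists s; split.
 suff [] : L2 P (tcut f r m) /\ L2cvg P (fun n => spn hS (s n)) (tcut f r m) by [].
 apply: (@L2_dominated _ _ _ P _ _ (fun=> b + 1)) => //.
 - by move=> n; exact: mbl_spn.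
 - exact: L2_cst.
have vq : q <= 2 * ((cell_rad q)%:R + 2) by have := rad_ge q; rewrite /q; lra.
have vb : (visible r : set E) `<=` big_cube q.
 by apply: (subset_trans (visible_cube (r := r))); exact: sub_cube vq.
apply: (ven_dominated (g := fun p => (8 * d%:R * L + 1 + L) * \1_(big_cube q) p.2)) => //.
- by move=> n; apply: vL2B; [exact: (vL2_F admS tfv_vS)|exact: vL2_cut_grad].
- apply: (L2_campbell (r := 2 * ((cell_rad q)%:R + 2)) (b := 8 * d%:R * L + 1 + L)).
 + apply: mfunM; first exact: measurable_cst.
  apply: (@measurableT_comp _ _ _ _ _ _ (\1_(big_cube q) : E -> R)); last exact: measurable_snd.
  by apply: mindic; exact: cube_mbl.
 + by rewrite !addr_ge0// !mulr_ge0.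
 + move=> p; rewrite normrM ger0_norm ?(ger0_norm (x := \1__ _))// ?indicE//.
  by rewrite !addr_ge0// !mulr_ge0.
- by move=> p; rewrite mulr_ge0 ?indicE// !addr_ge0// !mulr_ge0.
- move=> n mu x k mux; rewrite mxE [X in _ + X]mxE /= indicE.
 have [xb|xb] := pselect (big_cube q x); last first.
  rewrite s1// mxE add0r normrN memNset// mulr0; apply: le_trans (LP _ _ _) _.
  by rewrite indicE memNset ?mulr0// => /(sub_cube vq).
 have [N [X [i [Xx XP _]]]] := moved_enum mux xb.
 rewrite mem_set// mulr1 (le_trans (ler_normB _ _))// lerD//.
  by rewrite -Xx; exact: s4 XP.
 by apply: le_trans (LP _ _ _) _; rewrite ler_piMr// indicE; case: (_ \in _).
move=> mu x k mux; have [xb|xb] := pselect (big_cube q x); last first.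
 rewrite (_ : (fun n => _) = fun=> 0); first exact: cvg_cst.
 apply/funext => n; rewrite mxE [X in _ + X]mxE s1// mxE add0r.
 apply/eqP; rewrite oppr_eq0 -normr_le0; apply: le_trans (LP _ _ _) _.
 by rewrite indicE memNset ?mulr0// => /(sub_cube vq).
have [N [X [i [Xx XP _]]]] := moved_enum mux xb.
have EX : cut_grad f r m mu x ord0 k = Dcut f r m i k X.
 by rewrite (cut_grad_restr m (@cube_mbl _) vb xb mux XP Xx).
have := s5 mu N X i k XP; rewrite Xx => lim5.
have E2 n : (gF hS vS (s n) mu x - cut_grad f r m mu x) ord0 k =
  gF hS vS (s n) mu x ord0 k - Dcut f r m i k X.
 by rewrite -EX; move: (gF _ _ _ _ _) (cut_grad _ _ _ _ _) => G H; rewrite !mxE.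
under eq_fun do rewrite E2.
have := cvgB lim5 (cvg_cst (Dcut f r m i k X)); rewrite subrr; exact.
Qed.

Hypothesis fin : (H1sq P f (grad f) < +oo)%E.

(** On a given configuration the truncation is eventually inactive. The domination uses [grad f],
    square-integrable by [fin], plus a bounded field of bounded support. *)
Lemma cut_cvg : L2cvg P (fun m => tcut f r m) f /\
 ven (fun mu x => cut_grad f r m mu x - grad f mu x)
    (fun mu x => cut_grad f r m mu x - grad f mu x) @[m --> \oo] --> (0 : R).
Proof.
have [sqf vf] := H1sq_fin mf (mbl_grad Cf) fin.
have ev (mu : M) : \forall m \near \oo, lin (psi r) mu - m%:R <= 0.
 exists (Num.truncn (lin (psi r) mu)).+1 => // m /= hm.
 rewrite subr_le0; apply/ltW/(lt_le_trans (truncnS_gt _)); by rewrite ler_nat.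
split.
 suff [] : L2 P f /\ L2cvg P (fun m => tcut f r m) f by [].
 apply: (@L2_dominated _ _ _ P _ _ (fun=> b)) => //.
 - exact: mbl_cut.
 - exact: L2_cst.
 - by move=> m mu; exact: cut_bounded.
 move=> mu; apply: cvg_near_cst; apply: filterS (ev mu) => m h.
 by rewrite /tcut step0// subr0 mulr1.
have [B B0 BP] := dphs_bounded; have [D D0 dD] := @dstep_bounded R.
pose g (p : M * E) : R := \sum_k `|grad f p.1 p.2 ord0 k| + b * D * B * \1_(cube q) p.2.
apply: (ven_dominated (g := g)).
- by move=> m; apply: vL2B => //; exact: vL2_cut_grad.
- apply: L2D; first by apply: L2_sum => k; apply: L2_normr; exact: vf.
 apply: (L2_campbell (r := q) (b := b * D * B)).
 + apply: mfunM; first exact: measurable_cst.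
  apply: (@measurableT_comp _ _ _ _ _ _ (\1_(cube q) : E -> R)); last exact: measurable_snd.
  by apply: mindic; exact: cube_mbl.
 + by rewrite !mulr_ge0.
 + by move=> p; rewrite normrM ger0_norm ?(ger0_norm (x := \1__ _))// ?indicE// !mulr_ge0.
- by move=> p; rewrite addr_ge0 ?sumr_ge0// mulr_ge0 ?indicE// !mulr_ge0.
- move=> m mu x k _; rewrite mxE [X in _ + X]mxE cut_gradE.
 set t := lin _ _ - _; set G := grad f mu x ord0 k; set e := dphs _ _ _ _.
 rewrite (_ : _ - G = - (step t * G) - f mu * dstep t * e); last by ring.
 rewrite (le_trans (ler_normB _ _))// normrN; apply: lerD.
  rewrite normrM (bigD1 k)//= -[leLHS]addr0 lerD ?sumr_ge0//.
  by rewrite ler_piMl// ger0_norm ?step_ge0// step_le1.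
 rewrite !normrM -mulrA; apply: le_trans (_ : b * D * (B * \1_(cube q) x) <= _); last by rewrite mulrA.
 rewrite -[leRHS]mulrA; apply: ler_pM => //.
 by apply: ler_pM => //; exact: BP.
move=> mu x k _; apply: cvg_near_cst; apply: filterS (ev mu) => m h.
by rewrite /cut_grad step0// dstep_out; [rewrite subr0 scale1r mulr0 scale0r subr0 subrr mxE|left].
Qed.

End approximate.

Definition dist2 (g : M -> R) (G : M -> E -> E) (f : M -> R) (F : M -> E -> E) : R :=
 ip P (fun mu => g mu - f mu) (fun mu => g mu - f mu) +
 ven (fun mu x => G mu x - F mu x) (fun mu x => G mu x - F mu x).

Lemma dist2_triangle g G h H f F : L2 P g -> L2 P h -> L2 P f ->
 vL2 G -> vL2 H -> vL2 F ->
 dist2 g G f F <= 2 * dist2 g G h H + 2 * dist2 h H f F.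
Proof.
move=> sg sh shf sG sH sF.
have h1 : ip P (fun mu => g mu - f mu) (fun mu => g mu - f mu) <=
  2 * ip P (fun mu => g mu - h mu) (fun mu => g mu - h mu) +
  2 * ip P (fun mu => h mu - f mu) (fun mu => h mu - f mu).
 rewrite -!nrm_sqr; have := nrm_distD sg sh shf.
 have := nrm_ge0 P (fun mu => g mu - f mu).
 move: (nrm _ _) (nrm _ _) (nrm _ _) => x y z z0 zyx.
 apply: (@le_trans _ _ ((y + x) ^+ 2)); first by rewrite lerXn2r ?nnegrE// (le_trans z0).
 by rewrite -subr_ge0 (_ : _ - _ = (y - x) ^+ 2) ?sqr_ge0//; ring.
have := ven_triangle (vL2B sG sH) (vL2B sH sF).
rewrite (_ : (fun (mu : M) (x : E) => G mu x - H mu x + (H mu x - F mu x)) = fun mu x => G mu x - F mu x); last first.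
 by apply/funext => mu; apply/funext => x; rewrite addrA subrK.
by rewrite /dist2; lra.
Qed.

Lemma L2_spnS s : L2 P (spn hS s). Proof. exact: (L2_sp admS s). Qed.

Lemma vL2_gFS s : vL2 (gF hS vS s). Proof. exact: (vL2_F admS tfv_vS s). Qed.

Lemma Cc_infty_approx f (e : R) : Cc_infty f -> (H1sq P f (grad f) < +oo)%E -> 0 < e ->
 exists s, dist2 (spn hS s) (gF hS vS s) f (grad f) <= e.
Proof.
move=> Cf fin e0; have [[b fb] [V cV mf] sf] := Cf.
have [r0 Vr0] := compact_bnd cV; pose r := r0 + 2.
have Vr : V `<=` cube (r - 2) by rewrite /r addrK.
have fV mu := sigF_inv mu mf.
have [sqf vf] := H1sq_fin (mbl_wrtT mf) (mbl_grad Cf) fin.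
have [c1 c2] := cut_cvg Cf fV Vr fb fin; rewrite /L2cvg in c1.
have e8 : 0 < e / 8 by rewrite divr_gt0.
have [m hm] : exists m, dist2 (tcut f r m) (cut_grad f r m) f (grad f) <= e / 4.
 have [m h] := exists_small c1 c2 (divr_gt0 e0 (ltr0n _ 4)).
 by exists m; rewrite /dist2 -nrm_sqr expr2.
have [s [s1 s2]] := cut_approx Cf fV Vr fb m; rewrite /L2cvg in s1.
have [n hn] : exists n, dist2 (spn hS (s n)) (gF hS vS (s n)) (tcut f r m) (cut_grad f r m) <= e / 4.
 have [n h] := exists_small s1 s2 (divr_gt0 e0 (ltr0n _ 4)).
 by exists n; rewrite /dist2 -nrm_sqr expr2.
have sc : L2 P (tcut f r m) by apply: L2_cut => //; exact: fb.
have vc : vL2 (cut_grad f r m) by apply: vL2_cut_grad => //; exact: fb.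
exists (s n); apply: le_trans (dist2_triangle (L2_spnS _) sc sqf (vL2_gFS _) vc vf) _.
by move: hm hn; move: (dist2 _ _ _ _) (dist2 _ _ _ _) => a c; lra.
Qed.

Lemma H10_L2 f F : H10 P f F -> L2 P f /\ vL2 F.
Proof. by move=> [/Lfun2_L2 sf mF fin _]; apply: H1sq_fin => //; exact: sf.1. Qed.

(** The sequence [fn] defining H^1_0 is replaced term by term by combinations of exponentials within
    [1/(n+1)]. *)
Lemma H10_approx f F : H10 P f F -> exists s : nat -> seq (R * expS),
 L2cvg P (fun n => spn hS (s n)) f /\
 ven (fun mu x => gF hS vS (s n) mu x - F mu x)
    (fun mu x => gF hS vS (s n) mu x - F mu x) @[n --> \oo] --> (0 : R).
Proof.
move=> hF; have [sf vF] := H10_L2 hF; have [_ _ _ [fn [Cfn cfn]]] := hF.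
have sfn n : L2 P (fn n) /\ vL2 (grad (fn n)).
 have [C1 fin] := Cfn n; apply: H1sq_fin => //; last exact: mbl_grad.
 by have [_ [V _ /mbl_wrtT]] := C1.
have dfn : dist2 (fn n) (grad (fn n)) f F @[n --> \oo] --> (0 : R).
 move: cfn; rewrite (_ : (fun n => _) = fun n => (dist2 (fn n) (grad (fn n)) f F)%:E).
  by move=> /fine_cvgP[_].
 apply/funext => n; rewrite H1sqE//; first exact: L2B (sfn n).1 sf.
 exact: vL2B (sfn n).2 vF.
have /choice[s sP] : forall n, exists s, dist2 (spn hS s) (gF hS vS s) (fn n) (grad (fn n)) <= n.+1%:R^-1.
 by move=> n; apply: Cc_infty_approx; [exact: (Cfn n).1|exact: (Cfn n).2|rewrite invr_gt0].
exists s; pose D n := dist2 (spn hS (s n)) (gF hS vS (s n)) f F.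
have ip0 n : 0 <= ip P (fun mu => spn hS (s n) mu - f mu) (fun mu => spn hS (s n) mu - f mu) by exact: ip_ge0.
have ven0 n : 0 <= ven (fun mu x => gF hS vS (s n) mu x - F mu x) (fun mu x => gF hS vS (s n) mu x - F mu x).
 exact: (en_ge0 (@mfield_id) _ (@weight1)).
have D0 : D n @[n --> \oo] --> (0 : R).
 apply: (@cvg_bound _ _ (fun n => 2 * n.+1%:R^-1 + 2 * dist2 (fn n) (grad (fn n)) f F)).
  move=> n; rewrite sub0r normrN ger0_norm; last by rewrite addr_ge0.
  apply: le_trans (dist2_triangle _ (sfn n).1 _ _ (sfn n).2 _) _ => //.
  - exact: L2_spnS.
  - exact: vL2_gFS.
  by rewrite lerD2r ler_wpM2l.
 rewrite -[X in _ --> X](_ : 2 * 0 + 2 * 0 = 0); last by rewrite !mulr0 addr0.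
 by apply: cvgD; apply: cvgM => //; [exact: cvg_cst|exact: cvg_harmonic|exact: cvg_cst].
split.
 apply/L2cvgP => e e0; move/cvgr0Pnorm_lt : D0 => /(_ (e ^+ 2)); rewrite exprn_gt0// => /(_ isT)[N _ NP].
 exists N => n /NP; rewrite ger0_norm; last by rewrite /D addr_ge0.
 move=> Dn; rewrite -(@ltr_pXn2r _ 2) ?nnegrE ?nrm_ge0 ?(ltW e0)// nrm_sqr.
 by apply: le_lt_trans Dn; rewrite /D lerDl.
apply: (@cvg_bound _ _ D) => // n; rewrite sub0r normrN ger0_norm//.
by rewrite /D /dist2 lerDr.
Qed.

End density.

(** * The weighted operator on all of L^2 *)

Section weighted_operator_L2.
Variables (n : nat) (phi : nat -> E -> R) (al : nat -> R).
Hypotheses (wphi : forall j, weight (phi j)) (al0 : 0 <= al 0%N)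
(al_nd : forall j, al j <= al j.+1).

Local Notation valT := (@valU setT).

Section reindex.
Variables (I I' : Type) (h : I -> E -> R) (h' : I' -> E -> R) (r : I -> I').
Hypothesis hr : forall i, h' (r i) = h i.

(** Density in L^2 is known for all exponentials, the energy inequality for smooth ones, and
    localization for those supported in [U]. This map carries combinations from one index type to
    another without changing the functions. *)
Definition resp (s : seq (R * I)) : seq (R * I') := [seq (a.1, r a.2) | a <- s].

Lemma spn_resp s : spn h' (resp s) = spn h s.
Proof. by apply/funext => mu; rewrite /spn big_map; apply: eq_bigr => a _; rewrite hr. Qed.

Lemma gam_resp w s : gam h' w (resp s) = gam h w s.
Proof. by apply/funext => mu; rewrite /gam big_map; apply: eq_bigr => a _; rewrite hr. Qed.

Lemma Wop_resp s : Wop h' n phi al (resp s) = Wop h n phi al s.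
Proof.
apply/funext => mu; rewrite /Wop spn_resp; congr (_ - _).
by apply: eq_bigr => j _; rewrite gam_resp.
Qed.

End reindex.

Lemma gam_sub (I : Type) (h : I -> E -> R) w s t mu :
 gam h w (s ++ scl (-1) t) mu = gam h w s mu - gam h w t mu.
Proof.
rewrite /gam big_cat big_map; congr (_ + _); rewrite -sumrN; apply: eq_bigr => a _ /=.
by rewrite mulN1r mulNr.
Qed.

Lemma spn_sub (I : Type) (h : I -> E -> R) s t mu :
 spn h (s ++ scl (-1) t) mu = spn h s mu - spn h t mu.
Proof. by rewrite spn_cat spn_scl mulN1r. Qed.

Lemma Wop_sub (I : Type) (h : I -> E -> R) s t mu :
 Wop h n phi al (s ++ scl (-1) t) mu = Wop h n phi al s mu - Wop h n phi al t mu.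
Proof.
rewrite /Wop spn_sub; under eq_bigr do rewrite gam_sub mulrBr.
by rewrite sumrB; ring.
Qed.

Lemma expU_dense f : L2 P f -> forall e, 0 < e -> exists s, nrm P (fun mu => f mu - spn valT s mu) < e.
Proof.
move=> sf; have mf : measurable_wrt (sigF setT) f.
 by move=> B mB; have := sf.1 measurableT B mB; rewrite setTI.
by have [_] := app_sigF sf mf.
Qed.

Lemma al_ge0' j : 0 <= al j.
Proof. by elim: j => // j ih; exact: le_trans (al_nd j). Qed.

(** The lower bound is phrased with any [m] below the distances from [f] to the [sigF Q]-measurable
    functions, because [gam (\1_Q)] of the approximants is one of these; the conditional expectation
    later supplies [m] as a minimizer. *)
Theorem weighted_extension : exists Wb : (M -> R) -> M -> R, [/\
 forall f, L2 P f -> L2 P (Wb f),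
 forall f (s : nat -> seq (R * @expS)), L2 P f -> L2cvg P (fun k => spn hS (s k)) f ->
  L2cvg P (fun k => Wop hS n phi al (s k)) (Wb f),
 forall f g, L2 P f -> L2 P g -> ip P (Wb f) g = ip P f (Wb g) &
 [/\ forall f, L2 P f -> 0 <= ip P f (Wb f),
 forall f g, L2 P f -> L2 P g ->
  nrm P (fun mu => Wb f mu - Wb g mu) <= 2 * al n * nrm P (fun mu => f mu - g mu),
 forall (Q : set E) f (m : R), measurable Q -> (forall j x, (j < n)%N -> phi j x <= \1_Q x) ->
  L2 P f -> 0 <= m -> (forall Z, L2 P Z -> measurable_wrt (sigF Q) Z ->
   m <= nrm P (fun mu => f mu - Z mu)) -> al n * m ^+ 2 <= ip P f (Wb f) &
 forall (U : set E) u, (forall j x, U x -> phi j x = 1) -> L2 P u ->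
  measurable_wrt (sigF U) u -> ip P u (Wb u) = al 0%N * ip P u u]].
Proof.
have an0 : 0 <= 2 * al n by rewrite mulr_ge0// al_ge0'.
have admT := @admU setT.
have sqW := L2_Wop admT n al wphi.
have sqs := L2_sp admT.
have [Wb WbP] := extension sqs sqW (@spn_sub _ _) (@Wop_sub _ _)
 (nrm_Wop admT n wphi al0 al_nd) an0 expU_dense.
have dense f : L2 P f -> exists s : nat -> seq (R * @expU setT), L2cvg P (fun k => spn valT (s k)) f.
 move=> sf; have /choice[s sP] : forall k : nat, exists s, nrm P (fun x => f x - spn valT s x) < k.+1%:R^-1.
  by move=> k; apply: expU_dense => //; rewrite invr_gt0.
 exists s; apply: (cvg_bound (v := fun k => k.+1%:R^-1)); last exact: cvg_harmonic.
 by move=> k; rewrite sub0r normrN ger0_norm ?nrm_ge0// nrm_distC// ltW.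
have sWb f (sf : L2 P f) := (WbP f sf).1.
have cWb f (sf : L2 P f) := (WbP f sf).2.
exists Wb; split => //.
- move=> f s sf sfs; pose r (i : @expS) : @expU setT :=
  exist _ (hS i) (conj (admS i) (fun x (nx : ~ setT x) => False_ind _ (nx Logic.I))).
 have := cWb f sf (fun k => resp r (s k)).
 rewrite (_ : (fun k => spn valT _) = fun k => spn hS (s k)); last by apply/funext => k; rewrite (@spn_resp _ _ hS).
 rewrite (_ : (fun k => Wop valT n phi al _) = fun k => Wop hS n phi al (s k)).
  by apply.
 by apply/funext => k; rewrite (@Wop_resp _ _ hS).
- move=> f g sf sg; have [s fs] := dense f sf; have [t gt] := dense g sg.
 have h1 := cvg_ip (fun k => sqW (s k)) (fun k => sqs (t k)) (sWb f sf) sg (cWb f sf s fs) gt.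
 have h2 := cvg_ip (fun k => sqs (s k)) (fun k => sqW (t k)) sf (sWb g sg) fs (cWb g sg t gt).
 have E1 : (fun k => ip P (Wop valT n phi al (s k)) (spn valT (t k))) =
   fun k => ip P (spn valT (s k)) (Wop valT n phi al (t k)).
  by apply/funext => k; rewrite (Wop_sym admT n al wphi).
 by rewrite E1 in h1; exact: (cvg_unique _ h1 h2).
split.
- move=> f sf; have [s fs] := dense f sf.
 have h2 := cvg_ip (fun k => sqs (s k)) (fun k => sqW (s k)) sf (sWb f sf) fs (cWb f sf s fs).
 apply: (cvg_ge_lim (cvg_cst 0) h2) => k.
 exact: (Wop_ge0 admT n wphi al0 al_nd).
- move=> f g sf sg; have [s fs] := dense f sf; have [t gt] := dense g sg.
 have h1 : nrm P (fun x => Wop valT n phi al (s k) x - Wb f x) +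
   nrm P (fun x => Wop valT n phi al (t k) x - Wb g x) @[k --> \oo] --> (0 : R) + 0.
  by apply: cvgD; [exact: cWb|exact: cWb].
 have h2 : nrm P (fun x => spn valT (s k) x - f x) + nrm P (fun x => spn valT (t k) x - g x)
   @[k --> \oo] --> (0 : R) + 0 by exact: cvgD.
 rewrite addr0 in h1; rewrite addr0 in h2.
 apply: (@cvg_ge_lim _ (fun=> nrm P (fun mu => Wb f mu - Wb g mu)) (fun k =>
  (nrm P (fun x => Wop valT n phi al (s k) x - Wb f x) + nrm P (fun x => Wop valT n phi al (t k) x - Wb g x)) +
  2 * al n * (nrm P (fun mu => f mu - g mu) +
   (nrm P (fun x => spn valT (s k) x - f x) + nrm P (fun x => spn valT (t k) x - g x))))).
 + exact: cvg_cst.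
 + rewrite -[X in _ --> X](_ : 0 + 2 * al n * (nrm P (fun mu => f mu - g mu) + 0) = _); last by rewrite add0r addr0.
  apply: cvgD => //; apply: cvgM; first exact: cvg_cst.
  by apply: cvgD => //; exact: cvg_cst.
 move=> k; apply: le_trans (nrm_distD (sWb f sf) (sqW (s k)) (sWb g sg)) _.
 apply: le_trans (lerD (lexx _) (nrm_distD (sqW (s k)) (sqW (t k)) (sWb g sg))) _.
 rewrite (nrm_distC (sWb f sf) (sqW _)).
 have h3 := @W_lip _ _ _ P _ (spn valT) (Wop valT n phi al) (fun s t => s ++ scl (-1) t) (2 * al n)
  (@spn_sub _ _) (@Wop_sub _ _) (nrm_Wop admT n wphi al0 al_nd) (s k) (t k).
 have h4 := nrm_distD (sqs (s k)) sf (sqs (t k)).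
 have h5 := nrm_distD sf sg (sqs (t k)); rewrite (nrm_distC sg (sqs _)) in h5.
 have h6 := ler_wpM2l an0 (le_trans h4 (lerD (lexx _) h5)).
 move: h3 h6; move: (nrm _ _) (nrm _ _) (nrm _ _) (nrm _ _) (nrm _ _) (nrm _ _) (nrm _ _) => a1 a2 a3 a4 a5 a6 a7.
 by lra.
- move=> Q f m mQ phQ sf m0 mf; have [s fs] := dense f sf.
 have h2 := cvg_ip (fun k => sqs (s k)) (fun k => sqW (s k)) sf (sWb f sf) fs (cWb f sf s fs).
 have wQ : weight (\1_Q : E -> R).
  split; first exact: mindic.
  by move=> x; rewrite indicE; case: (_ \in _); rewrite ?lexx ?ler01.
 have h1 : al n * (m - nrm P (fun x => spn valT (s k) x - f x)) * (m - nrm P (fun x => spn valT (s k) x - f x)) @[k --> \oo] -->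
   al n * (m - 0) * (m - 0).
  have hm : m - nrm P (fun x => spn valT (s k) x - f x) @[k --> \oo] --> m - 0 by apply: cvgB => //; exact: cvg_cst.
  by apply: cvgM => //; apply: cvgM => //; exact: cvg_cst.
 rewrite subr0 -mulrA -expr2 in h1.
 suff : al n * m ^+ 2 <= ip P f (Wb f) + 0 by rewrite addr0.
 have h3 : ip P (spn valT (s k)) (Wop valT n phi al (s k)) +
   al n * nrm P (fun x => spn valT (s k) x - f x) ^+ 2 @[k --> \oo] --> ip P f (Wb f) + 0.
  apply: cvgD => //; rewrite -(mulr0 (al n)); apply: cvgM; first exact: cvg_cst.
  by under eq_fun do rewrite expr2; rewrite -(mulr0 0); exact: cvgM.
 apply: (cvg_ge_lim h1 h3) => k.
 have sg := L2_gam admT (s k) wQ.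
 have := mf _ sg (gam_sigF admT (s k) mQ) => hm.
 have h4 := nrm_distD sf (sqs (s k)) sg; rewrite (nrm_distC sf (sqs _)) in h4.
 have h5 := Wop_condexp admT wphi al0 al_nd (s k) mQ phQ.
 rewrite -nrm_sqr in h5.
 have a0 := al_ge0' n.
 have n0 := nrm_ge0 P (fun x => spn valT (s k) x - gam valT (\1_Q) (s k) x).
 have n1 := nrm_ge0 P (fun x => spn valT (s k) x - f x).
 apply: le_trans (_ : al n * nrm P (fun x => spn valT (s k) x - gam valT (\1_Q) (s k) x) ^+ 2 +
   al n * nrm P (fun x => spn valT (s k) x - f x) ^+ 2 <= _); last by rewrite lerD2r.
 rewrite -mulrA -mulrDr ler_wpM2l//.
 have h6 := le_trans hm h4; move: h6 n0 n1.
 move: (nrm P (fun x => spn valT (s k) x - f x)) (nrm P (fun x => spn valT (s k) x - gam valT (\1_Q) (s k) x)).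
 (* [m - e] may be negative; its square is then below [e^2], a term placed on the right for this
    case and vanishing in the limit. *)
 move=> e a h6 n0 n1; case: (leP m e) => me; last first.
  have h7 : 0 <= m - e by lra.
  have h8 : m - e <= a by lra.
  apply: (@le_trans _ _ (a * a)); first exact: ler_pM.
  by rewrite expr2 lerDl sqr_ge0.
 have h7 : 0 <= e - m by lra.
 have h8 : e - m <= e by lra.
 apply: (@le_trans _ _ (e * e)); last by rewrite expr2 -expr2 lerDr sqr_ge0.
 by rewrite -mulrNN !opprB; exact: ler_pM.
move=> U u phU su mu; have [_ dU] := app_sigF su mu.
have /choice[s sP] : forall k : nat, exists s, nrm P (fun x => u x - spn (@valU U) s x) < k.+1%:R^-1.
 by move=> k; apply: dU; rewrite invr_gt0.
have admU' := @admU U.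
have us : L2cvg P (fun k => spn (@valU U) (s k)) u.
 apply: (cvg_bound (v := fun k => k.+1%:R^-1)); last exact: cvg_harmonic.
 move=> k; rewrite sub0r normrN ger0_norm ?nrm_ge0// nrm_distC//; first exact/ltW/sP.
 exact: (L2_sp admU').
pose r (i : @expU U) : @expU setT :=
 exist _ (valU i) (conj (admU i) (fun x (nx : ~ setT x) => False_ind _ (nx Logic.I))).
have h1 := cWb u su (fun k => resp r (s k)).
have E1 : (fun k => spn valT (resp r (s k))) = fun k => spn (@valU U) (s k).
 by apply/funext => k; rewrite (@spn_resp _ _ (@valU U)).
have E2 : (fun k => Wop valT n phi al (resp r (s k))) = fun k mu => al 0%N * spn (@valU U) (s k) mu.
 apply/funext => k; rewrite (@Wop_resp _ _ (@valU U))// Wop_id// => j a x.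
 by have [/(phU j)->|/offU->] := pselect (U x); rewrite ?mul1r ?mulr0.
rewrite E1 E2 in h1.
have squ k := L2_sp admU' (s k).
have h2 := cvg_ip squ (fun k => L2Z (al 0%N) (squ k)) su (sWb u su) us (h1 us).
have h3 := cvg_ip squ squ su su us us.
have h4 : al 0%N * ip P (spn (@valU U) (s k)) (spn (@valU U) (s k)) @[k --> \oo] --> al 0%N * ip P u u.
 by apply: cvgM => //; exact: cvg_cst.
have E3 : (fun k => ip P (spn (@valU U) (s k)) (fun mu => al 0%N * spn (@valU U) (s k) mu)) =
  fun k => al 0%N * ip P (spn (@valU U) (s k)) (spn (@valU U) (s k)).
 by apply/funext => k; rewrite ipZr.
by rewrite E3 in h2; exact: (cvg_unique _ h2 h4).
Qed.

End weighted_operator_L2.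

(** * Energy bounds for the gradient of the weighted operator *)

Section bounded_fields.
Local Notation sq := (seq (R * @expS)).

(** Boundedness with respect to the H^1 norm of the combination. It keeps the fields [gW] bounded
    along a sequence converging in H^1_0. *)
Definition h1b (G : sq -> M -> E -> E) := (forall s, vL2 (G s)) /\
 exists2 K : R, 0 <= K & forall s, ven (G s) (G s) <=
  K * (ven (gF hS vS s) (gF hS vS s) + ip P (spn hS s) (spn hS s)).

Lemma h1bD G H : h1b G -> h1b H -> h1b (fun s mu x => G s mu x + H s mu x).
Proof.
move=> [vG [K K0 GK]] [vH [L L0 HL]]; split; first by move=> s; exact: vL2D.
exists (2 * K + 2 * L) => [|s]; first by rewrite addr_ge0// mulr_ge0.
apply: le_trans (ven_triangle (vG s) (vH s)) _.
have := GK s; have := HL s; move: (ven (G s) (G s)) (ven (H s) (H s)) (_ + _) => a b X.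
by rewrite mulrDl; lra.
Qed.

Lemma h1bZ c G : h1b G -> h1b (fun s mu x => c *: G s mu x).
Proof.
move=> [vG [K K0 GK]]; split; first by move=> s; exact: vL2Z.
exists (c * c * K) => [|s]; first by rewrite mulr_ge0// -expr2 sqr_ge0.
have mI := @mfield_id; have w1 := @weight1.
rewrite /ven (enZl mI c w1 (vG s) (vL2Z c (vG s))) (enZr mI c w1 (vG s) (vG s)).
have := GK s; rewrite /ven; move: (en _ _ _ _) (_ + _) => a X h.
by rewrite mulrA -[leRHS]mulrA ler_wpM2l// -expr2 sqr_ge0.
Qed.

Lemma h1b_sum (r : seq nat) (G : nat -> sq -> M -> E -> E) : (forall j, h1b (G j)) ->
 h1b (fun s mu x => \sum_(j <- r) G j s mu x).
Proof.
move=> hG; elim: r => [|j r ih].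
 split=> [s|]; first by under eq_fun do under eq_fun do rewrite big_nil; exact: vL2_0.
 exists 0 => // s; rewrite mul0r /ven /en /Rintegral integral0_eq// => p _.
 by rewrite big_nil bilin0l mulr0.
have := h1bD (hG j) ih; congr h1b; apply/funext => s; apply/funext => mu; apply/funext => x.
by rewrite big_cons.
Qed.

Variables (n : nat) (phi : nat -> E -> R) (g : nat -> E -> E) (al : nat -> R) (Cg : R).
Hypotheses (wphi : forall j, weight (phi j)) (bg : forall j, bv (g j)) (Cg0 : 0 <= Cg)
(phi_nd : forall j x, phi j x <= phi j.+1 x)
(g_bound : forall j x, sqnorm (g j x) <= Cg * (phi j.+1 x - phi j x)).

Lemma h1b_gW : h1b (gW hS vS n phi g al).
Proof.
have vF := vL2_gFS.
have hF : h1b (gF hS vS).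
 split; first exact: vF.
 by exists 1 => // s; rewrite mul1r lerDl ip_ge0.
have hY j : h1b (gY hS vS (phi j)).
 split=> [s|]; first exact: (vL2_Y admS tfv_vS s (wphi j)).
 exists 1 => // s; rewrite mul1r; apply: le_trans (_ : ven (gF hS vS s) (gF hS vS s) <= _); last first.
  by rewrite lerDl ip_ge0.
 exact: (le_en_Y admS tfv_vS s (@weight1) (wphi j)).
have hB j : h1b (gB hS (phi j) (g j)).
 split=> [s|]; first exact: (vL2_B admS s (wphi j) (bg j)).
 exists Cg => // s.
 apply: le_trans (le_en_B admS s (@weight1) (wphi j) (wphi j.+1) (bg j) Cg0 (phi_nd j) (g_bound j)) _.
 rewrite ler_wpM2l//; apply: le_trans (_ : qf (gK hS (phi j.+1)) s s <= _).
  by rewrite gerBl (psd_gK admS (wphi j)).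
 apply: le_trans (le_gK admS s (wphi j.+1) (@weight1) _) _.
  by move=> x; exact: weight_le1.
 rewrite -(ip_spn admS) lerDr.
 exact: (en_ge0 (@mfield_id) _ (@weight1)).
have hS' : h1b (fun s mu x => \sum_(0 <= j < n) (- (al j.+1 - al j)) *: (gY hS vS (phi j) s mu x + gB hS (phi j) (g j) s mu x)).
 apply: (@h1b_sum _ (fun j s mu x => (- (al j.+1 - al j)) *: (gY hS vS (phi j) s mu x + gB hS (phi j) (g j) s mu x))) => j.
 exact: (@h1bZ (- (al j.+1 - al j)) _ (h1bD (hY j) (hB j))).
have := h1bD (h1bZ (al n) hF) hS'; congr h1b.
apply/funext => s; apply/funext => mu; apply/funext => x; rewrite /gW; congr (_ + _).
by rewrite -sumrN; apply: eq_bigr => j _; rewrite scaleNr.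
Qed.

End bounded_fields.

(** * Choice of radii and weights, and the bound on the generator *)

Section parameters.
Variables (a0 : M -> 'M[R]_d) (L beta r0 Cd : R) (n : nat).
Hypotheses (aa : admissible L a0) (L1 : 1 <= L) (betaL : 4 * L <= beta) (Cd0 : 0 <= Cd)
(Cd_bound : forall y : R, `|dstep y| <= Cd).

Let b0 : 0 < beta. Proof. by move: L1 betaL; lra. Qed.

(** The increment [1/4] is the width of one transition, so the cutoff [phi_ j.+1] equals 1 on the
    whole transition of [phi_ j]. *)
Definition rad_ (j : nat) : R := r0 + j%:R / 4.
Definition phi_ (j : nat) : E -> R := phs (rad_ j).
Definition g_ (j : nat) : E -> E := dphs (rad_ j).
(** In terms of the radius the weight is [exp (2 (rad_ j - r0) / beta)], of order [exp (K / beta)]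
    at radius [K / 2]. *)
Definition al_ (j : nat) : R := expR (j%:R / (2 * beta)).
(** The coefficient at [x] looks at the unit ball around [x], on which [rr] increases by at most 1:
    hence the margin 1 between [D_] and [U_]. [T_] is what remains of the region where [phi_] is
    nonzero. *)
Definition D_ (j : nat) : set E := [set x | rr x <= rad_ j - 1].
Definition U_ (j : nat) : set E := [set x | rr x <= rad_ j].
Definition T_ (j : nat) : set E := [set x | rad_ j - 1 < rr x < rad_ j + 4^-1].
Let kp : R := expR (1 / (2 * beta)).

Lemma rad_S j : rad_ j.+1 = rad_ j + 4^-1.
Proof. by rewrite /rad_ -natr1; lra. Qed.

Lemma wphi_ j : weight (phi_ j).
Proof.
split; first exact: cts_mbl_mx (sm_continuous (sm_phs _)).
by move=> x; exact: phs01.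
Qed.

Lemma phi_S j x : phi_ j x <= phi_ j.+1 x.
Proof. by apply: phs_nd; rewrite rad_S lerDl invr_ge0. Qed.

Lemma g_bound_ j x : sqnorm (g_ j x) <= 64 * Cd ^+ 2 * (phi_ j.+1 x - phi_ j x).
Proof. by rewrite /phi_ rad_S; exact: sqnorm_dphs. Qed.

Lemma bv_g j : bv (g_ j).
Proof.
move=> l; split.
 have [f' sf' df] := sm_derive ord0 l (sm_phs (rad_ j)).
 rewrite (_ : (fun x => _) = f'); first exact: cts_mbl_mx (sm_continuous sf').
 by apply/funext => x; have [_ <-] := der_phs (rad_ j) l x; have [_ ->] := df x.
exists (8 * Cd) => x.
have h1 : g_ j x ord0 l ^+ 2 <= sqnorm (g_ j x).
 by rewrite /sqnorm (bigD1 l)//= lerDl sumr_ge0// => k _; exact: sqr_ge0.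
have h2 : sqnorm (g_ j x) <= (8 * Cd) ^+ 2.
 apply: le_trans (g_bound_ j x) _; have /andP[p0 _] := phs01 (rad_ j) x.
 have /andP[_ p1] := phs01 (rad_ j.+1) x.
 rewrite (_ : (8 * Cd) ^+ 2 = 64 * Cd ^+ 2 * 1); last by ring.
 by rewrite ler_wpM2l// ?mulr_ge0 ?sqr_ge0// /phi_; lra.
rewrite -(@ler_pXn2r _ 2) ?nnegrE ?mulr_ge0// real_normK ?num_real//.
exact: le_trans h1 h2.
Qed.

Lemma mbl_rr : mbl (@rr).
Proof. exact: cts_mbl_mx (sm_continuous (sm_rr)). Qed.

Lemma mD_ j : measurable (D_ j).
Proof.
have := mbl_rr measurableT (measurable_itv `]-oo, rad_ j - 1]%R); rewrite setTI.
by congr measurable; apply/seteqP; split => x /=; rewrite in_itv.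
Qed.

Lemma mU_ j : measurable (U_ j).
Proof.
have := mbl_rr measurableT (measurable_itv `]-oo, rad_ j]%R); rewrite setTI.
by congr measurable; apply/seteqP; split => x /=; rewrite in_itv.
Qed.

Lemma mT_ j : measurable (T_ j).
Proof.
have := mbl_rr measurableT (measurable_itv `](rad_ j - 1), (rad_ j + 4^-1)[%R); rewrite setTI.
by congr measurable; apply/seteqP; split => x /=; rewrite in_itv.
Qed.

Lemma locA_ j mu x : D_ j x -> cof a0 (restr mu (U_ j), x) = cof a0 (mu, x).
Proof.
rewrite /D_ /= => Dx; apply: (coef_local aa) => y xy; rewrite /U_ /=.
have : rr y <= rr x + 1; last by move: Dx; lra.
apply: rr_lip => // k; have h : (y ord0 k - x ord0 k) ^+ 2 <= 1.
 apply: le_trans xy; rewrite /sqnorm (bigD1 k)//= !mxE lerDl sumr_ge0// => l _.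
 exact: sqr_ge0.
rewrite -(@ler_pXn2r _ 2) ?nnegrE// real_normK ?num_real//.
by rewrite expr1n.
Qed.

Lemma al_S_ j : al_ j.+1 = kp * al_ j.
Proof. by rewrite /al_ /kp -expRD -natr1; congr expR; rewrite mulrDl addrC. Qed.

Lemma kp1_ : 1 <= kp.
Proof. by rewrite -expR0 ler_expR divr_ge0// mulr_ge0// ltW. Qed.

Lemma al_0 : al_ 0 = 1. Proof. by rewrite /al_ mul0r expR0. Qed.

Lemma al_nd_ j : al_ j <= al_ j.+1.
Proof. by rewrite al_S_ ler_peMl ?expR_ge0// kp1_. Qed.

Lemma al_le i j : (i <= j)%N -> al_ i <= al_ j.
Proof. by move=> ij; rewrite ler_expR ler_pM2r ?invr_gt0 ?mulr_gt0// ler_nat. Qed.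

Lemma al_diff j m : (j < m)%N -> al_ j.+1 - al_ j <= al_ m / (2 * beta).
Proof.
move=> jm; have E1 : al_ j = al_ j.+1 * expR (- (1 / (2 * beta))).
 by rewrite al_S_ /kp mulrAC -expRD subrr expR0 mul1r.
have h := expR_ge1Dx (- (1 / (2 * beta))).
have h0 : 0 < al_ j.+1 by exact: expR_gt0.
apply: (@le_trans _ _ (al_ j.+1 / (2 * beta))); last first.
 by rewrite ler_pM2r ?invr_gt0 ?mulr_gt0// al_le.
have aux (z w y : R) : 0 < y -> 1 - 1 * w <= z -> y - y * z <= y * w.
 by move=> y0 /(ler_wpM2l (ltW y0)); rewrite mulrBr mul1r mulr1; lra.
by rewrite E1; exact: (aux _ _ _ h0 h).
Qed.

(* At most five of the sets [T_ j] contain a given point. *)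
Lemma pointwise_ x : \sum_(0 <= j < n) (al_ j.+1 - al_ j) *
 (\1_(D_ j) x + ((1 + L) / 2 + beta / 6 / 2) * \1_(T_ j) x) <= al_ n.
Proof.
set th := (1 + L) / 2 + beta / 6 / 2.
have th0 : 0 <= th by rewrite /th; move: L1 b0; lra.
(* Uses [beta >= 4 L] and [L >= 1]: [5 th <= 5 L + 5 beta / 12 <= 5 beta / 3]. *)
have th5 : 5 * th <= 2 * beta by rewrite /th; move: L1 betaL; lra.
have D1 j : D_ j x -> \1_(D_ j) x = 1 :> R by move=> h; rewrite indicE mem_set.
have D0 j : ~ D_ j x -> \1_(D_ j) x = 0 :> R by move=> h; rewrite indicE memNset.
have T0 j : ~ T_ j x -> \1_(T_ j) x = 0 :> R by move=> h; rewrite indicE memNset.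
elim: n => [|m ih]; first by rewrite big_geq// expR_ge0.
have [Dm|Dm] := pselect (D_ m x).
 rewrite big_nat_recr//= D1// T0; last by move=> /andP[+ _]; rewrite ltNge Dm.
 by rewrite mulr0 addr0 mulr1; move: ih; lra.
have Dj j : (j <= m)%N -> ~ D_ j x.
 rewrite /D_ /= => jm Dj; apply: Dm; rewrite /D_ /=; apply: le_trans Dj _.
 by rewrite /rad_ lerD2r lerD2l ler_pM2r ?invr_gt0// ler_nat.
rewrite (@big_cat_nat _ _ _ (m.+1 - 5))//=; last exact: leq_subr.
rewrite big_nat big1 ?add0r; last first.
 move=> j /andP[_ jm]; rewrite D0; last by apply: Dj; apply: ltnW; apply: leq_trans jm _; rewrite leq_subLR -addn1 addnC leq_add2r.
 rewrite T0 ?mulr0 ?addr0 ?mulr0// => /andP[_]; apply/negP; rewrite -leNgt.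
 have : rad_ m - 1 < rr x by rewrite ltNge; apply/negP => h; exact: Dm.
 have : j%:R + 5 <= m%:R :> R.
  by rewrite -natrD ler_nat; move: jm; rewrite ltn_subRL addnC => h; rewrite -ltnS.
 by rewrite /rad_; lra.
apply: (@le_trans _ _ (\sum_(m.+1 - 5 <= j < m.+1) th * (al_ m.+1 / (2 * beta)))).
 rewrite big_nat [leRHS]big_nat; apply: ler_sum => j /andP[_ jm].
 rewrite D0; last exact: Dj.
 rewrite add0r mulrC -mulrA; apply: ler_wpM2l => //.
 apply: (@le_trans _ _ (al_ j.+1 - al_ j)); last exact: al_diff.
 have := al_nd_ j; rewrite -subr_ge0 => h; rewrite indicE; case: (_ \in _); rewrite ?mul1r ?mul0r//.
rewrite sumr_const_nat -[leLHS]mulr_natl.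
have h5 : (m.+1 - (m.+1 - 5))%:R <= 5 :> R by rewrite ler_nat leq_subLR addnC; have := leq_subr 5 m.+1; rewrite -leq_subLR.
have a0' : 0 < al_ m.+1 by exact: expR_gt0.
apply: (@le_trans _ _ (5 * (th * (al_ m.+1 / (2 * beta))))).
 by rewrite ler_wpM2r// !mulr_ge0// ?invr_ge0 ?mulr_ge0// ltW.
rewrite mulrA [leRHS](_ : _ = 2 * beta * (al_ m.+1 / (2 * beta))).
 by apply: ler_wpM2r => //; rewrite divr_ge0 ?expR_ge0// mulr_ge0// ltW.
by rewrite mulrC divfK// gt_eqF// mulr_gt0.
Qed.

(** The constant of [energy_ge] for [Cg = 64 Cd^2] and [eta = beta / 6]. The transitions can absorb
    an [eta] of order [beta], so together with [kp - 1] the rate is of order [1 / beta^2]. *)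
Definition rate_ : R := L * (64 * Cd ^+ 2) / (2 * (beta / 6)) * (kp - 1).

(** With [x = 1 / (2 beta) <= 1/8], [exp x <= 1 / (1 - x) <= 1 + 2 x]. *)
Lemma kp_le : kp - 1 <= 1 / beta.
Proof.
have h : 0 < 1 / (2 * beta) by rewrite divr_gt0// mulr_gt0.
have h1 : 1 / (2 * beta) <= 8^-1 by rewrite div1r lef_pV2 ?posrE ?mulr_gt0//; move: L1 betaL; lra.
have := expR_ge1Dx (- (1 / (2 * beta))); rewrite expRN -/kp.
have E1 : 1 / beta = 2 * (1 / (2 * beta)) by rewrite !div1r invfM mulrA divff ?mul1r.
rewrite E1; move: (1 / (2 * beta)) h h1 => x x0 x8 hx; have k0 : 0 < kp := expR_gt0 _.
have h2 : (1 - x) * kp <= 1 by rewrite -ler_pdivlMr// div1r; lra.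
by have := ler_wpM2l (ltW x0) x8; nra.
Qed.

Lemma rate_le : rate_ <= 192 * L * Cd ^+ 2 / beta ^+ 2.
Proof.
have E1 : L * (64 * Cd ^+ 2) / (2 * (beta / 6)) = 192 * L * Cd ^+ 2 / beta.
 by field; rewrite gt_eqF.
have E2 : 192 * L * Cd ^+ 2 / beta ^+ 2 = 192 * L * Cd ^+ 2 / beta * (1 / beta) by field; rewrite gt_eqF.
rewrite /rate_ E1 E2; apply: ler_wpM2l; last exact: kp_le.
by rewrite divr_ge0 ?mulr_ge0 ?sqr_ge0 ?(ltW b0)//; move: L1; lra.
Qed.

Lemma energy_ge_ (s : seq (R * @expS)) : en (cof a0) (fun=> 1) (gF hS vS s) (gW hS vS n phi_ g_ al_ s) >=
 - (rate_ * ip P (spn hS s) (Wop hS n phi_ al_ s)).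
Proof.
apply: (energy_ge admS tfv_vS (mfield_coef aa) (coef_ge aa) L1 wphi_ bv_g mD_ mU_ mT_ _ locA_
 (Cg := 64 * Cd ^+ 2) _ _ _ _ phi_S _ g_bound_ _ kp1_ al_S_ _ pointwise_).
- by move=> j x; rewrite /D_ /U_ /=; lra.
- by move=> j x; exact: phs1.
- by move=> j x Dx /andP[+ _]; rewrite ltNge Dx.
- move=> j x Dx Tx; apply: phs0; rewrite leNgt; apply/negP => h; apply: Tx; apply/andP; split => //.
 by rewrite ltNge; apply/negP.
- move=> j x Tx; apply: dphs0; have [h|h] := leP (rr x) (rad_ j); [by left|right].
 by rewrite leNgt; apply/negP => h'; apply: Tx; apply/andP; split => //; move: h; lra.
- by rewrite mulr_ge0// sqr_ge0.
- by rewrite al_0.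
- by rewrite divr_gt0.
Qed.

Variable Wb : (M -> R) -> M -> R.
Hypothesis sWb : forall f, L2 P f -> L2 P (Wb f).
Hypothesis Wb_lim : forall f (s : nat -> seq (R * @expS)), L2 P f -> L2cvg P (fun k => spn hS (s k)) f ->
 L2cvg P (fun k => Wop hS n phi_ al_ (s k)) (Wb f).

(** Formally [<g, W w> = - E(w, W w)], but only for smooth exponentials is [W] known to land in
    H^1_0. The equation is tested with [W] of approximants of [w]; then [F] is replaced by their
    gradients, at a cost that tends to 0 because [ven (G k)] stays bounded. *)
Lemma generator_ge w g F : L2 P g -> H10 P w F ->
 (forall v V, H10 P v V -> energy P a0 F V = - 'E_P[fun mu => (g mu * v mu)%R])%E ->
 ip P g (Wb w) <= rate_ * ip P w (Wb w).
Proof.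
move=> sg hw hE; have [sw vF] := H10_L2 hw; have mA := mfield_coef aa; have w1 := @weight1.
have [s [sc sd]] := H10_approx hw.
have mI := @mfield_id.
pose W k := Wop hS n phi_ al_ (s k); pose G k := gW hS vS n phi_ g_ al_ (s k).
pose Fk k := gF hS vS (s k).
have hW k : H10 P (W k) (G k).
 apply: (H10_Wop n al_ wphi_) => [j|j l x]; first exact: (sm_phs).
 exact: (der_phs).
have sW k : L2 P (W k) := (H10_L2 (hW k)).1.
have vG k : vL2 (G k) := (H10_L2 (hW k)).2.
have vFk k : vL2 (Fk k) := vL2_gFS (s k).
have ss k : L2 P (spn hS (s k)) := L2_spnS (s k).
have [_ [Kb Kb0 KbP]] := h1b_gW n al_ wphi_ bv_g (Cg := 64 * Cd ^+ 2)
  (mulr_ge0 (ler0n R 64) (sqr_ge0 Cd)) phi_S g_bound_.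
have e1 k : en (cof a0) (fun=> 1) F (G k) = - ip P g (W k).
 have := hE _ _ (hW k); rewrite (energyE mA vF (vG k)) (expectation_mul sg (sW k)).
 by move=> [].
have lim1 : ip P g (W k) @[k --> \oo] --> ip P g (Wb w).
 apply: (cvg_ip (fun=> sg) sW sg (sWb sw)); last exact: Wb_lim.
 by apply/L2cvgP => e e0; exists 0%N => k _; rewrite (_ : (fun x => _) = cst 0) ?nrm0//; apply/funext => x; rewrite subrr.
have lim2 : ip P (spn hS (s k)) (W k) @[k --> \oo] --> ip P w (Wb w).
 by apply: (cvg_ip ss sW sw (sWb sw) sc); exact: Wb_lim.
have lim3 : ip P (spn hS (s k)) (spn hS (s k)) @[k --> \oo] --> ip P w w.
 exact: (cvg_ip ss ss sw sw sc sc).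
pose Dk k := ven (fun mu x => Fk k mu x - F mu x) (fun mu x => Fk k mu x - F mu x).
pose B := 2 * (1 + ven F F) + (1 + ip P w w).
have venG : \forall k \near \oo, ven (G k) (G k) <= Kb * B.
 near=> k.
 apply: le_trans (KbP (s k)) _; apply: ler_wpM2l => //; apply: lerD.
  rewrite (_ : gF hS vS (s k) = fun mu x => (Fk k mu x - F mu x) + F mu x); last first.
   by apply/funext => mu; apply/funext => x; rewrite subrK.
  apply: le_trans (ven_triangle (vL2B (vFk k) vF) vF) _.
  rewrite mulrDr lerD2r ler_wpM2l//.
  by near: k; apply: (cvgr_le _ sd); exact: ltr01.
 by near: k; apply: (cvgr_le _ lim3); rewrite ltrDr.
suff h e : 0 < e -> ip P g (Wb w) <= rate_ * ip P w (Wb w) + e by apply/ler_addgt0Pr.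
move=> e0.
have B0 : 0 <= Kb * B.
 by rewrite mulr_ge0// /B; have := ip_ge0 P w; have : 0 <= ven F F := en_ge0 mI _ w1; lra.
(* With this parameter in Young's inequality the bounded energy of [G k] contributes at most
   [e / 2]; the other contribution tends to 0. *)
pose dl := e / (1 + L * (Kb * B)).
have q0 : 0 < 1 + L * (Kb * B) by have := mulr_ge0 (le_trans ler01 L1) B0; lra.
have dl0 : 0 < dl by rewrite divr_gt0.
have lim4 : rate_ * ip P (spn hS (s k)) (W k) + (e / 2 + (2 * dl)^-1 * (L * Dk k)) @[k --> \oo] --> rate_ * ip P w (Wb w) + (e / 2 + (2 * dl)^-1 * (L * 0)).
 apply: cvgD; first by apply: cvgMr.
 by apply: cvgD; [exact: cvg_cst|apply: cvgMr; apply: cvgMr].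
have : ip P g (Wb w) <= rate_ * ip P w (Wb w) + (e / 2 + (2 * dl)^-1 * (L * 0)).
 apply: (ler_cvg_to lim1 lim4); near=> k.
 have vD := vL2B (vFk k) vF.
 have h1 : en (cof a0) (fun=> 1) (fun mu x => Fk k mu x - F mu x) (G k) <= dl^-1 / 2 * (L * Dk k) + (2 * dl^-1)^-1 * (L * (Kb * B)).
  have dl1 : 0 < dl^-1 by rewrite invr_gt0.
  apply: le_trans (en_young mA w1 dl1 vD (vG k)) _.
  have dl2 : 0 <= dl^-1 / 2 by rewrite divr_ge0// ltW.
  have dl3 : 0 <= (2 * dl^-1)^-1 by rewrite invr_ge0 mulr_ge0// ltW.
  apply: lerD; first exact: (ler_wpM2l dl2 (en_le mA w1 vD)).
  apply: (ler_wpM2l dl3); apply: le_trans (en_le mA w1 (vG k)) _.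
  rewrite ler_wpM2l ?(le_trans ler01 L1)//.
  by near: k.
 rewrite (enBl mA w1 (vFk k) vF (vG k)) e1 opprK in h1.
 have h2 := energy_ge_ (s k); rewrite -/(W k) -/(G k) -/(Fk k) in h2.
 have h3 : (2 * dl^-1)^-1 * (L * (Kb * B)) <= e / 2.
  rewrite invfM invrK /dl -mulrA mulrC ler_wpM2r ?invr_ge0// mulrAC ler_pdivrMr// ler_wpM2l ?(ltW e0)//.
  by rewrite lerDr.
 have h4 (z : R) : z^-1 / 2 = (2 * z)^-1 by rewrite invfM mulrC.
 have aux (q1 q2 q3 q4 q5 q6 : R) : q1 + q2 <= q4 + q5 -> - q3 <= q1 -> q5 <= q6 -> q2 <= q3 + (q6 + q4) by lra.
 by rewrite h4 in h1; exact: (aux _ _ _ _ _ _ h1 h2 h3).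
by rewrite !mulr0 addr0; lra.
Unshelve. all: by end_near.
Qed.

End parameters.

(** * Conditional expectations as projections in L^2 *)

Section conditional_expectation.
Variable G : set (set M).
Hypothesis GM : forall A, G A -> measurable A.

Lemma integrableD2 (f g : M -> R) : intg P f -> intg P g ->
 intg P (fun x => f x - g x).
Proof. by move=> fi gi; apply: eq_integrable (integrableB measurableT fi gi). Qed.

Lemma mbl_wrt_fun (Z : M -> R) : measurable_wrt G Z -> mbl Z.
Proof. by move=> mZ _ B mB; rewrite setTI; apply: GM; exact: mZ. Qed.

(* Counting the multiples of [dl] below [y] recovers [y] up to [dl]. *)
Lemma staircase (dl y : R) (N : nat) : 0 < dl -> 0 <= y <= N%:R * dl ->
 0 <= y - \sum_(k < N) (if k.+1%:R * dl <= y then dl else 0) <= dl.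
Proof.
move=> dl0; elim: N => [|N ih] /andP[y0 yN].
 by rewrite mul0r in yN; rewrite big_ord0 subr0 y0/= (le_trans yN)// ltW.
rewrite big_ord_recr/=; have [yl|yl] := leP y (N%:R * dl).
 have -> : (N.+1%:R * dl <= y) = false.
  by apply/negbTE; rewrite -ltNge; apply: le_lt_trans yl _; rewrite ltr_pM2r// ltr_nat.
 by rewrite addr0; apply: ih; rewrite y0.
have -> : \sum_(k < N) (if k.+1%:R * dl <= y then dl else 0) = N%:R * dl.
 rewrite (eq_bigr (fun=> dl)) => [|k _]; first by rewrite sumr_const card_ord mulr_natl.
 by rewrite (le_trans _ (ltW yl))// ler_wpM2r ?(ltW dl0)// ler_nat.
move: yN yl; rewrite -natr1 mulrDl mul1r => yN yl.
by case: ifPn => [h|]; [|rewrite -ltNge => h]; apply/andP; split; lra.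
Qed.

Variables f g : M -> R.
Hypotheses (sf : L2 P f) (fg : is_condexp P G f g).

Let gi : intg P g. Proof. by case: fg. Qed.
Let fi : intg P f. Proof. exact: L2_integrable. Qed.
Let mg : measurable_wrt G g. Proof. by case: fg. Qed.
Let D x : R := f x - g x.
Let Di : intg P D. Proof. exact: integrableD2. Qed.
Let mD : mbl D.
Proof. by apply: mfunB; [exact: sf.1|exact: mbl_wrt_fun]. Qed.

Let bD_int (b : M -> R) (K : R) : mbl b -> (forall x, `|b x| <= K) ->
 intg P (fun x => b x * D x).
Proof.
move=> mb bK; apply: (le_integrable measurableT _ _ (integrableZl measurableT K Di)).
 by apply/mEFin; exact: mfunM.
move=> x _; change (`|(b x * D x)%:E| <= `|(K * D x)%:E|)%E.
rewrite !abse_EFin lee_fin !normrM ler_wpM2r//.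
exact: le_trans (bK x) (ler_norm K).
Qed.

Let D_set A : G A -> \int[P]_x (\1_A x * D x) = 0.
Proof.
move=> GA; have mA := GM GA.
have -> : \int[P]_x (\1_A x * D x) = \int[P]_(x in A) D x.
 rewrite [RHS]Rintegral_mkcond; apply: eq_Rintegral => x _.
 by rewrite patchE indicE; case: ifPn => _; rewrite ?mul1r ?mul0r.
have iA (h : M -> R) : intg P h -> P.-integrable A (EFin \o h).
 by move=> hi; exact: (integrableS measurableT mA _ hi).
rewrite RintegralB//; [|exact: iA|exact: iA].
by case: fg => _ _ /(_ A GA) E1; rewrite /Rintegral -E1 subrr.
Qed.

(** [is_condexp] tests against sets only. A bounded [b], shifted by [K] to become nonnegative, is
    approximated uniformly by multiples of indicators of its level sets ([staircase]). *)
Lemma condexp_orth_bounded (b : M -> R) (K : R) : 0 < K -> measurable_wrt G b ->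
 (forall x, `|b x| <= K) -> \int[P]_x (b x * D x) = 0.
Proof.
move=> K0 mb bK; have mb' := mbl_wrt_fun mb.
pose I := \int[P]_x `|D x|.
have aDi : intg P (fun x => `|D x|) by exact: integrable_norm.
have I0 : 0 <= I by apply: Rintegral_ge0 => x _.
have key N : `|\int[P]_x (b x * D x)| <= 2 * K * I * N.+1%:R^-1.
 have n0 : 0 < N.+1%:R :> R by rewrite ltr0n.
 pose dl := 2 * K / N.+1%:R; have dl0 : 0 < dl by rewrite divr_gt0// mulr_gt0.
 have NdE : N.+1%:R * dl = 2 * K by rewrite /dl mulrCA divff ?mulr1// gt_eqF.
 pose A (k : nat) := [set x | k.+1%:R * dl <= b x + K].
 have GA k : G (A k).
  have -> : A k = b @^-1` [set` `[k.+1%:R * dl - K, +oo[%R].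
   by apply/seteqP; split => x; rewrite /A /= in_itv/= andbT; lra.
  by apply: mb; exact: measurable_itv.
 pose s x := \sum_(k < N.+1) dl * \1_(A k) x.
 have sE x : s x = \sum_(k < N.+1) (if k.+1%:R * dl <= b x + K then dl else 0).
  apply: eq_bigr => k _; rewrite indicE; case: ifPn => h.
   by rewrite mem_set// mulr1.
  by rewrite memNset ?mulr0//; exact/negP.
 have sb x : `|b x + K - s x| <= dl.
  have : 0 <= b x + K - s x <= dl.
   rewrite sE; apply: staircase => //; rewrite NdE; have := bK x; rewrite ler_norml => /andP[].
   by move=> h1 h2; apply/andP; split; lra.
  by move=> /andP[h1 h2]; rewrite ger0_norm.
 have sDi k : intg P (fun x => \1_(A k) x * D x).
  apply: (@bD_int _ 1) => [|x]; first exact: mindic (GM (GA k)).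
  by rewrite indicE; case: (_ \in _); rewrite ?normr1 ?normr0.
 have sumD (r : seq 'I_N.+1) : intg P (fun x => \sum_(k <- r) dl * (\1_(A k) x * D x)) /\
   \int[P]_x (\sum_(k <- r) dl * (\1_(A k) x * D x)) = 0.
  elim: r => [|k r [ih1 ih2]].
   rewrite (_ : (fun x => _) = cst 0); last by apply/funext => x; rewrite big_nil.
   split; first exact: (finite_measure_integrable_cst P 0).
   by rewrite /Rintegral integral0_eq.
  have E1 : (fun x => \sum_(j <- k :: r) dl * (\1_(A j) x * D x)) =
    (fun x => dl * (\1_(A k) x * D x) + \sum_(j <- r) dl * (\1_(A j) x * D x)).
   by apply/funext => x; rewrite big_cons.
  have i1 : intg P (fun x => dl * (\1_(A k) x * D x)).
   by apply: eq_integrable (integrableZl measurableT dl (sDi k)).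
  rewrite E1; split; first by apply: eq_integrable (integrableD measurableT i1 ih1).
  rewrite RintegralD// ih2 addr0 RintegralZl//.
  by rewrite D_set// mulr0.
 have [sumi sum0] := sumD (index_enum 'I_N.+1).
 have sDE : (fun x => s x * D x) = fun x => \sum_(k < N.+1) dl * (\1_(A k) x * D x).
  by apply/funext => x; rewrite mulr_suml; apply: eq_bigr => k _; rewrite mulrA.
 have GT : G setT by have := mb setT measurableT; rewrite preimage_setT.
 have KDi : intg P (fun x => K * (\1_setT x * D x)).
  apply: eq_integrable (integrableZl measurableT K Di) => // x _ /=.
  by rewrite indicE in_setT mul1r.
 have bDi := bD_int mb' bK.
 have E2 : \int[P]_x (b x * D x) = \int[P]_x ((b x + K - s x) * D x).
  have -> : (fun x => (b x + K - s x) * D x) = (fun x => (b x * D x + K * (\1_setT x * D x)) - s x * D x).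
   apply/funext => x; rewrite indicE in_setT mul1r; move: (s x) (b x) (D x) => p q r; ring.
  rewrite RintegralB//; last by rewrite sDE.
   rewrite RintegralD// sDE sum0 subr0 RintegralZl ?D_set ?mulr0 ?addr0//.
   by apply: eq_integrable Di => // x _ /=; rewrite indicE in_setT mul1r.
  exact: eq_integrable (integrableD measurableT bDi KDi).
 have ms : mbl (fun x => b x + K - s x).
  apply: mfunB; first exact: measurable_funD.
  by apply: measurable_sum => k; apply: mfunM => //; exact: mindic (GM (GA k)).
 rewrite E2; apply: le_trans (le_normr_Rintegral measurableT (bD_int ms sb)) _.
 apply: (@le_trans _ _ (\int[P]_x (dl * `|D x|))).
  apply: le_Rintegral => //.
  - by apply: integrable_norm; exact: bD_int ms sb.
  - by apply: eq_integrable (integrableZl measurableT dl aDi).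
  - by move=> x _; rewrite normrM ler_wpM2r.
 rewrite RintegralZl// -/I /dl le_eqVlt; apply/orP; left; apply/eqP.
 by move: (_^-1) => z; ring.
apply/eqP; rewrite -normr_le0; apply/ler_addgt0Pr => e e0; rewrite add0r.
have : 2 * K * I * N.+1%:R^-1 @[N --> \oo] --> 2 * K * I * 0 by apply: cvgMr; exact: cvg_harmonic.
rewrite mulr0 => /cvgr_lt /(_ e e0)[N _ /(_ N (leqnn N))] /= h.
exact: le_trans (key N) (ltW h).
Qed.

Definition clip (n : nat) (x : R) : R := Num.max (- n.+1%:R) (Num.min n.+1%:R x).

Lemma clip_bounded n x : `|clip n x| <= n.+1%:R.
Proof.
have n0 : 0 < n.+1%:R :> R by rewrite ltr0n.
rewrite /clip ler_norml; apply/andP; split; first by rewrite le_max lexx.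
by rewrite ge_max ge_min lexx andbT; lra.
Qed.

Lemma clip_le n x : `|clip n x| <= `|x|.
Proof.
have n0 : 0 < n.+1%:R :> R by rewrite ltr0n.
rewrite /clip; case: (leP n.+1%:R x) => h1.
 have nn : - n.+1%:R <= n.+1%:R :> R by rewrite (le_trans _ (ltW n0))// oppr_le0 ltW.
 by rewrite (max_r nn) gtr0_norm//; exact: le_trans h1 (ler_norm x).
case: (leP (- n.+1%:R) x) => h2 //.
by rewrite normrN gtr0_norm//; have := ler_norm (- x); rewrite normrN; lra.
Qed.

Lemma clip_id n x : `|x| <= n.+1%:R -> clip n x = x.
Proof. by rewrite ler_norml /clip => /andP[h1 h2]; rewrite min_r// max_r. Qed.

Lemma cvg_clip (x : R) : clip n x @[n --> \oo] --> x.
Proof.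
apply: cvg_near_cst; exists `|Num.floor `|x| |%N => // n /= nx.
rewrite clip_id//; apply: ltW; apply: lt_le_trans (_ : (`|Num.floor `|x| |%N.+1%:R <= _)); last first.
 by rewrite ler_nat.
have : 0 <= `|x| by []; move: `|x| => z z0.
have := floorD1_gt z; rewrite -natr1 natr_absz ger0_norm ?floor_ge0// intrD.
by [].
Qed.

Lemma mbl_clip n : mbl (clip n).
Proof. by apply: measurable_maxr => //; exact: measurable_minr. Qed.

Lemma mbl_wrt_clip n (Z : M -> R) : measurable_wrt G Z -> measurable_wrt G (fun x => clip n (Z x)).
Proof.
move=> mZ B mB; have := mZ (clip n @^-1` B); apply.
by rewrite -[X in measurable X]setTI; exact: mbl_clip.
Qed.

Let sclip n (Z : M -> R) : mbl Z -> L2 P (fun x => clip n (Z x)).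
Proof.
move=> mZ; apply: (@L2_bounded _ _ _ P _ n.+1%:R) => [|x]; last exact: clip_bounded.
exact: mcomp (mbl_clip n) mZ.
Qed.

(** A priori [g] is only integrable. Its truncations [c] satisfy
    [|c|^2 <= <c, g> = <c, f> <= |c| |f|], so their norms are bounded by that of [f], and Fatou's
    lemma concludes. *)
Lemma condexp_L2 : L2 P g.
Proof.
have mg' := mbl_wrt_fun mg.
have sc n := sclip n mg'.
suff [] : L2 P g /\ nrm P g <= nrm P f by [].
apply: (L2_fatou sc mg') => [|n]; first by apply: aeW => x; exact: cvg_clip.
have n0 : 0 < n.+1%:R :> R by rewrite ltr0n.
have h0 := condexp_orth_bounded n0 (mbl_wrt_clip n mg) (fun x => clip_bounded n (g x)).
set c := fun x => clip n (g x).
have cfi := L2_mul (sc n) sf.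
have cDi := bD_int (sc n).1 (fun x => clip_bounded n (g x)).
have cgi : intg P (fun x => c x * g x).
 apply: eq_integrable (integrableB measurableT cfi cDi) => // x _.
 change ((c x * f x)%:E - (c x * D x)%:E = (c x * g x)%:E)%E.
 by rewrite -EFinB; congr EFin; rewrite /D; ring.
have h1 : nrm P c ^+ 2 <= ip P c f.
 have -> : ip P c f = \int[P]_x (c x * D x) + \int[P]_x (c x * g x).
  by rewrite -RintegralD//; apply: eq_Rintegral => x _; rewrite /D; ring.
 rewrite h0 add0r nrm_sqr; apply: le_Rintegral => //; first exact: (L2_mul (sc n) (sc n)).
 move=> x _; rewrite /c /clip; case: (leP n.+1%:R (g x)) => g1.
  have nn : - n.+1%:R <= n.+1%:R :> R by rewrite (le_trans _ (ltW n0))// oppr_le0 ltW.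
  by rewrite (max_r nn) ler_wpM2l// ltW.
 case: (leP (- n.+1%:R) (g x)) => g2 //; rewrite !mulNr lerN2 ler_wpM2l ?(ltW n0)// ltW//.
have [z|z] := leP (nrm P c) 0; first by apply: le_trans z _; exact: nrm_ge0.
rewrite -(ler_pM2l z) -expr2; apply: le_trans h1 _.
exact: le_trans (ler_norm _) (ip_le_nrm (sc n) sf).
Qed.

(** Orthogonality extends from bounded to square-integrable [Y] through truncations; Pythagoras'
    identity then gives the minimum. *)
Lemma condexp_min (Z : M -> R) : L2 P Z -> measurable_wrt G Z ->
 nrm P (fun x => f x - g x) <= nrm P (fun x => f x - Z x).
Proof.
have sg := condexp_L2; have sD : L2 P D := L2B sf sg.
have orth (Y : M -> R) : L2 P Y -> measurable_wrt G Y -> ip P Y D = 0.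
 move=> sY mY.
 have mabs : mbl (fun x => `|Y x|) by apply: mcomp => //; exact: sY.1.
 have [sabs _] : L2 P (fun x => `|Y x|) /\ nrm P (fun x => `|Y x|) <= nrm P Y.
  by apply: le_nrm => // x; rewrite normr_id.
 have [_ cY] := L2_dominated (fn := fun n x => clip n (Y x)) (f := Y) (g := fun x => `|Y x|)
  (fun n => (sclip n sY.1).1) sabs (fun n x => clip_le n (Y x)) (fun x => @cvg_clip (Y x)).
 have sc n := sclip n sY.1.
 have lim : ip P (fun x => clip n (Y x)) D @[n --> \oo] --> ip P Y D.
  apply: (cvg_ip sc (fun=> sD) sY sD cY).
  apply/L2cvgP => e e0; exists 0%N => n _; rewrite (_ : (fun x => _) = cst 0) ?nrm0//.
  by apply/funext => x; rewrite subrr.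
 have E1 : (fun n => ip P (fun x => clip n (Y x)) D) = fun=> 0.
  apply/funext => n; have n0 : 0 < n.+1%:R :> R by rewrite ltr0n.
  exact: (condexp_orth_bounded n0 (mbl_wrt_clip n mY) (fun x => clip_bounded n (Y x))).
 have l0 : (fun=> 0 : R) @ \oo --> (0 : R) by exact: cvg_cst.
 by rewrite E1 in lim; exact: (cvg_unique _ lim l0).
move=> sZ mZ; rewrite -/D -(@ler_pXn2r _ 2) ?nnegrE ?nrm_ge0// !nrm_sqr.
have sV : L2 P (fun x => g x - Z x) by exact: L2B.
have -> : (fun x => f x - Z x) = fun x => D x + (g x - Z x) by apply/funext => x; rewrite /D; ring.
have pyth (p q : M -> R) : L2 P p -> L2 P q -> ip P q p = 0 ->
  ip P (fun x => p x + q x) (fun x => p x + q x) = ip P p p + ip P q q.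
 move=> sp sq qp; have spq := L2D sp sq.
 by rewrite (ipDl sp sq spq) (ipDr sp sq sp) (ipDr sp sq sq) [ip P p q]ipC qp addr0 add0r.
have VD : ip P (fun x => g x - Z x) D = 0.
 by rewrite (ipBl sg sZ sD) (orth _ sg mg) (orth _ sZ mZ) subrr.
by rewrite (pyth _ _ sD sV VD) lerDl ip_ge0.
Qed.

End conditional_expectation.

End poisson_configurations.

(** * Assembling the estimate *)

Theorem theorem4p1 (R : realType) (Lambda : R) (hLambda : 1 <= Lambda) :
  exists C : R,
  forall (d : nat) (rho : R) (P : probability (config R d) R)
    (a0 : config R d -> 'M[R]_d)
    (S : R -> (config R d -> R) -> config R d -> R)
    (u : config R d -> R) (lu t K : R) (AKut : config R d -> R),
  (1 <= d)%N -> 0 < rho -> is_poisson rho P ->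
  admissible Lambda a0 -> associated_semigroup P a0 S ->
  u \in Lfun P 2%:E -> measurable_wrt (sigF (cube lu)) u ->
  Num.max (lu ^+ 2) (16 * Lambda ^+ 2) <= t ->
  Num.sqrt t <= K ->
  is_condexp P (sigF (cube K)) (S t u) AKut ->
  ('E_P[fun mu => ((S t u mu - AKut mu) ^+ 2)%R]
     <= (C * expR (- (K / Num.sqrt t)))%:E * 'E_P[fun mu => (u mu ^+ 2)%R])%E.
Proof.
have [Cd Cd0 CdP] := @dstep_bounded R.
(* [384 = 2 * 192] is the growth exponent [2 c t] with the bound [rate_le]. The 2 pays for the
   initial radius [r0] and the rounding of [n], given [beta >= 4]. *)
exists (expR (384 * Lambda * Cd ^+ 2 + 2)).
move=> d rho P a0 S u lu t K AK d_gt0 rho0 PP aa [MS SE] /Lfun2_L2 su mu; rewrite ge_max => /andP[lut Lt] tK AKP.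
pose beta := Num.sqrt t; rewrite -/beta in tK *.
have L0 : 0 < Lambda := lt_le_trans ltr01 hLambda.
have t0 : 0 < t by apply: lt_le_trans Lt; rewrite mulr_gt0// exprn_gt0.
have b0 : 0 < beta by rewrite sqrtr_gt0.
have bt : beta ^+ 2 = t by rewrite sqr_sqrtr// ltW.
have betaL : 4 * Lambda <= beta.
 rewrite -(@ler_pXn2r _ 2) ?nnegrE ?(ltW b0) ?mulr_ge0 ?(ltW L0)// bt.
 by rewrite (_ : (4 * Lambda) ^+ 2 = 16 * Lambda ^+ 2)//; ring.
have beta4 : 4 <= beta by lra.
have lub : lu <= beta.
 apply: le_trans (ler_norm _) _.
 by rewrite -(@ler_pXn2r _ 2) ?nnegrE ?(ltW b0)// real_normK ?num_real// bt.
(* On the cube of side [lu <= beta] one has [rr <= lu / 2 + 1 <= r0]. The number [n] counts the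
   transitions of width [1/4] that fit between [r0] and [K / 2], and is 0 when there is no room. *)
pose r0 := beta / 2 + 1; pose y := 4 * (K / 2 - r0); pose z := Num.max 0 y.
pose n := `|Num.floor z|%N.
have z0 : 0 <= z by rewrite le_max lexx.
have nz : n%:R <= z by rewrite /n natr_absz ger0_norm ?floor_ge0// ge_floor.
have zn : z <= n%:R + 1.
 by have := floorD1_gt z; rewrite /n natr_absz ger0_norm ?floor_ge0// intrD => /ltW.
have yz : y <= z by rewrite le_max lexx orbT.
have wphi : forall j, weight (@phi_ R d r0 j) := wphi_ d_gt0 r0.
have al0 : al_ beta 0 = 1 by exact: al_0.
have al_pos j : 0 < al_ beta j by exact: expR_gt0.
have al_nd : forall j, al_ beta j <= al_ beta j.+1 := al_nd_ hLambda betaL.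
have [|Wb [sWb Wlim Wsym [Wge0 Wlip Wmin Wloc]]] := weighted_extension PP rho0 d_gt0 n wphi _ al_nd.
 exact: ltW.
have c0 : 0 <= rate_ Lambda beta Cd.
 rewrite /rate_ mulr_ge0 ?subr_ge0 ?(kp1_ hLambda betaL)//.
 by rewrite divr_ge0 ?mulr_ge0 ?sqr_ge0 ?divr_ge0 ?(ltW L0) ?(ltW b0).
have gen w g : L2 P w -> L2 P g -> generator P S w g ->
  ip P g (Wb w) <= rate_ Lambda beta Cd * ip P w (Wb w).
 move=> sw sg /(SE _ _ ((Lfun2_L2 P w).2 sw) ((Lfun2_L2 P g).2 sg))[F hF FE].
 exact: (generator_ge PP rho0 d_gt0 aa hLambda betaL Cd0 CdP sWb Wlim sg hF FE).
have Kw0 : 0 <= 2 * al_ beta n by rewrite mulr_ge0// ltW.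
have dec := semigroup_decay MS Kw0 c0 sWb Wsym Wge0 Wlip gen su t0.
have Wu : ip P u (Wb u) = ip P u u.
 rewrite (Wloc (cube lu) u)// ?al0 ?mul1r// => j x lx; apply: phs1.
 apply: le_trans (rr_le d_gt0 (c := lu / 2) _) _ => [k|].
  by rewrite ler_norml; exact: lx.
 have := ler0n R j; rewrite /rad_ /r0; lra.
have sSu := S_sq MS (ltW t0) su.
have mK : measurable (@cube R d K) := cube_mbl K.
have sub A : sigF (@cube R d K) A -> measurable A by exact: sigF_mbl.
have sAK : L2 P AK := condexp_L2 sub sSu AKP.
pose m := nrm P (fun mu => S t u mu - AK mu).
(* For [j < n] the transition of [phi_ r0 j] ends before [K / 2], and [rr] dominates the sup norm,
   so the cutoff vanishes off the cube. An index [j < n] exists only if [n > 0], which forces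
   [z = y]. *)
have phK j (x : 'rV[R]_d) : (j < n)%N -> phi_ r0 j x <= \1_(cube K) x.
 move=> jn; have [xK|xK] := pselect (cube K x).
  by rewrite indicE mem_set//; have /andP[] := phs01 (rad_ r0 j) x.
 rewrite indicE memNset//.
 rewrite /phi_ phs0// leNgt; apply/negP => rx; apply: xK.
 have jn' : j%:R + 1 <= n%:R :> R by rewrite natr1 ler_nat.
 have zy : z = y.
  rewrite /z max_r// leNgt; apply/negP => y0; move: nz; rewrite /z max_l ?(ltW y0)//.
  by have := ler0n R j; lra.
 have rK : rr x <= K / 2.
  by apply: ltW; move: rx nz; rewrite zy /y /rad_; lra.
 by move=> k; rewrite -ler_norml; exact: le_trans (rr_ge d_gt0 x k) rK.
have main : al_ beta n * m ^+ 2 <= expR (2 * rate_ Lambda beta Cd * t) * ip P u u.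
 rewrite -Wu; apply: le_trans dec.
 apply: (Wmin (cube K)) => //; first exact: nrm_ge0.
 by move=> Z sZ mZ; exact: (condexp_min sub sSu AKP sZ mZ).
rewrite (expectation_sqr (L2B sSu sAK)) (expectation_sqr su) -EFinM lee_fin -nrm_sqr -/m.
have -> : m ^+ 2 = (al_ beta n)^-1 * (al_ beta n * m ^+ 2) by rewrite mulKf// gt_eqF.
apply: (@le_trans _ _ ((al_ beta n)^-1 * (expR (2 * rate_ Lambda beta Cd * t) * ip P u u))).
 by rewrite ler_wpM2l// invr_ge0 ltW.
rewrite mulrA ler_wpM2r ?ip_ge0// /al_ -expRN -!expRD ler_expR.
have h1 : 2 * rate_ Lambda beta Cd * t <= 384 * Lambda * Cd ^+ 2.
 have := rate_le hLambda betaL Cd0; rewrite bt ler_pdivlMr//; lra.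
have h2 : K / beta - 2 <= n%:R / (2 * beta).
 rewrite ler_pdivlMr ?mulr_gt0// mulrBl (_ : K / beta * (2 * beta) = 2 * K).
  by move: zn yz; rewrite /y /r0; lra.
 by field; rewrite gt_eqF.
lra.
Qed.
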